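(* There exists a $(17,2,1)$-universal transformer $T$ with both causally masked and unmasked attention heads, fixed model dimension and fixed feedforward width, that, when unrolled $\lceil\log_2 n\rceil$ times, solves connectivity on (directed or undirected) graphs over $n$ vertices: given as input the $n\times n$ adjacency matrix of a graph $G$ on vertices $\{1,\dots,n\}$ written row by row as $n^2$ tokens from $\{0,1\}$, followed by $n^3$ padding tokens $\square$, followed by $s$ copies of a token $a$ and then $t$ copies of a token $b$ (encoding $s,t\in\{1,\dots,n\}$ in unary), $T$ outputs whether $G$ has a path from vertex $s$ to vertex $t$.
   Context: Transformer model: for an input $w_1\cdots w_N$, each position $i$ carries a residual stream vector $\mathbf h_i$, initialized to a token embedding (no positional encodings; the first position is identifiable, e.g. via a beginning-of-sequence symbol). Each layer consists of a self-attention sublayer and a feedforward sublayer, each with masked pre-norm: it reads $\mathbf z_i=\mathrm{layer\_norm}(\mathbf u\odot\mathbf h_i)$ for a learned mask vector $\mathbf u$, computes $\delta_i$, and sets $\mathbf h_i\leftarrow\mathbf h_i+\delta_i$. A self-attention head outputs the uniform average of values $\mathbf v_j$ over those $j$ maximizing $\mathbf q_i^\top\mathbf k_j$ (averaging-hard attention), with $j$ ranging over $j\le i$ for causally masked heads and over all $j\le N$ for unmasked heads; queries/keys/values are linear in $\mathbf z$; heads are concatenated and linearly projected. A feedforward sublayer computes $\mathbf U\,\mathrm{ReLU}(\mathbf W\mathbf z_i)$; its hidden dimension is the feedforward width. The output is the maximal-logit token of a linear unembedding of the last position. Scalars use a $p$-bit datatype with $p\ge c\log N$ for a fixed $c>0$,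 and all primitive operations (including attention sums and layer norm) return the correctly rounded exact result on representable inputs. An $(s,r,t)$-universal transformer has fixed parameters (independent of input length) for $s$ initial layers, $r$ repeated layers and $t$ final layers; unrolled $d$ times, it applies the initial layers, then the block of $r$ repeated layers $d$ times with the same parameters, then the final layers. *)

(* Defs.v *)
From HB Require Import structures.
From mathcomp Require Import all_boot all_order all_algebra.
From mathcomp Require Import realalg.
Set Implicit Arguments. Unset Strict Implicit. Unset Printing Implicit Defensive.
Import Order.TTheory GRing.Theory Num.Theory.
Local Open Scope ring_scope.

(* Tokens: the input alphabet {0,1,square,a,b} plus a beginning-of-sequence symbol
   (used to make the first position identifiable).  The answer is read as the
   token 1 (path exists) or 0 (no path). *)
Inductive tok := T0 | T1 | TPad | TA | TB | TBOS.

Record Head (d dh : nat) := MkHead {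
  h_masked : bool;
  h_Q : 'I_dh -> 'I_d -> rat;
  h_K : 'I_dh -> 'I_d -> rat;
  h_V : 'I_dh -> 'I_d -> rat }.

(* One layer = self-attention sublayer (nh heads of dimension dh, concatenated and
   linearly projected) followed by a feedforward sublayer of width w; each
   sublayer has its own pre-norm mask vector. *)
Record Layer (d dh nh w : nat) := MkLayer {
  a_mask : 'I_d -> rat;
  a_heads : 'I_nh -> Head d dh;
  a_out : 'I_d -> 'I_nh -> 'I_dh -> rat;   (* projection of the concatenation *)
  f_mask : 'I_d -> rat;
  f_W : 'I_w -> 'I_d -> rat;
  f_U : 'I_d -> 'I_w -> rat }.

(* An (s,r,t)-universal transformer: s = size ut_init, r = size ut_rep,
   t = size ut_final.  Model dimension, head number/dimension and feedforward
   width are fixed fields. *)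
Record UTransformer := MkUT {
  ut_dim : nat;
  ut_hdim : nat;
  ut_nheads : nat;
  ut_ffw : nat;
  ut_emb : tok -> 'I_ut_dim -> rat;
  ut_init : seq (Layer ut_dim ut_hdim ut_nheads ut_ffw);
  ut_rep : seq (Layer ut_dim ut_hdim ut_nheads ut_ffw);
  ut_final : seq (Layer ut_dim ut_hdim ut_nheads ut_ffw);
  ut_unemb : tok -> 'I_ut_dim -> rat }.

Definition unrolled_layers (T : UTransformer) (dd : nat) :=
  ut_init T ++ flatten (nseq dd (ut_rep T)) ++ ut_final T.

Section Datatype.
Variable R : rcfType.

Definition representable (p : nat) (x : R) : Prop :=
  exists (m e : int), `|m| < (2 ^ p)%:R /\ `|e| < (2 ^ p)%:R /\
                      x = m%:~R * (2%:R : R) ^ e.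

Definition correct_rounding (p : nat) (rnd : R -> R) : Prop :=
  forall x : R, representable p (rnd x) /\
    forall r : R, representable p r -> `|x - rnd x| <= `|x - r|.
End Datatype.

Section Semantics.
Variable R : rcfType.
Variable rnd : R -> R.

(* parameters as stored in the datatype *)
Definition wt (x : rat) : R := rnd (ratr x).

Definition linmap (m n : nat) (W : 'I_m -> 'I_n -> rat) (z : 'I_n -> R) : 'I_m -> R :=
  fun i => rnd (\sum_(k < n) wt (W i k) * z k).

Definition maskv (d : nat) (u : 'I_d -> rat) (h : 'I_d -> R) : 'I_d -> R :=
  fun k => rnd (wt (u k) * h k).

Definition layer_norm (d : nat) (x : 'I_d -> R) : 'I_d -> R :=
  let mu := (\sum_(k < d) x k) / d%:R in
  let var := (\sum_(k < d) (x k - mu) ^+ 2) / d%:R in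
  fun k => rnd (if var == 0 then 0 else (x k - mu) / Num.sqrt var).

Definition relu (x : R) : R := Num.max 0 x.

(* a state: residual stream vectors at positions 0 .. N-1 *)
Definition state (d : nat) := nat -> 'I_d -> R.

Definition head_out (d dh N : nat) (hd : Head d dh) (z : state d) (i : nat)
  : 'I_dh -> R :=
  let q := linmap (h_Q hd) (z i) in
  let key j := linmap (h_K hd) (z j) in
  let score (j : nat) := rnd (\sum_(l < dh) q l * key j l) in
  let allowed (j : 'I_N) := ~~ h_masked hd || (j <= i)%N in
  let best := [set j : 'I_N | allowed j &&
                 [forall j' : 'I_N, allowed j' ==> (score j' <= score j)]] in
  fun l => rnd ((\sum_(j in best) linmap (h_V hd) (z j) l) / (#|best|%:R)).

Definition attn_sublayer (d dh nh w N : nat) (L : Layer d dh nh w) (h : state d)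
  : state d :=
  let z : state d := fun i => layer_norm (maskv (a_mask L) (h i)) in
  fun i k =>
    let delta := rnd (\sum_(hh < nh) \sum_(l < dh)
                        wt (a_out L k hh l) * head_out N (a_heads L hh) z i l) in
    rnd (h i k + delta).

Definition ff_sublayer (d dh nh w : nat) (L : Layer d dh nh w) (h : state d)
  : state d :=
  fun i k =>
    let z := layer_norm (maskv (f_mask L) (h i)) in
    let hid := fun m => relu (linmap (f_W L) z m) in
    rnd (h i k + linmap (f_U L) hid k).

Definition layer_apply (d dh nh w N : nat) (L : Layer d dh nh w) (h : state d)
  : state d := ff_sublayer L (attn_sublayer N L h).

Definition ut_logits (T : UTransformer) (dd : nat) (ws : seq tok) : tok -> R :=
  let w := TBOS :: ws in
  let N := size w in
  let h0 : state (ut_dim T) := fun i k => wt (@ut_emb T (nth TBOS w i) k) in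
  let hf := foldl (fun h L => layer_apply N L h) h0 (unrolled_layers T dd) in
  fun o => rnd (\sum_(k < ut_dim T) wt (@ut_unemb T o k) * hf N.-1 k).

Definition ut_outputs (T : UTransformer) (dd : nat) (ws : seq tok) (o : tok) : Prop :=
  forall o' : tok, o' <> o -> ut_logits T dd ws o' < ut_logits T dd ws o.
End Semantics.

(* vertices 1..n are represented by 'I_n (vertex i+1 <-> i); A i j = edge i -> j *)
Definition conn_input (n : nat) (A : 'I_n -> 'I_n -> bool) (s t : 'I_n) : seq tok :=
  [seq (if A i j then T1 else T0) | i <- enum 'I_n, j <- enum 'I_n]
  ++ nseq (n ^ 3) TPad ++ nseq (val s).+1 TA ++ nseq (val t).+1 TB.

(* Main.v *)
(* Reachability is computed by repeated squaring of Boolean matrices: starting from the adjacency matrix, a round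
   replaces R by R or R.R, so after ceil(log2 n) rounds R(i,j) says whether there is a nonempty walk from i to j.
   The entry R(i,j) lives at the adjacency token (i,j), and the padding token (i,j,k) evaluates R(i,k) and R(k,j);
   its value is then fetched by (i,j), whose attention score prefers, among the tokens (i,j,k), those where it is true.

   The positions have to be addressed without positional encodings. Causal uniform attention over the tokens of one
   kind gives 1/(r+2) for the r-th of them, and layer norm of the pair (1/(r+2), eta) turns this into eta (r+2) for a
   tiny eta. A token is looked up by its coordinates Y with the score (1 + X.Y)/|(1,Y)| = 1 + X.Y - |Y|^2/2 + O(|X|^4),
   which is largest for the Y nearest to X. The keys n q of the adjacency tokens make the quotient of r by n
   the result of one such lookup, and a second one yields the digits of r in base n.

   All rounding errors are at most about b^50 with b = 1/N, because p is at least 65 log N; the constants rho, tau and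
   eta, about b^7, b^9 and b^11, separate the scales of the position data, of the bits and of these errors. *)
Require Import Defs.
From HB Require Import structures.
From mathcomp Require Import all_boot all_order all_algebra.
From mathcomp Require Import realalg ring lra zify.
Import Order.TTheory GRing.Theory Num.Theory.
Local Open Scope ring_scope.
Set Implicit Arguments. Unset Strict Implicit. Unset Printing Implicit Defensive.

(** * Rounding to the datatype *)

(** The parameters may not depend on N, so even the small constants must be computed: a value
    present only at the first position is averaged over all positions once per layer, which
    multiplies it by about 1/N. This chain runs through the first eleven of the 17 initial layers.
    Layer norm is tamed by storing next to a feature its negative: the mean vanishes and layer norm
    divides by the Euclidean norm of the masked features. That norm is about 1 when the token flags
    are in the mask; when they are masked out, a dominant feature 1/(r+2), 1/(n+1) or rho takes
    over, and the layer divides by it. Features of the initial layers are written once, so their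
    analysis is a system of equations about a single state. Only the bits are overwritten, and the
    feedforward sublayers of a round clip or clear them, so their errors do not grow with the number
    of rounds. The scales fit together thus: in a lookup, unequal coordinates cost about dl^2 / 2,
    of order b^8; a true bit earns about tau / 2, of order b^9; the expansion of the score is
    accurate to order b^12. *)

Section Rounding.
Variables (R : archiRcfType) (p : nat) (rnd : R -> R).
Hypothesis Hrnd : correct_rounding p rnd.
Hypothesis Hp : (20 <= p)%N.

Lemma rnd_rep x : representable p (rnd x).
Proof. by case: (Hrnd x). Qed.

Lemma rnd_id x : representable p x -> rnd x = x.
Proof.
move=> rx; case: (Hrnd x) => _ /(_ x rx).
by rewrite subrr normr0 normr_le0 subr_eq0 => /eqP.
Qed.

Lemma rep_opp (x : R) : representable p x -> representable p (- x).
Proof.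
case=> m [e [Hm [He ->]]]; exists (- m), e; rewrite normrN; do !split=> //.
by rewrite mulrNz mulNr.
Qed.

Lemma rep_dyadic (m : int) (k : nat) :
  (`|m| < 1024)%N -> (k < 1024)%N -> representable p (m%:~R / 2 ^+ k : R).
Proof.
move=> Hm Hk; exists m, (- (k%:Z)).
have H : (1024 <= 2 ^ p)%N by apply: (@leq_trans (2 ^ 20)) => //; rewrite leq_exp2l.
rewrite -exprnN normrN; do !split.
- by apply: (@lt_le_trans _ _ 1024%:R); [lia | rewrite ler_nat].
- by apply: (@lt_le_trans _ _ 1024%:R); [lia | rewrite ler_nat].
Qed.

Lemma rep_int (m : int) : (`|m| < 1024)%N -> representable p (m%:~R : R).
Proof. by move=> Hm; have := @rep_dyadic m 0 Hm isT; rewrite expr0 divr1. Qed.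

Lemma rnd0 : rnd 0 = 0.
Proof. by apply: rnd_id; have := @rep_int 0 isT. Qed.

Lemma rnd1 : rnd 1 = 1.
Proof. by apply: rnd_id; have := @rep_int 1 isT. Qed.

Definition uerr : R := (2 ^+ (p - 10))^-1.

Lemma uerr_gt0 : 0 < uerr.
Proof. by rewrite invr_gt0 exprn_gt0. Qed.

(** Correct rounding does at least as well as rounding down to a multiple of 2^-(p-10); for |x| <=
    512 the mantissa of that multiple stays below 2^p. *)
Lemma rnd_err x : `|x| <= 512 -> `|rnd x - x| <= uerr.
Proof.
move=> Hx; set q := (p - 10)%N.
have q1 : (10 <= q)%N by rewrite /q; lia.
have P0 : (0 : R) < 2 ^+ q by rewrite exprn_gt0.
have /andP[f1 f2] := floor_itv (x * 2 ^+ q).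
set m := Num.floor _ in f1 f2.
have P1 : (1024 : R) <= 2 ^+ q.
  by rewrite (_ : 1024 = 2 ^+ 10) ?ler_eXn2l ?ltr1n // -natrX.
move: Hx; rewrite ler_norml => /andP[x1 x2].
have Hm : `|m| < (2 ^ p)%:R.
  have -> : (2 ^ p)%:R = 1024 * (2 ^+ q) :> int.
    by rewrite (_ : p = 10 + q)%N ?expnD ?natrM ?natrX // /q; lia.
  rewrite -(ltr_int R) intr_norm rmorphM /= rmorphXn /=.
  move: f2; rewrite intrD => f2; rewrite ltr_norml; apply/andP; split; nra.
have rm : representable p (m%:~R / 2 ^+ q : R).
  exists m, (- (q%:Z)); rewrite -exprnN normrN; do !split => //.
  rewrite (@lt_le_trans _ _ p.+1%:R) //; first by rewrite /q; lia.
  by rewrite ler_nat ltn_expl.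
case: (Hrnd x) => _ /(_ _ rm) H.
rewrite distrC; apply: le_trans H _; rewrite /uerr -/q.
have -> : x - m%:~R / 2 ^+ q = (x * 2 ^+ q - m%:~R) / 2 ^+ q by field; lra.
rewrite normrM [`|_^-1|]gtr0_norm ?invr_gt0 //.
rewrite -[leRHS]mul1r ler_wpM2r ?invr_ge0 ?ltW //.
by move: f2; rewrite intrD => f2; rewrite ger0_norm; lra.
Qed.

(** With l = [up_log 2 N] >= 3, the summand 15 l absorbs the ten bits lost in [uerr], and 2^(l c) >=
    N^c. The case c = 50 is the origin of the factor 65. *)
Lemma uerr_small (N c : nat) : (5 <= N)%N -> ((c + 15) * up_log 2 N <= p)%N ->
  uerr <= (N%:R^-1) ^+ c.
Proof.
move=> N5 Hc; rewrite exprVn lef_pV2 ?posrE ?exprn_gt0 ?ltr0n //; last lia.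
rewrite -!natrX ler_nat.
have L := @up_logP 2 N isT; set l := up_log 2 N in Hc L.
have l3 : (3 <= l)%N.
  rewrite leqNgt; apply/negP => l3.
  have : (2 ^ l <= 2 ^ 2)%N by rewrite leq_exp2l.
  by move: L N5; lia.
apply: (@leq_trans ((2 ^ l) ^ c)); first by case: c Hc => // c _; rewrite leq_exp2r.
rewrite -expnM leq_exp2l //; nia.
Qed.

End Rounding.

(** * Layers as linear forms over named features *)

(** A pair (f, c) gives feature f the coefficient c/64. Such parameters are dyadic and, for |c| <
    1024, stored exactly, so no error comes from the weights. *)
Definition lform := seq (nat * int).

Definition cf (s : lform) (f : nat) : rat := \sum_(t <- s | t.1 == f) (t.2%:~R / 64).

Definition ev (R : fieldType) (s : lform) (z : nat -> R) : R :=
  \sum_(t <- s) t.2%:~R / 64 * z t.1.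

Definition okf (n : nat) (s : lform) :=
  uniq (unzip1 s) && all (fun t => (t.1 < n)%N && (`|t.2| < 1024)%N) s.

Record head_spec := HeadSpec {
  hm : bool; hq : seq lform; hk : seq lform; hv : seq lform }.

Definition no_head := HeadSpec false [::] [::] [::].

(* [ao] lists (feature, (head, component)) and [fo] pairs a feature with a form in the hidden units. *)
Record layer_spec := LayerSpec {
  am : seq nat; hs : seq head_spec; ao : seq (nat * (nat * nat));
  fm : seq nat; hd : seq lform; fo : seq (nat * lform) }.

Notation dimT := (64 + 64)%N.

Definition lpart (g : nat -> rat) (k : 'I_dimT) : rat :=
  match split k with inl f => g f | inr _ => 0 end.

(* Coordinate [64 + f] carries the negative of feature [f], so that layer norm sees mean zero; only the
   features [f >= 56], which are rewritten in every round, are left without a partner, since rounding need not be odd. *)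
Definition opart (g : nat -> rat) (k : 'I_dimT) : rat :=
  match split k with inl f => g f | inr f => if (56 <= f)%N then 0 else - g f end.

Definition mpart (ms : seq nat) (k : 'I_dimT) : rat :=
  match split k with inl f => ((f : nat) \in ms)%:R | inr f => ((f : nat) \in ms)%:R end.

Definition mkH (s : head_spec) : Head dimT 4 :=
  @MkHead dimT 4 (hm s) (fun l => lpart (cf (nth [::] (hq s) l)))
    (fun l => lpart (cf (nth [::] (hk s) l))) (fun l => lpart (cf (nth [::] (hv s) l))).

Definition fo_at (sp : layer_spec) (f : nat) : lform :=
  flatten [seq e.2 | e <- fo sp & e.1 == f].

Definition mkL (sp : layer_spec) : Layer dimT 4 5 8 :=
  @MkLayer dimT 4 5 8 (mpart (am sp)) (fun hh => mkH (nth no_head (hs sp) hh))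
    (fun k hh l => opart (fun f => ((f, (hh : nat, l : nat)) \in ao sp)%:R) k)
    (mpart (fm sp)) (fun m => lpart (cf (nth [::] (hd sp) m)))
    (fun k m => opart (fun f => cf (fo_at sp f) m) k).

Definition pl (f : nat) : 'I_dimT := lshift 64 (inord f : 'I_64).
Definition pr (f : nat) : 'I_dimT := rshift 64 (inord f : 'I_64).

Lemma lpart_l g (f : 'I_64) : lpart g (lshift 64 f) = g f.
Proof. by rewrite /lpart -[lshift 64 f]/(unsplit (inl f)) unsplitK. Qed.
Lemma lpart_r g (f : 'I_64) : lpart g (rshift 64 f) = 0.
Proof. by rewrite /lpart -[rshift 64 f]/(unsplit (inr f)) unsplitK. Qed.
Lemma opart_l g (f : 'I_64) : opart g (lshift 64 f) = g f.
Proof. by rewrite /opart -[lshift 64 f]/(unsplit (inl f)) unsplitK. Qed.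
Lemma opart_r g (f : 'I_64) :
  opart g (rshift 64 f) = if (56 <= f)%N then 0 else - g f.
Proof. by rewrite /opart -[rshift 64 f]/(unsplit (inr f)) unsplitK. Qed.
Lemma mpart_l g (f : 'I_64) : mpart g (lshift 64 f) = ((f : nat) \in g)%:R.
Proof. by rewrite /mpart -[lshift 64 f]/(unsplit (inl f)) unsplitK. Qed.
Lemma mpart_r g (f : 'I_64) : mpart g (rshift 64 f) = ((f : nat) \in g)%:R.
Proof. by rewrite /mpart -[rshift 64 f]/(unsplit (inr f)) unsplitK. Qed.

Lemma inordv (f : 'I_64) : inord f = f :> 'I_64.
Proof. exact: inord_val. Qed.

Section Forms.
Variables (R : archiRcfType) (p : nat) (rnd : R -> R).
Hypothesis Hrnd : correct_rounding p rnd.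
Hypothesis Hp : (20 <= p)%N.

Lemma rep_coef (m : int) : (`|m| < 1024)%N -> representable p (m%:~R / 64 : R).
Proof.
move=> Hm; have := @rep_dyadic R p Hp m 6 Hm isT.
by rewrite (_ : 2 ^+ 6 = 64) // -natrX.
Qed.

Lemma cf_notin s f : f \notin unzip1 s -> cf s f = 0.
Proof.
move=> H; rewrite /cf big1_seq // => t /andP[/eqP e ts].
by rewrite -e map_f in H.
Qed.

Lemma ratr_coef (m : int) : ratr (m%:~R / 64 : rat) = m%:~R / 64 :> R.
Proof. by rewrite rmorphM fmorphV /= !ratr_int ?ratr_nat. Qed.

Lemma wt_cf n s f : okf n s -> wt rnd (cf s f) = ratr (cf s f) /\
   wt rnd (- cf s f) = - ratr (cf s f).
Proof.
elim: s => [|[g c] s IH] /=.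
  by rewrite /cf big_nil /wt oppr0 rmorph0 oppr0 (rnd0 Hrnd Hp).
rewrite /okf /= => /andP[/andP[gs us] /andP[/andP[gn cc] al]].
rewrite /cf big_cons /=; case: eqP => [<-|_]; last first.
  by rewrite -/(cf s f); apply: IH; rewrite /okf us al.
rewrite -/(cf s g) (cf_notin gs) addr0 /wt rmorphN /= ratr_coef.
split; apply: (rnd_id Hrnd); first exact: rep_coef.
by apply: rep_opp; apply: rep_coef.
Qed.

Lemma sum_cf n s (z : nat -> R) : okf n s ->
  \sum_(f < n) wt rnd (cf s f) * z f = ev s z.
Proof.
move=> ok; rewrite (eq_bigr (fun f : 'I_n => ratr (cf s f) * z f)); last first.
  by move=> f _; case: (wt_cf f ok) => ->.
elim: s ok => [|[g c] s IH].
  move=> _; rewrite /ev big_nil big1 // => f _.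
  by rewrite /cf big_nil rmorph0 mul0r.
rewrite /okf /= => /andP[/andP[gs us] /andP[/andP[gn cc] al]].
rewrite /ev big_cons /= -/(ev s z) -IH; last by rewrite /okf us al.
rewrite (bigD1 (Ordinal gn)) //= [in RHS](bigD1 (Ordinal gn)) //= addrA.
congr (_ + _).
  rewrite /cf big_cons /= eqxx -/(cf s g) (cf_notin gs) addr0 ratr_coef.
  by rewrite rmorph0 mul0r addr0.
apply: eq_bigr => f fg; rewrite /cf big_cons /=; case: eqP => // gf.
by case/eqP: fg; apply: val_inj.
Qed.

Lemma sum_cfN n s (z : nat -> R) : okf n s ->
  \sum_(f < n) wt rnd (- cf s f) * z f = - ev s z.
Proof.
move=> ok; rewrite -(@sum_cf n) // -sumrN; apply: eq_bigr => f _.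
by case: (wt_cf f ok) => -> ->; rewrite mulNr.
Qed.

Lemma linmap_l m (W : 'I_m -> lform) (z : 'I_dimT -> R) l : okf 64 (W l) ->
  linmap rnd (fun l => lpart (cf (W l))) z l = rnd (ev (W l) (fun f => z (pl f))).
Proof.
move=> ok; rewrite /linmap big_split_ord /= -(@sum_cf 64) //; congr rnd.
rewrite [X in _ + X]big1 => [|f _]; last first.
  by rewrite lpart_r /wt rmorph0 (rnd0 Hrnd Hp) mul0r.
rewrite addr0; apply: eq_bigr => f _.
by rewrite lpart_l /pl inordv.
Qed.

(** Layer norm of a paired state. Partners cancel in the mean and count twice in the variance,
    unpaired features count once in both; [lnS] is 64 times the variance of the 128 coordinates,
    which accounts for the factor 8 in [lnf]. *)
Definition lnmu (ms : seq nat) (v : nat -> R) : R :=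
  (\sum_(f <- ms | (56 <= f)%N) v f) / 128.
Definition lnS (ms : seq nat) (v : nat -> R) : R :=
  \sum_(f <- ms | ~~ (56 <= f)%N) v f ^+ 2
  + (\sum_(f <- ms | (56 <= f)%N) v f ^+ 2) / 2 - 64 * lnmu ms v ^+ 2.
Definition lnf (ms : seq nat) (v : nat -> R) (f : nat) : R :=
  rnd (if lnS ms v == 0 then 0
       else 8 * ((f \in ms)%:R * v f - lnmu ms v) / Num.sqrt (lnS ms v)).

Definition symv (h : 'I_dimT -> R) :=
  forall f, (f < 64)%N -> representable p (h (pl f)) /\
     h (pr f) = if (56 <= f)%N then 0 else - h (pl f).

Definition okm (ms : seq nat) := uniq ms && all (fun f => (f < 64)%N) ms.

Lemma sum_mem n ms (G : nat -> R) : uniq ms -> all (fun f => (f < n)%N) ms ->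
  \sum_(f < n) ((f : nat) \in ms)%:R * G f = \sum_(f <- ms) G f.
Proof.
move=> um /allP am.
rewrite -(big_mkord xpredT (fun f => (f \in ms)%:R * G f)).
rewrite (eq_bigr (fun f => if f \in ms then G f else 0)); last first.
  by move=> f _; case: ifP; rewrite ?mul1r ?mul0r.
rewrite -big_mkcond -big_filter.
apply: perm_big; apply: uniq_perm => //; first by rewrite filter_uniq ?iota_uniq.
move=> f; rewrite mem_filter mem_index_iota /=.
by case fm: (f \in ms) => //=; rewrite am.
Qed.

Lemma sum_mask ms (G : nat -> R) : okm ms ->
  \sum_(f < 64) ((f : nat) \in ms)%:R * G f = \sum_(f <- ms) G f.
Proof. by case/andP; apply: sum_mem. Qed.

Lemma maskv_pl ms h f : symv h -> (f < 64)%N ->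
  maskv rnd (mpart ms) h (pl f) = (f \in ms)%:R * h (pl f) /\
  maskv rnd (mpart ms) h (pr f) = (f \in ms)%:R * h (pr f).
Proof.
move=> sh f64; case: (sh f f64) => r1 r2.
rewrite /maskv /pl /pr mpart_l mpart_r -/(pl f) -/(pr f) inordK //.
case: (f \in ms); rewrite /wt ?rmorph1 ?rmorph0 ?(rnd1 Hrnd Hp) ?(rnd0 Hrnd Hp).
  rewrite !mul1r; split; apply: (rnd_id Hrnd) => //.
  rewrite r2; case: ifP => _; last exact: rep_opp.
  exact: (@rep_int _ _ Hp 0 isT).
by rewrite !mul0r (rnd0 Hrnd Hp).
Qed.

Lemma ln_pl ms h f : symv h -> okm ms -> (f < 64)%N ->
  layer_norm rnd (maskv rnd (mpart ms) h) (pl f) = lnf ms (fun f => h (pl f)) f.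
Proof.
move=> sh ok f64; rewrite /layer_norm /lnf; cbv zeta.
set x := maskv _ _ _; set v := fun f => h (pl f).
have xl (g : 'I_64) : x (lshift 64 g) = ((g : nat) \in ms)%:R * v g.
  by rewrite /x; have := maskv_pl ms sh (ltn_ord g); rewrite /pl /pr inordv => -[-> _]; rewrite /v /pl inordv.
have xr (g : 'I_64) : x (rshift 64 g) = ((g : nat) \in ms)%:R * (if (56 <= g)%N then 0 else - v g).
  rewrite /x; have := maskv_pl ms sh (ltn_ord g); rewrite /pl /pr inordv => -[_ ->].
  by rewrite /v /pl inordv; have [_] := sh g (ltn_ord g); rewrite /pr /pl inordv => ->.
have S1 : \sum_(k < dimT) x k = 128 * lnmu ms v.
  rewrite /lnmu mulrC divfK ?pnatr_eq0 // [RHS]big_mkcond -sum_mask //.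
  rewrite big_split_ord /= -big_split; apply: eq_bigr => g _ /=.
  by rewrite xl xr -mulrDr; case: ifP => _; rewrite ?addr0 ?subrr.
have D0 : (dimT%:R : R) = 128 by rewrite (_ : dimT = 128%N).
have S2 : \sum_(k < dimT) x k ^+ 2 = 128 * ((lnS ms v + 64 * lnmu ms v ^+ 2) / 64).
  rewrite /lnS subrK big_split_ord /= -big_split /=.
  rewrite [\sum_(f <- ms | ~~ _) _]big_mkcond [\sum_(f <- ms | (56 <= f)%N) _]big_mkcond /=.
  rewrite -!sum_mask // mulr_suml -big_split /= mulr_suml mulr_sumr.
  apply: eq_bigr => g _.
  rewrite xl xr; case: ifP => _ /=; case: ((g : nat) \in ms); rewrite ?mul1r ?mul0r; field => //.
have -> : (\sum_(k < dimT) x k) / dimT%:R = lnmu ms v.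
  by rewrite S1 D0; field.
have -> : (\sum_(k < dimT) (x k - lnmu ms v) ^+ 2) / dimT%:R = lnS ms v / 64.
  rewrite (eq_bigr (fun k => x k ^+ 2 + (- (2 * lnmu ms v) * x k + lnmu ms v ^+ 2))); last first.
    by move=> k _; ring.
  rewrite !big_split /= -mulr_sumr S1 S2 sumr_const card_ord D0.
  rewrite (_ : (lnmu ms v ^+ 2) *+ dimT = lnmu ms v ^+ 2 * 128); last first.
    by rewrite -D0 mulr_natr.
  by field.
congr rnd.
have -> : (lnS ms v / 64 == 0) = (lnS ms v == 0).
  by rewrite mulf_eq0 invr_eq0 pnatr_eq0 orbF.
case: ifP => // S0.
have -> : x (pl f) = (f \in ms)%:R * v f by rewrite /x (proj1 (maskv_pl ms sh f64)).
have -> : Num.sqrt (lnS ms v / 64) = Num.sqrt (lnS ms v) / 8.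
  case: (lerP 0 (lnS ms v)) => Sg.
    have e8 : 64^-1 = (8^-1) ^+ 2 :> R by field.
    by rewrite sqrtrM // e8 sqrtr_sqr ger0_norm // invr_ge0.
  (* The square root of a negative number is 0 by convention, on both sides. *)
  have Sg' : lnS ms v / 64 <= 0 by lra.
  by rewrite !ler0_sqrtr ?mul0r // ltW.
by rewrite invfM invrK mulrA mulrAC [_ * 8]mulrC.
Qed.

End Forms.

(** * Attention and feedforward sublayers as maps on features *)

Section Steps.
Variables (R : archiRcfType) (p : nat) (rnd : R -> R).
Hypothesis Hrnd : correct_rounding p rnd.
Hypothesis Hp : (20 <= p)%N.
Variable N : nat.

Definition score (s : head_spec) (Z : nat -> nat -> R) (i j : nat) : R :=
  rnd (\sum_(l < 4) rnd (ev (nth [::] (hq s) l) (Z i)) * rnd (ev (nth [::] (hk s) l) (Z j))).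
Definition best (s : head_spec) (Z : nat -> nat -> R) (i : nat) : {set 'I_N} :=
  [set j : 'I_N | (~~ hm s || (j <= i)%N) &&
    [forall j' : 'I_N, (~~ hm s || (j' <= i)%N) ==> (score s Z i j' <= score s Z i j)]].
Definition hval (s : head_spec) (Z : nat -> nat -> R) (l j : nat) : R :=
  rnd (ev (nth [::] (hv s) l) (Z j)).
Definition hout (s : head_spec) (Z : nat -> nat -> R) (i l : nat) : R :=
  rnd ((\sum_(j in best s Z i) hval s Z l j) / #|best s Z i|%:R).

Definition okh (s : head_spec) :=
  [&& all (okf 64) (hq s), all (okf 64) (hk s) & all (okf 64) (hv s)].

Lemma okf_nth W l : all (okf 64) W -> okf 64 (nth [::] W l).
Proof.
move=> /allP H; case: (ltnP l (size W)) => lW; first exact/H/mem_nth.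
by rewrite nth_default.
Qed.

Lemma linmap_nth m W (z : 'I_dimT -> R) (l : 'I_m) : all (okf 64) W ->
  linmap rnd (fun l : 'I_m => lpart (cf (nth [::] W l))) z l
  = rnd (ev (nth [::] W l) (fun f => z (pl f))).
Proof.
move=> ok.
by rewrite (@linmap_l R p rnd Hrnd Hp m (fun l : 'I_m => nth [::] W l)) //; apply: okf_nth.
Qed.

Lemma headE s (z : state R dimT) i (l : 'I_4) : okh s ->
  head_out rnd N (mkH s) z i l = hout s (fun j f => z j (pl f)) i l.
Proof.
case/and3P=> oq ok ov; rewrite /head_out /hout /best; cbv zeta.
have sE j : rnd (\sum_(l0 < 4) linmap rnd (h_Q (mkH s)) (z i) l0 * linmap rnd (h_K (mkH s)) (z j) l0)
  = score s (fun j f => z j (pl f)) i j.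
  by rewrite /score; congr rnd; apply: eq_bigr => l0 _; rewrite !linmap_nth.
congr (rnd (_ / _%:R)); last first.
  apply: eq_card => j; rewrite !inE /= sE; congr (_ && _).
  by apply: eq_forallb => j'; rewrite sE.
rewrite /hval; apply: eq_big => [j|j _]; last by rewrite linmap_nth.
rewrite !inE /= sE; congr (_ && _).
by apply: eq_forallb => j'; rewrite sE.
Qed.

Definition ao_at sp f : option (nat * nat) := ohead [seq e.2 | e <- ao sp & e.1 == f].

Definition okao (s : seq (nat * (nat * nat))) := uniq (unzip1 s) &&
  all (fun e => [&& (e.1 < 64)%N, (e.2.1 < 5)%N & (e.2.2 < 4)%N]) s.

Lemma mem_ao sp f x : okao (ao sp) -> ((f, x) \in ao sp) = (ao_at sp f == Some x).
Proof.
rewrite /okao /ao_at => /andP[+ _]; elim: (ao sp) => [|[g y] s IH] //=.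
case/andP=> gs us; rewrite in_cons {}IH // xpair_eqE [g == f]eq_sym.
case: eqP => [fg|//] /=; subst g.
rewrite (_ : [seq e <- s | e.1 == f] = [::]) /=.
  by rewrite orbF; apply/eqP/eqP => [->|[]].
apply/eqP; rewrite -(negbK (_ == _)) -has_filter; apply/negP => /hasP[e es /eqP ef].
by move/negP: gs; apply; rewrite -ef map_f.
Qed.

Definition symst (h : state R dimT) := forall i, symv p (h i).

Definition feat (h : state R dimT) (i f : nat) : R := h i (pl f).

Definition astep sp (H : nat -> nat -> R) (i f : nat) : R :=
  if ao_at sp f is Some (hh, l) then
    rnd (H i f + hout (nth no_head (hs sp) hh) (fun j => lnf rnd (am sp) (H j)) i l)
  else H i f.

Definition oka sp := [&& okao (ao sp), okm (am sp) & all okh (hs sp)].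

Lemma eq_hout s Z Z' i l : okh s -> (forall j f, (f < 64)%N -> Z j f = Z' j f) -> hout s Z i l = hout s Z' i l.
Proof.
move=> /and3P[oq ok ov] ZZ.
have evE W m j : all (okf 64) W -> ev (nth [::] W m) (Z j) = ev (nth [::] W m) (Z' j).
  move=> /(okf_nth m) /andP[_ /allP oW]; apply: eq_big_seq => t /oW /andP[t64 _].
  by rewrite ZZ.
have sE j : score s Z i j = score s Z' i j.
  by rewrite /score; congr rnd; apply: eq_bigr => l0 _; rewrite !evE.
have bE : best s Z i = best s Z' i.
  apply/setP => j; rewrite !inE sE; congr (_ && _).
  by apply: eq_forallb => j'; rewrite sE.
by rewrite /hout bE; congr (rnd (_ / _)); apply: eq_bigr => j _; rewrite /hval evE.
Qed.

(** The partner stays the exact negative because a paired feature is written from the value 0: the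
    increment is already representable, so adding it to 0 and negating it involve no rounding. *)
Lemma attn_step sp (h : state R dimT) i f : oka sp -> symst h ->
  ((f < 56)%N -> f \in unzip1 (ao sp) -> feat h i f = 0) -> (f < 64)%N ->
  attn_sublayer rnd N (mkL sp) h i (pl f) = astep sp (feat h) i f /\
  attn_sublayer rnd N (mkL sp) h i (pr f) =
     (if (56 <= f)%N then 0 else - astep sp (feat h) i f) /\
  representable p (astep sp (feat h) i f).
Proof.
case/and3P=> oo om oh sh fresh f64.
have [rf nf] := sh i f f64.
rewrite /attn_sublayer; cbv zeta; set z := fun j => layer_norm _ _.
pose Z := fun j => lnf rnd (am sp) (feat h j).
have hE hh (l : 'I_4) : head_out rnd N (mkH (nth no_head (hs sp) hh)) z i l
   = hout (nth no_head (hs sp) hh) Z i l.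
  have okhh : okh (nth no_head (hs sp) hh).
    case: (ltnP hh (size (hs sp))) => hhs; last by rewrite nth_default.
    by move/(all_nthP no_head): oh; apply.
  rewrite headE //; apply: eq_hout => // j g g64.
  by rewrite /z (ln_pl Hrnd Hp (sh j)).
have rh hh l : representable p (hout (nth no_head (hs sp) hh) Z i l) by apply: (rnd_rep Hrnd).
have dl (k : 'I_dimT) g c : (forall hh : 'I_5, forall l : 'I_4,
    wt rnd (@a_out _ _ _ _ (mkL sp) k hh l) = c * (ao_at sp g == Some (hh : nat, l : nat))%:R) ->
   \sum_(hh < 5) \sum_(l < 4) wt rnd (@a_out _ _ _ _ (mkL sp) k hh l) *
     head_out rnd N (a_heads (mkL sp) hh) z i l =
   if ao_at sp g is Some (hh, l) then c * hout (nth no_head (hs sp) hh) Z i l else 0.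
  move=> wE; under eq_bigr => hh _ do under eq_bigr => l _ do rewrite wE /= hE.
  case aE: (ao_at sp g) => [[h0 l0]|]; last first.
    by rewrite big1 // => hh _; rewrite big1 // => l _; rewrite mulr0 mul0r.
  have : (g, (h0, l0)) \in ao sp by rewrite mem_ao // aE.
  move=> gin; case/andP: (oo) => _ /allP al; case/and3P: (al _ gin) => _ /= h5 l4.
  rewrite (bigD1 (Ordinal h5)) //= (bigD1 (Ordinal l4)) //= eqxx mulr1.
  rewrite big1 => [|l ll]; last first.
    rewrite (_ : (_ == _) = false) ?mulr0 ?mul0r //; apply/negP => /eqP[] e.
    by move/eqP: ll; apply; apply: val_inj.
  rewrite big1 => [|hh hl]; last first.
    rewrite big1 // => l _.
    rewrite (_ : (_ == _) = false) ?mulr0 ?mul0r //; apply/negP => /eqP[e _].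
    by move/eqP: hl; apply; apply: val_inj.
  by rewrite !addr0.
have wl : forall hh : 'I_5, forall l : 'I_4,
    wt rnd (@a_out _ _ _ _ (mkL sp) (pl f) hh l) = 1 * (ao_at sp f == Some (hh : nat, l : nat))%:R.
  move=> hh l; rewrite /= /pl opart_l inordK // mem_ao //.
  by case: (_ == _); rewrite /wt ?rmorph1 ?rmorph0 ?(rnd1 Hrnd Hp) ?(rnd0 Hrnd Hp) ?mulr1 ?mulr0.
have wr : forall hh : 'I_5, forall l : 'I_4,
    wt rnd (@a_out _ _ _ _ (mkL sp) (pr f) hh l) =
    (if (56 <= f)%N then 0 else - 1) * (ao_at sp f == Some (hh : nat, l : nat))%:R.
  move=> hh l; rewrite /= /pr opart_r inordK // mem_ao //.
  have rN1 : rnd (- 1) = - 1 by apply: (rnd_id Hrnd); have := @rep_int R p Hp (- 1) isT.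
  case: ifP => _; case: (_ == _);
   by rewrite /wt ?rmorphN /= ?rmorph1 ?rmorph0 ?oppr0 ?rN1 ?(rnd0 Hrnd Hp) ?mulr1 ?mulr0.
rewrite (dl _ _ _ wl) (dl _ _ _ wr) /astep -/Z -/(feat h i f) -/(feat h i f) in rf nf *.
rewrite nf; case aE: (ao_at sp f) => [[h0 l0]|]; last first.
  rewrite (rnd0 Hrnd Hp) !addr0; split; first exact: (rnd_id Hrnd).
  split; last by [].
  case: ifP => _; first exact: (rnd0 Hrnd Hp).
  by apply: (rnd_id Hrnd); apply: rep_opp.
rewrite mul1r (rnd_id Hrnd (rh _ _)); split; first by [].
split; last exact: (rnd_rep Hrnd).
case: ifP => f56; first by rewrite mul0r (rnd0 Hrnd Hp) addr0 (rnd0 Hrnd Hp).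
have f0 : feat h i f = 0.
  apply: fresh; first by rewrite ltnNge f56.
  have : (f, (h0, l0)) \in ao sp by rewrite mem_ao // aE.
  by move/(map_f fst).
rewrite f0 oppr0 !add0r mulN1r.
have rN := rep_opp (rh h0 l0).
by rewrite (rnd_id Hrnd rN) (rnd_id Hrnd rN) (rnd_id Hrnd (rh _ _)).
Qed.

Definition hid sp (v : nat -> R) (m : nat) : R :=
  relu (rnd (ev (nth [::] (hd sp) m) (lnf rnd (fm sp) v))).
Definition fstep sp (v : nat -> R) (f : nat) : R :=
  rnd (v f + rnd (ev (fo_at sp f) (hid sp v))).

(** A paired feature may only copy one hidden unit, with coefficient 64/64 = 1, so that its partner
    receives exactly the negative. The unpaired features, from 56 on, may combine several units. *)
Definition okff sp := [&& okm (fm sp), all (okf 64) (hd sp),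
  all (fun e => okf 8 (fo_at sp e.1)) (fo sp) &
  all (fun e => (56 <= e.1)%N || (if fo_at sp e.1 is [:: (m, c)] then c == 64 else false)) (fo sp)].

Lemma ff_step sp (h : state R dimT) i f : okff sp -> symst h ->
  ((f < 56)%N -> f \in unzip1 (fo sp) -> feat h i f = 0) -> (f < 64)%N ->
  ff_sublayer rnd (mkL sp) h i (pl f) = fstep sp (feat h i) f /\
  ff_sublayer rnd (mkL sp) h i (pr f) =
     (if (56 <= f)%N then 0 else - fstep sp (feat h i) f) /\
  representable p (fstep sp (feat h i) f).
Proof.
case/and4P=> om od o8 op sh fresh f64.
have [rf nf] := sh i f f64.
rewrite /ff_sublayer; cbv zeta; set z := layer_norm _ _.
set hi := fun m => relu _.
have hE (m : 'I_8) : hi m = hid sp (feat h i) m.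
  rewrite /hi /hid /= linmap_nth //; congr (relu (rnd _)).
  have /andP[_ /allP oW] := okf_nth m od; apply: eq_big_seq => t /oW /andP[t64 _].
  by rewrite /z (ln_pl Hrnd Hp (sh i)).
have rh m : representable p (hid sp (feat h i) m).
  rewrite /hid /relu maxEle; case: ifP => _; first exact: (rnd_rep Hrnd).
  exact: (@rep_int _ _ Hp 0).
have ok8 : okf 8 (fo_at sp f).
  case fo0: (f \in unzip1 (fo sp)).
    by move/mapP: fo0 => [e es ->]; move/allP: o8; apply.
  rewrite /fo_at (_ : [seq e <- fo sp | e.1 == f] = [::]) //.
  apply/eqP; rewrite -(negbK (_ == _)) -has_filter; apply/negP => /hasP[e es /eqP ef].
  by move/negP: fo0; apply; rewrite -ef map_f.
have lE : linmap rnd (f_U (mkL sp)) hi (pl f) = rnd (ev (fo_at sp f) (hid sp (feat h i))).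
  rewrite /linmap -(sum_cf Hrnd Hp (n := 8)) //; congr rnd; apply: eq_bigr => m _.
  by rewrite /= /pl opart_l inordK // hE.
have lN : linmap rnd (f_U (mkL sp)) hi (pr f) =
    if (56 <= f)%N then 0 else rnd (- ev (fo_at sp f) (hid sp (feat h i))).
  rewrite /linmap; case: ifP => f56.
    rewrite big1 ?(rnd0 Hrnd Hp) // => m _.
    by rewrite /= /pr opart_r inordK // f56 /wt rmorph0 (rnd0 Hrnd Hp) mul0r.
  rewrite -(sum_cfN Hrnd Hp (n := 8)) //; congr rnd; apply: eq_bigr => m _.
  by rewrite /= /pr opart_r inordK // f56 hE.
rewrite lE lN /fstep -/(feat h i f) -/(feat h i f) in rf nf *.
rewrite nf; split; first by [].
split; last exact: (rnd_rep Hrnd).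
case: ifP => f56; first by rewrite addr0 (rnd0 Hrnd Hp).
case fo0: (f \in unzip1 (fo sp)); last first.
  rewrite (_ : fo_at sp f = [::]); last first.
    rewrite /fo_at (_ : [seq e <- fo sp | e.1 == f] = [::]) //.
    apply/eqP; rewrite -(negbK (_ == _)) -has_filter; apply/negP => /hasP[e es /eqP ef].
    by move/negP: fo0; apply; rewrite -ef map_f.
  rewrite /ev big_nil oppr0 (rnd0 Hrnd Hp) !addr0 (rnd_id Hrnd rf).
  exact: (rnd_id Hrnd (rep_opp rf)).
have f0 : feat h i f = 0 by apply: fresh => //; rewrite ltnNge f56.
rewrite f0 oppr0 !add0r.
move/mapP: fo0 => [e es fe]; have := (allP op) e es; rewrite -fe f56 /=.
case: (fo_at sp f) => [//|[m c] []] // /eqP ->.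
rewrite /ev big_cons big_nil /= addr0 (_ : 64%:~R / 64 = 1 :> R) ?mul1r; last by field.
have rN := rep_opp (rh m).
by rewrite (rnd_id Hrnd rN) (rnd_id Hrnd rN) !(rnd_id Hrnd (rh _)).
Qed.

End Steps.

(** * Straight-line computations in which each feature is written once *)

Inductive sublayer := SA of layer_spec | SF of layer_spec.

Definition targets (x : sublayer) : seq nat :=
  match x with SA sp => unzip1 (ao sp) | SF sp => unzip1 (fo sp) end.
Definition smask (x : sublayer) : seq nat :=
  match x with SA sp => am sp | SF sp => fm sp end.
Definition oks (x : sublayer) : bool :=
  match x with
  | SA sp => oka sp
  | SF sp => okff sp && all (fun e => if fo_at sp e.1 is [:: (m, c)] then c == 64 else false) (fo sp)
  end.

(* Every feature is written by at most one sublayer, after the features that this sublayer reads. *)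
Fixpoint chk (W : seq nat) (s : seq sublayer) : bool :=
  if s is x :: s' then
    [&& oks x, all (fun f => (f < 64)%N && (f \notin W)) (targets x),
        all (fun f => f \in W) (smask x) & chk (W ++ targets x) s']
  else true.

Definition subs_of (sps : seq layer_spec) : seq sublayer :=
  flatten [seq [:: SA sp; SF sp] | sp <- sps].

Section Trajectory.
Variables (R : archiRcfType) (p : nat) (rnd : R -> R).
Hypothesis Hrnd : correct_rounding p rnd.
Hypothesis Hp : (20 <= p)%N.
Variable N : nat.

Definition sapply (h : state R dimT) (x : sublayer) : state R dimT :=
  match x with
  | SA sp => attn_sublayer rnd N (mkL sp) h
  | SF sp => ff_sublayer rnd (mkL sp) h
  end.

Lemma foldl_subs sps (h : state R dimT) :
  foldl (fun h L => layer_apply rnd N L h) h (map mkL sps) = foldl sapply h (subs_of sps).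
Proof. by elim: sps h => //= sp s IH h; rewrite IH. Qed.

(** Both sides are read off the same state [V]. With single assignment the state after the last
    sublayer satisfies the equations of all sublayers at once, and time disappears from the
    analysis. *)
Definition seqn (V : nat -> nat -> R) (x : sublayer) : Prop :=
  match x with
  | SA sp => forall i f hh l, (f, (hh, l)) \in ao sp ->
      V i f = hout rnd N (nth no_head (hs sp) hh) (fun j => lnf rnd (am sp) (V j)) i l
  | SF sp => forall i f m, (f, [:: (m, 64%:Z)]) \in fo sp -> V i f = hid rnd sp (V i) m
  end.

Fixpoint eqns (V : nat -> nat -> R) (s : seq sublayer) : Prop :=
  if s is x :: s' then seqn V x /\ eqns V s' else True.

Lemma fo_at_nil sp f : f \notin unzip1 (fo sp) -> fo_at sp f = [::].
Proof.
move=> fo0; rewrite /fo_at (_ : [seq e <- fo sp | e.1 == f] = [::]) //.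
apply/eqP; rewrite -(negbK (_ == _)) -has_filter; apply/negP => /hasP[e es /eqP ef].
by move/negP: fo0; apply; rewrite -ef map_f.
Qed.

Lemma ao_at_none sp f : f \notin unzip1 (ao sp) -> ao_at sp f = None.
Proof.
move=> fo0; rewrite /ao_at (_ : [seq e <- ao sp | e.1 == f] = [::]) //.
apply/eqP; rewrite -(negbK (_ == _)) -has_filter; apply/negP => /hasP[e es /eqP ef].
by move/negP: fo0; apply; rewrite -ef map_f.
Qed.

Lemma sapply_sym x h : oks x -> symst p h ->
  (forall i f, (f < 56)%N -> f \in targets x -> feat h i f = 0) -> symst p (sapply h x).
Proof.
case: x => sp /= ok sh fresh i f f64.
  have [e1 [e2 r]] := @attn_step R p rnd Hrnd Hp N sp h i f ok sh (fun a b => fresh i f a b) f64.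
  by rewrite e1 e2.
case/andP: ok => ok _.
have [e1 [e2 r]] := @ff_step R p rnd Hrnd Hp sp h i f ok sh (fun a b => fresh i f a b) f64.
by rewrite e1 e2.
Qed.

Lemma sapply_same x h i f : oks x -> symst p h -> (f < 64)%N -> f \notin targets x ->
  feat (sapply h x) i f = feat h i f.
Proof.
case: x => sp /= ok sh f64 nf; rewrite /feat /=.
  have fr : (f < 56)%N -> f \in unzip1 (ao sp) -> feat h i f = 0 by rewrite (negbTE nf).
  have [-> _] := @attn_step R p rnd Hrnd Hp N sp h i f ok sh fr f64.
  by rewrite /astep ao_at_none.
case/andP: ok => ok _.
have fr : (f < 56)%N -> f \in unzip1 (fo sp) -> feat h i f = 0 by rewrite (negbTE nf).
have [-> _] := @ff_step R p rnd Hrnd Hp sp h i f ok sh fr f64.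
rewrite /fstep fo_at_nil // /ev big_nil (rnd0 Hrnd Hp) addr0.
by apply: (rnd_id Hrnd); case: (sh i f f64).
Qed.

Lemma lnf_ext ms (v w : nat -> R) g : {in ms, v =1 w} -> lnf rnd ms v g = lnf rnd ms w g.
Proof.
move=> vw; have muE : lnmu ms v = lnmu ms w.
  rewrite /lnmu; congr (_ / _); rewrite big_seq_cond [RHS]big_seq_cond.
  by apply: eq_bigr => f /andP[/vw].
have SE : lnS ms v = lnS ms w.
  rewrite /lnS muE; congr (_ + _ / _ - _); rewrite big_seq_cond [RHS]big_seq_cond;
  by apply: eq_bigr => f /andP[/vw ->].
rewrite /lnf muE SE; case gm: (g \in ms); last by rewrite !mul0r.
by rewrite !mul1r (vw _ gm).
Qed.

Lemma eq_score s (Z Z' : nat -> nat -> R) i j : (forall j, Z j =1 Z' j) ->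
  score rnd s Z i j = score rnd s Z' i j.
Proof.
move=> ZZ; have evE W k : ev W (Z k) = ev W (Z' k) by apply: eq_bigr => t _; rewrite ZZ.
by rewrite /score; congr rnd; apply: eq_bigr => l _; rewrite !evE.
Qed.

Lemma hout_ext s (Z Z' : nat -> nat -> R) i l : (forall j, Z j =1 Z' j) ->
  hout rnd N s Z i l = hout rnd N s Z' i l.
Proof.
move=> ZZ; have bE : best rnd N s Z i = best rnd N s Z' i.
  apply/setP => j; rewrite !inE (eq_score _ _ _ ZZ); congr (_ && _).
  by apply: eq_forallb => j'; rewrite (eq_score _ _ _ ZZ).
rewrite /hout bE; congr (rnd (_ / _)); apply: eq_bigr => j _; rewrite /hval.
by congr rnd; apply: eq_bigr => t _; rewrite ZZ.
Qed.

(** [W] collects the features written so far. Those outside [W] are still 0, which is the freshness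
    that [attn_step] and [ff_step] require; those in [W] never change again, so an equation that
    holds when a feature is written survives to the end. *)
Lemma trajectory s W (h : state R dimT) : chk W s -> symst p h ->
  (forall i f, (f < 64)%N -> f \notin W -> feat h i f = 0) ->
  let V := feat (foldl sapply h s) in
  [/\ symst p (foldl sapply h s),
      forall i f, (f < 64)%N -> f \in W -> V i f = feat h i f,
      forall i f, (f < 64)%N -> f \notin W ++ flatten (map targets s) -> V i f = 0
    & eqns V s].
Proof.
elim: s W h => [|x s IH] W h /=.
  by move=> _ sh h0; split=> // i f f64; rewrite cats0; apply: h0.
case/and4P=> okx /allP tx /allP mx cs sh h0.
have fresh i f : (f < 56)%N -> f \in targets x -> feat h i f = 0.
  by move=> f56 /tx /andP[f64 fW]; apply: h0.
have sh1 := sapply_sym okx sh fresh.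
have h1 i f : (f < 64)%N -> f \notin W ++ targets x -> feat (sapply h x) i f = 0.
  rewrite mem_cat negb_or => f64 /andP[fW ft].
  by rewrite (sapply_same _ okx sh) // h0.
have [s1 s2 s3 s4] := IH _ _ cs sh1 h1.
have VW i f : (f < 64)%N -> f \in W -> feat (foldl sapply (sapply h x) s) i f = feat h i f.
  move=> f64 fW; rewrite s2 ?mem_cat ?fW //; apply: sapply_same => //.
  by apply/negP => /tx /andP[_]; rewrite fW.
split=> //; first by move=> i f f64; rewrite catA; apply: s3.
split=> //.
have fx i f : f \in targets x -> (f < 64)%N /\ feat h i f = 0 /\
    feat (foldl sapply (sapply h x) s) i f = feat (sapply h x) i f.
  move=> ft; case/andP: (tx _ ft) => f64 fW; split=> //; split; first exact: h0.
  by apply: s2 => //; rewrite mem_cat ft orbT.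
case: x okx tx mx {cs fresh} sh1 h1 s1 s2 s3 s4 VW fx => sp /= okx tx mx sh1 h1 s1 s2 s3 s4 VW fx.
  move=> i f hh l fin.
  have ft : f \in unzip1 (ao sp) by apply/mapP; exists (f, (hh, l)).
  have [f64 [f0 ->]] := fx i f ft.
  rewrite /feat; have fr : (f < 56)%N -> f \in unzip1 (ao sp) -> feat h i f = 0 by [].
  have [-> _] := @attn_step R p rnd Hrnd Hp N sp h i f okx sh fr f64.
  case/and3P: okx => oo /andP[_ /allP om] _.
  move: fin; rewrite mem_ao // => /eqP aE; rewrite /astep aE f0 add0r.
  rewrite (rnd_id Hrnd); last exact: (rnd_rep Hrnd).
  apply: hout_ext => j g; apply: lnf_ext => m mm; rewrite -/(feat _ j m) VW //; first exact: om.
  exact: mx.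
move=> i f m fin.
have ft : f \in unzip1 (fo sp) by apply/mapP; exists (f, [:: (m, 64%:Z)]).
have [f64 [f0 ->]] := fx i f ft.
have fr : (f < 56)%N -> f \in unzip1 (fo sp) -> feat h i f = 0 by [].
case/andP: okx => okx /allP one.
rewrite /feat; have [-> _] := @ff_step R p rnd Hrnd Hp sp h i f okx sh fr f64.
rewrite /fstep f0 add0r.
have -> : fo_at sp f = [:: (m, 64%:Z)].
  have := one _ fin => /=.
  have : (m, 64%:Z) \in fo_at sp f.
    by apply/flattenP; exists [:: (m, 64%:Z)]; rewrite ?inE //; apply/mapP; exists (f, [:: (m, 64%:Z)]); rewrite ?mem_filter ?eqxx.
  by case: (fo_at sp f) => [//|[m' c] [|//]]; rewrite inE => /eqP -> _.
case/and4P: okx => /andP[_ /allP om] _ _ _.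
rewrite /ev big_cons big_nil addr0 /= (_ : 64%:~R / 64 = 1 :> R) ?mul1r; last by field.
have rh : representable p (hid rnd sp (feat h i) m).
  rewrite /hid /relu maxEle; case: ifP => _; first exact: (rnd_rep Hrnd).
  exact: (@rep_int _ _ Hp 0).
rewrite !(rnd_id Hrnd rh) /hid; congr (relu (rnd _)); apply: eq_bigr => t _.
congr (_ * _); apply: lnf_ext => g gm; rewrite -/(feat _ i g) VW //; first exact: om.
exact: mx.
Qed.

End Trajectory.

(** * The transformer *)

(* Intended values at a position that is the [r]-th (from 0) of its kind of token, where [b = 1 / N], [rho], [tau]
   and [eta] are of the order of [b^7], [b^9] and [b^11], and [dl = eta / rho]:
   [fY, fX, fDS] = [1/(r+2), 1/(n+1), 1/(s+2)]; [fG k] is about [b^k] at the first position and 0 elsewhere;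
   [fE1, fES, fE2, fE3] = [eta] times [r+2, s+2, (n+1)(r+2), n+1]; [fKY, fKD] = [dl n r, dl];
   [fDP, fDN] are the positive parts of [dl (s-r)] and [dl (r-s)]; [fQQ, fNQ] = [eta] times [r/n, n (r/n)];
   [fII, fJJ] = [eta] times the quotient and remainder of [r/n] by [n];
   [fKQ, fKR, fKI, fKJ] = [dl] times [r/n, r mod n, (r/n)/n, (r/n) mod n];
   at the last position, [fGG] and [fGB] are bounded below if [s = t] and negligible otherwise.
   The bits, stored as 0 or [tau]: [bR] is the current matrix on the adjacency positions, [bX, bY, bA] are its entries
   [(i,k)], [(k,j)] and their conjunction at the padding position [(i,j,k)], [bO] is the disjunction over [k]. *)
Notation fBOS := 0%N.  Notation fT0 := 1%N.  Notation fT1 := 2%N.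
Notation fPAD := 3%N.  Notation fTA := 4%N.  Notation fTB := 5%N.
Notation fY := 6%N.    Notation fX := 7%N.   Notation fDS := 8%N.
Notation fG k := (8 + k)%N.
Notation fRHO := 19%N. Notation fTAU := 20%N. Notation fETA := 21%N.
Notation fE1 := 22%N.  Notation fES := 23%N. Notation fE2 := 24%N. Notation fE3 := 25%N.
Notation fKY := 26%N.  Notation fDP := 27%N. Notation fDN := 28%N. Notation fKD := 29%N.
Notation fQQ := 30%N.  Notation fNQ := 31%N. Notation fGG := 32%N.
Notation fII := 33%N.  Notation fJJ := 34%N.
Notation fKQ := 35%N.  Notation fKR := 36%N. Notation fKI := 37%N. Notation fKJ := 38%N.
Notation fGB := 39%N.
Notation bR := 56%N.   Notation bX := 57%N.  Notation bY := 58%N.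
Notation bA := 59%N.   Notation bO := 60%N.  Notation bANS := 61%N.

Definition flags := [:: fBOS; fT0; fT1; fPAD; fTA; fTB].

(* Layer norm multiplies a dominant unit feature by 8, hence the usual coefficient 8/64. *)
Definition c8 (l : seq nat) : lform := [seq (f, 8%:Z) | f <- l].
Arguments c8 : simpl never.

(** Every key list contains [fBOS]: the first position ties with the tokens of the query's kind and
    contributes the only value 1 to their average. *)
Definition hd_Y := HeadSpec true
  [:: c8 [:: fT0; fT1]; c8 [:: fPAD]; c8 [:: fTA]; c8 [:: fTB]]
  [:: c8 [:: fBOS; fT0; fT1]; c8 [:: fBOS; fPAD]; c8 [:: fBOS; fTA]; c8 [:: fBOS; fTB]]
  [:: c8 [:: fBOS]].
(** The share of adjacency tokens among adjacency and padding tokens is n^2 / (n^2 + n^3) =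
    1/(n+1). *)
Definition hd_X := HeadSpec false [:: c8 flags] [:: c8 [:: fT0; fT1; fPAD]] [:: c8 [:: fT0; fT1]].
Definition hd_DS := HeadSpec false [:: c8 flags] [:: c8 [:: fBOS; fTA]] [:: c8 [:: fBOS]].
(* At the first position this head averages feature [f] over the whole input; elsewhere it looks at the padding. *)
Definition hd_gate f := HeadSpec false [:: c8 [:: fT0; fT1; fPAD; fTA; fTB]] [:: c8 [:: fPAD]]
  [:: c8 [:: f]].
(** Without queries all scores are 0, and the average runs over the whole input. *)
Definition hd_unif f := HeadSpec false [::] [::] [:: c8 [:: f]].

Definition layer_first := LayerSpec flags [:: hd_Y; hd_X; hd_DS; hd_gate fBOS]
  [:: (fY, (0, 0)); (fX, (1, 0)); (fDS, (2, 0)); (fG 1, (3, 0))]%N flags [::] [::].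

Definition layer_chain k out := LayerSpec (fG k :: flags)
  [:: no_head; no_head; no_head; hd_gate (fG k); hd_unif (fG k)] out flags.

Definition chain k := layer_chain k [:: (fG k.+1, (3, 0))]%N [::] [::].

Definition ff_only ms hd fo := LayerSpec [::] [::] [::] ms hd fo.

Definition key_mask := flags ++ [:: fKY; fETA; fE1; fE2; fE3; fRHO].
(** The first coordinate is eta (r - (n-1)/2). The shift by (n-1)/2 turns rounding to the nearest
    multiple of n into rounding down, so that the nearest key n q has q = r/n. *)
Definition q_div : seq lform := [:: [:: (fE1, 8%:Z); (fE3, - 4%:Z); (fETA, - 8%:Z)]; [::]; c8 [:: fRHO]].
Definition k_div : seq lform := [:: c8 [:: fKY]; [::]; c8 [:: fT0; fT1]].
(** This is eta (r - n (r/n)), the remainder of r modulo n in units of eta. *)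
Definition l_rem : lform := [:: (fE1, 8%:Z); (fETA, - 16%:Z); (fNQ, - 8%:Z)].

(** Coefficients - 16 on the flags of all kinds but one switch a hidden unit off: at the other kinds
    its argument is at most 11/10 - 2, so relu returns 0; this produces [bR] at the tokens 1 and
    [fGB] at the tokens b. The feedforward masks without flags let [fY], [fDS], [fX] and [fRHO] in
    turn dominate the norm and thus act as divisors. *)
Definition init_specs : seq layer_spec :=
  [:: layer_first; chain 1; chain 2; chain 3; chain 4; chain 5;
      layer_chain 6 [:: (fG 7, (3, 0)); (fRHO, (4, 0))]%N [::] [::];
      chain 7;
      LayerSpec (fG 8 :: flags) [:: no_head; no_head; no_head; hd_gate (fG 8); hd_unif (fG 8)]
        [:: (fG 9, (3, 0)); (fTAU, (4, 0))]%N (fTAU :: flags)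
        [:: [:: (fTAU, 8%:Z); (fBOS, - 16%:Z); (fT0, - 16%:Z); (fPAD, - 16%:Z);
                (fTA, - 16%:Z); (fTB, - 16%:Z)]]
        [:: (bR, [:: (0%N, 64%:Z)])];
      chain 9;
      LayerSpec (fG 10 :: flags) [:: no_head; no_head; no_head; no_head; hd_unif (fG 10)]
        [:: (fETA, (4, 0))]%N [:: fY; fETA] [:: c8 [:: fETA]] [:: (fE1, [:: (0%N, 64%:Z)])];
      ff_only [:: fDS; fETA] [:: c8 [:: fETA]] [:: (fES, [:: (0%N, 64%:Z)])];
      ff_only [:: fX; fETA; fE1] [:: c8 [:: fE1]; c8 [:: fETA]]
        [:: (fE2, [:: (0%N, 64%:Z)]); (fE3, [:: (1%N, 64%:Z)])];
      ff_only [:: fRHO; fETA; fE1; fE2; fE3; fES]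
        [:: [:: (fE2, 8%:Z); (fE1, - 8%:Z); (fE3, - 16%:Z); (fETA, 16%:Z)];
            [:: (fES, 8%:Z); (fE1, - 8%:Z)]; [:: (fE1, 8%:Z); (fES, - 8%:Z)]; c8 [:: fETA]]
        [:: (fKY, [:: (0%N, 64%:Z)]); (fDP, [:: (1%N, 64%:Z)]); (fDN, [:: (2%N, 64%:Z)]);
            (fKD, [:: (3%N, 64%:Z)])];
      LayerSpec key_mask
        [:: HeadSpec false q_div k_div
          [:: [:: (fE1, 8%:Z); (fETA, - 16%:Z)];
              [:: (fE2, 8%:Z); (fE1, - 8%:Z); (fE3, - 16%:Z); (fETA, 16%:Z)]]]
        [:: (fQQ, (0, 0)); (fNQ, (0, 1))]%N
        [:: fKD; fDP; fDN] [:: [:: (fKD, 8%:Z); (fDP, - 16%:Z); (fDN, - 16%:Z)]]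
        [:: (fGG, [:: (0%N, 64%:Z)])];
      LayerSpec (key_mask ++ [:: fQQ; fNQ])
        [:: HeadSpec false q_div k_div [:: c8 [:: fQQ]; l_rem]]
        [:: (fII, (0, 0)); (fJJ, (0, 1))]%N
        [:: fRHO; fQQ; fNQ; fE1; fETA; fII; fJJ]
        [:: c8 [:: fQQ]; l_rem; c8 [:: fII]; c8 [:: fJJ]]
        [:: (fKQ, [:: (0%N, 64%:Z)]); (fKR, [:: (1%N, 64%:Z)]); (fKI, [:: (2%N, 64%:Z)]);
            (fKJ, [:: (3%N, 64%:Z)])];
      ff_only (fGG :: flags)
        [:: [:: (fGG, 8%:Z); (fBOS, - 16%:Z); (fT0, - 16%:Z); (fT1, - 16%:Z); (fPAD, - 16%:Z);
                (fTA, - 16%:Z)]]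
        [:: (fGB, [:: (0%N, 64%:Z)])]].

(* Coordinate [fZ] is never written, so that after layer norm it carries minus the mean; weighting it so that the
   coefficients of a form sum to zero makes the form insensitive to the mean, i.e. to the unpaired features. *)
Notation fZ := 63%N.
Definition bal (f : lform) : lform := (fZ, - foldr (fun t a => t.2 + a) 0 f) :: f.

Definition adj_keys : seq lform := [:: bal (c8 [:: fKQ]); bal (c8 [:: fKR]); bal (c8 [:: fT0; fT1])].

(** At the padding token (i,j,k) the two heads query (i,k) and (k,j). Units 0 and 1 form the ramp
    relu L - relu (L - tau) with L = 2 X + 2 Y - 5/2 tau, a conjunction that ends near 0 or tau even
    for inexact inputs. The remaining pairs relu z - relu (- z) = z subtract the old contents, since
    a residual stream can only be added to. *)
Definition rep1 := LayerSpec (flags ++ [:: fKQ; fKR; fII; fJJ; fE1; fETA; fNQ; fRHO; bR; fZ])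
  [:: HeadSpec false [:: bal (c8 [:: fII]); bal l_rem; bal (c8 [:: fRHO])] adj_keys [:: bal (c8 [:: bR])];
      HeadSpec false [:: bal l_rem; bal (c8 [:: fJJ]); bal (c8 [:: fRHO])] adj_keys [:: bal (c8 [:: bR])]]
  [:: (bX, (0, 0)); (bY, (1, 0))]%N
  (flags ++ [:: fTAU; bX; bY; bA; fZ])
  [:: bal [:: (bX, 16%:Z); (bY, 16%:Z); (fTAU, - 20%:Z)]; bal [:: (bX, 16%:Z); (bY, 16%:Z); (fTAU, - 28%:Z)];
      bal (c8 [:: bA]); bal [:: (bA, - 8%:Z)]; bal (c8 [:: bX]); bal [:: (bX, - 8%:Z)];
      bal (c8 [:: bY]); bal [:: (bY, - 8%:Z)]]
  [:: (bA, [:: (0%N, 64%:Z); (1%N, - 64%:Z); (2%N, - 64%:Z); (3%N, 64%:Z)]);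
      (bX, [:: (4%N, - 64%:Z); (5%N, 64%:Z)]); (bY, [:: (6%N, - 64%:Z); (7%N, 64%:Z)])].

(** The fourth query coordinate rho/2 meets [bA] in the key, so that among equal coordinates true
    bits win. The ramp now starts at L = 2 R + 2 O - tau/2, which makes it a disjunction. *)
Definition rep2 := LayerSpec (flags ++ [:: fKI; fKJ; fQQ; fE1; fETA; fNQ; fRHO; bA; fZ])
  [:: HeadSpec false [:: bal (c8 [:: fQQ]); bal l_rem; bal (c8 [:: fRHO]); bal [:: (fRHO, 4%:Z)]]
        [:: bal (c8 [:: fKI]); bal (c8 [:: fKJ]); bal (c8 [:: fPAD]); bal (c8 [:: bA])] [:: bal (c8 [:: bA])]]
  [:: (bO, (0, 0))]%N
  (flags ++ [:: fTAU; bR; bO; fZ])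
  [:: bal [:: (bR, 16%:Z); (bO, 16%:Z); (fTAU, - 4%:Z)]; bal [:: (bR, 16%:Z); (bO, 16%:Z); (fTAU, - 12%:Z)];
      bal (c8 [:: bR]); bal [:: (bR, - 8%:Z)]; bal (c8 [:: bO]); bal [:: (bO, - 8%:Z)]]
  [:: (bR, [:: (0%N, 64%:Z); (1%N, - 64%:Z); (2%N, - 64%:Z); (3%N, 64%:Z)]);
      (bO, [:: (4%N, - 64%:Z); (5%N, 64%:Z)])].

(** The last position is the b-token of rank t and therefore knows both coordinates of the entry
    (s,t). For s = t the answer is yes even without a closed walk: then [fGB] lets the first
    position win, whose value 1 exceeds all bits. *)
Definition final_spec := LayerSpec (flags ++ [:: fKQ; fKR; fES; fE1; fETA; fRHO; fGB; bR; fZ])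
  [:: HeadSpec false [:: bal [:: (fES, 8%:Z); (fETA, - 16%:Z)]; bal [:: (fE1, 8%:Z); (fETA, - 16%:Z)];
          bal (c8 [:: fRHO]); bal (c8 [:: fGB])]
        [:: bal (c8 [:: fKQ]); bal (c8 [:: fKR]); bal (c8 [:: fT0; fT1]); bal (c8 [:: fBOS])]
        [:: bal (c8 [:: fBOS; bR])]]
  [:: (bANS, (0, 0))]%N flags [::] [::].

Definition tok_flag (o : tok) : nat :=
  match o with TBOS => fBOS | T0 => fT0 | T1 => fT1 | TPad => fPAD | TA => fTA | TB => fTB end.

(** The logit tau/2 of [T0] is the threshold against which the answer bit is compared; tokens other
    than [T0] and [T1] get logit 0. *)
Definition unemb (o : tok) : 'I_dimT -> rat :=
  lpart (cf (match o with
             | T1 => [:: (bANS, 64%:Z)]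
             | T0 => [:: (fTAU, 32%:Z)]
             | _ => [::] end)).

Definition connectivity_transformer : UTransformer :=
  @MkUT dimT 4 5 8 (fun o => opart (fun f => (f == tok_flag o)%:R))
    (map mkL init_specs) (map mkL [:: rep1; rep2]) [:: mkL final_spec] unemb.

Lemma chk_init : chk flags (subs_of init_specs).
Proof. by []. Qed.

Lemma ok_rep : [&& oka rep1, okff rep1, oka rep2, okff rep2, oka final_spec & okff final_spec].
Proof. by []. Qed.

(** * The input tokens *)

Section Tokens.
Variables (n : nat) (A : 'I_n -> 'I_n -> bool) (s t : 'I_n).

Lemma nth_allpairs (T U W : Type) (f : T -> U -> W) x0 y0 z0 s1 s2 i j :
  (i < size s1)%N -> (j < size s2)%N ->
  nth z0 (allpairs f s1 s2) (i * size s2 + j) = f (nth x0 s1 i) (nth y0 s2 j).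
Proof.
move=> + js; elim: s1 i => [//|a s1 IH] [|i] /= is1.
  by rewrite mul0n add0n nth_cat size_map js (nth_map y0).
rewrite nth_cat size_map mulSn -addnA ltnNge leq_addr /=.
by rewrite addKn IH.
Qed.

Definition inp := TBOS :: conn_input A s t.
Definition sPAD := (1 + n * n)%N.
Definition sTA := (sPAD + n ^ 3)%N.
Definition sTB := (sTA + s.+1)%N.
Definition len := (sTB + t.+1)%N.
Definition tokn i := nth TBOS inp i.

Lemma size_adj : size [seq (if A i j then T1 else T0) | i <- enum 'I_n, j <- enum 'I_n] = (n * n)%N.
Proof. by rewrite size_allpairs size_enum_ord. Qed.

Lemma size_inp : size inp = len.
Proof.
rewrite /inp -[size _]/(size (conn_input A s t)).+1 /conn_input !size_cat size_adj !size_nseq.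
by rewrite /len /sTB /sTA /sPAD -[_.+1 in LHS]add1n !addnA.
Qed.


Lemma tok_adj (i j : 'I_n) : tokn (1 + (i * n + j)) = if A i j then T1 else T0.
Proof.
rewrite /tokn /inp add1n /= nth_cat size_adj.
have ij : (i * n + j < n * n)%N by case: i j => i hi [j hj] /=; nia.
rewrite ij; have := @nth_allpairs _ _ _ (fun i j => if A i j then T1 else T0) i j TBOS
  (enum 'I_n) (enum 'I_n) i j.
by rewrite size_enum_ord => -> //; rewrite !nth_ord_enum.
Qed.

Lemma tok_PAD i : (sPAD <= i < sTA)%N -> tokn i = TPad.
Proof.
case: i => [|i] /andP[]; rewrite /sTA /sPAD ?add1n // => i1 i2.
have e1 : (i < n * n)%N = false by lia.
have e2 : (i - n * n < n ^ 3)%N by lia.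
by rewrite /tokn /inp /= nth_cat size_adj e1 nth_cat size_nseq e2 nth_nseq e2.
Qed.

Lemma tok_TA i : (sTA <= i < sTB)%N -> tokn i = TA.
Proof.
case: i => [|i] /andP[]; rewrite /sTB /sTA /sPAD ?add1n // => i1 i2.
have e1 : (i < n * n)%N = false by lia.
have e2 : (i - n * n < n ^ 3)%N = false by lia.
have e3 : (i - n * n - n ^ 3 < s.+1)%N by lia.
by rewrite /tokn /inp /= nth_cat size_adj e1 nth_cat size_nseq e2 nth_cat size_nseq e3 nth_nseq e3.
Qed.

Lemma tok_TB i : (sTB <= i < len)%N -> tokn i = TB.
Proof.
case: i => [|i] /andP[]; rewrite /len /sTB /sTA /sPAD ?add1n // => i1 i2.
have e1 : (i < n * n)%N = false by lia.
have e2 : (i - n * n < n ^ 3)%N = false by lia.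
have e3 : (i - n * n - n ^ 3 < s.+1)%N = false by lia.
have e4 : (i - n * n - n ^ 3 - s.+1 < t.+1)%N by lia.
by rewrite /tokn /inp /= nth_cat size_adj e1 nth_cat size_nseq e2 nth_cat size_nseq e3 nth_nseq e4.
Qed.

Definition isadj i := (0 < i < sPAD)%N.
Definition ispad i := (sPAD <= i < sTA)%N.

Lemma adj_split i : isadj i -> exists a b : 'I_n, i = (1 + (a * n + b))%N.
Proof.
case: i => [//|k] /andP[_ kn]; have kn' : (k < n * n)%N by rewrite /sPAD in kn; lia.
have n0 : (0 < n)%N by case: (n) s => // -[].
have h1 : (k %/ n < n)%N by rewrite ltn_divLR.
have h2 : (k %% n < n)%N by rewrite ltn_mod.
by exists (Ordinal h1), (Ordinal h2) => /=; rewrite -divn_eq add1n.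
Qed.

(** Only the kind of a position is classified: the entry at an adjacency position is left as
    [tokn i] on both sides. *)
Lemma tok_cases i : (i < len)%N -> tokn i =
  if (i == 0)%N then TBOS else if (i < sPAD)%N then (if tokn i is T1 then T1 else T0) else
  if (i < sTA)%N then TPad else if (i < sTB)%N then TA else TB.
Proof.
move=> iN; case: eqP => [->//|/eqP i0].
case: ifP => i1.
  have /adj_split [a [b ->]] : isadj i by rewrite /isadj lt0n i0.
  by rewrite tok_adj; case: ifP.
case: ifP => i2; first by rewrite tok_PAD // i2 leqNgt i1.
case: ifP => i3; first by rewrite tok_TA // i3 leqNgt i2.
by rewrite tok_TB // iN leqNgt i3.
Qed.

(* [rank2 i] is the index of position [i] among the tokens of its kind, plus 2. *)
Definition rank2 i :=
  if (i < sPAD)%N then i.+1 else if (i < sTA)%N then (i - sPAD).+2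
  else if (i < sTB)%N then (i - sTA).+2 else (i - sTB).+2.

Lemma n_gt0 : (0 < n)%N. Proof. by case: (n) s => // -[]. Qed.

Lemma rank2_le i : (i < len)%N -> (0 < rank2 i <= len)%N.
Proof.
by rewrite /rank2 /len /sTB /sTA /sPAD; do !case: ifP => //; lia.
Qed.

End Tokens.

(** * Hard attention and layer norm under rounding *)

Section Heads.
Variables (R : archiRcfType) (p : nat) (rnd : R -> R).
Hypothesis Hrnd : correct_rounding p rnd.
Hypothesis Hp : (20 <= p)%N.
Notation u := (uerr R p).

Lemma uerr_le1 : u <= 2^-1 ^+ 10.
Proof.
rewrite /uerr exprVn lef_pV2 ?posrE ?exprn_gt0 //.
by rewrite ler_eXn2l ?ltr1n //; lia.
Qed.

Lemma uerr_le : u <= 1 / 1000.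
Proof. by have := uerr_le1; rewrite exprVn -natrX; lra. Qed.

Section OneHead.
Variables (N : nat) (hsp : head_spec) (Z : nat -> nat -> R) (i : nat).
Hypothesis iN : (i < N)%N.
Notation sc := (score rnd hsp Z i).
Notation B := (best rnd N hsp Z i).
Definition allowed (j : nat) := ~~ hm hsp || (j <= i)%N.

Lemma bestP (j : 'I_N) :
  reflect (allowed j /\ forall j' : 'I_N, allowed j' -> sc j' <= sc j) (j \in B).
Proof.
rewrite inE -/(allowed j); apply: (iffP andP) => -[aj H]; split=> //.
  by move=> j' aj'; move/forallP: H => /(_ j'); rewrite -/(allowed j') aj'.
by apply/forallP => j'; apply/implyP; apply: H.
Qed.

Lemma best_witness : exists j : 'I_N, j \in B.
Proof.
have a0 : allowed (Ordinal iN) by rewrite /allowed leqnn orbT.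
have [j aj H] := @arg_maxP _ _ _ (Ordinal iN) (fun j : 'I_N => allowed j) (fun j : 'I_N => sc j) a0.
by exists j; apply/bestP; split.
Qed.

Lemma card_best_gt0 : (0 < #|B|)%N.
Proof. by have [j jB] := best_witness; apply/card_gt0P; exists j. Qed.

Lemma best_beaten (j j' : 'I_N) : allowed j' -> sc j < sc j' -> j \notin B.
Proof.
move=> aj' lt; apply/negP => /bestP[_ /(_ j' aj')].
by rewrite leNgt lt.
Qed.

(** An average of numbers close to v is close to v whatever the set of maximisers is, so ties need
    no separate treatment. *)
Lemma hout_approx l (v e : R) : `|v| <= 256 -> 0 <= e <= 1 ->
  (forall j : 'I_N, j \in B -> `|hval rnd hsp Z l j - v| <= e) ->
  `|hout rnd N hsp Z i l - v| <= e + u.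
Proof.
move=> v256 /andP[e0 e1] H; have c0 := card_best_gt0.
have cR : (0 : R) < #|B|%:R by rewrite ltr0n.
set q := (\sum_(j in B) hval rnd hsp Z l j) / #|B|%:R.
have qv : `|q - v| <= e.
  have -> : q - v = (\sum_(j in B) (hval rnd hsp Z l j - v)) / #|B|%:R.
    by rewrite sumrB sumr_const mulrBl -[v *+ _]mulr_natr mulfK ?gt_eqF.
  rewrite normrM [`|_^-1|]gtr0_norm ?invr_gt0 // ler_pdivrMr //.
  apply: le_trans (ler_norm_sum _ _ _) _.
  apply: le_trans (ler_sum _ (fun j jB => H j jB)) _.
  by rewrite sumr_const mulr_natr.
have q512 : `|q| <= 512.
  move: qv v256; rewrite !ler_norml => /andP[? ?] /andP[? ?]; apply/andP; split; lra.
have := rnd_err Hrnd Hp q512; rewrite /hout -/q.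
move: qv; rewrite !ler_norml => /andP[? ?] /andP[? ?]; apply/andP; split; lra.
Qed.

Lemma hout_const l v : representable p v ->
  (forall j : 'I_N, j \in B -> hval rnd hsp Z l j = v) -> hout rnd N hsp Z i l = v.
Proof.
move=> rv H; rewrite /hout (eq_bigr (fun=> v)) //.
rewrite sumr_const -[v *+ _]mulr_natr mulfK ?(rnd_id Hrnd) //.
by rewrite pnatr_eq0 -lt0n card_best_gt0.
Qed.

Lemma hout_set (P : pred 'I_N) l : B =i P ->
  hout rnd N hsp Z i l = rnd ((\sum_(j | P j) hval rnd hsp Z l j) / #|P|%:R).
Proof.
by move=> BP; rewrite /hout (eq_card BP); congr (rnd (_ / _)); apply: eq_bigl.
Qed.

Lemma best_eq (P : pred nat) c : (exists2 j : 'I_N, allowed j & P j) ->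
  (forall j : 'I_N, allowed j -> P j -> sc j = c) ->
  (forall j : 'I_N, allowed j -> ~~ P j -> sc j < c) ->
  B =i [pred j : 'I_N | allowed j && P j].
Proof.
move=> [j0 aj0 P0] H1 H2 j; rewrite !inE -/(allowed j).
apply/idP/idP => [jB|/andP[aj Pj]].
  have /bestP[aj /(_ j0 aj0)] : j \in B by rewrite inE.
  by rewrite aj /=; case: (boolP (P j)) => // nP; rewrite (H1 j0) // leNgt H2.
rewrite aj /=; apply/forallP => j'; apply/implyP => aj'.
rewrite (H1 j) //; case: (boolP (P j')) => Pj'; first by rewrite H1.
exact/ltW/H2.
Qed.

End OneHead.

Definition wnorm (f : lform) : nat := sumn [seq `|t.2|%N | t <- f].

Definition lin (f : lform) (ms : seq nat) (v : nat -> R) : R :=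
  ev f (fun g => 8 * (v g - lnmu ms v)).

Lemma ev_diff (f : lform) (z w : nat -> R) (e : R) : (wnorm f <= 128)%N ->
  (forall g, g \in unzip1 f -> `|z g - w g| <= e) -> 0 <= e -> `|ev f z - ev f w| <= 2 * e.
Proof.
move=> wf H e0; rewrite /ev -sumrB.
apply: le_trans (ler_norm_sum _ _ _) _.
have : \sum_(t <- f) `|(t.2)%:~R / 64 * z t.1 - (t.2)%:~R / 64 * w t.1|
   <= \sum_(t <- f) (`|t.2|%N)%:R * (e / 64).
  rewrite !big_seq; apply: ler_sum => t tf; rewrite -mulrBr normrM.
  rewrite normrM [`|_^-1|]gtr0_norm ?invr_gt0 // -mulrA natr_absz -intr_norm.
  apply: ler_wpM2l; first by rewrite ler0z.
  rewrite mulrC ler_pM2r ?invr_gt0 //.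
  by apply: H; apply: (map_f fst tf).
move/le_trans; apply; rewrite -mulr_suml -natr_sum.
have -> : (\sum_(t <- f) `|t.2| = wnorm f)%N by rewrite /wnorm sumnE big_map.
have : (wnorm f)%:R <= 128 :> R by rewrite ler_nat.
by move=> h; nra.
Qed.

(** [D] stands for the size of the largest masked feature. The hypothesis D^2 <= 4 [lnS] keeps the
    normalised features below 32, where each is rounded with error at most u; weights of total at
    most 128/64 double this error, and the outer rounding adds one more u. *)
Lemma lnf_lin (f : lform) ms v (D : R) : (wnorm f <= 128)%N -> {subset unzip1 f <= ms} ->
  0 < D -> (forall g, g \in ms -> `|v g| <= D) -> `|lnmu ms v| <= D ->
  D ^+ 2 <= 4 * lnS ms v ->
  `|rnd (ev f (lnf rnd ms v)) - lin f ms v / Num.sqrt (lnS ms v)| <= 3 * u.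
Proof.
move=> wf fm D0 vD muD DS.
have D2 : 0 < D ^+ 2 by rewrite exprn_gt0.
have S0 : 0 < lnS ms v by lra.
set q := Num.sqrt (lnS ms v).
have q0 : 0 < q by rewrite sqrtr_gt0.
have Dq : D <= 2 * q.
  have qq : q ^+ 2 = lnS ms v by rewrite sqr_sqrtr // ltW.
  by nra.
pose w g := 8 * (v g - lnmu ms v) / q.
have w32 g : g \in ms -> `|w g| <= 32.
  move=> gm; rewrite /w normrM [`|_^-1|]gtr0_norm ?invr_gt0 // ler_pdivrMr //.
  move: (vD g gm) muD; rewrite !ler_norml => /andP[? ?] /andP[? ?]; apply/andP; split; lra.
have u0 := uerr_gt0 R p; have u1 := uerr_le.
have zw g : g \in unzip1 f -> `|lnf rnd ms v g - w g| <= u.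
  move=> /fm gm; rewrite /lnf gm mul1r gt_eqF // -/(w g); apply: (rnd_err Hrnd Hp).
  by apply: le_trans (w32 g gm) _; rewrite ler_nat.
have E1 := ev_diff wf zw (ltW u0).
have E2 : `|ev f w - ev f (fun=> 0)| <= 2 * 32.
  by apply: ev_diff => // g /fm /w32; rewrite subr0.
have e0 : ev f (fun=> 0) = 0 :> R by rewrite /ev big1 // => t _; rewrite mulr0.
have ew : ev f w = lin f ms v / q.
  by rewrite /lin /ev mulr_suml; apply: eq_bigr => t _; rewrite /w !mulrA.
rewrite -ew; rewrite e0 subr0 in E2.
have E3 : `|ev f (lnf rnd ms v)| <= 512.
  move: E1 E2; rewrite !ler_norml => /andP[? ?] /andP[? ?]; apply/andP; split; lra.
have := rnd_err Hrnd Hp E3; move: E1.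
rewrite !ler_norml => /andP[? ?] /andP[? ?]; apply/andP; split; lra.
Qed.

Lemma lnmu0 ms (v : nat -> R) : all (fun f => (f < 56)%N) ms -> lnmu ms v = 0.
Proof.
move=> /allP H; rewrite /lnmu big_seq_cond big1 ?mul0r // => f /andP[/H].
by rewrite ltnNge => /negbTE ->.
Qed.

Lemma lnS0 ms (v : nat -> R) : all (fun f => (f < 56)%N) ms ->
  lnS ms v = \sum_(f <- ms) v f ^+ 2.
Proof.
move=> H; rewrite /lnS lnmu0 // expr0n mulr0 subr0.
rewrite [X in _ + X / _]big_seq_cond [X in _ + X / _]big1 => [|f /andP[fm]]; last first.
  by have := allP H f fm; rewrite ltnNge => /negbTE ->.
rewrite mul0r addr0 big_seq_cond [RHS]big_seq_cond; apply: eq_bigl => f.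
by case fm: (f \in ms) => //=; have := allP H f fm; rewrite ltnNge => ->.
Qed.

Lemma lin0 f ms (v : nat -> R) : all (fun f => (f < 56)%N) ms ->
  lin f ms v = ev f (fun g => 8 * v g).
Proof. by move=> H; rewrite /lin lnmu0 //; apply: eq_bigr => t _; rewrite subr0. Qed.

(** After multiplication by sqrt (1 + w) and squaring, both bounds become polynomial identities
    whose remainder has constant sign on [0,1]. *)
Lemma inv_sqrt_bounds (w : R) : 0 <= w <= 1 ->
  1 - w / 2 <= (Num.sqrt (1 + w))^-1 <= 1 - w / 2 + 3 / 8 * w ^+ 2.
Proof.
move=> /andP[w0 w1].
set q := Num.sqrt (1 + w).
have q0 : 0 < q by rewrite sqrtr_gt0; lra.
have qq : q ^+ 2 = 1 + w by rewrite sqr_sqrtr //; lra.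
have q2 : q <= 2 by nra.
have sq1 (a : R) : 0 <= a -> (a ^+ 2 <= 1 -> a <= 1) * (1 <= a ^+ 2 -> 1 <= a).
  by move=> a0; split=> h; nra.
have r0 : 0 < q^-1 by rewrite invr_gt0.
have rq : q * q^-1 = 1 by rewrite divff // gt_eqF.
have w2 : 0 <= w ^+ 2 by rewrite exprn_ge0.
have w3 : 0 <= w ^+ 3 by rewrite exprn_ge0.
have H1 : (1 - w / 2) * q <= 1.
  apply: (sq1 _ _).1; first by apply: mulr_ge0; lra.
  rewrite exprMn qq.
  have -> : (1 - w / 2) ^+ 2 * (1 + w) = 1 - w ^+ 2 * (3 / 4 - w / 4) by field.
  have : 0 <= w ^+ 2 * (3 / 4 - w / 4) by apply: mulr_ge0; lra.
  lra.
have H2 : 1 <= (1 - w / 2 + 3 / 8 * w ^+ 2) * q.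
  apply: (sq1 _ _).2; first by apply: mulr_ge0; lra.
  rewrite exprMn qq.
  have -> : (1 - w / 2 + 3 / 8 * w ^+ 2) ^+ 2 * (1 + w)
    = 1 + w ^+ 3 * (5 / 8 - 15 / 64 * w + 9 / 64 * w ^+ 2) by field.
  have : 0 <= w ^+ 3 * (5 / 8 - 15 / 64 * w + 9 / 64 * w ^+ 2) by apply: mulr_ge0; lra.
  lra.
apply/andP; split; nra.
Qed.

End Heads.

(** * Exact attention on token flags: ranks, n, s and the first power of 1/N *)

Section FirstLayer.
Variables (R : archiRcfType) (p : nat) (rnd : R -> R).
Hypothesis Hrnd : correct_rounding p rnd.
Hypothesis Hp : (20 <= p)%N.
Variables (n : nat) (A : 'I_n -> 'I_n -> bool) (s t : 'I_n).
Notation N := (len s t).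
Notation tok i := (tokn A s t i).
Variable V : nat -> nat -> R.
Hypothesis Vflag : forall i f, f \in flags -> V i f = (f == tok_flag (tok i))%:R.
Hypothesis Veq : eqns rnd N V (subs_of init_specs).

Lemma flag_in i : tok_flag (tok i) \in flags.
Proof. by case: (tok i). Qed.

Lemma flags_sq i : \sum_(f <- flags) V i f ^+ 2 = 1.
Proof.
rewrite (eq_big_seq (fun f => (f == tok_flag (tok i))%:R)); last first.
  by move=> f /Vflag ->; case: (_ == _); rewrite ?expr1n ?expr0n.
by rewrite /flags !big_cons big_nil; case: (tok i) => /=; rewrite !(addr0, add0r).
Qed.

Lemma ev_c8 l (z : nat -> R) : ev (c8 l) z = (\sum_(f <- l) z f) / 8.
Proof.
rewrite /ev big_map mulr_suml; apply: eq_bigr => f _ /=.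
by rewrite (_ : 8%:~R / 64 = 8^-1 :> R) 1?mulrC //; field.
Qed.

Lemma sum_flag i l : uniq l -> {subset l <= flags} ->
  \sum_(f <- l) V i f = (tok_flag (tok i) \in l)%:R.
Proof.
move=> ul lf; rewrite (eq_big_seq (fun f => if f == tok_flag (tok i) then 1 else 0)); last first.
  by move=> f /lf /Vflag ->; case: eqP.
rewrite -big_mkcond /= -big_filter.
case tl: (tok_flag (tok i) \in l).
  rewrite (_ : [seq f <- l | _] = [:: tok_flag (tok i)]) ?big_seq1 //.
  exact: filter_pred1_uniq.
rewrite (_ : [seq f <- l | _] = [::]) ?big_nil //.
apply/eqP; rewrite -(negbK (_ == _)) -has_filter; apply/negP => /hasP[f fl /eqP ef].
by rewrite -ef fl in tl.
Qed.

(** Flags pass layer norm without error: if the norm is 1 they become 0 or 8, and a flag that is 0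
    stays 0 under any norm. The second alternative serves the first position, where the gate feature
    makes the norm differ from 1. *)
Lemma lnf_flag ms j f : f \in flags -> f \in ms -> all (fun f => (f < 56)%N) ms ->
  lnS ms (V j) = 1 \/ V j f = 0 -> lnf rnd ms (V j) f = 8 * V j f.
Proof.
move=> ff fm am H; rewrite /lnf fm mul1r lnmu0 // subr0.
case: H => [->|->].
  rewrite oner_eq0 sqrtr1 divr1 (rnd_id Hrnd) //.
  rewrite Vflag //; case: (_ == _); first by rewrite mulr1; have := @rep_int R p Hp 8 isT.
  by rewrite mulr0; have := @rep_int R p Hp 0 isT.
by rewrite mulr0 mul0r; case: ifP => _; rewrite (rnd0 Hrnd Hp).
Qed.

Lemma rep_bool (b : bool) : representable p (b%:R : R).
Proof. by case: b; [have := @rep_int R p Hp 1 isT | have := @rep_int R p Hp 0 isT]. Qed.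

Lemma ev_flags ms j l : uniq l -> all (mem flags) l -> all (mem ms) l ->
  all (fun f => (f < 56)%N) ms -> lnS ms (V j) = 1 \/ tok_flag (tok j) \notin l ->
  rnd (ev (c8 l) (lnf rnd ms (V j))) = (tok_flag (tok j) \in l)%:R.
Proof.
move=> ul /allP lf0 /allP lm0 am H.
have lf : {subset l <= flags} := lf0; have lm : {subset l <= ms} := lm0.
rewrite ev_c8 (eq_big_seq (fun f => 8 * V j f)).
  rewrite -mulr_sumr sum_flag // mulrC mulKf ?pnatr_eq0 //.
  exact/(rnd_id Hrnd)/rep_bool.
move=> f fl; rewrite lnf_flag //; [exact: lf|exact: lm|].
case: H => [->|nl]; [by left|right].
rewrite Vflag ?lf //; case: eqP => // e; by rewrite -e fl in nl.
Qed.


Lemma lnS_flags j : lnS flags (V j) = 1.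
Proof. by rewrite lnS0 // flags_sq. Qed.

Lemma Nle_cards a b : (b <= N)%N ->
  #|[pred j : 'I_N | (a <= j < b)%N]| = (b - a)%N.
Proof.
move=> bN; rewrite -sum1_card -(big_mkord (fun j => (a <= j < b)%N) (fun=> 1%N)).
rewrite sum1_count -size_filter.
rewrite (_ : [seq j <- index_iota 0 N | (a <= j < b)%N] = index_iota a b) ?size_iota //.
apply: (@irr_sorted_eq _ ltn) => //.
- exact: ltn_trans.
- exact: ltnn.
- by apply: sorted_filter; [exact: ltn_trans | exact: iota_ltn_sorted].
- exact: iota_ltn_sorted.
by move=> j; rewrite mem_filter !mem_index_iota /=; lia.
Qed.

Lemma len_gt0 : (0 < N)%N. Proof. by rewrite /len addnS. Qed.
Definition pos0 : 'I_N := Ordinal len_gt0.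

Lemma card_BOS_range a b : (0 < a)%N -> (b <= N)%N ->
  #|[pred j : 'I_N | (j == pos0) || (a <= j < b)%N]| = (b - a).+1.
Proof.
move=> a0 bN; rewrite -(Nle_cards a bN).
have := cardU1 pos0 [pred j : 'I_N | (a <= j < b)%N]; rewrite !inE /= leqNgt a0 /= add1n => <-.
by apply: eq_card => j; rewrite !inE.
Qed.

Lemma tok_flag0 : tok_flag (tok 0) = fBOS. Proof. by []. Qed.

Lemma tok_adj_or i : isadj n i -> tok i = T0 \/ tok i = T1.
Proof. by move/(adj_split s) => [a [b ->]]; rewrite tok_adj; case: ifP; [right|left]. Qed.

Lemma flag_adj i : (i < N)%N -> (tok_flag (tok i) \in [:: fT0; fT1]) = isadj n i.
Proof.
move=> iN; rewrite /isadj; case i1: (i < sPAD n)%N; last first.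
  rewrite andbF tok_cases // i1; case: eqP => // _; by do !case: ifP.
case: i iN i1 => [//|i] iN i1; rewrite /= ?andbT.
by have /tok_adj_or[->|->] : isadj n i.+1 by rewrite /isadj i1.
Qed.

Lemma flag_BOS i : (i < N)%N -> (tok_flag (tok i) == fBOS) = (i == 0)%N.
Proof.
move=> iN; case: (eqVneq i 0%N) => [->//|i0].
rewrite tok_cases // (negbTE i0); case: ifP => i1; last by do !case: ifP.
by case: (tok i).
Qed.

Lemma flag_PAD i : (i < N)%N -> (tok_flag (tok i) == fPAD) = ispad n i.
Proof.
move=> iN; rewrite tok_cases // /ispad; case: (eqVneq i 0%N) => [->//|i0].
case: (ltnP i (sPAD n)) => i1; first by case: (tok i).
by case: (ltnP i (sTA n)) => i2 //; case: ifP.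
Qed.

Lemma flag_TA i : (i < N)%N -> (tok_flag (tok i) == fTA) = (sTA n <= i < sTB s)%N.
Proof.
move=> iN; rewrite tok_cases //; case: (eqVneq i 0%N) => [->|i0].
  by rewrite /sTA /sPAD.
case: (ltnP i (sPAD n)) => i1.
  by rewrite (_ : (sTA n <= i)%N = false) /=; [case: (tok i) | move: i1; rewrite /sTA; lia].
case: (ltnP i (sTA n)) => i2 //.
by case: (ltnP i (sTB s)) => i3.
Qed.

Lemma flag_TB i : (i < N)%N -> (tok_flag (tok i) == fTB) = (sTB s <= i)%N.
Proof.
move=> iN; rewrite tok_cases //; case: (eqVneq i 0%N) => [->|i0].
  by rewrite /sTB /sTA /sPAD.
have h1 : (sPAD n <= sTA n)%N by rewrite /sTA leq_addr.
have h2 : (sTA n <= sTB s)%N by rewrite /sTB leq_addr.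
case: (ltnP i (sPAD n)) => i1; first by rewrite (_ : (sTB s <= i)%N = false) /=; [case: (tok i) | lia].
case: (ltnP i (sTA n)) => i2; first by rewrite (_ : (sTB s <= i)%N = false) //; lia.
by case: (ltnP i (sTB s)) => i3.
Qed.

Lemma sum_BOS (P : pred 'I_N) : P pos0 ->
  \sum_(j | P j) ((tok_flag (tok j) \in [:: fBOS])%:R : R) = 1.
Proof.
move=> P0; rewrite (bigD1 pos0) //= big1 ?addr0 // => j /andP[_ j0].
by rewrite inE flag_BOS // (_ : (j == 0 :> nat) = false) //; apply/negbTE.
Qed.

Let Z j := lnf rnd flags (V j).

Lemma V_Y i : (i < N)%N -> V i fY = rnd (1 / (rank2 s i)%:R).
Proof.
move=> iN; have -> : V i fY = hout rnd N hd_Y Z i 0 by case: Veq => H _; exact: (H i fY 0%N 0%N isT).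
pose same j := [|| tok_flag (tok j) == fBOS,
  (tok_flag (tok j) \in [:: fT0; fT1]) && (tok_flag (tok i) \in [:: fT0; fT1]),
  (tok_flag (tok j) == fPAD) && (tok_flag (tok i) == fPAD),
  (tok_flag (tok j) == fTA) && (tok_flag (tok i) == fTA) |
  (tok_flag (tok j) == fTB) && (tok_flag (tok i) == fTB)].
have scE (j : 'I_N) : score rnd hd_Y Z i j =
    (same j && (tok_flag (tok i) != fBOS))%:R.
  rewrite /score !big_ord_recl big_ord0 /= /Z.
  rewrite !ev_flags //; try (by left; rewrite lnS_flags).
  rewrite addr0 -!natrM -!natrD (_ : (_ + _)%N = (same j && (tok_flag (tok i) != fBOS))).
    exact/(rnd_id Hrnd)/rep_bool.
  by rewrite /same; case: (tok i); case: (tok j).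
(* [a] is the start of the block of tokens of the kind of [i]. At the first position it is 1, and
   the range from [a] to [i] is empty. *)
set a := (i.+2 - rank2 s i)%N.
have a0 : (0 < a)%N by rewrite /a /rank2 /sTB /sTA /sPAD; do !case: ifP => ?; lia.
have ra : ((i.+1 - a).+1 = rank2 s i)%N.
  by rewrite /a /rank2; do !case: ifP => ?; lia.
have bE : best rnd N hd_Y Z i =i [pred j : 'I_N | (j == pos0) || (a <= j < i.+1)%N].
  move=> j.
  (* The query of the first position is 0, but the causal mask leaves it no choice but itself. *)
  case: (eqVneq i 0%N) => [i0|i0].
    rewrite !inE i0 /= ltnS; case: (eqVneq j pos0) => [->|j0] /=.
      by apply/forallP => j'; apply/implyP; rewrite leqn0 => /eqP ->.
    have jn0 : (j : nat) != 0%N by apply: contra j0 => /eqP e; apply/eqP/val_inj.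
    by rewrite leqn0 (negbTE jn0) andbF.
  have fi : tok_flag (tok i) != fBOS by rewrite flag_BOS.
  rewrite (@best_eq _ _ _ _ _ _ (fun j => same j) 1).
  - rewrite !inE /allowed /= ltnS.
    case: (eqVneq j pos0) => [->|j0] /=; first by rewrite /same tok_flag0.
    rewrite andbC; case ji: (j <= i)%N; rewrite ?andbF ?andbT //=.
    have jn0 : (j == 0 :> nat) = false.
      by apply/negbTE; apply: contra j0 => /eqP e; apply/eqP/val_inj.
    rewrite /same !flag_BOS ?flag_adj ?flag_PAD ?flag_TA ?flag_TB // jn0 /=.
    rewrite /a /rank2 /isadj /ispad; move: jn0 i0 ji.
    have h1 : (sPAD n <= sTA n)%N by rewrite /sTA leq_addr.
    have h2 : (sTA n <= sTB s)%N by rewrite /sTB leq_addr.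
    by do !case: ifP => ?; lia.
  - by exists pos0; rewrite /allowed ?leq0n // /same tok_flag0.
  - by move=> k _ sk; rewrite scE sk fi.
  - by move=> k _ sk; rewrite scE (negbTE sk) ltr01.
rewrite (hout_set _ bE) card_BOS_range // ra.
rewrite (eq_bigr (fun j : 'I_N => (tok_flag (tok j) \in [:: fBOS])%:R)); last first.
  move=> j _; rewrite /hval /= /Z ev_flags //.
  by left; rewrite lnS_flags.
by rewrite sum_BOS // eqxx.
Qed.

Lemma ev_nil (z : nat -> R) : ev [::] z = 0.
Proof. by rewrite /ev big_nil. Qed.

Lemma sum_indicator (P Q : pred 'I_N) : {subset Q <= P} ->
  \sum_(j | P j) ((Q j)%:R : R) = #|Q|%:R.
Proof.
move=> QP; rewrite -natr_sum -sum1_card big_mkcond /= [in RHS]big_mkcond /=; congr _%:R.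
apply: eq_bigr => j _; rewrite -[Q j]/(j \in Q); case jQ: (j \in Q); last by case: ifP.
by have := QP j jQ; rewrite -topredE /= => ->.
Qed.

Lemma thresholds : [/\ (1 < sPAD n)%N, (sPAD n < sTA n)%N, (sTA n < sTB s)%N & (sTB s < N)%N].
Proof.
have n0 := n_gt0 s; have n2 : (0 < n * n)%N by rewrite muln_gt0 n0.
have n3 : (0 < n ^ 3)%N by rewrite expn_gt0 n0.
by rewrite /len /sTB /sTA /sPAD; split; lia.
Qed.

Lemma V_X i : (i < N)%N -> V i fX = rnd (1 / (n%:R + 1)).
Proof.
move=> iN; have -> : V i fX = hout rnd N hd_X Z i 0.
  by case: Veq => H _; exact: (H i fX 1%N 0%N isT).
have [h0 h1 h2 h3] := thresholds; have n0 := n_gt0 s.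
have fl l : tok_flag (tok i) \in flags by rewrite flag_in.
have scE (j : 'I_N) : score rnd hd_X Z i j = (tok_flag (tok j) \in [:: fT0; fT1; fPAD])%:R.
  rewrite /score !big_ord_recl big_ord0 /= !ev_nil (rnd0 Hrnd Hp) !mul0r !addr0 /Z.
  rewrite !ev_flags //; try (by left; rewrite lnS_flags).
  by rewrite flag_in mul1r; apply/(rnd_id Hrnd)/rep_bool.
have fE (j : 'I_N) : (tok_flag (tok j) \in [:: fT0; fT1; fPAD]) = (1 <= j < sTA n)%N.
  have := flag_adj (ltn_ord j); have := flag_PAD (ltn_ord j).
  rewrite !inE orbA => -> ->; rewrite /isadj /ispad; lia.
have bE : best rnd N hd_X Z i =i [pred j : 'I_N | 1 <= j < sTA n]%N.
  move=> j; rewrite (@best_eq _ _ _ _ _ _ (fun j => tok_flag (tok j) \in [:: fT0; fT1; fPAD]) 1).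
  - by rewrite !inE /allowed /= -fE !inE.
  - have h : (1 < N)%N by lia.
    by exists (Ordinal h); rewrite ?fE //=; lia.
  - by move=> k _ sk; rewrite scE sk.
  - by move=> k _ sk; rewrite scE (negbTE sk) ltr01.
rewrite (hout_set _ bE) Nle_cards; last by lia.
rewrite (eq_bigr (fun j : 'I_N => ([pred j : 'I_N | 1 <= j < sPAD n]%N j)%:R)); last first.
  move=> j _; rewrite /hval /= /Z ev_flags //; last by left; rewrite lnS_flags.
  by rewrite flag_adj // /isadj.
rewrite sum_indicator ?Nle_cards; [|lia|by move=> j; rewrite !inE; lia].
have n3 : (n ^ 3 = n * n * n)%N by rewrite !expnS expn0 muln1 mulnA.
have -> : (sPAD n - 1 = n * n)%N by rewrite /sPAD addKn.
have -> : (sTA n - 1 = n * n * n.+1)%N by rewrite /sTA /sPAD -addnA addKn n3 mulnS.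
congr rnd; rewrite !natrM -natr1; field.
have : (0 : R) < n%:R by rewrite ltr0n.
by move=> ?; rewrite !gt_eqF //; lra.
Qed.

Lemma V_DS i : (i < N)%N -> V i fDS = rnd (1 / (s.+2)%:R).
Proof.
move=> iN; have -> : V i fDS = hout rnd N hd_DS Z i 0.
  by case: Veq => H _; exact: (H i fDS 2%N 0%N isT).
have [h0 h1 h2 h3] := thresholds.
have scE (j : 'I_N) : score rnd hd_DS Z i j = (tok_flag (tok j) \in [:: fBOS; fTA])%:R.
  rewrite /score !big_ord_recl big_ord0 /= !ev_nil (rnd0 Hrnd Hp) !mul0r !addr0 /Z.
  rewrite !ev_flags //; try (by left; rewrite lnS_flags).
  by rewrite flag_in mul1r; apply/(rnd_id Hrnd)/rep_bool.
have fE (j : 'I_N) : (tok_flag (tok j) \in [:: fBOS; fTA]) =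
    ((j == pos0) || (sTA n <= j < sTB s)%N).
  by have := flag_BOS (ltn_ord j); have := flag_TA (ltn_ord j); rewrite !inE => -> ->.
have bE : best rnd N hd_DS Z i =i [pred j : 'I_N | (j == pos0) || (sTA n <= j < sTB s)%N].
  move=> j; rewrite (@best_eq _ _ _ _ _ _ (fun j => tok_flag (tok j) \in [:: fBOS; fTA]) 1).
  - by rewrite !inE /allowed /= -fE !inE.
  - by exists pos0.
  - by move=> k _ sk; rewrite scE sk.
  - by move=> k _ sk; rewrite scE (negbTE sk) ltr01.
rewrite (hout_set _ bE) card_BOS_range; [|lia|lia].
rewrite (eq_bigr (fun j : 'I_N => (tok_flag (tok j) \in [:: fBOS])%:R)); last first.
  by move=> j _; rewrite /hval /= /Z ev_flags //; left; rewrite lnS_flags.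
by rewrite sum_BOS ?eqxx // /sTB addKn.
Qed.

Section Gate.
Variables (ms : seq nat) (f : nat) (w : R).
Hypothesis ms56 : all (fun g => (g < 56)%N) ms.
Hypothesis msf : all (mem ms) flags.
Hypothesis S1 : forall j, (0 < j < N)%N -> lnS ms (V j) = 1.
Let Z' j := lnf rnd ms (V j).
Hypothesis v0 : forall j, (0 < j < N)%N -> rnd (ev (c8 [:: f]) (Z' j)) = 0.
Hypothesis vw : rnd (ev (c8 [:: f]) (Z' 0)) = w.
Hypothesis wr : representable p w.

Lemma sub_msf l : all (mem flags) l -> all (mem ms) l.
Proof. by move=> /allP H; apply/allP => g /H; apply: (allP msf). Qed.

Lemma hout_avg hsp i : (i < N)%N -> hv hsp = [:: c8 [:: f]] -> hm hsp = false ->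
  (forall j : 'I_N, score rnd hsp Z' i j = 0) -> hout rnd N hsp Z' i 0 = rnd (w / N%:R).
Proof.
move=> iN hvE hmE s0.
have bE : best rnd N hsp Z' i =i [pred j : 'I_N | xpredT j].
  move=> j; rewrite (@best_eq _ _ _ _ _ _ (fun=> true) 0) ?inE /allowed ?hmE //.
  by exists pos0; rewrite ?/allowed ?hmE.
rewrite (hout_set _ bE) (bigD1 pos0) //= big1 => [|j j0].
  by rewrite /hval hvE vw addr0 card_ord.
rewrite /hval hvE /= v0 // ltn_ord andbT lt0n; apply: contra j0 => /eqP e.
exact/eqP/val_inj.
Qed.

(** The query omits [fBOS]. Hence at the first position all scores are 0 and nothing is excluded
    from the average, while everywhere else the padding tokens win, and their values are 0. *)
Lemma hout_gate i : (i < N)%N ->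
  hout rnd N (hd_gate f) Z' i 0 = if (i == 0)%N then rnd (w / N%:R) else 0.
Proof.
move=> iN; have [h0 h1 h2 h3] := thresholds; have n0 := n_gt0 s.
pose l := [:: fT0; fT1; fPAD; fTA; fTB].
case: (eqVneq i 0%N) => [->|i0].
  apply: hout_avg => // j; rewrite /score !big_ord_recl big_ord0 /= !ev_nil (rnd0 Hrnd Hp) !mul0r !addr0.
  by rewrite [X in X * _]ev_flags ?sub_msf //= ?mul0r ?(rnd0 Hrnd Hp) //; right.
have scE (j : 'I_N) : score rnd (hd_gate f) Z' i j = (tok_flag (tok j) \in [:: fPAD])%:R.
  rewrite /score !big_ord_recl big_ord0 /= !ev_nil (rnd0 Hrnd Hp) !mul0r !addr0.
  rewrite !ev_flags ?sub_msf //.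
  - have : tok_flag (tok i) != fBOS by rewrite flag_BOS.
    by case: (tok i) => // _; rewrite mul1r; apply/(rnd_id Hrnd)/rep_bool.
  - case: (eqVneq (j : nat) 0%N) => [->|j0]; first by right.
    by left; apply: S1; rewrite lt0n j0 ltn_ord.
  - by left; apply: S1; rewrite lt0n i0.
apply: hout_const => //; first exact: (rep_bool false).
move=> j jB; rewrite /hval /=.
have : tok_flag (tok j) == fPAD.
  have p1 : (sPAD n < N)%N by lia.
  apply: contraT => nP; move/negP: jB; case; apply/negP.
  apply: (@best_beaten _ _ _ _ _ _ _ (Ordinal p1)) => //.
  by rewrite !scE !inE (negbTE nP) flag_PAD // /ispad /= leqnn h1 ltr01.
rewrite flag_PAD // /ispad => /andP[jP _].
by rewrite v0 // ltn_ord andbT; lia.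
Qed.

Lemma hout_unif i : (i < N)%N -> hout rnd N (hd_unif f) Z' i 0 = rnd (w / N%:R).
Proof.
move=> iN; apply: hout_avg => // j.
by rewrite /score !big_ord_recl big_ord0 /= !ev_nil (rnd0 Hrnd Hp) !mul0r !addr0 (rnd0 Hrnd Hp).
Qed.

End Gate.

(** The gate value as it leaves layer norm next to a flag 1: divided by sqrt (1 + g^2) and rounded
    twice. The chain is therefore only approximately geometric. *)
Definition shrink (g : R) : R := rnd (rnd (8 * g / Num.sqrt (1 + g ^+ 2)) / 8).

Section ChainStep.
Variable f : nat.
Hypothesis f56 : (f < 56)%N.
Hypothesis fnf : f \notin flags.
Hypothesis V0 : forall j, (0 < j < N)%N -> V j f = 0.
Let Z' j := lnf rnd (f :: flags) (V j).

Lemma lnS_chain j : lnS (f :: flags) (V j) = 1 + V j f ^+ 2.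
Proof.
have m56 : all (fun g => (g < 56)%N) (f :: flags) by rewrite /= f56.
by rewrite lnS0 // big_cons flags_sq addrC.
Qed.

Lemma chain_hyps : [/\ all (fun g => (g < 56)%N) (f :: flags), all (mem (f :: flags)) flags,
  forall j, (0 < j < N)%N -> lnS (f :: flags) (V j) = 1,
  forall j, (0 < j < N)%N -> rnd (ev (c8 [:: f]) (Z' j)) = 0 &
  rnd (ev (c8 [:: f]) (Z' 0)) = shrink (V 0 f)].
Proof.
have m56 : all (fun g => (g < 56)%N) (f :: flags) by rewrite /= f56.
split=> //.
- by apply/allP => g gf; rewrite /= in_cons gf orbT.
- by move=> j j0; rewrite lnS_chain V0 // expr0n addr0.
- move=> j j0; rewrite ev_c8 big_seq1 /Z' /lnf V0 // lnmu0 // mulr0 subr0 mulr0 mul0r if_same.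
  by rewrite (rnd0 Hrnd Hp) mul0r (rnd0 Hrnd Hp).
rewrite ev_c8 big_seq1 /Z' /lnf lnS_chain lnmu0 // mem_head mul1r subr0.
rewrite gt_eqF //; have := sqr_ge0 (V 0 f); lra.
Qed.

Lemma hout_chain_gate i : (i < N)%N ->
  hout rnd N (hd_gate f) Z' i 0 = if (i == 0)%N then rnd (shrink (V 0 f) / N%:R) else 0.
Proof. by have [c1 c2 c3 c4 c5] := chain_hyps; apply: hout_gate => //; apply: (rnd_rep Hrnd). Qed.

Lemma hout_chain_unif i : (i < N)%N ->
  hout rnd N (hd_unif f) Z' i 0 = rnd (shrink (V 0 f) / N%:R).
Proof. by have [c1 c2 c3 c4 c5] := chain_hyps; apply: hout_unif => //; apply: (rnd_rep Hrnd). Qed.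

End ChainStep.

Lemma V_G1 i : (i < N)%N -> V i (fG 1) = if (i == 0)%N then rnd (1 / N%:R) else 0.
Proof.
move=> iN; have -> : V i (fG 1) = hout rnd N (hd_gate fBOS) Z i 0.
  by case: Veq => H _; exact: (H i (fG 1) 3%N 0%N isT).
apply: (@hout_gate flags) => //.
- by move=> j _; rewrite lnS_flags.
- move=> j /andP[j0 jN]; rewrite ev_flags //; last by left; rewrite lnS_flags.
  by rewrite inE flag_BOS // gtn_eqF.
- by rewrite ev_flags //; left; rewrite lnS_flags.
Qed.

End FirstLayer.

(** * Numerical constants *)

(* Discards the facts that were not pushed to the goal: linear arithmetic gets slow in a large context. *)
Ltac wipe := repeat match goal with
  | H : is_true (@Order.le _ _ _ _) |- _ => clear H
  | H : is_true (@Order.lt _ _ _ _) |- _ => clear H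
  | H : is_true (_ && _) |- _ => clear H
  end.

Section Numerics.
Variable R : archiRcfType.
Implicit Types b x y e q S D L : R.

Lemma relu_lip x y e : `|x - y| <= e -> `|relu x - relu y| <= e.
Proof.
rewrite /relu !maxEle; case: ifP => hx; case: ifP => hy;
  rewrite !ler_norml => /andP[h1 h2]; apply/andP; split; move: hx hy; lra.
Qed.

Lemma relu_pos x : 0 <= x -> relu x = x.
Proof. by rewrite /relu maxEle => ->. Qed.

Lemma relu_neg x : x <= 0 -> relu x = 0.
Proof. by rewrite /relu maxEle => h; case: ifP => // h'; lra. Qed.

Lemma relu_ge0 x : 0 <= relu x.
Proof. by rewrite /relu maxEle; case: ifP. Qed.

(** The amplification principle: if one feature [D] dominates the masked features, division by their
    norm is division by [D] up to a relative error e/2. *)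
Lemma inv_sqrt_approx D S e : 0 < D -> D ^+ 2 <= S <= D ^+ 2 * (1 + e) -> e <= 1 ->
  D^-1 * (1 - e / 2) <= (Num.sqrt S)^-1 <= D^-1.
Proof.
move=> D0 /andP[S1 S2] e1.
have D2 : 0 < D ^+ 2 by rewrite exprn_gt0.
set w := S / D ^+ 2 - 1.
have SE : S = D ^+ 2 * (1 + w) by rewrite /w addrC subrK mulrCA divff ?mulr1 // gt_eqF.
have w0 : 0 <= w by rewrite SE in S1; nra.
have we : w <= e by rewrite SE ler_pM2l // in S2; lra.
have -> : Num.sqrt S = D * Num.sqrt (1 + w).
  by rewrite SE sqrtrM ?sqr_ge0 // sqrtr_sqr gtr0_norm.
rewrite invfM; have w01 : 0 <= w <= 1 by rewrite w0; lra.
have /andP[h1 _] := inv_sqrt_bounds w01.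
have i0 : 0 < D^-1 by rewrite invr_gt0.
have h3 : (Num.sqrt (1 + w))^-1 <= 1.
  rewrite invf_le1 ?sqrtr_gt0; last by lra.
  by rewrite -[leLHS]sqrtr1 ler_sqrt; lra.
by apply/andP; split; nra.
Qed.

Lemma div_sqrt_approx L D S e : 0 < D -> D ^+ 2 <= S <= D ^+ 2 * (1 + e) -> e <= 1 ->
  `|L / Num.sqrt S - L / D| <= `|L| / D * (e / 2).
Proof.
move=> D0 SD e1; have /andP[h1 h2] := inv_sqrt_approx D0 SD e1.
rewrite -mulrBr normrM -[leRHS]mulrA ler_wpM2l ?normr_ge0 //.
rewrite ler_norml; apply/andP; split; lra.
Qed.

(** Here q is 1 / sqrt (1 + g^2), and z, y, x are the successive rounded results. For g <= 23/100
    the factor q loses less than 2.7 percent, and the rounding errors are thousandths of b0 g. *)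
Lemma cst_step_real (b0 u0 g q z y x : R) : 0 < b0 <= 1 / 5 -> 0 < u0 <= 1 / 1000 ->
  0 <= g <= 23 / 100 -> 1000 * u0 <= b0 * g -> 1 - g ^+ 2 / 2 <= q <= 1 ->
  z - u0 <= 8 * g * q <= z + u0 -> y - u0 <= z / 8 <= y + u0 -> x - u0 <= y * b0 <= x + u0 ->
  97 / 100 * (b0 * g) <= x <= 101 / 100 * (b0 * g).
Proof.
move=> /andP[b0' b5] /andP[u0' u1] /andP[g0 g1] ug /andP[q1 q2] /andP[z1 z2] /andP[y1 y2] /andP[x1 x2].
have gg : g ^+ 2 <= 53 / 1000 by move: g0 g1; wipe; nra.
have gq1 : 973 / 1000 * g <= g * q by move: g0 q1 gg; wipe; nra.
have gq2 : g * q <= g by move: g0 q2; wipe; nra.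
have w1 : g * q - 2 * u0 <= y by move: z1 z2 y1 y2 u0'; wipe; lra.
have w2 : y <= g * q + 2 * u0 by move: z1 z2 y1 y2 u0'; wipe; lra.
have p1 : b0 * (973 / 1000 * g - 2 * u0) <= y * b0.
  by rewrite mulrC ler_pM2r //; move: w1 gq1; wipe; lra.
have p2 : y * b0 <= b0 * (g + 2 * u0).
  by rewrite [leRHS]mulrC ler_pM2r //; move: w2 gq2; wipe; lra.
have p3 : b0 * u0 <= 1 / 5 * u0 by rewrite ler_pM2r.
by move: ug x1 x2 p1 p2 p3 u0'; wipe => *; apply/andP; split; lra.
Qed.

Lemma exprS_le b k j c : 0 < b <= 1 / 5 -> c * (1 / 5) ^+ j <= 1 -> 0 <= c ->
  c * b ^+ (k + j) <= b ^+ k.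
Proof.
move=> /andP[b0 b5] cj c0; rewrite exprD mulrCA -[leRHS]mulr1.
apply: ler_wpM2l; first by rewrite exprn_ge0 // ltW.
apply: le_trans cj; apply: ler_wpM2l => //.
by apply: lerXn2r; rewrite ?nnegrE //; lra.
Qed.

Definition u_bound p b : Prop := uerr R p <= b ^+ 50.

End Numerics.

(** * The size of the constants computed by repeated averaging *)

Section Constants.
Variables (R : archiRcfType) (p : nat) (rnd : R -> R).
Hypothesis Hrnd : correct_rounding p rnd.
Hypothesis Hp : (20 <= p)%N.
Variable N : nat.
Hypothesis N5 : (5 <= N)%N.
Notation u := (uerr R p).
Variable b : R.
Hypothesis bE : b = N%:R^-1.
Hypothesis Hu : u_bound p b.

Lemma b_gt0 : 0 < b. Proof. by rewrite bE invr_gt0 ltr0n; lia. Qed.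
Lemma b_le : b <= 1 / 5.
Proof. by rewrite bE mul1r lef_pV2 ?posrE ?ltr0n //; [rewrite ler_nat | lia]. Qed.
Lemma b_itv : 0 < b <= 1 / 5. Proof. by rewrite b_gt0 b_le. Qed.
Lemma Nb : N%:R * b = 1. Proof. by rewrite bE divff // pnatr_eq0; lia. Qed.

Lemma u_small k c : (k + 38 <= 50)%N -> 0 <= c <= 10 ^+ 12 -> c * u <= b ^+ k.
Proof.
move=> k50 /andP[c0 c1]; apply: le_trans (_ : c * b ^+ 50 <= _); first exact: ler_wpM2l.
rewrite (_ : 50 = k + (50 - k))%N; last by lia.
apply: exprS_le => //; first exact: b_itv.
apply: le_trans (_ : c * (1 / 5) ^+ 38 <= _).
  apply: ler_wpM2l => //; apply: ler_wiXn2l; [lra|lra|lia].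
by lra.
Qed.

(** Indices are shifted by one: [cst k] is about b^(k+1). *)
Fixpoint cst (k : nat) : R := if k is k'.+1 then rnd (shrink rnd (cst k') * b) else rnd b.

Lemma rnd_near x c : `|x| <= c -> c <= 512 -> rnd x - u <= x <= rnd x + u.
Proof.
move=> xc c512; have := rnd_err Hrnd Hp (le_trans xc c512).
by rewrite ler_norml => /andP[? ?]; apply/andP; split; lra.
Qed.

Lemma cst_step g : 0 <= g <= 23 / 100 -> 1000 * u <= b * g ->
  97 / 100 * (b * g) <= rnd (shrink rnd g * b) <= 101 / 100 * (b * g).
Proof.
move=> g01 ug; have u0 := uerr_gt0 R p; have u1 := uerr_le R Hp.
have b05 := b_itv; have gg := sqr_ge0 g.
have w01 : 0 <= g ^+ 2 <= 1 by rewrite gg; move: g01; wipe => /andP[? ?]; nra.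
have /andP[h1 _] := inv_sqrt_bounds w01.
rewrite /shrink; set q := (Num.sqrt _)^-1 in h1 *.
have h2 : q <= 1.
  rewrite /q invf_le1 ?sqrtr_gt0; last by move: gg; wipe; lra.
  by rewrite -[leLHS]sqrtr1 ler_sqrt; move: gg; wipe; lra.
have q0 : 0 <= q by rewrite invr_ge0 sqrtr_ge0.
move: q q0 h1 h2 => q q0 h1 h2.
have n1 : `|8 * g * q| <= 8.
  by move: g01 q0 h2; wipe => /andP[? ?] ? ?; rewrite ger0_norm; nra.
have r1 := rnd_near n1 (ler_nat _ 8 512).
move: (rnd (8 * g * q)) r1 n1 => z r1 n1.
have n2 : `|z / 8| <= 2.
  move: r1 n1 u1; wipe; rewrite !ler_norml => /andP[? ?] /andP[? ?] ?; apply/andP; split; lra.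
have r2 := rnd_near n2 (ler_nat _ 2 512).
move: (rnd (z / 8)) r2 => y r2.
have n3 : `|y * b| <= 3.
  have : `|y| <= 3.
    move: r2 n2 u1; wipe; rewrite !ler_norml => /andP[? ?] /andP[? ?] ?; apply/andP; split; lra.
  rewrite normrM [`|b|]gtr0_norm ?b_gt0 // => y3; move: b05 (normr_ge0 y) y3; wipe => /andP[? ?] ? ?; nra.
have r3 := rnd_near n3 (ler_nat _ 3 512).
by apply: (cst_step_real b05 _ g01 ug _ r1 r2 r3); apply/andP.
Qed.

(** Since (101/100)^10 <= 111/100 and b <= 1/5, the value is at most 0.222; this is the origin of
    the bound 23/100. *)
Lemma cst_size k : (k <= 9)%N ->
  (97 / 100) ^+ k.+1 * b ^+ k.+1 <= cst k <= (101 / 100) ^+ k.+1 * b ^+ k.+1 ->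
  0 <= cst k <= 23 / 100 /\ 1000 * u <= b * cst k.
Proof.
move=> k9 /andP[]; have b0 := b_gt0; have b5 := b_le.
have k101 : (101 / 100 : R) ^+ k.+1 <= 111 / 100.
  apply: le_trans (_ : (101 / 100) ^+ 10 <= _); last by lra.
  by rewrite ler_eXn2l //; lra.
have k97 : 7 / 10 <= (97 / 100 : R) ^+ k.+1.
  apply: le_trans (_ : _ <= (97 / 100) ^+ 10) _; first by lra.
  by apply: ler_wiXn2l => //; lra.
have B0 : 0 < b ^+ k.+1 by rewrite exprn_gt0.
have Bb : b ^+ k.+1 <= b by rewrite exprS; apply: ler_piMr; [exact: ltW | apply: exprn_ile1; lra].
have B11 : b ^+ 11 <= b * b ^+ k.+1.
  by rewrite -exprS; apply: ler_wiXn2l; [exact: ltW | lra | lia].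
have u11 : 2000 * u <= b ^+ 11 by apply: u_small => //; apply/andP; split; lra.
move: k101 k97 B0 Bb B11 u11.
move: ((101 / 100) ^+ k.+1) ((97 / 100) ^+ k.+1) (b ^+ k.+1) (b ^+ 11) (cst k) => c d B B' g.
move=> k101 k97 B0 Bb B11 u11 h1 h2.
have g0 : 7 / 10 * B <= g by apply: le_trans h1; rewrite ler_pM2r.
have g1 : g <= 111 / 100 * B by apply: le_trans h2 _; rewrite ler_pM2r.
have bg : b * (7 / 10 * B) <= b * g by rewrite ler_pM2l.
by split; [move: g0 g1 B0 Bb b5; wipe => *; apply/andP; split; lra | move: bg B11 u11 (uerr_gt0 R p); wipe; lra].
Qed.

Lemma cst_bounds k : (k <= 10)%N ->
  (97 / 100) ^+ k.+1 * b ^+ k.+1 <= cst k <= (101 / 100) ^+ k.+1 * b ^+ k.+1.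
Proof.
have b0 := b_gt0; have b5 := b_le; have u0 := uerr_gt0 R p.
elim: k => [_|k IH k10].
  rewrite /= !expr1.
  have e1 : `|rnd b - b| <= u.
    by apply: (rnd_err Hrnd Hp); rewrite ler_norml; apply/andP; split; lra.
  have := @u_small 1 1000 isT; rewrite expr1 => /(_ _) H.
  have {}H : 1000 * u <= b by apply: H; lra.
  by move: e1; rewrite ler_norml => /andP[? ?]; apply/andP; split; lra.
have IH' := IH (ltnW k10).
have [g1 g2] := cst_size k10 IH'.
case/andP: IH' => h1 h2; have /andP[s1 s2] := cst_step g1 g2.
rewrite -/(cst k.+1) in s1 s2; rewrite ![_ ^+ k.+2]exprS.
move: h1 h2 s1 s2.
move: ((101 / 100) ^+ k.+1) ((97 / 100) ^+ k.+1) (b ^+ k.+1) (cst k) (cst k.+1) => c d B g g' h1 h2 s1 s2.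
have t1 : b * (d * B) <= b * g by rewrite ler_pM2l.
have t2 : b * g <= b * (c * B) by rewrite ler_pM2l.
by apply/andP; split; lra.
Qed.

Lemma cst_ratio k : (k <= 9)%N ->
  97 / 100 * (b * cst k) <= cst k.+1 <= 101 / 100 * (b * cst k).
Proof.
move=> k9; have [g1 g2] := cst_size k9 (cst_bounds (leq_trans k9 (leqnSn _))).
exact: cst_step.
Qed.

Notation rho := (cst 6).
Notation tau := (cst 8).
Notation eta := (cst 10).

Lemma rho_bounds : 8 / 10 * b ^+ 7 <= rho <= 11 / 10 * b ^+ 7.
Proof.
have /andP[h1 h2] := @cst_bounds 6 isT; have B0 : 0 < b ^+ 7 by rewrite exprn_gt0 // b_gt0.
move: h1 h2; move: (b ^+ 7) B0 => B B0 h1 h2; apply/andP; split; nra.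
Qed.

Lemma tau_bounds : 3 / 4 * b ^+ 9 <= tau <= 11 / 10 * b ^+ 9.
Proof.
have /andP[h1 h2] := @cst_bounds 8 isT; have B0 : 0 < b ^+ 9 by rewrite exprn_gt0 // b_gt0.
move: h1 h2; move: (b ^+ 9) B0 => B B0 h1 h2; apply/andP; split; nra.
Qed.

(** The bound is relative to [rho], four steps earlier in the chain: the keys have unit eta / rho,
    whose bounds would otherwise combine the slack of two long chains. *)
Lemma eta_bounds : 85 / 100 * (b ^+ 4 * rho) <= eta <= 11 / 10 * (b ^+ 4 * rho).
Proof.
have b0 := b_gt0.
have step k x y : (k <= 9)%N -> 0 <= x -> x <= cst k <= y ->
    97 / 100 * b * x <= cst k.+1 <= 101 / 100 * b * y.
  move=> k9 x0 /andP[h1 h2]; have /andP[h3 h4] := cst_ratio k9.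
  have : b * x <= b * cst k by rewrite ler_pM2l.
  have : b * cst k <= b * y by rewrite ler_pM2l.
  by move=> ? ?; apply/andP; split; lra.
have r0 : 0 <= rho.
  have /andP[h _] := rho_bounds; apply: le_trans h.
  by apply: mulr_ge0; [lra | apply: exprn_ge0; exact: ltW].
have bx x : 0 <= x -> 0 <= 97 / 100 * b * x.
  by move=> x0; apply: mulr_ge0 => //; apply: mulr_ge0; [lra | exact: ltW].
have s7 := @step 6 _ _ isT r0 (introT andP (conj (lexx rho) (lexx rho))).
have s8 := @step 7 _ _ isT (bx _ r0) s7.
have s9 := @step 8 _ _ isT (bx _ (bx _ r0)) s8.
have /andP[h1 h2] := @step 9 _ _ isT (bx _ (bx _ (bx _ r0))) s9.
have rb : 0 <= b ^+ 4 * rho := mulr_ge0 (exprn_ge0 4 (ltW b0)) r0.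
move: rho eta rb h1 h2 => r e; rewrite !exprS expr0 mulr1; wipe => rb h1 h2.
by apply/andP; split; lra.
Qed.

End Constants.

Section InitFacts.
Variables (R : archiRcfType) (p : nat) (rnd : R -> R).
Hypothesis Hrnd : correct_rounding p rnd.
Hypothesis Hp : (20 <= p)%N.
Variables (n : nat) (A : 'I_n -> 'I_n -> bool) (s t : 'I_n).
Notation N := (len s t).
Notation tok i := (tokn A s t i).
Variable V : nat -> nat -> R.
Hypothesis Vflag : forall i f, f \in flags -> V i f = (f == tok_flag (tok i))%:R.
Hypothesis Veq : eqns rnd N V (subs_of init_specs).
Variable b : R.
Hypothesis bE : b = N%:R^-1.
Hypothesis Hu : u_bound p b.

Definition no_layer := LayerSpec [::] [::] [::] [::] [::] [::].

Lemma eqns_nth (l : seq sublayer) k : eqns rnd N V l -> (k < size l)%N ->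
  seqn rnd N V (nth (SA no_layer) l k).
Proof. by elim: l k => [|x l IH] [|k] //= [H H']; [|apply: IH]. Qed.

Definition gate_ok k := V 0 (fG k) = cst rnd b k.-1 /\
  forall j, (0 < j < N)%N -> V j (fG k) = 0.

Lemma gate_ok_next k : (fG k < 56)%N -> (fG k) \notin flags -> (0 < k)%N -> gate_ok k ->
  (forall i, V i (fG k.+1) = hout rnd N (hd_gate (fG k)) (fun j => lnf rnd (fG k :: flags) (V j)) i 0) ->
  gate_ok k.+1.
Proof.
move=> k56 kf k0 [g0 gz] H; split.
  rewrite H (hout_chain_gate Hrnd Hp Vflag) ?len_gt0 // eqxx g0 -bE.
  by case: k k0 {k56 kf g0 gz H}.
move=> j /andP[j0 jN]; rewrite H (hout_chain_gate Hrnd Hp Vflag) //.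
by rewrite gtn_eqF.
Qed.

Lemma gates : [/\ gate_ok 6, gate_ok 8 & gate_ok 10].
Proof.
have g1 : gate_ok 1.
  split; first by rewrite (V_G1 Hrnd Hp Vflag Veq) ?len_gt0 //= mul1r -bE.
  by move=> j /andP[j0 jN]; rewrite (V_G1 Hrnd Hp Vflag Veq) // gtn_eqF.
have next k m l : nth (SA no_layer) (subs_of init_specs) m = SA l ->
   (m < 34)%N -> am l = fG k :: flags -> nth no_head (hs l) 3 = hd_gate (fG k) ->
   ((fG k.+1, (3, 0)) \in ao l)%N -> (fG k < 56)%N -> fG k \notin flags -> (0 < k)%N ->
   gate_ok k -> gate_ok k.+1.
  move=> ml m34 aml hsl aol k56 kf k0 gk; apply: gate_ok_next => // i.
  have := @eqns_nth _ m Veq m34; rewrite ml /= => /(_ i _ _ _ aol).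
  by rewrite aml hsl.
(* The attention sublayer of layer j is entry 2 j of the list of sublayers. *)
have g2 := next 1%N 2 _ erefl isT erefl erefl isT isT isT isT g1.
have g3 := next 2%N 4 _ erefl isT erefl erefl isT isT isT isT g2.
have g4 := next 3%N 6 _ erefl isT erefl erefl isT isT isT isT g3.
have g5 := next 4%N 8 _ erefl isT erefl erefl isT isT isT isT g4.
have g6 := next 5%N 10 _ erefl isT erefl erefl isT isT isT isT g5.
have g7 := next 6%N 12 _ erefl isT erefl erefl isT isT isT isT g6.
have g8 := next 7%N 14 _ erefl isT erefl erefl isT isT isT isT g7.
have g9 := next 8%N 16 _ erefl isT erefl erefl isT isT isT isT g8.
have g10 := next 9%N 18 _ erefl isT erefl erefl isT isT isT isT g9.
by split.
Qed.

Lemma unif_out k i : (fG k < 56)%N -> (fG k) \notin flags -> (0 < k)%N -> gate_ok k ->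
  (i < N)%N ->
  hout rnd N (hd_unif (fG k)) (fun j => lnf rnd (fG k :: flags) (V j)) i 0 = cst rnd b k.
Proof.
move=> k56 kf k0 [g0 gz] iN; rewrite (hout_chain_unif Hrnd Hp Vflag) //.
by rewrite g0 -bE; case: k k0 {k56 kf g0 gz}.
Qed.

Lemma V_RHO i : (i < N)%N -> V i fRHO = cst rnd b 6.
Proof.
move=> iN; have [g6 _ _] := gates.
by rewrite -(@unif_out 6 _ isT isT isT g6 iN); exact: (@eqns_nth _ 12 Veq isT i fRHO 4%N 0%N isT).
Qed.

Lemma V_TAU i : (i < N)%N -> V i fTAU = cst rnd b 8.
Proof.
move=> iN; have [_ g8 _] := gates.
by rewrite -(@unif_out 8 _ isT isT isT g8 iN); exact: (@eqns_nth _ 16 Veq isT i fTAU 4%N 0%N isT).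
Qed.

Lemma V_ETA i : (i < N)%N -> V i fETA = cst rnd b 10.
Proof.
move=> iN; have [_ _ g10] := gates.
by rewrite -(@unif_out 10 _ isT isT isT g10 iN); exact: (@eqns_nth _ 20 Veq isT i fETA 4%N 0%N isT).
Qed.

End InitFacts.

(** * Integers recovered from rounded reciprocals *)

Section Reciprocals.
Variable R : archiRcfType.
Implicit Types b x y m W q : R.

Lemma bpow b k j : 0 < b <= 1 / 5 -> 0 < b ^+ (k + j) <= (1 / 5) ^+ j * b ^+ k.
Proof.
move=> /andP[b0 b5]; rewrite exprn_gt0 //= exprD mulrC ler_pM2r ?exprn_gt0 //.
by apply: lerXn2r; rewrite ?nnegrE //; [exact: ltW | lra].
Qed.

(** [W] is the squared norm of the other masked features. Since y >= b/2, it changes the inverse of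
    the norm by at most W / (2 y^3) <= 16 b^15, while 1/y itself misses m by at most 2 b^48. *)
Lemma recip_approx b u0 y m W : 0 < b <= 1 / 5 -> 0 < u0 <= b ^+ 50 ->
  y - u0 <= 1 / m <= y + u0 -> 1 <= m -> m * b <= 1 -> 0 <= W <= 4 * b ^+ 18 ->
  [/\ b / 2 <= y, y ^+ 2 <= y ^+ 2 + W & `|(Num.sqrt (y ^+ 2 + W))^-1 - m| <= b ^+ 13].
Proof.
move=> bb /andP[u0' u1] /andP[y1 y2] m1 mb /andP[W0 W1].
have /andP[b0 b5] := bb.
have m0 : 0 < m by lra.
have bm : b <= 1 / m by rewrite ler_pdivlMr // mulrC.
have u2 : u0 <= b / 10.
  by have /andP[_] := bpow 1 49 bb; rewrite expr1; move: u1 b0; wipe => *; lra.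
have yb : b / 2 <= y by move: bm y2 u2 b0; wipe; lra.
have y0 : 0 < y by move: yb b0; wipe; lra.
set i := y^-1; have i0 : 0 < i by rewrite invr_gt0.
have yi : y * i = 1 by rewrite divff // gt_eqF.
have bi : b * i <= 2 by move: yb yi i0; wipe; nra.
have bi0 : 0 < b * i by rewrite mulr_gt0.
have b3 : (b * i) ^+ 3 <= 8.
  have -> : (b * i) ^+ 3 = (b * i) * ((b * i) * (b * i)) by ring.
  have h : (b * i) * (b * i) <= 4 by move: bi bi0; wipe; nra.
  by have : 0 < (b * i) * (b * i) := mulr_gt0 bi0 bi0; move: h bi bi0; wipe; nra.
set e := W * i ^+ 2.
have e0 : 0 <= e by rewrite mulr_ge0 ?sqr_ge0.
have iS : y ^+ 2 <= y ^+ 2 + W <= y ^+ 2 * (1 + e).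
  have -> : y ^+ 2 * (1 + e) = y ^+ 2 + W * (y * i) ^+ 2 by rewrite /e; ring.
  by rewrite yi; move: W0; wipe => ?; apply/andP; split; lra.
have ie : i * e <= 32 * b ^+ 15.
  have -> : i * e = W * i ^+ 3 by rewrite /e; ring.
  apply: (@le_trans _ _ (4 * b ^+ 18 * i ^+ 3)).
    by apply: ler_wpM2r => //; rewrite exprn_ge0 // ltW.
  have -> : 4 * b ^+ 18 * i ^+ 3 = 4 * b ^+ 15 * (b * i) ^+ 3 by ring.
  have : 0 < b ^+ 15 by rewrite exprn_gt0.
  by move: b3; wipe; nra.
have e1 : e <= 1.
  apply: (@le_trans _ _ (4 * b ^+ 18 * i ^+ 2)).
    by apply: ler_wpM2r => //; exact: sqr_ge0.
  have -> : 4 * b ^+ 18 * i ^+ 2 = 4 * b ^+ 16 * ((b * i) * (b * i)) by ring.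
  have h : (b * i) * (b * i) <= 4 by move: bi bi0; wipe; nra.
  have /andP[h1 h2] := bpow 0 16 bb; rewrite expr0 in h2.
  have h3 : 4 * b ^+ 16 * ((b * i) * (b * i)) <= 4 * b ^+ 16 * 4.
    by apply: ler_wpM2l => //; move: h1; wipe; lra.
  by move: h3 h2; wipe; lra.
have /andP[q1 q2] := inv_sqrt_approx y0 iS e1.
rewrite -/i in q1 q2; split=> //; first by case/andP: iS.
move: q1 q2; move: ((Num.sqrt _)^-1) => q q1 q2.
have im : `|i - m| <= 2 * b ^+ 48.
  have -> : i - m = i * m * (1 / m - y).
    by rewrite /i; field; rewrite !gt_eqF.
  rewrite normrM [`|i * m|]gtr0_norm ?mulr_gt0 //.
  have d : `|1 / m - y| <= u0.
    by rewrite ler_norml; move: y1 y2; wipe => *; apply/andP; split; lra.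
  apply: (@le_trans _ _ (i * m * b ^+ 50)).
    by apply: ler_wpM2l; [exact: ltW (mulr_gt0 i0 m0) | exact: le_trans d u1].
  have -> : i * m * b ^+ 50 = (b * i) * (m * b) * b ^+ 48 by ring.
  apply: ler_wpM2r; first by apply: exprn_ge0; exact: ltW.
  by move: bi bi0 mb (mulr_gt0 m0 b0); wipe; nra.
have /andP[_ h1] := bpow 13 2 bb; have /andP[_ h2] := bpow 13 35 bb.
have B0 : 0 < b ^+ 13 by rewrite exprn_gt0.
move: im; rewrite ler_norml => /andP[m1' m2'].
by rewrite ler_norml; move: q1 q2 ie m1' m2' h1 h2 B0 {iS y1 y2}; wipe => *; apply/andP; split; lra.
Qed.

(** All that the later estimates know about the constants: [rho], [tau] and [eta] become variables
    there, detached from the rounded recursion [cst]. *)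
Definition consts_ok b (u0 rho tau eta : R) : Prop :=
  [/\ 0 < b <= 1 / 5, 0 < u0 <= b ^+ 50, 8 / 10 * b ^+ 7 <= rho <= 11 / 10 * b ^+ 7,
      3 / 4 * b ^+ 9 <= tau <= 11 / 10 * b ^+ 9
    & 85 / 100 * (b ^+ 4 * rho) <= eta <= 11 / 10 * (b ^+ 4 * rho)].

Lemma consts_eta b (u0 rho tau eta : R) : consts_ok b u0 rho tau eta ->
  [/\ 0 < rho, 0 < tau, 0 < eta & 68 / 100 * b ^+ 11 <= eta <= 121 / 100 * b ^+ 11].
Proof.
case=> bb _ /andP[r1 r2] /andP[t1 _] /andP[e1 e2].
have /andP[b7 _] := bpow 0 7 bb; have /andP[b9 _] := bpow 0 9 bb.
have /andP[b4 _] := bpow 0 4 bb.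
rewrite !add0n in b4 b7 b9.
have r0 : 0 < rho by move: r1 b7; wipe; lra.
have br : 0 < b ^+ 4 * rho := mulr_gt0 b4 r0.
have rr : b ^+ 4 * (8 / 10 * b ^+ 7) <= b ^+ 4 * rho <= b ^+ 4 * (11 / 10 * b ^+ 7).
  by apply/andP; split; rewrite ler_pM2l.
have E : b ^+ 11 = b ^+ 4 * b ^+ 7 by rewrite -exprD.
case/andP: rr => rr1 rr2.
split=> //; first by move: t1 b9; wipe; lra.
  by move: e1 br; wipe; lra.
by rewrite E; move: e1 e2 rr1 rr2; wipe => *; apply/andP; split; lra.
Qed.

Lemma consts_u b (u0 rho tau eta : R) : consts_ok b u0 rho tau eta ->
  1000 * u0 <= eta * b ^+ 30.
Proof.
move=> H; have [_ _ e0 /andP[e1 _]] := consts_eta H.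
case: H => bb /andP[_ u1] _ _ _; have /andP[b30 _] := bpow 0 30 bb; rewrite add0n in b30.
have h : 68 / 100 * b ^+ 11 * b ^+ 30 <= eta * b ^+ 30 by rewrite ler_pM2r.
have /andP[_ h2] := bpow 41 9 bb.
have E : b ^+ 41 = b ^+ 11 * b ^+ 30 by rewrite -exprD.
have /andP[b41 _] := bpow 0 41 bb; rewrite add0n in b41.
by rewrite E in h2 b41; move: u1 h h2 b41; wipe; rewrite -mulrA; lra.
Qed.

End Reciprocals.

Section Forms2.
Variables (R : archiRcfType) (p : nat) (rnd : R -> R).
Hypothesis Hrnd : correct_rounding p rnd.
Hypothesis Hp : (20 <= p)%N.
Notation u := (uerr R p).

Definition lin8 (f : lform) (v : nat -> R) : R := ev f (fun g => 8 * v g).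
Definition sumsq (ms : seq nat) (v : nat -> R) : R := \sum_(g <- ms) v g ^+ 2.

Lemma form_approx (f : lform) ms v (D : R) : all (fun g => (g < 56)%N) ms ->
  (wnorm f <= 128)%N -> all (mem ms) (unzip1 f) ->
  0 < D -> (forall g, g \in ms -> `|v g| <= D) -> D ^+ 2 <= 4 * sumsq ms v ->
  `|rnd (ev f (lnf rnd ms v)) - lin8 f v / Num.sqrt (sumsq ms v)| <= 3 * u.
Proof.
move=> m56 wf /allP fm D0 vD DS.
have := @lnf_lin R p rnd Hrnd Hp f ms v D wf fm D0 vD; rewrite lnmu0 // normr0 lnS0 // lin0 //.
by move=> H; apply: H => //; exact: ltW.
Qed.

Lemma hid_approx sp v m (D : R) : all (fun g => (g < 56)%N) (fm sp) ->
  (wnorm (nth [::] (hd sp) m) <= 128)%N -> all (mem (fm sp)) (unzip1 (nth [::] (hd sp) m)) ->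
  0 < D -> (forall g, g \in fm sp -> `|v g| <= D) -> D ^+ 2 <= 4 * sumsq (fm sp) v ->
  `|hid rnd sp v m - relu (lin8 (nth [::] (hd sp) m) v / Num.sqrt (sumsq (fm sp) v))| <= 3 * u.
Proof. by move=> *; apply: relu_lip; apply: (form_approx (D := D)). Qed.

End Forms2.

(** * Position data *)

Section Data.
Variables (R : archiRcfType) (p : nat) (rnd : R -> R).
Hypothesis Hrnd : correct_rounding p rnd.
Hypothesis Hp : (20 <= p)%N.
Variables (n : nat) (A : 'I_n -> 'I_n -> bool) (s t : 'I_n).
Notation N := (len s t).
Notation tok i := (tokn A s t i).
Variable V : nat -> nat -> R.
Hypothesis Vflag : forall i f, f \in flags -> V i f = (f == tok_flag (tok i))%:R.
Hypothesis Veq : eqns rnd N V (subs_of init_specs).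
Notation u := (uerr R p).
Variables b rho tau eta : R.
Hypothesis Nb : N%:R * b = 1.
Hypothesis Hc : consts_ok b u rho tau eta.
Hypothesis Vrho : forall i, (i < N)%N -> V i fRHO = rho.
Hypothesis Vtau : forall i, (i < N)%N -> V i fTAU = tau.
Hypothesis Veta : forall i, (i < N)%N -> V i fETA = eta.

Lemma lin8_cons f c l (v : nat -> R) : lin8 ((f, c) :: l) v = c%:~R / 8 * v f + lin8 l v.
Proof. by rewrite /lin8 /ev big_cons /=; congr (_ + _); field. Qed.
Lemma lin8_nil (v : nat -> R) : lin8 [::] v = 0.
Proof. by rewrite /lin8 /ev big_nil. Qed.
Lemma lin8_c8 l (v : nat -> R) : lin8 (c8 l) v = \sum_(f <- l) v f.
Proof. by rewrite /lin8 ev_c8 -mulr_sumr mulrC mulKf ?pnatr_eq0. Qed.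

Lemma V_ff k sp f m i ms form (D : R) :
  nth (SA no_layer) (subs_of init_specs) k = SF sp -> (k < 34)%N ->
  (f, [:: (m, 64%:Z)]) \in fo sp -> fm sp = ms -> nth [::] (hd sp) m = form ->
  all (fun g => (g < 56)%N) ms -> (wnorm form <= 128)%N -> all (mem ms) (unzip1 form) ->
  0 < D -> (forall g, g \in ms -> `|V i g| <= D) -> D ^+ 2 <= 4 * sumsq ms (V i) ->
  `|V i f - relu (lin8 form (V i) / Num.sqrt (sumsq ms (V i)))| <= 3 * u.
Proof.
move=> ek k34 fin <- <- m56 wf fm D0 vD DS.
have := eqns_nth Veq k34; rewrite ek => /(_ i f m fin) ->.
exact: (hid_approx Hrnd Hp (D := D)).
Qed.

Lemma b_ok : 0 < b <= 1 / 5. Proof. by case: Hc. Qed.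
Lemma u_ok : 0 < u <= b ^+ 50. Proof. by case: Hc. Qed.

Lemma nat_b m : (m <= N)%N -> m%:R * b <= 1.
Proof.
move=> mN; rewrite -[leRHS]Nb ler_pM2r ?ler_nat //.
by have /andP[] := b_ok.
Qed.

Lemma cubeN : (n * n * n + n * n + 3 <= N)%N.
Proof.
rewrite /len /sTB /sTA /sPAD (_ : n ^ 3 = n * n * n)%N; first by lia.
by rewrite !expnS expn0 muln1 mulnA.
Qed.

Lemma n1_le : (n.+1 <= N)%N.
Proof.
apply: leq_trans cubeN; rewrite -addnA; apply: (@leq_trans (n * n + 3)); last exact: leq_addl.
by have := leq_pmulr n (n_gt0 s); lia.
Qed.

Lemma s2_le : (s.+2 <= N)%N.
Proof.
apply: leq_trans cubeN; rewrite -addnA; apply: (@leq_trans (n * n + 3)); last exact: leq_addl.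
by have := leq_pmulr n (n_gt0 s); have := ltn_ord s; lia.
Qed.

Lemma div_fact (E y m W : R) : y - u <= 1 / m <= y + u -> 1 <= m -> m * b <= 1 ->
  0 <= W <= 4 * b ^+ 18 ->
  `|E - relu (eta / Num.sqrt (y ^+ 2 + W))| <= 3 * u -> `|E - eta * m| <= eta * b ^+ 12.
Proof.
move=> hy m1 mb hW; have [h1 h2 h3] := recip_approx b_ok u_ok hy m1 mb hW.
have [r0 t0 e0 _] := consts_eta Hc; have eu := consts_u Hc.
rewrite relu_pos; last by apply: mulr_ge0; [exact: ltW | rewrite invr_ge0 sqrtr_ge0].
move: h3; move: ((Num.sqrt _)^-1) => q h3.
have d : `|eta * q - eta * m| <= eta * b ^+ 13.
  by rewrite -mulrBr normrM gtr0_norm // ler_pM2l.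
have /andP[_ p1] := bpow 12 1 b_ok; have /andP[_ p2] := bpow 12 18 b_ok.
have /andP[p0 _] := bpow 0 12 b_ok; rewrite add0n in p0.
have q1 : eta * b ^+ 13 <= 1 / 5 * (eta * b ^+ 12).
  by rewrite [leRHS]mulrCA ler_pM2l //; move: p1; rewrite expr1.
have q2 : eta * b ^+ 30 <= 1 / 5 * (eta * b ^+ 12).
  rewrite [leRHS]mulrCA ler_pM2l //; apply: le_trans p2 _; rewrite ler_pM2r //; lra.
move: d; rewrite !ler_norml => /andP[d1 d2] /andP[d3 d4].
have u0 := uerr_gt0 R p.
by move: q1 q2 eu d1 d2 d3 d4 u0; wipe => *; apply/andP; split; lra.
Qed.

Lemma eta_sq : 0 <= eta ^+ 2 <= b ^+ 18.
Proof.
have [_ _ e0 /andP[_ e2]] := consts_eta Hc; rewrite sqr_ge0 /=.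
have /andP[_ p1] := bpow 9 2 b_ok; have /andP[p0 _] := bpow 0 9 b_ok; rewrite add0n in p0.
have : eta <= b ^+ 9 by move: e2 p1 p0; wipe; lra.
have -> : b ^+ 18 = b ^+ 9 ^+ 2 by rewrite -exprM.
by move=> h; apply: lerXn2r; rewrite ?nnegrE // ltW.
Qed.

Lemma rnd_recip m y : (0 < m)%N -> y = rnd (1 / m%:R) -> y - u <= 1 / m%:R <= y + u.
Proof.
move=> m0 ->; apply: (rnd_near Hrnd Hp (c := 1)); last by rewrite ler1n.
rewrite normrM normr1 mul1r ger0_norm ?invr_ge0 ?ler0n //.
by rewrite invf_le1 ?ltr0n // ler1n.
Qed.

Lemma data_gen f f0 k sp i m : (i < N)%N -> (0 < m <= N)%N -> V i f0 = rnd (1 / m%:R) ->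
  nth (SA no_layer) (subs_of init_specs) k = SF sp -> (k < 34)%N ->
  (f, [:: (0%N, 64%:Z)]) \in fo sp -> fm sp = [:: f0; fETA] -> nth [::] (hd sp) 0 = c8 [:: fETA] ->
  (f0 < 56)%N -> `|V i f - eta * m%:R| <= eta * b ^+ 12.
Proof.
move=> iN /andP[m0 mN] yE ek k34 fin fmE hdE f56.
have hy := rnd_recip m0 yE; have m1 : 1 <= m%:R :> R by rewrite ler1n.
have mb := nat_b mN; have /andP[e1 e2] := eta_sq.
have hW : 0 <= eta ^+ 2 <= 4 * b ^+ 18.
  by rewrite e1 /=; move: e1 e2; wipe; lra.
have [h1 h2 h3] := recip_approx b_ok u_ok hy m1 mb hW.
have [r0 t0 e0 /andP[_ e3]] := consts_eta Hc; have /andP[b0 b5] := b_ok.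
have y0 : 0 < V i f0 by move: h1 b0; wipe; lra.
have ey : eta <= V i f0.
  have /andP[_ p1] := bpow 1 10 b_ok; rewrite expr1 in p1.
  by move: p1 e3 h1 b0; wipe; lra.
apply: (@div_fact _ (V i f0) _ (eta ^+ 2)) => //.
have := @V_ff k sp f 0 i [:: f0; fETA] (c8 [:: fETA]) (V i f0) ek k34 fin fmE hdE.
rewrite lin8_c8 big_seq1 /sumsq !big_cons big_nil addr0 Veta // => H.
apply: H => //; first by rewrite /= f56.
  by rewrite /= inE orbT.
  move=> g; rewrite !inE => /orP[/eqP->|/eqP->]; first by rewrite gtr0_norm.
  by rewrite Veta // gtr0_norm.
by move: h2 (sqr_ge0 (V i f0)); wipe; lra.
Qed.

Lemma E1_fact i : (i < N)%N -> `|V i fE1 - eta * (rank2 s i)%:R| <= eta * b ^+ 12.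
Proof.
move=> iN; apply: (@data_gen fE1 fY 21 _ i) => //; first exact: rank2_le.
exact: (V_Y Hrnd Hp Vflag Veq).
Qed.

Lemma ES_fact i : (i < N)%N -> `|V i fES - eta * (s.+2)%:R| <= eta * b ^+ 12.
Proof.
move=> iN; apply: (@data_gen fES fDS 23 _ i) => //; first exact: s2_le.
exact: (V_DS Hrnd Hp Vflag Veq).
Qed.

Lemma E1_small i : (i < N)%N -> 0 < V i fE1 <= 12 / 10 * (eta * N%:R).
Proof.
move=> iN; have := E1_fact iN; rewrite ler_distl => /andP[h1 h2].
have [r0 t0 e0 _] := consts_eta Hc.
have /andP[_ p1] := bpow 0 12 b_ok; rewrite expr0 add0n in p1.
have /andP[m1 m2] := rank2_le iN.
have m1' : 1 <= (rank2 s i)%:R :> R by rewrite ler1n.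
have m2' : (rank2 s i)%:R <= N%:R :> R by rewrite ler_nat.
have k1 : eta * 1 <= eta * (rank2 s i)%:R by rewrite ler_pM2l.
have k2 : eta * (rank2 s i)%:R <= eta * N%:R by rewrite ler_pM2l.
have k3 : eta * b ^+ 12 <= eta * (1 / 10) by rewrite ler_pM2l //; move: p1; wipe; lra.
by move: h1 h2 k1 k2 k3 e0; wipe => *; apply/andP; split; lra.
Qed.

Lemma N_ge1 : 1 <= N%:R :> R. Proof. by rewrite ler1n len_gt0. Qed.

Lemma bS k : b ^+ k.+1 * N%:R = b ^+ k.
Proof. by rewrite exprSr -mulrA [b * _]mulrC Nb mulr1. Qed.

Lemma etaN : eta * N%:R <= b ^+ 9 / 4.
Proof.
have [r0 t0 e0 /andP[_ e2]] := consts_eta Hc.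
have /andP[b0 _] := b_ok.
have -> : b ^+ 9 / 4 = (b ^+ 10 / 4) * N%:R.
  by rewrite [RHS]mulrAC bS.
rewrite ler_pM2r ?ltr0n ?len_gt0 //.
have /andP[p0 p1] := bpow 10 1 b_ok.
by move: e2 p0 p1; rewrite expr1; wipe; lra.
Qed.

Lemma X_recip i : (i < N)%N -> V i fX = rnd (1 / n.+1%:R).
Proof. by move=> iN; rewrite (V_X Hrnd Hp Vflag Veq) // natr1. Qed.

Lemma E1_sq i : (i < N)%N -> 0 <= eta ^+ 2 + V i fE1 ^+ 2 <= 4 * b ^+ 18.
Proof.
move=> iN; have /andP[h1 h2] := E1_small iN; have h3 := etaN.
have /andP[g1 g2] := eta_sq; have g3 := sqr_ge0 (V i fE1).
have : V i fE1 <= b ^+ 9.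
  have /andP[b9 _] := bpow 0 9 b_ok; rewrite add0n in b9.
  by move: h2 h3 b9; wipe; lra.
have E : b ^+ 18 = b ^+ 9 ^+ 2 by rewrite -exprM.
move=> h; have : V i fE1 ^+ 2 <= b ^+ 18.
  by rewrite E; apply: lerXn2r; rewrite ?nnegrE // ltW // (lt_le_trans h1 h).
by move: g1 g2 g3; wipe => *; apply/andP; split; lra.
Qed.

(** [fX], about 1/(n+1), dominates this mask, so one normalisation multiplies both eta and [fE1] by
    n+1. The common factor q is kept for the product estimate of [E2_fact]. *)
Lemma E23_mask i : (i < N)%N -> let q := (Num.sqrt (V i fX ^+ 2 + (eta ^+ 2 + V i fE1 ^+ 2)))^-1 in
  [/\ `|V i fE3 - relu (eta * q)| <= 3 * u, `|V i fE2 - relu (V i fE1 * q)| <= 3 * u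
    & `|q - n.+1%:R| <= b ^+ 13].
Proof.
move=> iN q; have hy := rnd_recip (ltn0Sn n) (X_recip iN).
have m1 : 1 <= n.+1%:R :> R by rewrite ler1n.
have mb := nat_b n1_le; have hW := E1_sq iN.
have [h1 h2 h3] := recip_approx b_ok u_ok hy m1 mb hW.
have [r0 t0 e0 /andP[_ e3]] := consts_eta Hc; have /andP[b0 b5] := b_ok.
have y0 : 0 < V i fX by move: h1 b0; wipe; lra.
have /andP[E0 E1] := E1_small iN; have E2 := etaN.
have b9 : b ^+ 9 <= b / 25.
  have /andP[p0 p1] := bpow 1 8 b_ok; rewrite expr1 in p1.
  by move: p0 p1 b0; wipe; lra.
have eN : eta <= eta * N%:R by apply: ler_peMr; [exact: ltW | exact: N_ge1].
have ey : eta <= V i fX by move: eN E2 b9 h1 b0; wipe; lra.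
have Ey : V i fE1 <= V i fX by move: E1 E2 b9 h1 b0; wipe; lra.
have vD g : g \in [:: fX; fETA; fE1] -> `|V i g| <= V i fX.
  by rewrite !inE => /or3P[/eqP->|/eqP->|/eqP->]; rewrite ?Veta // gtr0_norm.
have SE : sumsq [:: fX; fETA; fE1] (V i) = V i fX ^+ 2 + (eta ^+ 2 + V i fE1 ^+ 2).
  by rewrite /sumsq !big_cons big_nil addr0 Veta.
have DS : V i fX ^+ 2 <= 4 * sumsq [:: fX; fETA; fE1] (V i).
  by rewrite SE; move: h2 (sqr_ge0 (V i fX)); wipe; lra.
split=> //.
  have := @V_ff 25 _ fE3 1 i _ (c8 [:: fETA]) _ erefl isT isT erefl erefl isT isT isT y0 vD DS.
  by rewrite SE lin8_c8 big_seq1 Veta.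
have := @V_ff 25 _ fE2 0 i _ (c8 [:: fE1]) _ erefl isT isT erefl erefl isT isT isT y0 vD DS.
by rewrite SE lin8_c8 big_seq1.
Qed.

Lemma E3_fact i : (i < N)%N -> `|V i fE3 - eta * n.+1%:R| <= eta * b ^+ 12.
Proof.
move=> iN; have [h _ _] := E23_mask iN.
apply: (div_fact _ _ _ _ h).
- exact: rnd_recip (X_recip iN).
- by rewrite ler1n.
- exact: nat_b n1_le.
- exact: E1_sq.
Qed.



Lemma u_eta k : (k <= 30)%N -> 1000 * u <= eta * b ^+ k.
Proof.
move=> k30; have [r0 t0 e0 _] := consts_eta Hc.
apply: le_trans (consts_u Hc) _; rewrite ler_pM2l //.
by have /andP[b0 b5] := b_ok; apply: ler_wiXn2l => //; [exact: ltW | lra].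
Qed.

(** The error eta b^12 of [fE1] is multiplied by q <= 2 N, and the error b^13 of q by at most eta N;
    as N b = 1, both remain below eta b^10. *)
Lemma E2_fact i : (i < N)%N ->
  `|V i fE2 - eta * (n.+1%:R * (rank2 s i)%:R)| <= eta * b ^+ 10.
Proof.
move=> iN; have [_ h hq] := E23_mask iN; have h1 := E1_fact iN.
have /andP[E0 _] := E1_small iN; have [r0 t0 e0 _] := consts_eta Hc.
have uu := @u_eta 10 isT; have u0 := uerr_gt0 R p.
move: h hq; set q := (Num.sqrt _)^-1.
have q0 : 0 <= q by rewrite invr_ge0 sqrtr_ge0.
move: q q0 => q q0; rewrite relu_pos; last exact: mulr_ge0 (ltW E0) q0.
have mN : n.+1%:R <= N%:R :> R by rewrite ler_nat n1_le.
have rN : (rank2 s i)%:R <= N%:R :> R by rewrite ler_nat; case/andP: (rank2_le iN).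
have r0' : 0 <= (rank2 s i)%:R :> R by rewrite ler0n.
have m0' : 0 <= n.+1%:R :> R by rewrite ler0n.
move: (V i fE1) (V i fE2) h1 E0 => e1 e2 h1 E0 h hq.
move: (n.+1%:R) ((rank2 s i)%:R) mN rN r0' m0' hq h1 => m r mN rN r0' m0' hq h1.
have N1 := N_ge1; have /andP[p0 p1] := bpow 10 1 b_ok; have /andP[p2 p3] := bpow 10 2 b_ok.
have /andP[p4 p5] := bpow 10 3 b_ok; have /andP[p6 _] := bpow 0 10 b_ok; rewrite add0n in p6.
have q1 : `|(e1 - eta * r) * q| <= eta * (2 * b ^+ 11).
  rewrite normrM [`|q|]ger0_norm //.
  have qN : q <= 2 * N%:R.
    move: hq; rewrite ler_distl => /andP[_ hq].
    have /andP[_ p13] := bpow 0 13 b_ok; rewrite expr0 add0n in p13.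
    by move: hq mN N1 p13; wipe; lra.
  apply: (@le_trans _ _ (eta * b ^+ 12 * (2 * N%:R))).
    by apply: ler_pM => //.
  have -> : eta * b ^+ 12 * (2 * N%:R) = eta * (2 * (b ^+ 12 * N%:R)) by ring.
  by rewrite bS.
have q2 : `|eta * r * (q - m)| <= eta * b ^+ 12.
  rewrite normrM ger0_norm; last exact: mulr_ge0 (ltW e0) r0'.
  apply: (@le_trans _ _ (eta * N%:R * b ^+ 13)).
    apply: ler_pM => //; first exact: mulr_ge0 (ltW e0) r0'.
    by rewrite ler_pM2l.
  by rewrite -mulrA [N%:R * _]mulrC bS.
have E : e2 - eta * (m * r) = (e2 - e1 * q) + (e1 - eta * r) * q + eta * r * (q - m) by ring.
rewrite E; apply: le_trans (ler_normD _ _) _.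
have k1 : eta * (2 * b ^+ 11) <= eta * (1 / 2 * b ^+ 10) by rewrite ler_pM2l //; move: p1 p0; rewrite expr1; wipe; lra.
have k2 : eta * b ^+ 12 <= eta * (1 / 4 * b ^+ 10) by rewrite ler_pM2l //; move: p3 p6; wipe; lra.
have := ler_normD (e2 - e1 * q) ((e1 - eta * r) * q).
by move: h q1 q2 k1 k2 uu u0; wipe; lra.
Qed.

End Data.

(** * Attention scores compared up to rounding *)

Section Lookup.
Variables (R : archiRcfType) (p : nat) (rnd : R -> R).
Hypothesis Hrnd : correct_rounding p rnd.
Hypothesis Hp : (20 <= p)%N.
Notation u := (uerr R p).

Lemma ev_bound (f : lform) (w : nat -> R) c : 0 <= c ->
  (forall g, g \in unzip1 f -> `|w g| <= c) -> `|ev f w| <= (wnorm f)%:R / 64 * c.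
Proof.
move=> c0 H; rewrite /ev; apply: le_trans (ler_norm_sum _ _ _) _.
have -> : (wnorm f)%:R / 64 * c = \sum_(t <- f) (`|t.2|%N)%:R / 64 * c.
  by rewrite /wnorm sumnE big_map natr_sum !mulr_suml.
rewrite !big_seq; apply: ler_sum => t tf.
rewrite !normrM [`|64^-1|]gtr0_norm ?invr_gt0 // natr_absz -intr_norm.
apply: ler_pM => //; first by rewrite mulr_ge0 ?ler0z ?invr_ge0.
by apply: H; apply: (map_f fst tf).
Qed.

(** States whose mask shows a token flag: the norm is then bounded below, and layer norm changes the
    features by bounded factors only. *)
Definition flagged (ms : seq nat) (v : nat -> R) :=
  [/\ forall g, g \in ms -> `|v g| <= 1, `|lnmu ms v| <= 1 / 10 & 9 / 10 <= lnS ms v].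

Lemma flagged_sqrt ms v : flagged ms v -> 9 / 10 <= Num.sqrt (lnS ms v).
Proof.
case=> _ _ S9; have q0 := sqrtr_ge0 (lnS ms v).
have qq : Num.sqrt (lnS ms v) ^+ 2 = lnS ms v by rewrite sqr_sqrtr //; move: S9; wipe; lra.
move: S9 qq q0; move: (lnS ms v) => S; move: (Num.sqrt S) => q; wipe => *; nra.
Qed.

Lemma flagged_form (f : lform) ms v : flagged ms v -> (wnorm f <= 48)%N -> all (mem ms) (unzip1 f) ->
  `|rnd (ev f (lnf rnd ms v)) - lin f ms v / Num.sqrt (lnS ms v)| <= 3 * u /\
  `|lin f ms v / Num.sqrt (lnS ms v)| <= 22 / 3.
Proof.
move=> F wf /allP fm; have [v1 mu1 S9] := F; split.
  apply: (@lnf_lin R p rnd Hrnd Hp f ms v 1) => //.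
  - by apply: leq_trans wf _.
  - by move: mu1; wipe; lra.
  - by rewrite expr1n; move: S9; wipe; lra.
have q9 := flagged_sqrt F.
(* 48/64 bounds the total weight and 88/10 = 8 (1 + 1/10) a centred feature; division by 9/10 then
   gives 22/3. *)
have lb : `|lin f ms v| <= 48 / 64 * (88 / 10).
  apply: le_trans (_ : (wnorm f)%:R / 64 * (88 / 10) <= _).
    rewrite /lin; apply: ev_bound; first by lra.
    move=> g /fm gm; move: (v1 g gm) mu1; rewrite !ler_norml; wipe => /andP[? ?] /andP[? ?].
    by apply/andP; split; lra.
  by rewrite ler_pM2r ?ler_pM2r ?invr_gt0 //; [rewrite ler_nat | lra].
rewrite normrM [`|_^-1|]gtr0_norm ?invr_gt0; last by move: q9; wipe; lra.
rewrite ler_pdivrMr; last by move: q9; wipe; lra.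
by move: lb q9; wipe; lra.
Qed.

Definition okq (hsp : head_spec) (ms : seq nat) :=
  all (fun f => (wnorm f <= 48)%N && all (mem ms) (unzip1 f)) (hq hsp ++ hk hsp).

Lemma okq_nth hsp ms l : okq hsp ms ->
  ((wnorm (nth [::] (hq hsp) l) <= 48)%N /\ all (mem ms) (unzip1 (nth [::] (hq hsp) l))) *
  ((wnorm (nth [::] (hk hsp) l) <= 48)%N /\ all (mem ms) (unzip1 (nth [::] (hk hsp) l))).
Proof.
rewrite /okq all_cat => /andP[h1 h2]; split; apply/andP.
  case: (ltnP l (size (hq hsp))) => lq; last by rewrite nth_default.
  by move/(all_nthP [::]): h1; apply.
case: (ltnP l (size (hk hsp))) => lq; last by rewrite nth_default.
by move/(all_nthP [::]): h2; apply.
Qed.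

Definition dot (hsp : head_spec) (ms : seq nat) (v w : nat -> R) : R :=
  \sum_(l < 4) lin (nth [::] (hq hsp) l) ms v * lin (nth [::] (hk hsp) l) ms w.

(** Each of the four products has factors of size at most 7.5 with errors at most 3 u, hence an
    error at most 45 u; their sum 180 u leaves room for the outer rounding. *)
Lemma score_approx hsp ms (v : nat -> nat -> R) i j : okq hsp ms ->
  flagged ms (v i) -> flagged ms (v j) ->
  `|score rnd hsp (fun j => lnf rnd ms (v j)) i j
     - dot hsp ms (v i) (v j) / (Num.sqrt (lnS ms (v i)) * Num.sqrt (lnS ms (v j)))| <= 200 * u.
Proof.
move=> ok Fi Fj.
have u0 := uerr_gt0 R p; have u1 := uerr_le R Hp.
pose a l := lin (nth [::] (hq hsp) l) ms (v i) / Num.sqrt (lnS ms (v i)).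
pose c l := lin (nth [::] (hk hsp) l) ms (v j) / Num.sqrt (lnS ms (v j)).
have -> : dot hsp ms (v i) (v j) / (Num.sqrt (lnS ms (v i)) * Num.sqrt (lnS ms (v j)))
    = \sum_(l < 4) a l * c l.
  by rewrite /dot mulr_suml; apply: eq_bigr => l _; rewrite /a /c invfM mulrACA.
pose f (l : 'I_4) := rnd (ev (nth [::] (hq hsp) l) (lnf rnd ms (v i))) *
  rnd (ev (nth [::] (hk hsp) l) (lnf rnd ms (v j))).
have -> : score rnd hsp (fun j => lnf rnd ms (v j)) i j = rnd (\sum_(l < 4) f l) by [].
have E l : `|f l - a l * c l| <= 45 * u /\ `|f l| <= 57.
  have [[q1 q2] [k1 k2]] := okq_nth l ok.
  have [e1 e2] := flagged_form Fi q1 q2; have [e3 e4] := flagged_form Fj k1 k2.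
  rewrite /f -/(a l) -/(c l) in e1 e2 e3 e4 *.
  move: (rnd (ev (nth [::] (hq hsp) l) _)) (rnd (ev (nth [::] (hk hsp) l) _)) (a l) (c l) e1 e2 e3 e4 => q k al cl e1 e2 e3 e4.
  have -> : q * k - al * cl = (q - al) * k + al * (k - cl) by ring.
  have k6 : `|k| <= 75 / 10.
    have := ler_normD (k - cl) cl; rewrite subrK; move: e3 e4 u1; wipe; lra.
  have q6 : `|q| <= 75 / 10.
    have := ler_normD (q - al) al; rewrite subrK; move: e1 e2 u1; wipe; lra.
  split; last first.
    rewrite normrM; apply: le_trans (_ : 75 / 10 * (75 / 10) <= _); first exact: ler_pM.
    by lra.
  apply: le_trans (ler_normD _ _) _; rewrite !normrM.
  have h1 : `|q - al| * `|k| <= 3 * u * (75 / 10) by apply: ler_pM.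
  have h2 : `|al| * `|k - cl| <= 22 / 3 * (3 * u) by apply: ler_pM.
  by move: h1 h2 u0; wipe; lra.
have S1 : `|\sum_(l < 4) f l - \sum_(l < 4) a l * c l| <= 180 * u.
  rewrite -sumrB; apply: le_trans (ler_norm_sum _ _ _) _.
  apply: le_trans (ler_sum _ (fun l _ => (E l).1)) _.
  by rewrite sumr_const card_ord -mulr_natr; lra.
have S2 : `|\sum_(l < 4) f l| <= 228.
  apply: le_trans (ler_norm_sum _ _ _) _.
  apply: le_trans (ler_sum _ (fun l _ => (E l).2)) _.
  by rewrite sumr_const card_ord -mulr_natr; lra.
have := rnd_near Hrnd Hp S2 (ler_nat _ 228 512).
by move: S1 u0; rewrite !ler_distl; wipe => /andP[? ?] ? /andP[? ?]; apply/andP; split; lra.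
Qed.

(** The norm of the query is common to all scores and at most 2, so the margin 1000 u shrinks to no
    less than 500 u, which exceeds twice the error 200 u of a score. *)
Lemma lookup_beats N hsp ms (v : nat -> nat -> R) i (j j0 : 'I_N) : okq hsp ms -> hm hsp = false ->
  flagged ms (v i) -> flagged ms (v j) -> flagged ms (v j0) -> lnS ms (v i) <= 4 ->
  dot hsp ms (v i) (v j) / Num.sqrt (lnS ms (v j)) + 1000 * u
    <= dot hsp ms (v i) (v j0) / Num.sqrt (lnS ms (v j0)) ->
  j \notin best rnd N hsp (fun j => lnf rnd ms (v j)) i.
Proof.
move=> ok hm0 Fi Fj F0 S4 H; apply: (@best_beaten _ _ _ _ _ _ _ j0); first by rewrite /allowed hm0.
have := score_approx ok Fi Fj; have := score_approx ok Fi F0.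
have q9 := flagged_sqrt Fi.
have q2 : Num.sqrt (lnS ms (v i)) <= 2.
  have [_ _ S9] := Fi.
  have qq : Num.sqrt (lnS ms (v i)) ^+ 2 = lnS ms (v i) by rewrite sqr_sqrtr //; move: S9; wipe; lra.
  move: S4 qq q9; move: (lnS ms (v i)) => S; move: (Num.sqrt S) => q; wipe => *; nra.
have E (x y z : R) : x / (y * z) = y^-1 * (x / z) by rewrite invfM mulrCA.
rewrite !E !ler_distl; set x := dot _ _ _ _ / _; set y := dot _ _ _ _ / _.
rewrite -/x -/y in H.
have u0 := uerr_gt0 R p.
set l := (Num.sqrt (lnS ms (v i)))^-1.
have l0 : 1 / 2 <= l by rewrite mul1r lef_pV2 ?posrE //; move: q9; wipe; lra.
have : l * (1000 * u) <= l * (x - y) by rewrite ler_pM2l; move: H l0; wipe; lra.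
move: (score _ _ _ _ _) (score _ _ _ _ _) => s1 s2.
have : 1 / 2 * (1000 * u) <= l * (1000 * u) by rewrite ler_pM2r //; move: u0; wipe; lra.
by move: u0; wipe => ? h1 h2 /andP[? ?] /andP[? ?]; lra.
Qed.

(** Used with t = X.Y plus a possible bonus and w close to |Y|^2: when these are quadratic in small
    coordinates, the error w^2 + |t| w is of fourth order. *)
Lemma expand_bound (t w : R) : 0 <= w <= 1 -> `|t| <= 1 ->
  `|(1 + t) / Num.sqrt (1 + w) - (1 + t - w / 2)| <= w ^+ 2 + `|t| * w.
Proof.
move=> w01 t1; have /andP[h1 h2] := inv_sqrt_bounds w01; have /andP[w0 w1] := w01.
move: h1 h2; move: ((Num.sqrt _)^-1) => q h1 h2.
set r := q - (1 - w / 2).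
have r0 : 0 <= r by rewrite /r; move: h1; wipe; lra.
have r1 : r <= 3 / 8 * w ^+ 2 by rewrite /r; move: h2; wipe; lra.
have -> : (1 + t) * q - (1 + t - w / 2) = r * (1 + t) - t * w / 2 by rewrite /r; field.
have e1 : `|r * (1 + t)| <= 3 / 8 * w ^+ 2 * 2.
  rewrite normrM ger0_norm //; apply: ler_pM => //.
  by apply: le_trans (ler_normD _ _) _; rewrite normr1; move: t1; wipe; lra.
have e2 : `|t * w / 2| <= `|t| * w.
  rewrite !normrM [`|2^-1|]gtr0_norm ?invr_gt0 // [`|w|]ger0_norm //.
  by move: (mulr_ge0 (normr_ge0 t) w0); wipe; lra.
apply: le_trans (ler_normB _ _) _.
by move: e1 e2 (sqr_ge0 w); wipe; lra.
Qed.

End Lookup.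

(** * Rescaling by the small dominant feature rho *)

Section Amplify.
Variables (R : archiRcfType) (p : nat) (rnd : R -> R).
Hypothesis Hrnd : correct_rounding p rnd.
Hypothesis Hp : (20 <= p)%N.
Variables (n : nat) (A : 'I_n -> 'I_n -> bool) (s t : 'I_n).
Notation N := (len s t).
Notation tok i := (tokn A s t i).
Variable V : nat -> nat -> R.
Hypothesis Vflag : forall i f, f \in flags -> V i f = (f == tok_flag (tok i))%:R.
Hypothesis Veq : eqns rnd N V (subs_of init_specs).
Notation u := (uerr R p).
Variables b rho tau eta : R.
Hypothesis Nb : N%:R * b = 1.
Hypothesis Hc : consts_ok b u rho tau eta.
Hypothesis Vrho : forall i, (i < N)%N -> V i fRHO = rho.
Hypothesis Vtau : forall i, (i < N)%N -> V i fTAU = tau.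
Hypothesis Veta : forall i, (i < N)%N -> V i fETA = eta.
Let E1f := E1_fact Hrnd Hp Vflag Veq Nb Hc Veta.
Let ESf := ES_fact Hrnd Hp Vflag Veq Nb Hc Veta.
Let E2f := E2_fact Hrnd Hp Vflag Veq Nb Hc Veta.
Let E3f := E3_fact Hrnd Hp Vflag Veq Nb Hc Veta.
Notation dl := (eta / rho).

Lemma dl_facts : [/\ 85 / 100 * b ^+ 4 <= dl <= 11 / 10 * b ^+ 4, eta = dl * rho, 0 < dl & 0 < rho <= 1 / 10].
Proof.
have [r0 t0 e0 _] := consts_eta Hc; have [bb _ /andP[r1 r2] _ /andP[e1 e2]] := Hc.
split.
- by apply/andP; split; [rewrite ler_pdivlMr // -[leLHS]mulrA | rewrite ler_pdivrMr // -[leRHS]mulrA].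
- by rewrite divfK // gt_eqF.
- exact: divr_gt0.
rewrite r0 /=; have /andP[p0 p1] := bpow 0 7 bb; rewrite expr0 add0n in p1.
by move: r2 p1; wipe; lra.
Qed.

Lemma data_small x (m : R) k : (0 < k)%N -> `|x - eta * m| <= eta * b ^+ k -> 0 <= m <= N%:R ->
  `|x| <= rho * (12 / 10 * (dl * N%:R)).
Proof.
move=> k0 h /andP[m0 m1]; have [_ E d0 _] := dl_facts; have [r0 _ e0 _] := consts_eta Hc.
have -> : rho * (12 / 10 * (dl * N%:R)) = 12 / 10 * (eta * N%:R) by rewrite {2}E; ring.
have bk : b ^+ k <= 1 / 5.
  case: k k0 {h} => // k _; have /andP[_ h] := bpow 0 k.+1 (b_ok Hc).
  rewrite add0n expr0 mulr1 in h; apply: le_trans h _.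
  by rewrite exprS ler_piMr //; [lra | apply: exprn_ile1; lra].
have N1 := N_ge1 R s t.
have k1 : eta * b ^+ k <= 1 / 5 * (eta * N%:R).
  by rewrite [leRHS]mulrCA ler_pM2l //; move: bk N1; wipe; lra.
have k2 : 0 <= eta * m <= eta * N%:R by rewrite mulr_ge0 ?(ltW e0) //= ler_pM2l.
case/andP: k2 => k2 k3; move: h; rewrite ler_distl ler_norml => /andP[h1 h2].
by move: k1 k2 k3 h1 h2; wipe => *; apply/andP; split; lra.
Qed.

Definition ms14 := [:: fRHO; fETA; fE1; fE2; fE3; fES].
(** (n+1)(r+2) - (r+2) - 2 (n+1) + 2 = n r. *)
Definition l_key : lform := [:: (fE2, 8%:Z); (fE1, - 8%:Z); (fE3, - 16%:Z); (fETA, 16%:Z)].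

Lemma l_keyE i : (i < N)%N -> lin8 l_key (V i) = V i fE2 - V i fE1 - 2 * V i fE3 + 2 * eta.
Proof. by move=> iN; rewrite !lin8_cons lin8_nil Veta //; field. Qed.

Lemma dlN : 0 < dl * N%:R <= 11 / 10 * b ^+ 3.
Proof.
have [/andP[_ d1] _ d0 _] := dl_facts.
have N0 : 0 < N%:R :> R by rewrite ltr0n len_gt0.
rewrite mulr_gt0 //=; have := bS Nb 3 => <-; rewrite mulrA ler_pM2r //.
Qed.

Lemma rank2_bounds i : (i < N)%N -> 0 <= ((rank2 s i)%:R : R) <= N%:R.
Proof. by move=> iN; have /andP[_ h] := rank2_le iN; rewrite ler0n ler_nat. Qed.

Lemma n1_bounds : 0 <= (n.+1%:R : R) <= N%:R.
Proof. by rewrite ler0n ler_nat (n1_le Hp s t). Qed.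
Lemma s2_bounds : 0 <= (s.+2%:R : R) <= N%:R.
Proof. by rewrite ler0n ler_nat (s2_le Hp s t). Qed.

(** [fE2] has its own bound y because (n+1)(r+2) stays of order N on adjacency positions, where the
    key must be accurate, but is only bounded by N^2 in general. *)
Lemma S14 i y : (i < N)%N -> `|V i fE2| <= rho * y -> 0 <= y <= 1 ->
  rho ^+ 2 <= sumsq ms14 (V i) <= rho ^+ 2 * (1 + (6 * (dl * N%:R) ^+ 2 + y ^+ 2)) /\
  (forall g, g \in ms14 -> `|V i g| <= rho).
Proof.
move=> iN h2 /andP[y0 y1]; have [_ E d0 /andP[r0 _]] := dl_facts.
have /andP[g0 g1] := dlN; have [_ _ e0 _] := consts_eta Hc.
have g2 : dl * N%:R <= 1 / 10.
  have /andP[_ p1] := bpow 0 3 (b_ok Hc); rewrite add0n expr0 in p1.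
  by move: g1 p1; wipe; lra.
have h1 := data_small (isT : 0 < 12)%N (E1f iN) (rank2_bounds iN).
have h3 := data_small (isT : 0 < 12)%N (E3f iN) n1_bounds.
have hs := data_small (isT : 0 < 12)%N (ESf iN) s2_bounds.
have he : `|eta| <= rho * (12 / 10 * (dl * N%:R)).
  rewrite gtr0_norm // {1}E mulrC ler_pM2l // mulrCA; apply: ler_peMr; first exact: ltW.
  by have := N_ge1 R s t; wipe; lra.
have sq (x z : R) : `|x| <= rho * z -> 0 <= z -> 0 <= x ^+ 2 <= rho ^+ 2 * z ^+ 2.
  move=> hx z0; rewrite sqr_ge0 -exprMn -(real_normK (num_real x)); apply: lerXn2r; rewrite ?nnegrE //.
  by apply: mulr_ge0 => //; exact: ltW.
set g := 12 / 10 * (dl * N%:R) in h1 h3 hs he.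
have gg0 : 0 <= g by rewrite /g; move: g0; wipe; lra.
have gg1 : g <= 1 by rewrite /g; move: g2; wipe; lra.
have gE : g ^+ 2 = 144 / 100 * (dl * N%:R) ^+ 2 by rewrite /g exprMn; congr (_ * _); field.
have /andP[q1 q1'] := sq _ _ h1 gg0; have /andP[q3 q3'] := sq _ _ h3 gg0.
have /andP[q4 q4'] := sq _ _ hs gg0; have /andP[q5 q5'] := sq _ _ he gg0.
have /andP[q2 q2'] := sq _ _ h2 y0.
have S : sumsq ms14 (V i) = rho ^+ 2 + (eta ^+ 2 + V i fE1 ^+ 2 + V i fE2 ^+ 2 + V i fE3 ^+ 2 + V i fES ^+ 2).
  by rewrite /sumsq !big_cons big_nil addr0 Veta // Vrho // !addrA.
split.
  have k : 0 <= rho ^+ 2 * (dl * N%:R) ^+ 2 by rewrite mulr_ge0 ?sqr_ge0.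
  rewrite S !mulrDr mulr1; move: k q1 q1' q2 q2' q3 q3' q4 q4' q5 q5'; rewrite gE; wipe => *.
  by apply/andP; split; lra.
have big (z x : R) : `|x| <= rho * z -> z <= 1 -> `|x| <= rho.
  by move=> hx z1; apply: le_trans hx _; apply: ler_piMr => //; exact: ltW.
move=> f; rewrite !inE.
case/orP=> [/eqP->|/orP[/eqP->|/orP[/eqP->|/orP[/eqP->|/orP[/eqP->|/eqP->]]]]];
  rewrite ?Vrho ?Veta //.
- by rewrite gtr0_norm.
- exact: (big _ _ he gg1).
- exact: (big _ _ h1 gg1).
- exact: (big _ _ h2 y1).
- exact: (big _ _ h3 gg1).
- exact: (big _ _ hs gg1).
Qed.

Lemma b_small k : 0 < b ^+ k <= (1 / 5) ^+ k.
Proof. by have := bpow 0 k (b_ok Hc); rewrite add0n expr0 mulr1. Qed.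

Lemma u_dl k : (k <= 30)%N -> 1000 * u <= dl * b ^+ k.
Proof.
move=> k30; apply: le_trans (u_eta Hc k30) _.
have [_ E d0 /andP[r0 r1]] := dl_facts; have /andP[bk _] := b_small k.
rewrite {1}E ler_pM2r // ler_piMr ?ltW //; by move: r1; wipe; lra.
Qed.

Lemma E2_bound i (M : R) : (i < N)%N -> n.+1%:R * (rank2 s i)%:R <= M -> 
  `|V i fE2| <= rho * (dl * (M + 1)).
Proof.
move=> iN hM; have := E2f iN; have [_ E d0 /andP[r0 r1]] := dl_facts.
have [_ _ e0 _] := consts_eta Hc.
have -> : rho * (dl * (M + 1)) = eta * M + eta by rewrite {2 3}E; ring.
have /andP[b0 b1] := b_small 10.
have k1 : eta * b ^+ 10 <= eta.
  rewrite ger_pMr //; apply: le_trans b1 _; apply: exprn_ile1; lra.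
have k2 : eta * (n.+1%:R * (rank2 s i)%:R) <= eta * M by rewrite ler_pM2l.
have k3 : 0 <= eta * (n.+1%:R * (rank2 s i)%:R).
  by rewrite mulr_ge0 ?(ltW e0) // mulr_ge0 ?ler0n.
by rewrite ler_distl ler_norml => /andP[h1 h2]; move: k1 k2 k3 h1 h2 e0; wipe => *; apply/andP; split; lra.
Qed.

Lemma S14_gen i : (i < N)%N ->
  rho ^+ 2 <= sumsq ms14 (V i) <= rho ^+ 2 * (1 + 2 * b ^+ 4) /\
  (forall g, g \in ms14 -> `|V i g| <= rho) /\ `|V i fE2| <= rho * (12 / 10 * b ^+ 2).
Proof.
move=> iN; have [/andP[_ d1] E d0 /andP[r0 r1]] := dl_facts.
have hM : n.+1%:R * (rank2 s i)%:R <= N%:R * N%:R :> R.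
  have /andP[h1 h2] := n1_bounds; have /andP[h3 h4] := rank2_bounds iN.
  exact: ler_pM.
have h := E2_bound iN hM.
have /andP[b2 b2'] := b_small 2; have /andP[b4 b4'] := b_small 4; have /andP[b3 b3'] := b_small 3.
have y1 : dl * (N%:R * N%:R + 1) <= 12 / 10 * b ^+ 2.
  apply: (@le_trans _ _ (11 / 10 * b ^+ 4 * (N%:R * N%:R + 1))).
    by rewrite ler_pM2r // ltr_wpDl // mulr_ge0 ?ler0n.
  have -> : 11 / 10 * b ^+ 4 * (N%:R * N%:R + 1) = 11 / 10 * (b ^+ 4 * N%:R * N%:R + b ^+ 4) by ring.
  rewrite !(bS Nb); have /andP[_ h4] := bpow 2 2 (b_ok Hc).
  by move: h4 b2; wipe; lra.
have y0 : 0 <= dl * (N%:R * N%:R + 1).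
  by apply: mulr_ge0; [exact: ltW | rewrite addr_ge0 // mulr_ge0 ?ler0n].
have y01 : 0 <= dl * (N%:R * N%:R + 1) <= 1 by rewrite y0; move: y1 b2 b2'; wipe; lra.
have [h1 h2] := S14 iN h y01; split; last first.
  by split => //; apply: le_trans h _; rewrite ler_pM2l.
case/andP: h1 => h1 h3; rewrite h1 /=; apply: le_trans h3 _.
rewrite ler_pM2l ?exprn_gt0 // lerD2l.
have /andP[g0 g1] := dlN.
have g2 : (dl * N%:R) ^+ 2 <= 121 / 100 * b ^+ 6.
  apply: le_trans (_ : (11 / 10 * b ^+ 3) ^+ 2 <= _).
    by apply: lerXn2r; rewrite ?nnegrE ?(ltW g0) //; move: b3; wipe; lra.
  by rewrite exprMn -exprM; have -> : (11 / 10 : R) ^+ 2 = 121 / 100 by field.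
have y2 : (dl * (N%:R * N%:R + 1)) ^+ 2 <= 144 / 100 * b ^+ 4.
  apply: le_trans (_ : (12 / 10 * b ^+ 2) ^+ 2 <= _).
    by apply: lerXn2r; rewrite ?nnegrE //; move: b2; wipe; lra.
  by rewrite exprMn -exprM; have -> : (12 / 10 : R) ^+ 2 = 144 / 100 by field.
have /andP[_ h6] := bpow 4 2 (b_ok Hc).
by move: g2 y2 h6 b4; wipe; lra.
Qed.

Lemma amp14 i e f m form : (i < N)%N ->
  rho ^+ 2 <= sumsq ms14 (V i) <= rho ^+ 2 * (1 + e) -> e <= 1 ->
  (f, [:: (m, 64%:Z)]) \in fo (nth no_layer init_specs 13) ->
  nth [::] (hd (nth no_layer init_specs 13)) m = form ->
  (wnorm form <= 128)%N -> all (mem ms14) (unzip1 form) ->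
  `|V i f - relu (lin8 form (V i) / Num.sqrt (sumsq ms14 (V i)))| <= 3 * u /\
  `|V i f - relu (lin8 form (V i) / rho)| <= `|lin8 form (V i)| / rho * (e / 2) + 3 * u.
Proof.
move=> iN hS e1 fin hform wf fm; have [_ [vD _]] := S14_gen iN.
have [_ _ _ /andP[r0 _]] := dl_facts; have /andP[S1 _] := hS.
have DS : rho ^+ 2 <= 4 * sumsq ms14 (V i) by move: S1 (sqr_ge0 rho); wipe; lra.
have h := V_ff Hrnd Hp Veq (erefl : nth (SA no_layer) (subs_of init_specs) 27 = SF (nth no_layer init_specs 13))
  isT fin erefl hform isT wf fm r0 vD DS.
split=> //.
have h2 := relu_lip (div_sqrt_approx (lin8 form (V i)) r0 hS e1).
have := ler_normD (V i f - relu (lin8 form (V i) / Num.sqrt (sumsq ms14 (V i))))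
  (relu (lin8 form (V i) / Num.sqrt (sumsq ms14 (V i))) - relu (lin8 form (V i) / rho)).
rewrite addrA subrK; rewrite -/ms14 in h; by move: h h2; wipe; lra.
Qed.

Lemma key_small i : (i < N)%N -> `|lin8 l_key (V i)| <= rho * (3 * b ^+ 2).
Proof.
move=> iN; have [_ [_ h2]] := S14_gen iN; rewrite l_keyE //.
have h1 := data_small (isT : 0 < 12)%N (E1f iN) (rank2_bounds iN).
have h3 := data_small (isT : 0 < 12)%N (E3f iN) n1_bounds.
have [_ E d0 /andP[r0 _]] := dl_facts; have [_ _ e0 _] := consts_eta Hc.
have he : eta <= rho * (12 / 10 * (dl * N%:R)).
  rewrite {1}E mulrC ler_pM2l // mulrCA; apply: ler_peMr; first exact: ltW.
  by have := N_ge1 R s t; wipe; lra.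
have g1 : rho * (12 / 10 * (dl * N%:R)) <= rho * (27 / 100 * b ^+ 2).
  rewrite ler_pM2l //; have /andP[_ g1] := dlN; have /andP[_ h] := bpow 2 1 (b_ok Hc).
  by have /andP[b2 _] := b_small 2; move: g1 h b2; rewrite expr1; wipe; lra.
move: h1 h2 h3; rewrite !ler_norml => /andP[? ?] /andP[? ?] /andP[? ?].
have rb : 0 <= rho * b ^+ 2 by have /andP[b2 _] := b_small 2; rewrite mulr_ge0 ?ltW.
by apply/andP; split; lra.
Qed.

(** Outside the adjacency positions the key has no meaning; its size still matters, because it
    enters the norm of every position. *)
Lemma KY_gen i : (i < N)%N -> 0 <= V i fKY <= 4 * b ^+ 2.
Proof.
move=> iN; have [hS _] := S14_gen iN.
have b4 : 2 * b ^+ 4 <= 1 by have /andP[_ h] := b_small 4; move: h; wipe; lra.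
have [_ h] := @amp14 i _ fKY 0 l_key iN hS b4 isT erefl isT isT.
apply/andP; split.
  have -> : V i fKY = hid rnd (nth no_layer init_specs 13) (V i) 0.
    exact: (eqns_nth Veq (isT : 27 < 34)%N i fKY 0%N isT).
  exact: relu_ge0.
have k := key_small iN; have [_ _ d0 /andP[r0 _]] := dl_facts.
have k1 : `|lin8 l_key (V i)| / rho <= 3 * b ^+ 2 by rewrite ler_pdivrMr // mulrC.
have r1 : relu (lin8 l_key (V i) / rho) <= `|lin8 l_key (V i)| / rho.
  apply: le_trans (ler_norm _) _; have := @relu_lip R (lin8 l_key (V i) / rho) 0 _ (lexx _).
  by rewrite [relu 0]relu_pos // !subr0 normrM [`|rho^-1|]gtr0_norm ?invr_gt0.
have k2 : `|lin8 l_key (V i)| / rho * (2 * b ^+ 4 / 2) <= 3 * b ^+ 2 * (1 / 10).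
  apply: ler_pM => //; first by apply: divr_ge0 => //; exact: ltW.
    by have /andP[h' _] := b_small 4; move: h'; wipe; lra.
  by have /andP[_ h'] := b_small 4; move: h'; wipe; lra.
have uu : 1000 * u <= b ^+ 2.
  apply: le_trans (u_dl (isT : 2 <= 30)%N) _; have /andP[b2 _] := b_small 2.
  have [/andP[_ d1] _ _ _] := dl_facts; have /andP[_ h'] := b_small 4.
  by rewrite ger_pMl //; move: d1 h'; wipe; lra.
have u0 := uerr_gt0 R p; have /andP[b2 _] := b_small 2.
move: h; rewrite ler_distl => /andP[_ h].
by move: h k1 r1 k2 uu u0 b2; wipe; lra.
Qed.

(** On adjacency positions the norm exceeds rho by a relative error of order b^6, and the key is at
    most about dl N, so this loss is of order dl b^5. *)
Lemma KY_adj i : (i < N)%N -> isadj n i -> `|V i fKY - dl * (n%:R * i.-1%:R)| <= dl * b ^+ 3.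
Proof.
move=> iN adj; have /andP[i0 iP] := adj.
have r2 : rank2 s i = i.+1 by rewrite /rank2 iP.
have [/andP[_ d1] E d0 /andP[r0 r1]] := dl_facts; have [_ _ e0 _] := consts_eta Hc.
have cube := cubeN Hp s t; have n0 := n_gt0 s.
have nn : (n <= n * n * n)%N by rewrite -mulnA leq_pmulr // muln_gt0 n0.
have iP' : (i <= n * n)%N by move: iP; rewrite /sPAD; lia.
have hM : n.+1%:R * (rank2 s i)%:R <= 2 * N%:R :> R.
  rewrite r2 -natrM -natrM ler_nat; apply: (@leq_trans (n.+1 * (n * n).+1)).
    by rewrite leq_mul2l ltnS iP' orbT.
  by rewrite mulSn mulnS mulnA; lia.
have hE2 := E2_bound iN hM.
have N1 := N_ge1 R s t; have /andP[g0 g1] := dlN.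
have y0 : 0 <= dl * (2 * N%:R + 1) by apply: mulr_ge0; [exact: ltW | move: N1; wipe; lra].
have /andP[b3 b3'] := b_small 3; have /andP[b6 b6'] := b_small 6.
have y1 : dl * (2 * N%:R + 1) <= 33 / 10 * b ^+ 3.
  have : dl * 1 <= dl * N%:R by rewrite ler_pM2l.
  by move: g1; wipe; lra.
have y01 : 0 <= dl * (2 * N%:R + 1) <= 1 by rewrite y0; move: y1 b3'; wipe; lra.
have [hS _] := S14 iN hE2 y01.
have e1 : 6 * (dl * N%:R) ^+ 2 + (dl * (2 * N%:R + 1)) ^+ 2 <= 19 * b ^+ 6.
  have g2 : (dl * N%:R) ^+ 2 <= 121 / 100 * b ^+ 6.
    apply: le_trans (_ : (11 / 10 * b ^+ 3) ^+ 2 <= _).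
      by apply: lerXn2r; rewrite ?nnegrE ?(ltW g0) //; move: b3; wipe; lra.
    by rewrite exprMn -exprM; have -> : (11 / 10 : R) ^+ 2 = 121 / 100 by field.
  have y2 : (dl * (2 * N%:R + 1)) ^+ 2 <= 1089 / 100 * b ^+ 6.
    apply: le_trans (_ : (33 / 10 * b ^+ 3) ^+ 2 <= _).
      by apply: lerXn2r; rewrite ?nnegrE //; move: b3; wipe; lra.
    by rewrite exprMn -exprM; have -> : (33 / 10 : R) ^+ 2 = 1089 / 100 by field.
  by move: g2 y2 b6; wipe; lra.
have hS' : rho ^+ 2 <= sumsq ms14 (V i) <= rho ^+ 2 * (1 + 19 * b ^+ 6).
  case/andP: hS => h1 h2; rewrite h1 /=; apply: le_trans h2 _.
  by rewrite ler_pM2l ?exprn_gt0 // lerD2l.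
have e1' : 19 * b ^+ 6 <= 1 by move: b6'; wipe; lra.
have [_ h] := @amp14 i _ fKY 0 l_key iN hS' e1' isT erefl isT isT.
have LE : `|lin8 l_key (V i) - eta * (n%:R * i.-1%:R)| <= eta * (2 * b ^+ 10).
  rewrite l_keyE //; have f1 := E1f iN; have f2 := E2f iN; have f3 := E3f iN.
  rewrite r2 in f1 f2.
  have -> : n%:R * i.-1%:R = n.+1%:R * i.+1%:R - i.+1%:R - 2 * n.+1%:R + 2 :> R.
    by rewrite -[in RHS](prednK i0) -!natr1; ring.
  have /andP[b10 _] := b_small 10; have /andP[_ b12] := bpow 10 2 (b_ok Hc).
  have k12 : eta * b ^+ 12 <= eta * (1 / 5 * b ^+ 10).
    by rewrite ler_pM2l //; apply: le_trans b12 _; rewrite ler_pM2r //; wipe; lra.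
  have k10 : 0 <= eta * b ^+ 10 by rewrite mulr_ge0 ?ltW.
  move: f1 f2 f3 k12 k10; rewrite !ler_distl; wipe => /andP[? ?] /andP[? ?] /andP[? ?] ? ?.
  by apply/andP; split; lra.
have iR : n%:R * i.-1%:R <= N%:R :> R.
  rewrite -natrM ler_nat; apply: (@leq_trans (n * (n * n))).
    by rewrite leq_mul2l; apply/orP; right; exact: leq_trans (leq_pred _) iP'.
  by apply: leq_trans cube; rewrite mulnA -addnA leq_addr.
have k0 : 0 <= n%:R * i.-1%:R :> R by rewrite mulr_ge0 ?ler0n.
set K := n%:R * i.-1%:R in iR k0 LE *.
have LD : `|lin8 l_key (V i) / rho - dl * K| <= dl * (2 * b ^+ 10).
  have -> : lin8 l_key (V i) / rho - dl * K = (lin8 l_key (V i) - eta * K) / rho by ring.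
  rewrite normrM [`|rho^-1|]gtr0_norm ?invr_gt0 // ler_pdivrMr //.
  by rewrite mulrAC -E.
have LB : `|lin8 l_key (V i)| / rho <= dl * (N%:R + 1).
  have -> : `|lin8 l_key (V i)| / rho = `|lin8 l_key (V i) / rho|.
    by rewrite normrM [`|rho^-1|]gtr0_norm ?invr_gt0.
  have /andP[_ b10] := b_small 10.
  have k2 : dl * (2 * b ^+ 10) <= dl * 1 by rewrite ler_pM2l //; move: b10; wipe; lra.
  have k3 : dl * K <= dl * N%:R by rewrite ler_pM2l.
  have k4 : 0 <= dl * K by apply: mulr_ge0 => //; exact: ltW.
  by move: LD; rewrite ler_distl ler_norml => /andP[l1 l2]; apply/andP; split; move: l1 l2 k2 k3 k4 d0; wipe; lra.
have R2 := relu_lip LD; rewrite [relu (dl * K)]relu_pos in R2; last by apply: mulr_ge0 => //; exact: ltW.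
have T : `|lin8 l_key (V i)| / rho * (19 * b ^+ 6 / 2) <= dl * (19 * b ^+ 5).
  apply: (@le_trans _ _ (dl * (N%:R + 1) * (19 * b ^+ 6 / 2))).
    by rewrite ler_pM2r //; move: b6; wipe; lra.
  have -> : dl * (N%:R + 1) * (19 * b ^+ 6 / 2) = dl * (19 / 2 * (b ^+ 6 * N%:R + b ^+ 6)) by field; rewrite gt_eqF.
  rewrite (bS Nb) ler_pM2l //; have /andP[_ h5] := bpow 5 1 (b_ok Hc).
  by have /andP[b5 _] := b_small 5; move: h5 b5; rewrite expr1; wipe; lra.
have uu := u_dl (isT : 5 <= 30)%N; have u0 := uerr_gt0 R p.
have f5 : dl * (20 * b ^+ 5) <= dl * (8 / 10 * b ^+ 3).
  rewrite ler_pM2l //; have /andP[_ h5] := bpow 3 2 (b_ok Hc).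
  by move: h5 b3; wipe; lra.
have f10 : dl * (2 * b ^+ 10) <= dl * (1 / 10 * b ^+ 3).
  rewrite ler_pM2l //; have /andP[_ h5] := bpow 3 7 (b_ok Hc).
  by move: h5 b3; wipe; lra.
have := ler_normD (V i fKY - relu (lin8 l_key (V i) / rho)) (relu (lin8 l_key (V i) / rho) - dl * K).
rewrite addrA subrK; have : 0 <= dl * b ^+ 5 by rewrite mulr_ge0 ?ltW // exprn_gt0 //; case/andP: (b_ok Hc).
have : 0 <= dl * b ^+ 3 by rewrite mulr_ge0 ?ltW.
by move: h R2 T uu u0 f5 f10; wipe; lra.
Qed.

End Amplify.

(** * The test s = r for the rank r of a token *)

Section Equality.
Variables (R : archiRcfType) (p : nat) (rnd : R -> R).
Hypothesis Hrnd : correct_rounding p rnd.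
Hypothesis Hp : (20 <= p)%N.
Variables (n : nat) (A : 'I_n -> 'I_n -> bool) (s t : 'I_n).
Notation N := (len s t).
Notation tok i := (tokn A s t i).
Variable V : nat -> nat -> R.
Hypothesis Vflag : forall i f, f \in flags -> V i f = (f == tok_flag (tok i))%:R.
Hypothesis Veq : eqns rnd N V (subs_of init_specs).
Notation u := (uerr R p).
Variables b rho tau eta : R.
Hypothesis Nb : N%:R * b = 1.
Hypothesis Hc : consts_ok b u rho tau eta.
Hypothesis Vrho : forall i, (i < N)%N -> V i fRHO = rho.
Hypothesis Vtau : forall i, (i < N)%N -> V i fTAU = tau.
Hypothesis Veta : forall i, (i < N)%N -> V i fETA = eta.
Let E1f := E1_fact Hrnd Hp Vflag Veq Nb Hc Veta.
Let ESf := ES_fact Hrnd Hp Vflag Veq Nb Hc Veta.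
Let dlf := dl_facts Hc.
Let S14g := S14_gen Hrnd Hp Vflag Veq Nb Hc Vrho Veta.
Let a14 := amp14 Hrnd Hp Vflag Veq Nb Hc Vrho Veta.
Notation dl := (eta / rho).

Lemma u_dl3 : 1000 * u <= dl.
Proof. by have := u_dl Hc (isT : 0 <= 30)%N; rewrite expr0 mulr1. Qed.

Lemma V_ff_ge0 k sp f m i : nth (SA no_layer) (subs_of init_specs) k = SF sp -> (k < 34)%N ->
  (f, [:: (m, 64%:Z)]) \in fo sp -> 0 <= V i f.
Proof.
move=> ek k34 fin; have := eqns_nth Veq k34; rewrite ek => /(_ i f m fin) ->.
exact: relu_ge0.
Qed.

(** The three outputs come from one normalisation and share its factor q. The next layer only
    compares them with each other, so it is enough to know rho q within one percent. *)
Lemma eq14 i : (i < N)%N -> exists q, [/\ 99 / 100 <= rho * q <= 1, `|V i fKD - eta * q| <= 3 * u,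
  `|V i fDP - relu ((V i fES - V i fE1) * q)| <= 3 * u &
  `|V i fDN - relu ((V i fE1 - V i fES) * q)| <= 3 * u].
Proof.
move=> iN; have [hS _] := S14g iN; have [_ E d0 /andP[r0 _]] := dlf.
have b4 := b_small Hc 4; have b4' : 2 * b ^+ 4 <= 1 by move: b4; wipe => /andP[_ h]; lra.
have [k1 _] := a14 (f := fKD) (m := 3) (form := c8 [:: fETA]) iN hS b4' isT erefl isT isT.
have [k2 _] := a14 (f := fDP) (m := 1) iN hS b4' isT erefl isT isT.
have [k3 _] := a14 (f := fDN) (m := 2) iN hS b4' isT erefl isT isT.
have /andP[q1 q2] := inv_sqrt_approx r0 hS b4'.
move: k1 k2 k3 q1 q2; move: ((Num.sqrt _)^-1) => q k1 k2 k3 q1 q2.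
have rr : rho * rho^-1 = 1 by rewrite divff // gt_eqF.
have q3 : 99 / 100 <= rho * q.
  have : rho * (rho^-1 * (1 - 2 * b ^+ 4 / 2)) <= rho * q by rewrite ler_pM2l.
  by rewrite mulrA rr; move: b4; wipe => /andP[_ h] ?; lra.
exists q; split.
- by rewrite q3 /= -rr ler_pM2l.
- move: k1; rewrite lin8_c8 big_seq1 Veta // relu_pos // mulr_ge0 ?(ltW (_ : 0 < eta)) //.
    by have [] := consts_eta Hc.
  by rewrite -(pmulr_rge0 _ r0); move: q3; wipe; lra.
- move: k2; rewrite !lin8_cons lin8_nil.
  by have -> : 8%:~R / 8 * V i fES + ((- 8%:Z)%:~R / 8 * V i fE1 + 0) = V i fES - V i fE1 by field.
- move: k3; rewrite !lin8_cons lin8_nil.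
  by have -> : 8%:~R / 8 * V i fE1 + ((- 8%:Z)%:~R / 8 * V i fES + 0) = V i fE1 - V i fES by field.
Qed.

Lemma KD_bounds i : (i < N)%N -> 98 / 100 * dl <= V i fKD <= 101 / 100 * dl.
Proof.
move=> iN; have [q [/andP[q1 q2] h _ _]] := eq14 iN; have [_ E d0 _] := dlf.
have uu := u_dl3; have u0 := uerr_gt0 R p.
have E' : eta * q = dl * (rho * q) by rewrite {1}E mulrA.
have k1 : dl * (99 / 100) <= dl * (rho * q) by rewrite ler_pM2l.
have k2 : dl * (rho * q) <= dl * 1 by rewrite ler_pM2l.
by move: h; rewrite ler_distl E'; move: uu u0 k1 k2 d0; wipe => ? ? ? ? ? /andP[? ?]; apply/andP; split; lra.
Qed.

Lemma sum3_sq (x y z : R) : (x + y + z) ^+ 2 <= 4 * (x ^+ 2 + y ^+ 2 + z ^+ 2).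
Proof.
have -> : 4 * (x ^+ 2 + y ^+ 2 + z ^+ 2) = (x + y + z) ^+ 2 + ((x - y) ^+ 2 + (x - z) ^+ 2 + (y - z) ^+ 2
  + x ^+ 2 + y ^+ 2 + z ^+ 2) by ring.
by rewrite lerDl !addr_ge0 ?sqr_ge0.
Qed.

Lemma GG_form i : (i < N)%N ->
  let r := Num.sqrt (V i fKD ^+ 2 + V i fDP ^+ 2 + V i fDN ^+ 2) in
  [/\ `|V i fGG - relu ((V i fKD - 2 * V i fDP - 2 * V i fDN) / r)| <= 3 * u,
      V i fKD <= r & r <= V i fKD + V i fDP + V i fDN].
Proof.
move=> iN r; have p0 := @V_ff_ge0 27 _ fDP 1 i erefl isT isT.
have n0 := @V_ff_ge0 27 _ fDN 2 i erefl isT isT.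
have /andP[k0 _] := KD_bounds iN; have [_ _ d0 _] := dlf.
have kd : 0 < V i fKD by move: k0 d0; wipe; lra.
have S0 : 0 <= V i fKD ^+ 2 + V i fDP ^+ 2 + V i fDN ^+ 2 by rewrite !addr_ge0 ?sqr_ge0.
have rr : r ^+ 2 = V i fKD ^+ 2 + V i fDP ^+ 2 + V i fDN ^+ 2 by rewrite sqr_sqrtr.
have r0 : 0 <= r by rewrite sqrtr_ge0.
split.
- have := @V_ff R p rnd Hrnd Hp n s t V Veq 29 _ fGG 0 i [:: fKD; fDP; fDN]
    [:: (fKD, 8%:Z); (fDP, - 16%:Z); (fDN, - 16%:Z)] (V i fKD + V i fDP + V i fDN) erefl isT isT erefl erefl isT isT isT.
  rewrite /sumsq !big_cons big_nil addr0 addrA -/r !lin8_cons lin8_nil.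
  have -> : 8%:~R / 8 * V i fKD + ((- 16%:Z)%:~R / 8 * V i fDP + ((- 16%:Z)%:~R / 8 * V i fDN + 0))
    = V i fKD - 2 * V i fDP - 2 * V i fDN by field.
  apply; [by move: kd p0 n0; wipe; lra| |exact: sum3_sq].
  move=> g; rewrite !inE => /or3P[/eqP->|/eqP->|/eqP->]; rewrite ger0_norm ?(ltW kd) //;
    by move: kd p0 n0; wipe; lra.
- by move: rr r0 kd (sqr_ge0 (V i fDP)) (sqr_ge0 (V i fDN)); move: (r) => r'; wipe => *; nra.
by move: rr r0 kd p0 n0; move: (r) (V i fKD) (V i fDP) (V i fDN) => r' x y z; wipe => *; nra.
Qed.

Lemma GG_bounds i : (i < N)%N -> 0 <= V i fGG <= 11 / 10.
Proof.
move=> iN; have p0 := @V_ff_ge0 27 _ fDP 1 i erefl isT isT.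
have n0 := @V_ff_ge0 27 _ fDN 2 i erefl isT isT.
rewrite (@V_ff_ge0 29 _ fGG 0 i erefl isT isT) /=.
have [h h1 h2] := GG_form iN; set r := Num.sqrt _ in h h1 h2.
have /andP[k0 _] := KD_bounds iN; have [_ _ d0 _] := dlf; have u1 := uerr_le R Hp.
have r0 : 0 < r by move: k0 d0 h1; wipe; lra.
have : relu ((V i fKD - 2 * V i fDP - 2 * V i fDN) / r) <= 1.
  rewrite /relu maxEle; case: ifP => // _; rewrite ler_pdivrMr // mul1r.
  by move: h1 p0 n0; wipe; lra.
by move: h; rewrite ler_distl; move: u1; wipe => ? /andP[? ?] ?; lra.
Qed.

Definition last_pos := (sTB s + t)%N.
Lemma last_lt : (last_pos < N)%N. Proof. by rewrite /last_pos /len addnS. Qed.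
Lemma rank2_last : rank2 s last_pos = t.+2.
Proof.
have [h0 h1 h2 h3] := thresholds Hp s t.
have e1 : (sTB s + t < sPAD n)%N = false by lia.
have e2 : (sTB s + t < sTA n)%N = false by lia.
have e3 : (sTB s + t < sTB s)%N = false by lia.
by rewrite /rank2 /last_pos e1 e2 e3 addKn.
Qed.

(** For s = t both differences nearly vanish and the quotient is close to 1. Otherwise [fDP] or
    [fDN] is at least about dl, and subtracting it twice from [fKD], also about dl, makes the
    numerator negative. *)
Lemma GG_last : if s == t then 8 / 10 <= V last_pos fGG else V last_pos fGG <= 3 * u.
Proof.
have iN := last_lt; have [q [/andP[q1 q2] _ hp hn]] := eq14 iN.
have [h h1 h2] := GG_form iN; move: h h1 h2; set r := Num.sqrt _ => h h1 h2.
have /andP[k0 k1] := KD_bounds iN; have [_ E d0 /andP[r0 _]] := dlf; have u0 := uerr_gt0 R p.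
have uu := u_dl3; have u1 := uerr_le R Hp.
have p0 := @V_ff_ge0 27 _ fDP 1 last_pos erefl isT isT.
have n0 := @V_ff_ge0 27 _ fDN 2 last_pos erefl isT isT.
have f1 := E1f iN; have fs := ESf iN; rewrite rank2_last in f1.
have q0 : 0 < q by rewrite -(pmulr_rgt0 _ r0); move: q1; wipe; lra.
have /andP[_ b12] := b_small Hc 12.
have e0 : 0 < eta by have [] := consts_eta Hc.
have r0' : 0 < r by move: k0 d0 h1; wipe; lra.
have x1 : `|(V last_pos fES - V last_pos fE1) * q - dl * (rho * q) * (s%:R - t%:R)| <= dl / 100.
  have -> : (V last_pos fES - V last_pos fE1) * q - dl * (rho * q) * (s%:R - t%:R)
     = (V last_pos fES - eta * s.+2%:R - (V last_pos fE1 - eta * t.+2%:R)) * q.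
    by rewrite mulrA -E -(addn2 s) -(addn2 t) !natrD; ring.
  rewrite normrM [`|q|]gtr0_norm //.
  apply: (@le_trans _ _ (2 * (eta * b ^+ 12) * q)).
    rewrite ler_pM2r //; apply: le_trans (ler_normB _ _) _.
    by move: f1 fs; wipe; lra.
  have -> : 2 * (eta * b ^+ 12) * q = dl * (2 * b ^+ 12 * (rho * q)) by rewrite [in LHS]E; ring.
  rewrite ler_pM2l //; apply: (@le_trans _ _ (2 * b ^+ 12 * 1)).
    by rewrite ler_pM2l // mulr_gt0 //; case/andP: (b_small Hc 12).
  by move: b12; wipe; lra.
case: ifP => [/eqP st|st].
  rewrite st subrr mulr0 subr0 in x1.
  have y1 : relu ((V last_pos fES - V last_pos fE1) * q) <= dl / 100.
    have := relu_lip (e := dl / 100) (x := (V last_pos fES - V last_pos fE1) * q) (y := 0).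
    rewrite subr0 [relu 0]relu_pos // subr0 => /(_ x1); rewrite ger0_norm //; exact: relu_ge0.
  have y2 : relu ((V last_pos fE1 - V last_pos fES) * q) <= dl / 100.
    have := relu_lip (e := dl / 100) (x := (V last_pos fE1 - V last_pos fES) * q) (y := 0).
    rewrite subr0 [relu 0]relu_pos // subr0 -opprB mulNr normrN => /(_ x1); rewrite ger0_norm //; exact: relu_ge0.
  have g1 : 83 / 100 <= (V last_pos fKD - 2 * V last_pos fDP - 2 * V last_pos fDN) / r.
    rewrite ler_pdivlMr //; move: hp hn; rewrite !ler_distl => /andP[_ z1] /andP[_ z2].
    by move: z1 z2 y1 y2 k0 k1 h2 uu d0 u0; wipe; lra.
  rewrite relu_pos in h; last by move: g1; wipe; lra.
  by move: h; rewrite ler_distl; move: g1 u1; wipe => ? ? /andP[? ?]; lra.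
have neg : relu ((V last_pos fKD - 2 * V last_pos fDP - 2 * V last_pos fDN) / r) = 0.
  apply: relu_neg; rewrite pmulr_lle0 ?invr_gt0 //.
  have kq : dl * (99 / 100) <= dl * (rho * q) by rewrite ler_pM2l.
  have : (s < t)%N || (t < s)%N by rewrite -neq_ltn; move: st; rewrite -val_eqE => ->.
  move: hp hn x1; rewrite !ler_distl => /andP[z1 _] /andP[z2 _] /andP[x1 x2] /orP[lt|lt].
    have dd : t%:R - s%:R >= 1 :> R by rewrite -natrB ?ler1n ?subn_gt0 // ltnW.
    have kd : dl * (rho * q) * 1 <= dl * (rho * q) * (t%:R - s%:R).
      by rewrite ler_pM2l // mulr_gt0 // mulr_gt0.
    have y : (V last_pos fE1 - V last_pos fES) * q <= relu ((V last_pos fE1 - V last_pos fES) * q).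
      by rewrite /relu maxEle; case: ifP => // /negbT; rewrite -ltNge => /ltW.
    by move: z2 x2 kd kq y k1 p0 uu d0 u0; wipe; lra.
  have dd : s%:R - t%:R >= 1 :> R by rewrite -natrB ?ler1n ?subn_gt0 // ltnW.
  have kd : dl * (rho * q) * 1 <= dl * (rho * q) * (s%:R - t%:R).
    by rewrite ler_pM2l // mulr_gt0 // mulr_gt0.
  have y : (V last_pos fES - V last_pos fE1) * q <= relu ((V last_pos fES - V last_pos fE1) * q).
    by rewrite /relu maxEle; case: ifP => // /negbT; rewrite -ltNge => /ltW.
  by move: z1 x1 kd kq y k1 n0 uu d0 u0; wipe; lra.
by rewrite neg subr0 in h; apply: le_trans (ler_norm _) h.
Qed.

End Equality.

(** * The gate of the equality test and the initial matrix bits *)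

Section InitBits.
Variables (R : archiRcfType) (p : nat) (rnd : R -> R).
Hypothesis Hrnd : correct_rounding p rnd.
Hypothesis Hp : (20 <= p)%N.
Variables (n : nat) (A : 'I_n -> 'I_n -> bool) (s t : 'I_n).
Notation N := (len s t).
Notation tok i := (tokn A s t i).
Variable V : nat -> nat -> R.
Hypothesis Vflag : forall i f, f \in flags -> V i f = (f == tok_flag (tok i))%:R.
Hypothesis Veq : eqns rnd N V (subs_of init_specs).
Notation u := (uerr R p).
Variables b rho tau eta : R.
Hypothesis Nb : N%:R * b = 1.
Hypothesis Hc : consts_ok b u rho tau eta.
Hypothesis Vrho : forall i, (i < N)%N -> V i fRHO = rho.
Hypothesis Vtau : forall i, (i < N)%N -> V i fTAU = tau.
Hypothesis Veta : forall i, (i < N)%N -> V i fETA = eta.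

Lemma flag_sum_ne i f : f \in flags -> \sum_(g <- rem f flags) V i g = (tok_flag (tok i) != f)%:R.
Proof.
move=> fin; rewrite (sum_flag Vflag) ?rem_uniq //; last by move=> g /mem_rem.
have un : uniq flags by [].
by rewrite (rem_filter _ un) mem_filter /= flag_in andbT.
Qed.

(** The test [fGG] can also succeed at a token of another kind with rank s. Suppressing it outside
    the b-tokens keeps it out of the norms of the keys among which the final layer chooses. *)
Lemma GB_bounds i : (i < N)%N -> 0 <= V i fGB <= 9 / 10 /\
  (tok i <> TB -> V i fGB <= 3 * u).
Proof.
move=> iN; have /andP[g0 g1] := GG_bounds Hrnd Hp Vflag Veq Nb Hc Vrho Veta iN.
have u0 := uerr_gt0 R p; have u1 := uerr_le R Hp.
have SE : sumsq (fGG :: flags) (V i) = V i fGG ^+ 2 + 1.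
  by rewrite /sumsq big_cons (flags_sq Vflag).
set f : lform := [:: (fGG, 8%:Z); (fBOS, - 16%:Z); (fT0, - 16%:Z); (fT1, - 16%:Z); (fPAD, - 16%:Z); (fTA, - 16%:Z)].
have LE : lin8 f (V i) = V i fGG - 2 * (tok_flag (tok i) != fTB)%:R.
  rewrite -(flag_sum_ne i (isT : fTB \in flags)) /= !big_cons big_nil /f !lin8_cons lin8_nil.
  by field.
have h : `|V i fGB - relu (lin8 f (V i) / Num.sqrt (sumsq (fGG :: flags) (V i)))| <= 3 * u.
  apply: (@V_ff R p rnd Hrnd Hp n s t V Veq 33 _ fGB 0 i _ f 2 erefl isT isT erefl erefl isT isT isT).
  - by [].
  - move=> g; rewrite inE => /orP[/eqP->|gf]; first by rewrite ger0_norm //; move: g1; wipe; lra.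
    by rewrite Vflag //; case: (_ == _); rewrite ?normr1 ?normr0 //; lra.
  - by rewrite SE; move: (sqr_ge0 (V i fGG)); wipe; lra.
move: h; rewrite LE SE; set r := Num.sqrt _.
have r0 : 0 < r by rewrite sqrtr_gt0; move: (sqr_ge0 (V i fGG)); wipe; lra.
have rr : r ^+ 2 = V i fGG ^+ 2 + 1 by rewrite sqr_sqrtr //; move: (sqr_ge0 (V i fGG)); wipe; lra.
rewrite (@V_ff_ge0 R rnd n s t V Veq 33 _ fGB 0 i erefl isT isT) /=.
have B9 : relu ((V i fGG - 2 * (tok_flag (tok i) != fTB)%:R) / r) <= 8 / 10.
  rewrite /relu maxEle; case: ifP => _; last by lra.
  rewrite ler_pdivrMr //; apply: (@le_trans _ _ (V i fGG)).
    by rewrite gerBl mulr_ge0 // ler0n.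
  by move: rr r0 g0 g1; move: (r) (V i fGG) => r' x; wipe => *; nra.
move=> h; split; first by move: h B9 u1; rewrite ler_distl; wipe => /andP[? ?] ? ?; lra.
move=> nB; have ne : tok_flag (tok i) != fTB by move: nB; case: (tok i).
move: h; rewrite ne mulr1 relu_neg ?subr0; first by move=> h; apply: le_trans (ler_norm _) h.
by rewrite pmulr_lle0 ?invr_gt0 //; move: g1; wipe; lra.
Qed.

Lemma GB_last : if s == t then 5 / 10 <= V (last_pos s t) fGB else V (last_pos s t) fGB <= 6 * u.
Proof.
set i := last_pos s t; have iN : (i < N)%N by apply: last_lt.
have /andP[g0 g1] := GG_bounds Hrnd Hp Vflag Veq Nb Hc Vrho Veta iN.
have u0 := uerr_gt0 R p; have u1 := uerr_le R Hp.
have tB : tok_flag (tok i) == fTB.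
  by rewrite (flag_TB Hp) // /i /last_pos leq_addr.
have SE : sumsq (fGG :: flags) (V i) = V i fGG ^+ 2 + 1.
  by rewrite /sumsq big_cons (flags_sq Vflag).
set f : lform := [:: (fGG, 8%:Z); (fBOS, - 16%:Z); (fT0, - 16%:Z); (fT1, - 16%:Z); (fPAD, - 16%:Z); (fTA, - 16%:Z)].
have LE : lin8 f (V i) = V i fGG.
  transitivity (V i fGG - 2 * (tok_flag (tok i) != fTB)%:R).
    rewrite -(flag_sum_ne i (isT : fTB \in flags)) /= !big_cons big_nil /f !lin8_cons lin8_nil.
    by field.
  by rewrite tB mulr0 subr0.
have h : `|V i fGB - relu (lin8 f (V i) / Num.sqrt (sumsq (fGG :: flags) (V i)))| <= 3 * u.
  apply: (@V_ff R p rnd Hrnd Hp n s t V Veq 33 _ fGB 0 i _ f 2 erefl isT isT erefl erefl isT isT isT).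
  - by [].
  - move=> g; rewrite inE => /orP[/eqP->|gf]; first by rewrite ger0_norm //; move: g1; wipe; lra.
    by rewrite Vflag //; case: (_ == _); rewrite ?normr1 ?normr0 //; lra.
  - by rewrite SE; move: (sqr_ge0 (V i fGG)); wipe; lra.
move: h; rewrite LE SE; set r := Num.sqrt _.
have r0 : 0 < r by rewrite sqrtr_gt0; move: (sqr_ge0 (V i fGG)); wipe; lra.
have rr : r ^+ 2 = V i fGG ^+ 2 + 1 by rewrite sqr_sqrtr //; move: (sqr_ge0 (V i fGG)); wipe; lra.
rewrite relu_pos; last by apply: divr_ge0 => //; exact: ltW.
have := GG_last Hrnd Hp Vflag Veq Nb Hc Vrho Veta; rewrite -/i; case: ifP => _ gl.
  have : 53 / 100 <= V i fGG / r.
    rewrite ler_pdivlMr //; move: rr r0 gl g1; move: (r) (V i fGG) => r' x; wipe => *; nra.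
  by rewrite ler_distl; move: u1; wipe => ? ? /andP[? ?]; lra.
have r1 : 1 <= r by move: rr r0 (sqr_ge0 (V i fGG)); move: (r) => r'; wipe => *; nra.
have : V i fGG / r <= 3 * u.
  rewrite ler_pdivrMr //; apply: le_trans gl _; apply: ler_peMr => //; move: u0; wipe; lra.
by rewrite ler_distl; wipe => ? /andP[? ?]; lra.
Qed.

Lemma tau_small : 0 < tau <= 1 / 100 /\ 1000 * u <= tau.
Proof.
have [_ t0 e0 /andP[_ e2]] := consts_eta Hc; have [bb _ _ /andP[t1 t2] _] := Hc.
have /andP[_ p9] := bpow 0 9 bb; rewrite expr0 add0n in p9.
have /andP[p0 p11] := bpow 9 2 bb; split; first by rewrite t0; move: t2 p9; wipe; lra.
have := u_eta Hc (isT : 0 <= 30)%N; rewrite expr0 mulr1.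
have /andP[q9 _] := bpow 0 9 bb; rewrite add0n in q9.
by move: e2 p0 p11 t1 q9; wipe; lra.
Qed.

Lemma R_init i : (i < N)%N -> `|V i bR - tau * (tok_flag (tok i) == fT1)%:R| <= tau / 50.
Proof.
move=> iN; have [/andP[t0 t1] tu] := tau_small; have u0 := uerr_gt0 R p.
have SE : sumsq (fTAU :: flags) (V i) = 1 + tau ^+ 2.
  by rewrite /sumsq big_cons (flags_sq Vflag) Vtau // addrC.
set f : lform := [:: (fTAU, 8%:Z); (fBOS, - 16%:Z); (fT0, - 16%:Z); (fPAD, - 16%:Z); (fTA, - 16%:Z); (fTB, - 16%:Z)].
have LE : lin8 f (V i) = tau - 2 * (tok_flag (tok i) != fT1)%:R.
  rewrite -(flag_sum_ne i (isT : fT1 \in flags)) /= !big_cons big_nil /f !lin8_cons lin8_nil Vtau //.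
  by field.
have h : `|V i bR - relu (lin8 f (V i) / Num.sqrt (sumsq (fTAU :: flags) (V i)))| <= 3 * u.
  apply: (@V_ff R p rnd Hrnd Hp n s t V Veq 17 _ bR 0 i _ f 1 erefl isT isT erefl erefl isT isT isT).
  - by [].
  - move=> g; rewrite inE => /orP[/eqP->|gf].
      by rewrite Vtau // gtr0_norm //; move: t1; wipe; lra.
    by rewrite Vflag //; case: (_ == _); rewrite ?normr1 ?normr0.
  - by rewrite SE expr1n; move: (sqr_ge0 tau); wipe; lra.
move: h; rewrite LE SE.
have w01 : 0 <= tau ^+ 2 <= 1 by rewrite sqr_ge0 /=; move: t0 t1; wipe => *; nra.
have /andP[h1 _] := inv_sqrt_bounds w01.
have r1 : 1 <= Num.sqrt (1 + tau ^+ 2).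
  by rewrite -[leLHS]sqrtr1 ler_sqrt; move: (sqr_ge0 tau); wipe; lra.
have h2 : (Num.sqrt (1 + tau ^+ 2))^-1 <= 1 by rewrite invf_le1 //; move: r1; wipe; lra.
have t2 : tau ^+ 2 <= 1 / 100 by move: t0 t1; wipe => *; nra.
have i0 : 0 < (Num.sqrt (1 + tau ^+ 2))^-1 by rewrite invr_gt0; move: r1; wipe; lra.
move: h1 h2 i0; move: ((Num.sqrt _)^-1) => q h1 h2 i0.
case: (tok_flag (tok i) == fT1); rewrite /= ?mulr0 ?mulr1 ?subr0.
  rewrite relu_pos; last by rewrite mulr_ge0 ?ltW.
  have k1 : tau * (99 / 100) <= tau * q by rewrite ler_pM2l //; move: h1 t2; wipe; lra.
  have k2 : tau * q <= tau * 1 by rewrite ler_pM2l.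
  by rewrite !ler_distl; move: k1 k2 t0 tu u0; wipe => ? ? ? ? ? /andP[? ?]; apply/andP; split; lra.
rewrite relu_neg ?subr0; first by move: tu u0; wipe; lra.
by rewrite pmulr_lle0 //; move: t1; wipe; lra.
Qed.

End InitBits.

(** * Division of positions by the number of vertices *)

Section Nearest.
Variable R : archiRcfType.
Implicit Types b X Y e w c : R.

(** Completing the square, 1 + X Y - Y^2/2 is a constant minus (X - Y)^2/2. The two expansions cost
    6 c^4 each; the noise nu1 can only lower the losing score, so only nu0 is charged. *)
Lemma nearest_cmp X Y0 Y1 nu0 nu1 c d : 0 <= c -> c <= 1 / 4 -> `|X| <= c -> `|Y0| <= c -> `|Y1| <= c ->
  0 <= nu0 <= c ^+ 2 -> 0 <= nu1 <= c ^+ 2 ->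
  d + 12 * (c ^+ 2) ^+ 2 + nu0 <= ((X - Y1) ^+ 2 - (X - Y0) ^+ 2) / 2 ->
  (1 + X * Y1) / Num.sqrt (1 + (Y1 ^+ 2 + nu1)) + d <= (1 + X * Y0) / Num.sqrt (1 + (Y0 ^+ 2 + nu0)).
Proof.
move=> c0 c4 X1 h0 h1 /andP[n0 n0'] /andP[n1 n1'] H.
have c2 : 0 <= c ^+ 2 <= 1 / 16 by rewrite sqr_ge0 /=; move: c0 c4; wipe => *; nra.
have sq Y : `|Y| <= c -> 0 <= Y ^+ 2 <= c ^+ 2.
  move=> hY; rewrite sqr_ge0 -(real_normK (num_real Y)); apply: lerXn2r => //.
  by rewrite nnegrE.
have E Y nu : `|Y| <= c -> 0 <= nu -> nu <= c ^+ 2 ->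
    `|(1 + X * Y) / Num.sqrt (1 + (Y ^+ 2 + nu)) - (1 + X * Y - (Y ^+ 2 + nu) / 2)| <= 6 * (c ^+ 2) ^+ 2.
  move=> hY u0 u1; have /andP[y0 y1] := sq Y hY.
  have XY : `|X * Y| <= c ^+ 2 by rewrite normrM expr2; apply: ler_pM.
  have w2 : 0 <= Y ^+ 2 + nu <= 2 * c ^+ 2 by apply/andP; split; move: y0 y1 u0 u1; wipe; lra.
  have [wl wu] := andP w2.
  apply: le_trans (expand_bound _ _) _.
  - by rewrite wl /=; case/andP: c2 => _ c2; move: wu c2; wipe; lra.
  - by case/andP: c2 => _ c2; move: XY c2; wipe; lra.
  have k1 : (Y ^+ 2 + nu) ^+ 2 <= (2 * c ^+ 2) ^+ 2.
    by apply: lerXn2r; rewrite ?nnegrE //; apply: le_trans wl wu.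
  have k2 : `|X * Y| * (Y ^+ 2 + nu) <= c ^+ 2 * (2 * c ^+ 2) by apply: ler_pM.
  have -> : 6 * (c ^+ 2) ^+ 2 = (2 * c ^+ 2) ^+ 2 + c ^+ 2 * (2 * c ^+ 2) by ring.
  by move: k1 k2; wipe; lra.
have := E Y0 nu0 h0 n0 n0'; have := E Y1 nu1 h1 n1 n1'.
rewrite !ler_distl => /andP[_ a1] /andP[a0 _].
have id : ((X - Y1) ^+ 2 - (X - Y0) ^+ 2) / 2 = X * Y0 - Y0 ^+ 2 / 2 - (X * Y1 - Y1 ^+ 2 / 2) by field.
rewrite id in H.
by move: a0 a1 H n0 n1; wipe; lra.
Qed.

End Nearest.

Section Division.
Variables (R : archiRcfType) (p : nat) (rnd : R -> R).
Hypothesis Hrnd : correct_rounding p rnd.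
Hypothesis Hp : (20 <= p)%N.
Variables (n : nat) (A : 'I_n -> 'I_n -> bool) (s t : 'I_n).
Notation N := (len s t).
Notation tok i := (tokn A s t i).
Variable V : nat -> nat -> R.
Hypothesis Vflag : forall i f, f \in flags -> V i f = (f == tok_flag (tok i))%:R.
Hypothesis Veq : eqns rnd N V (subs_of init_specs).
Notation u := (uerr R p).
Variables b rho tau eta : R.
Hypothesis Nb : N%:R * b = 1.
Hypothesis Hc : consts_ok b u rho tau eta.
Hypothesis Vrho : forall i, (i < N)%N -> V i fRHO = rho.
Hypothesis Vtau : forall i, (i < N)%N -> V i fTAU = tau.
Hypothesis Veta : forall i, (i < N)%N -> V i fETA = eta.
Let E1f := E1_fact Hrnd Hp Vflag Veq Nb Hc Veta.
Let E3f := E3_fact Hrnd Hp Vflag Veq Nb Hc Veta.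
Let dlf := dl_facts Hc.
Let KYg := KY_gen Hrnd Hp Vflag Veq Nb Hc Vrho Veta.
Let KYa := KY_adj Hrnd Hp Vflag Veq Nb Hc Vrho Veta.
Notation dl := (eta / rho).

Definition query i := V i fE1 - V i fE3 / 2 - eta.

Lemma query_fact i : (i < N)%N ->
  `|query i / rho - dl * ((rank2 s i)%:R - 2 - (n%:R - 1) / 2)| <= dl * b ^+ 3.
Proof.
move=> iN; have [_ E d0 /andP[r0 _]] := dlf; have f1 := E1f iN; have f3 := E3f iN.
have -> : query i / rho - dl * ((rank2 s i)%:R - 2 - (n%:R - 1) / 2) =
    (V i fE1 - eta * (rank2 s i)%:R - (V i fE3 - eta * n.+1%:R) / 2) / rho.
  by rewrite /query -natr1; field; rewrite gt_eqF.
rewrite normrM [`|rho^-1|]gtr0_norm ?invr_gt0 // ler_pdivrMr // mulrAC -E.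
have /andP[b3 _] := b_small Hc 3; have /andP[_ pb] := bpow 3 9 (b_ok Hc).
have [_ _ e0 _] := consts_eta Hc.
have k : eta * b ^+ 12 <= eta * (1 / 5 * b ^+ 3).
  by rewrite ler_pM2l //; apply: le_trans pb _; rewrite ler_pM2r //; lra.
have k0 : 0 <= eta * b ^+ 3 by rewrite mulr_ge0 ?ltW.
move: f1 f3; rewrite !ler_distl; move: k k0; wipe => ? ? /andP[? ?] /andP[? ?].
by apply/andP; split; lra.
Qed.

Lemma N_ge5 : (5 <= N)%N.
Proof.
have n0 := n_gt0 s; apply: leq_trans (cubeN Hp s t).
by apply: (@leq_add 2 3) => //; apply: (@leq_add 1 1); rewrite ?muln_gt0 ?n0.
Qed.

Lemma half_n : 0 <= ((n%:R - 1) / 2 : R) <= N%:R / 4.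
Proof.
have n1 : 1 <= n%:R :> R by rewrite ler1n; apply: n_gt0 s.
have cube := cubeN Hp s t.
have : n%:R * n%:R * n%:R + n%:R * n%:R + 3 <= N%:R :> R.
  by rewrite -!natrM -!natrD ler_nat.
move: (n%:R) (N%:R) n1 => x y; wipe => h1 h2; apply/andP; split; first by lra.
have : 0 <= x * x * x by rewrite !mulr_ge0 //; lra.
by move=> ?; nra.
Qed.

Lemma query_small i : (i < N)%N -> `|query i / rho| <= 3 / 2 * b ^+ 3.
Proof.
move=> iN; have h := query_fact iN; have [/andP[_ d1] E d0 _] := dlf.
have /andP[r0 r1] := rank2_bounds R iN; have /andP[n0 n1] := half_n.
have N1 := N_ge1 R s t; have /andP[g0 g1] := dlN Nb Hc.
have /andP[b3 b3'] := b_small Hc 3.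
have N5 : 5 <= N%:R :> R by rewrite ler_nat; apply: N_ge5.
have k1 : `|dl * ((rank2 s i)%:R - 2 - (n%:R - 1) / 2)| <= dl * N%:R.
  rewrite normrM gtr0_norm // ler_pM2l // ler_norml.
  by move: r0 r1 n0 n1 N5; wipe => *; apply/andP; split; lra.
have k2 : dl * b ^+ 3 <= 1 / 10 * b ^+ 3.
  rewrite ler_pM2r //; have /andP[_ b4] := b_small Hc 4; move: d1 b4; wipe; lra.
have := ler_normD (query i / rho - dl * ((rank2 s i)%:R - 2 - (n%:R - 1) / 2)) (dl * ((rank2 s i)%:R - 2 - (n%:R - 1) / 2)).
by rewrite subrK; move: h k1 k2 g1 b3; wipe; lra.
Qed.

(** The keys n q of the adjacency positions can approach n^3; the padding makes the input long
    enough for them. *)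
Lemma adj_index i : isadj n i -> (n * i.-1 <= N)%N.
Proof.
case/andP=> i0 iP; apply: leq_trans (cubeN Hp s t); rewrite -addnA.
apply: (leq_trans _ (leq_addr _ _)); rewrite -mulnA leq_mul2l; apply/orP; right.
by case: i i0 iP => // k _; rewrite /sPAD add1n ltnS /=; exact: ltnW.
Qed.

Lemma KY_small i : (i < N)%N -> isadj n i -> `|V i fKY| <= 3 / 2 * b ^+ 3.
Proof.
move=> iN adj; have h := KYa iN adj; have [/andP[_ d1] E d0 _] := dlf.
have /andP[g0 g1] := dlN Nb Hc; have /andP[b3 b3'] := b_small Hc 3.
have k1 : 0 <= dl * (n%:R * i.-1%:R) <= dl * N%:R.
  by rewrite -natrM mulr_ge0 ?ler0n ?(ltW d0) //= ler_pM2l // ler_nat; apply: adj_index.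
have k2 : dl * b ^+ 3 <= 1 / 10 * b ^+ 3.
  rewrite ler_pM2r //; have /andP[_ b4] := b_small Hc 4; move: d1 b4; wipe; lra.
case/andP: k1 => k0 k1; move: h; rewrite ler_distl ler_norml; move: k0 k1 k2 g1 b3; wipe => ? ? ? ? ? /andP[? ?].
by apply/andP; split; lra.
Qed.

Section DivHead.
Variables (hsp : head_spec) (ms : seq nat).
Hypothesis hqE : hq hsp = q_div.
Hypothesis hkE : hk hsp = k_div.
Hypothesis hmE : hm hsp = false.
Hypothesis ms56 : all (fun g => (g < 56)%N) ms.
Hypothesis msok : okq hsp ms.
Hypothesis msle : forall j g, (j < N)%N -> g \in ms -> `|V j g| <= 1.
Variable nu : nat -> R.
Hypothesis SE : forall j, (j < N)%N -> lnS ms (V j) = 1 + (V j fKY ^+ 2 + nu j).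
Hypothesis nub : forall j, (j < N)%N -> 0 <= nu j <= 2 * b ^+ 14.

Lemma div_flagged j : (j < N)%N -> flagged ms (V j).
Proof.
move=> jN; split=> [g gm||]; first exact: msle.
  by rewrite lnmu0 // normr0; lra.
by rewrite SE //; have /andP[h _] := nub jN; move: h (sqr_ge0 (V j fKY)); wipe; lra.
Qed.

(** Queries are in units of eta with last coordinate rho, keys in units of dl = eta / rho with last
    coordinate 1. A common factor rho splits off and leaves 1 + X Y at adjacency positions, with X
    and Y both in units of dl. *)
Lemma div_dot i j : (i < N)%N -> (j < N)%N ->
  dot hsp ms (V i) (V j) = rho * (query i / rho * V j fKY + (isadj n j)%:R).
Proof.
move=> iN jN; have [_ _ _ /andP[r0 _]] := dlf.
rewrite /dot !big_ord_recl big_ord0 hqE hkE /= !lin0 // -!/(lin8 _ _).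
rewrite !lin8_c8 !lin8_nil !mul0r !addr0 !big_seq1 add0r !lin8_cons lin8_nil Vrho // Veta //.
rewrite (sum_flag Vflag) //; last exact: (allP (isT : all (mem flags) [:: fT0; fT1])).
rewrite (flag_adj A jN).
rewrite mulrDr; congr (_ + _).
have -> : rho * (query i / rho * V j fKY) = query i * V j fKY by field; rewrite gt_eqF.
by congr (_ * _); rewrite /query; field.
Qed.

Lemma div_beats i (j j0 : 'I_N) (c : R) : (i < N)%N ->
  dot hsp ms (V i) (V j) / Num.sqrt (lnS ms (V j)) + rho * c
    <= dot hsp ms (V i) (V j0) / Num.sqrt (lnS ms (V j0)) -> 1 / 100 * b ^+ 8 <= c ->
  j \notin best rnd N hsp (fun j => lnf rnd ms (V j)) i.
Proof.
move=> iN H hc; apply: (lookup_beats Hrnd Hp msok hmE (div_flagged iN)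
  (div_flagged (ltn_ord j)) (div_flagged (ltn_ord j0))).
  rewrite SE //; have /andP[_ h] := nub iN; have /andP[k0 k1] := KYg iN.
  have /andP[_ b14] := b_small Hc 14; have /andP[_ b2] := b_small Hc 2.
  have : V i fKY ^+ 2 <= 1 by rewrite expr_le1 //; move: k1 b2; wipe; lra.
  by move: h b14; wipe; lra.
apply: le_trans H; rewrite lerD2l.
have [bb _ /andP[r1 _] _ _] := Hc; have [_ _ _ /andP[r0 _]] := dlf.
have k : rho * (1 / 100 * b ^+ 8) <= rho * c by rewrite ler_pM2l.
apply: le_trans k; have /andP[b8 _] := b_small Hc 8.
have : 8 / 10 * b ^+ 7 * (1 / 100 * b ^+ 8) <= rho * (1 / 100 * b ^+ 8).
  by rewrite ler_pM2r //; move: b8; wipe; lra.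
have -> : 8 / 10 * b ^+ 7 * (1 / 100 * b ^+ 8) = 8 / 1000 * b ^+ 15.
  by rewrite (exprD b 7 8); field.
have := u_eta Hc (isT : 10 <= 30)%N.
have [_ _ e0 /andP[_ e2]] := consts_eta Hc.
have : eta * b ^+ 10 <= 121 / 100 * b ^+ 11 * b ^+ 10 by rewrite ler_pM2r //; case/andP: (b_small Hc 10).
rewrite -mulrA -exprD; have /andP[p0 p1] := bpow 15 6 bb.
have /andP[p15 _] := b_small Hc 15.
by move: p1 p15; wipe; lra.
Qed.

(** A position of another kind lacks the indicator, worth 1, while its coordinate term is at most
    1/10; already the first adjacency token beats it. *)
Lemma div_best_adj i (j : 'I_N) : (i < N)%N ->
  j \in best rnd N hsp (fun j => lnf rnd ms (V j)) i -> isadj n j.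
Proof.
move=> iN; apply: contraTT => nadj.
have [t0 t1 t2 t3] := thresholds Hp s t; have p1 : (1 < N)%N by lia.
have adj1 : isadj n 1 by rewrite /isadj t0.
have jN := ltn_ord j; have [_ _ _ /andP[r0 _]] := dlf.
apply: (@div_beats i j (Ordinal p1) (1 / 2)) => //; last first.
  by have /andP[_ b8] := b_small Hc 8; move: b8; wipe; lra.
rewrite !div_dot // (negbTE nadj) adj1 addr0 (_ : true%:R = 1 :> R) //.
rewrite -[leRHS]mulrA -[X in X + _ <= _]mulrA -mulrDr ler_pM2l // !SE //=.
have x1 := query_small iN; have y1 := KY_small p1 adj1; have /andP[y0 y0'] := KYg jN.
move: (query i / rho) x1 => X x1.
have /andP[n1 n1'] := nub p1; have /andP[n0 n0'] := nub jN.
have /andP[b3 b3'] := b_small Hc 3; have /andP[_ b2] := b_small Hc 2; have /andP[_ b14] := b_small Hc 14.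
have bx : 3 / 2 * b ^+ 3 <= 1 / 10 by move: b3'; wipe; lra.
have {}x1 := le_trans x1 bx; have {}y1 := le_trans y1 bx.
have w1 : 0 <= V 1 fKY ^+ 2 + nu 1 <= 1 / 10.
  have : V 1 fKY ^+ 2 <= 1 / 100.
    by move: y1; rewrite ler_norml; wipe => /andP[? ?]; nra.
  by move: n1 n1' b14 (sqr_ge0 (V 1 fKY)); wipe => *; apply/andP; split; lra.
have xy : - (1 / 100) <= X * V 1 fKY.
  have : `|X * V 1 fKY| <= 1 / 10 * (1 / 10) by rewrite normrM; apply: ler_pM.
  by rewrite ler_norml => /andP[h _]; apply: le_trans h; lra.
have A1 : X * V j fKY / Num.sqrt (1 + (V j fKY ^+ 2 + nu j)) <= 1 / 10.
  have s1 : 1 <= Num.sqrt (1 + (V j fKY ^+ 2 + nu j)).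
    by rewrite -[leLHS]sqrtr1 ler_sqrt; move: n0 (sqr_ge0 (V j fKY)); wipe; lra.
  rewrite ler_pdivrMr; last by move: s1; wipe; lra.
  have : X * V j fKY <= 1 / 10.
    have : `|X * V j fKY| <= 1 / 10 * 1.
      by rewrite normrM; apply: ler_pM => //; rewrite ger0_norm //; move: y0' b2; wipe; lra.
    by rewrite ler_norml => /andP[_ h]; apply: le_trans h _; lra.
  by move: s1; wipe; lra.
have w1' : 0 <= V 1 fKY ^+ 2 + nu 1 <= 1 by case/andP: w1 => -> /= w1; move: w1; wipe; lra.
have /andP[q1 _] := inv_sqrt_bounds w1'.
have q2 : 95 / 100 <= (Num.sqrt (1 + (V 1 fKY ^+ 2 + nu 1)))^-1.
  by case/andP: w1 => _ w1; move: q1 w1; wipe; lra.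
have : 99 / 100 * (95 / 100) <= (1 + X * V 1 fKY) / Num.sqrt (1 + (V 1 fKY ^+ 2 + nu 1)).
  by apply: ler_pM => //; move: xy; wipe; lra.
by rewrite [1 + _]addrC; move: A1; wipe; lra.
Qed.

(** The shifted query lies within (n-1)/2 of the right multiple of n and at least (n+1)/2 away from
    every other one. The squared distances differ by about dl^2 n, of order at least b^8, against an
    expansion error of order b^12. *)
Lemma div_best i (j j0 : 'I_N) : (i < N)%N -> isadj n j0 ->
  (n * j0.-1 <= (rank2 s i).-2 < n * j0.-1 + n)%N -> (2 <= rank2 s i)%N ->
  j \in best rnd N hsp (fun j => lnf rnd ms (V j)) i -> j = j0.
Proof.
move=> iN adj0 /andP[r1 r2] r2' jb; have adj := div_best_adj iN jb.
apply/eqP; apply: contraTT jb => ne.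
have jN := ltn_ord j; have j0N := ltn_ord j0; have [/andP[d1 d2] _ d0 /andP[r0 _]] := dlf.
apply: (@div_beats i j j0 (1 / 100 * b ^+ 8)) => //.
rewrite !div_dot // adj adj0 (_ : true%:R = 1 :> R) //.
rewrite -[leRHS]mulrA -[X in X + _ <= _]mulrA -mulrDr ler_pM2l // !SE //.
have x1 := query_small iN; have y1 := KY_small jN adj; have y0 := KY_small j0N adj0.
have /andP[b3 b3'] := b_small Hc 3.
have cs : (3 / 2 * b ^+ 3) ^+ 2 = 9 / 4 * b ^+ 6.
  by rewrite exprMn -exprM; congr (_ * _); field.
have /andP[b6 b6'] := b_small Hc 6; have /andP[_ p14] := bpow 6 8 (b_ok Hc).
have nb k : (k < N)%N -> 0 <= nu k <= (3 / 2 * b ^+ 3) ^+ 2.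
  by move=> kN; have /andP[h1 h2] := nub kN; rewrite h1 cs /=; move: h2 p14 b6; wipe; lra.
rewrite ![_ + 1]addrC; apply: (@nearest_cmp _ _ _ _ _ _ (3 / 2 * b ^+ 3)) => //.
- by move: b3; wipe; lra.
- by move: b3'; wipe; lra.
- exact: nb.
- exact: nb.
have q := query_fact iN; have k1 := KYa jN adj; have k0 := KYa j0N adj0.
move: (query i / rho) q x1 => X q x1; move: (V j fKY) (V j0 fKY) k1 k0 y1 y0 => Y1 Y0 k1 k0 y1 y0.
set x := (rank2 s i)%:R - 2 - (n%:R - 1) / 2 in q.
have xE : x = (rank2 s i).-2%:R - (n%:R - 1) / 2.
  by rewrite /x -[in LHS](subnK r2') natrD addrK subn2.
have n1 : 1 <= n%:R :> R by rewrite ler1n; apply: n_gt0 s.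
have D0 : `|x - n%:R * j0.-1%:R| <= (n%:R - 1) / 2.
  rewrite xE -natrM; have : ((rank2 s i).-2.+1)%:R <= (n * j0.-1)%:R + n%:R :> R by rewrite -natrD ler_nat.
  have : (n * j0.-1)%:R <= (rank2 s i).-2%:R :> R by rewrite ler_nat.
  rewrite -natr1; move: ((n * j0.-1)%:R) ((rank2 s i).-2%:R) (n%:R) => a c m; wipe => h1 h2.
  by rewrite ler_norml; apply/andP; split; lra.
have D1 : (n%:R + 1) / 2 <= `|x - n%:R * j.-1%:R|.
  have : (j.-1 < j0.-1)%N || (j0.-1 < j.-1)%N.
    rewrite -neq_ltn; apply: contra ne => /eqP e; apply/eqP/val_inj.
    by case/andP: adj => j1 _; case/andP: adj0 => j2 _; rewrite -[LHS](prednK j1) -[RHS](prednK j2) e.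
  rewrite xE -natrM; case/orP=> lt.
    have : (n * j.-1)%:R + n%:R <= (rank2 s i).-2%:R :> R.
      by rewrite -natrD ler_nat addnC -mulnS; apply: leq_trans r1; rewrite leq_mul2l lt orbT.
    move: ((n * j.-1)%:R) ((rank2 s i).-2%:R) (n%:R) n1 => a c m; wipe => n1 h1.
    by apply: le_trans (ler_norm _); lra.
  have : (rank2 s i).-2%:R + 1 <= (n * j.-1)%:R :> R.
    by rewrite natr1 ler_nat; apply: leq_trans r2 _; rewrite addnC -mulnS leq_mul2l lt orbT.
  move: ((n * j.-1)%:R) ((rank2 s i).-2%:R) (n%:R) n1 => a c m; wipe => n1 h1.
  by rewrite -normrN; apply: le_trans (ler_norm _); lra.
have F0 : `|X - Y0| <= dl * ((n%:R - 1) / 2 + 2 * b ^+ 3).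
  have -> : X - Y0 = (X - dl * x) - (Y0 - dl * (n%:R * j0.-1%:R)) + dl * (x - n%:R * j0.-1%:R) by ring.
  apply: le_trans (ler_normD _ _) _; have := ler_normB (X - dl * x) (Y0 - dl * (n%:R * j0.-1%:R)).
  have : `|dl * (x - n%:R * j0.-1%:R)| <= dl * ((n%:R - 1) / 2).
    by rewrite normrM gtr0_norm // ler_pM2l.
  by move: q k0; wipe; lra.
have F1 : dl * ((n%:R + 1) / 2 - 2 * b ^+ 3) <= `|X - Y1|.
  have := ler_normD (X - Y1) ((dl * x - X) + (Y1 - dl * (n%:R * j.-1%:R))).
  have -> : X - Y1 + ((dl * x - X) + (Y1 - dl * (n%:R * j.-1%:R))) = dl * (x - n%:R * j.-1%:R) by ring.
  rewrite normrM gtr0_norm //; have := ler_normD (dl * x - X) (Y1 - dl * (n%:R * j.-1%:R)).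
  rewrite [`|dl * x - X|]distrC.
  have : dl * ((n%:R + 1) / 2) <= dl * `|x - n%:R * j.-1%:R| by rewrite ler_pM2l.
  by move: q k1; wipe; lra.
have G0 : (X - Y0) ^+ 2 <= (dl * ((n%:R - 1) / 2 + 2 * b ^+ 3)) ^+ 2.
  rewrite -(real_normK (num_real (X - Y0))); apply: lerXn2r; rewrite ?nnegrE //.
  by apply: le_trans F0.
have G1 : (dl * ((n%:R + 1) / 2 - 2 * b ^+ 3)) ^+ 2 <= (X - Y1) ^+ 2.
  rewrite -[leRHS](real_normK (num_real (X - Y1))); apply: lerXn2r; rewrite ?nnegrE //.
  by apply: mulr_ge0; [exact: ltW | move: n1 b3'; wipe; lra].
have GE : (dl * ((n%:R + 1) / 2 - 2 * b ^+ 3)) ^+ 2 - (dl * ((n%:R - 1) / 2 + 2 * b ^+ 3)) ^+ 2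
   = dl ^+ 2 * (n%:R * (1 - 4 * b ^+ 3)) by field; case: Hc => *; rewrite gt_eqF.
have n9 : 9 / 10 <= n%:R * (1 - 4 * b ^+ 3).
  have : 1 * (1 - 4 * b ^+ 3) <= n%:R * (1 - 4 * b ^+ 3) by rewrite ler_pM2r //; move: b3'; wipe; lra.
  by move: b3'; wipe; lra.
have d8 : 72 / 100 * b ^+ 8 <= dl ^+ 2.
  have : (85 / 100 * b ^+ 4) ^+ 2 <= dl ^+ 2.
    apply: lerXn2r; rewrite ?nnegrE ?(ltW d0) //.
    by have /andP[b4 _] := b_small Hc 4; move: b4; wipe; lra.
  have -> : (85 / 100 * b ^+ 4) ^+ 2 = 289 / 400 * b ^+ 8.
    by rewrite exprMn -exprM; congr (_ * _); field.
  by have /andP[b8 _] := b_small Hc 8; move: b8; wipe; lra.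
have k9 : 72 / 100 * b ^+ 8 * (9 / 10) <= dl ^+ 2 * (n%:R * (1 - 4 * b ^+ 3)).
  by apply: ler_pM => //; have /andP[b8 _] := b_small Hc 8; move: b8; wipe; lra.
have c4 : ((3 / 2 * b ^+ 3) ^+ 2) ^+ 2 = 81 / 16 * b ^+ 12.
  by rewrite cs exprMn -exprM; congr (_ * _); field.
rewrite c4; have /andP[_ h1] := nub j0N.
have /andP[_ p12] := bpow 8 4 (b_ok Hc); have /andP[_ p14'] := bpow 8 6 (b_ok Hc).
have /andP[b8 _] := b_small Hc 8.
by move: G0 G1 GE k9 h1 p12 p14' b8; wipe; lra.
Qed.

End DivHead.

End Division.

(** * Values fetched by the division heads *)

Section Values.
Variables (R : archiRcfType) (p : nat) (rnd : R -> R).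
Hypothesis Hrnd : correct_rounding p rnd.
Hypothesis Hp : (20 <= p)%N.
Variables (n : nat) (A : 'I_n -> 'I_n -> bool) (s t : 'I_n).
Notation N := (len s t).
Notation tok i := (tokn A s t i).
Variable V : nat -> nat -> R.
Hypothesis Vflag : forall i f, f \in flags -> V i f = (f == tok_flag (tok i))%:R.
Hypothesis Veq : eqns rnd N V (subs_of init_specs).
Notation u := (uerr R p).
Variables b rho tau eta : R.
Hypothesis Nb : N%:R * b = 1.
Hypothesis Hc : consts_ok b u rho tau eta.
Hypothesis Vrho : forall i, (i < N)%N -> V i fRHO = rho.
Hypothesis Vtau : forall i, (i < N)%N -> V i fTAU = tau.
Hypothesis Veta : forall i, (i < N)%N -> V i fETA = eta.

Let dlf := dl_facts Hc.

Definition rk i := (rank2 s i).-2.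

Lemma rk_adj i : isadj n i -> rk i = i.-1 /\ (i.-1 < n * n)%N.
Proof.
case/andP=> i0 iP; rewrite /rk /rank2 iP; split; first by case: i i0 iP.
by case: i i0 iP => // k _; rewrite /sPAD add1n ltnS.
Qed.

Lemma rk_pad i : ispad n i -> rk i = (i - sPAD n)%N /\ (rk i < n * n * n)%N.
Proof.
case/andP=> i0 iP; have E : rk i = (i - sPAD n)%N by rewrite /rk /rank2 ltnNge i0 /= iP.
split=> //; rewrite E ltn_subLR // (_ : n * n * n = n ^ 3)%N //.
by rewrite !expnS expn0 muln1 mulnA.
Qed.

Lemma rank2_ge2 i : isadj n i || ispad n i -> (2 <= rank2 s i)%N.
Proof.
case/orP=> /andP[i0 iP]; first by rewrite /rank2 iP; case: i i0 iP.
by rewrite /rank2 (_ : (i < sPAD n)%N = false) ?iP // ltnNge i0.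
Qed.

Lemma rk_lt i : isadj n i || ispad n i -> (rk i < n * n * n)%N.
Proof.
case/orP=> h; last by have [_] := rk_pad h.
have [-> h1] := rk_adj h; apply: leq_trans h1 _; rewrite leq_pmulr //; exact: n_gt0 s.
Qed.

Lemma adj_of_lt q : (q < n * n)%N -> exists2 j : 'I_N, (j : nat) = q.+1 & isadj n j.
Proof.
move=> qn; have [_ t1 t2 t3] := thresholds Hp s t.
have qP : (q.+1 < sPAD n)%N by rewrite /sPAD add1n ltnS.
have qN : (q.+1 < N)%N := ltn_trans (ltn_trans (ltn_trans qP t1) t2) t3.
by exists (Ordinal qN).
Qed.

Lemma quot_adj i : isadj n i || ispad n i ->
  exists j : 'I_N, [/\ (j : nat) = (rk i %/ n).+1, isadj n j &
    (n * j.-1 <= (rank2 s i).-2 < n * j.-1 + n)%N].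
Proof.
move=> /rk_lt r3; have n0 := n_gt0 s.
have [|j jE ja] := @adj_of_lt (rk i %/ n); first by rewrite ltn_divLR.
exists j; split=> //; rewrite jE /= -/(rk i) mulnC leq_trunc_div /=.
by rewrite addnC -mulSn; apply: ltn_ceil.
Qed.

Lemma sq_data x z : `|x| <= rho * z -> 0 <= z -> 0 <= x ^+ 2 <= rho ^+ 2 * z ^+ 2.
Proof.
have [_ _ _ /andP[r0 _]] := dlf.
move=> hx z0; rewrite sqr_ge0 -exprMn -(real_normK (num_real x)); apply: lerXn2r; rewrite ?nnegrE //.
by apply: mulr_ge0 => //; exact: ltW.
Qed.

(** The norm distorts eta m by a relative error of order b^6; since m <= N, this is an absolute
    error of order eta b^5. *)
Lemma form_val (f : lform) ms j (m c w : R) : all (fun g => (g < 56)%N) ms ->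
  (wnorm f <= 128)%N -> all (mem ms) (unzip1 f) -> (forall g, g \in ms -> `|V j g| <= 1) ->
  lnS ms (V j) = 1 + w -> 0 <= w <= 3 * b ^+ 6 ->
  `|lin8 f (V j) - eta * m| <= eta * c -> 0 <= m <= N%:R -> 0 <= c <= 1 ->
  `|rnd (ev f (lnf rnd ms (V j))) - eta * m| <= eta * (c + b ^+ 4 / 2).
Proof.
move=> m56 wf fm v1 SE /andP[w0 w1] L /andP[m0 m1] /andP[c0 c1].
have S : sumsq ms (V j) = 1 + w by rewrite -SE lnS0.
have [_ _ e0 _] := consts_eta Hc.
have := @form_approx R p rnd Hrnd Hp f ms (V j) 1 m56 wf fm ltr01 v1.
rewrite S expr1n => /(_ _) h; have {}h := h (ltac:(move: w0; wipe; lra)).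
have /andP[b6 b6'] := b_small Hc 6.
have w01 : 0 <= w <= 1 by rewrite w0 /=; move: w1 b6'; wipe; lra.
have /andP[q1 q2] := inv_sqrt_bounds w01.
set q := (Num.sqrt (1 + w))^-1 in h q1 q2.
have q1' : q <= 1.
  have : w ^+ 2 <= w by rewrite expr2 ler_piMr //; case/andP: w01.
  by move: q2 w0; wipe; lra.
have Lb : `|lin8 f (V j)| <= eta * (N%:R + 1).
  have k : 0 <= eta * m <= eta * N%:R by rewrite mulr_ge0 ?(ltW e0) //= ler_pM2l.
  have k2 : eta * c <= eta by rewrite -[leRHS]mulr1 ler_pM2l.
  case/andP: k => k k1; move: L; rewrite ler_distl ler_norml mulrDr mulr1 => /andP[h1 h2].
  by move: k k1 k2 h1 h2 e0; wipe => *; apply/andP; split; lra.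
have d1 : `|lin8 f (V j) * q - lin8 f (V j)| <= eta * (N%:R + 1) * (3 / 2 * b ^+ 6).
  rewrite -{2}[lin8 f (V j)]mulr1 -mulrBr normrM; apply: ler_pM => //.
  by rewrite distrC ger0_norm; move: q1 q1' w1; wipe; lra.
have bN : b ^+ 6 * N%:R = b ^+ 5 := bS Nb 5.
have d2 : eta * (N%:R + 1) * (3 / 2 * b ^+ 6) = eta * (3 / 2 * (b ^+ 5 + b ^+ 6)).
  by rewrite -mulrA; congr (_ * _); rewrite -bN; field.
have d3 : eta * (3 / 2 * (b ^+ 5 + b ^+ 6)) <= eta * (4 / 10 * b ^+ 4).
  rewrite ler_pM2l //; have /andP[_ p5] := bpow 4 1 (b_ok Hc); have /andP[_ p6] := bpow 4 2 (b_ok Hc).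
  have /andP[b4 _] := b_small Hc 4; move: p5 p6 b4; wipe; lra.
have u4 := u_eta Hc (isT : 4 <= 30)%N.
have k4 : 0 < eta * b ^+ 4 by rewrite mulr_gt0 //; case/andP: (b_small Hc 4).
move: h d1 L; rewrite d2 !ler_distl !mulrDr => /andP[a1 a2] /andP[a3 a4] /andP[a5 a6].
by move: d3 u4 k4 a1 a2 a3 a4 a5 a6; rewrite !mulrDr; wipe => *; apply/andP; split; lra.
Qed.

Section DivValue.
Variables (hsp : head_spec) (ms : seq nat).
Hypothesis hqE : hq hsp = q_div.
Hypothesis hkE : hk hsp = k_div.
Hypothesis hmE : hm hsp = false.
Hypothesis ms56 : all (fun g => (g < 56)%N) ms.
Hypothesis msok : okq hsp ms.
Hypothesis msle : forall j g, (j < N)%N -> g \in ms -> `|V j g| <= 1.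
Variable nu : nat -> R.
Hypothesis SE : forall j, (j < N)%N -> lnS ms (V j) = 1 + (V j fKY ^+ 2 + nu j).
Hypothesis nub : forall j, (j < N)%N -> 0 <= nu j <= 2 * b ^+ 14.
Variables (l : nat) (m : nat -> R) (c : R).
Hypothesis wf : (wnorm (nth [::] (hv hsp) l) <= 128)%N.
Hypothesis fm : all (mem ms) (unzip1 (nth [::] (hv hsp) l)).
Hypothesis c01 : 0 <= c <= 2 * b ^+ 4.
Hypothesis mN : forall j, (j < N)%N -> isadj n j -> 0 <= m j.-1 <= N%:R.
Hypothesis Lm : forall j, (j < N)%N -> isadj n j ->
  `|lin8 (nth [::] (hv hsp) l) (V j) - eta * m j.-1| <= eta * c.
Let Z j := lnf rnd ms (V j).

Lemma div_hval i (j : 'I_N) : (i < N)%N -> j \in best rnd N hsp Z i ->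
  isadj n j /\ `|hval rnd hsp Z l j - eta * m j.-1| <= eta * (c + b ^+ 4 / 2).
Proof.
move=> iN jb; have jN := ltn_ord j.
have adj := div_best_adj Hrnd Hp Vflag Veq Nb Hc Vrho Veta hqE hkE hmE ms56 msok msle SE nub iN jb.
split=> //; apply: (form_val (w := V j fKY ^+ 2 + nu j) ms56 wf fm _ (SE jN) _ (Lm jN adj) (mN jN adj)).
- by move=> g; apply: msle.
- have y := KY_small Hrnd Hp Vflag Veq Nb Hc Vrho Veta jN adj.
  have /andP[n0 n1] := nub jN; have /andP[b6 _] := b_small Hc 6.
  have /andP[_ p14] := bpow 6 8 (b_ok Hc).
  have y2 : V j fKY ^+ 2 <= (3 / 2 * b ^+ 3) ^+ 2.
    rewrite -(real_normK (num_real (V j fKY))); apply: lerXn2r; rewrite ?nnegrE //.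
    by apply: le_trans y.
  have : (3 / 2 * b ^+ 3) ^+ 2 = 9 / 4 * b ^+ 6 by rewrite exprMn -exprM; congr (_ * _); field.
  move: y2 n0 n1 b6 p14 (sqr_ge0 (V j fKY)); wipe => y2 *; apply/andP; split; lra.
- case/andP: c01 => -> /= c1; have /andP[_ b4] := b_small Hc 4; move: c1 b4; wipe; lra.
Qed.

Lemma div_hout i : (i < N)%N -> isadj n i || ispad n i ->
  `|hout rnd N hsp Z i l - eta * m (rk i %/ n)%N| <= eta * (c + b ^+ 4 * 6 / 10).
Proof.
move=> iN ap; have [j0 [j0E a0 r0]] := quot_adj ap.
have [_ _ e0 /andP[_ e1]] := consts_eta Hc; have j0N := ltn_ord j0.
have /andP[m0 m1] := mN j0N a0; rewrite j0E /= in m0 m1.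
have /andP[c0 c1] := c01; have /andP[b4 b4'] := b_small Hc 4.
have u4 := u_eta Hc (isT : 4 <= 30)%N.
have et := etaN Nb Hc; have /andP[_ b9] := b_small Hc 9; have /andP[_ b11] := b_small Hc 11.
have eN : 0 <= eta * m (rk i %/ n)%N <= eta * N%:R by rewrite mulr_ge0 ?(ltW e0) //= ler_pM2l.
apply: le_trans (hout_approx Hrnd Hp (e := eta * (c + b ^+ 4 / 2)) _ _ _ _) _ => //.
- by case/andP: eN => h1 h2; rewrite ger0_norm //; move: h2 et b9; wipe; lra.
- have : 0 <= eta * (c + b ^+ 4 / 2) <= eta * 1.
    rewrite mulr_ge0 ?ler_pM2l ?(ltW e0) //=; by move: c0 c1 b4 b4'; wipe; lra.
  by case/andP=> -> /=; move: e1 b11; wipe; lra.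
- move=> j jb; have [_ h] := div_hval iN jb.
  have jE := div_best Hrnd Hp Vflag Veq Nb Hc Vrho Veta hqE hkE hmE ms56 msok msle SE nub iN a0 r0 (rank2_ge2 ap) jb.
  by move: h; rewrite jE j0E.
have : 0 < eta * b ^+ 4 by exact: mulr_gt0.
by move: u4; rewrite !mulrDr; wipe; lra.
Qed.

(** At positions that are neither adjacency nor padding tokens the winner is not determined. It is
    still an adjacency token, so the fetched value is bounded and harmless in later norms. *)
Lemma div_bound i : (i < N)%N -> `|hout rnd N hsp Z i l| <= 12 / 10 * (eta * N%:R).
Proof.
move=> iN; have [_ _ e0 /andP[_ e1]] := consts_eta Hc.
have /andP[c0 c1] := c01; have /andP[b4 b4'] := b_small Hc 4.
have u4 := u_eta Hc (isT : 4 <= 30)%N; have N1 := N_ge1 R s t.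
have et := etaN Nb Hc; have /andP[_ b9] := b_small Hc 9.
have eN : eta <= eta * N%:R by rewrite ler_peMr // ltW.
have k : eta * b ^+ 4 <= eta * (1 / 5) ^+ 4 by rewrite ler_pM2l.
have kc : eta * c <= eta * (2 * b ^+ 4) by rewrite ler_pM2l.
rewrite -[hout _ _ _ _ _ _]subr0.
apply: le_trans (hout_approx Hrnd Hp (e := 11 / 10 * (eta * N%:R)) _ _ _ _) _ => //.
- by rewrite normr0.
- by move: et b9 eN e0; wipe => *; apply/andP; split; lra.
- move=> j jb; have [aj h] := div_hval iN jb; rewrite subr0.
  have /andP[m0 m1] := mN (ltn_ord j) aj.
  have k1 : 0 <= eta * m j.-1 <= eta * N%:R by rewrite mulr_ge0 ?(ltW e0) //= ler_pM2l.
  case/andP: k1 => k0 k1; move: h; rewrite ler_distl ler_norml mulrDr => /andP[h1 h2].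
  by move: h1 h2 k kc k0 k1 eN e0; rewrite !mulrA; wipe => *; apply/andP; split; lra.
by move: u4 k eN e0; wipe; lra.
Qed.

End DivValue.

End Values.

(** * Quotients, remainders and the digits of r in base n *)

Section Quotients.
Variables (R : archiRcfType) (p : nat) (rnd : R -> R).
Hypothesis Hrnd : correct_rounding p rnd.
Hypothesis Hp : (20 <= p)%N.
Variables (n : nat) (A : 'I_n -> 'I_n -> bool) (s t : 'I_n).
Notation N := (len s t).
Notation tok i := (tokn A s t i).
Variable V : nat -> nat -> R.
Hypothesis Vflag : forall i f, f \in flags -> V i f = (f == tok_flag (tok i))%:R.
Hypothesis Veq : eqns rnd N V (subs_of init_specs).
Notation u := (uerr R p).
Variables b rho tau eta : R.
Hypothesis Nb : N%:R * b = 1.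
Hypothesis Hc : consts_ok b u rho tau eta.
Hypothesis Vrho : forall i, (i < N)%N -> V i fRHO = rho.
Hypothesis Vtau : forall i, (i < N)%N -> V i fTAU = tau.
Hypothesis Veta : forall i, (i < N)%N -> V i fETA = eta.

Let E1f := E1_fact Hrnd Hp Vflag Veq Nb Hc Veta.
Let E2f := E2_fact Hrnd Hp Vflag Veq Nb Hc Veta.
Let E3f := E3_fact Hrnd Hp Vflag Veq Nb Hc Veta.
Let dlf := dl_facts Hc.
Notation dl := (eta / rho).
Notation gN := (12 / 10 * (dl * N%:R)).

Lemma gN_bounds : 0 <= gN <= 2 * b ^+ 3.
Proof. by have /andP[g0 g1] := dlN Nb Hc; have /andP[b3 _] := b_small Hc 3; move: g0 g1 b3; wipe => *; apply/andP; split; lra. Qed.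

Lemma eta_gN : rho * gN = 12 / 10 * (eta * N%:R).
Proof. by have [_ E _ _] := dlf; rewrite {2}E; ring. Qed.

Lemma data_bounds j : (j < N)%N ->
  [/\ `|eta| <= rho * gN, `|V j fE1| <= rho * gN, `|V j fE3| <= rho * gN & `|V j fE2| <= rho * (12 / 10 * b ^+ 2)].
Proof.
move=> jN; have [_ _ e0 _] := consts_eta Hc; have N1 := N_ge1 R s t; split.
- rewrite eta_gN gtr0_norm //; have : eta <= eta * N%:R by rewrite ler_peMr // ltW.
  by move: e0; wipe; lra.
- exact: (data_small Hc (isT : (0 < 12)%N) (E1f jN) (rank2_bounds R jN)).
- exact: (data_small Hc (isT : (0 < 12)%N) (E3f jN) (n1_bounds R Hp s t)).
- by have [_ [_]] := S14_gen Hrnd Hp Vflag Veq Nb Hc Vrho Veta jN.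
Qed.

(** Squared norm of the masked features other than flags and key. It acts as noise in the score and
    must stay far below the gap of order b^8. *)
Definition nuA j := eta ^+ 2 + V j fE1 ^+ 2 + V j fE2 ^+ 2 + V j fE3 ^+ 2 + rho ^+ 2.

Lemma nuA_bounds j : (j < N)%N -> 0 <= nuA j <= 15 / 10 * b ^+ 14.
Proof.
move=> jN; have [h0 h1 h3 h2] := data_bounds jN; have /andP[g0 g1] := gN_bounds.
have /andP[b2 b2'] := b_small Hc 2; have /andP[b3 b3'] := b_small Hc 3.
have /andP[q0 q0'] := sq_data Hc h0 g0; have /andP[q1 q1'] := sq_data Hc h1 g0.
have /andP[q3 q3'] := sq_data Hc h3 g0.
have b2n : 0 <= 12 / 10 * b ^+ 2 by move: b2; wipe; lra.
have /andP[q2 q2'] := sq_data Hc h2 b2n.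
have [_ _ /andP[r1 r2] _ _] := Hc.
have r14 : rho ^+ 2 <= 121 / 100 * b ^+ 14.
  have -> : 121 / 100 * b ^+ 14 = (11 / 10 * b ^+ 7) ^+ 2 by rewrite exprMn -exprM; congr (_ * _); field.
  have /andP[b7 _] := b_small Hc 7.
  by apply: lerXn2r; rewrite ?nnegrE //; move: b7 r1 r2; wipe; lra.
have k2 : (12 / 10 * b ^+ 2) ^+ 2 <= 1 / 100.
  have : (12 / 10 * b ^+ 2) ^+ 2 <= (12 / 10 * (1 / 5) ^+ 2) ^+ 2.
    by apply: lerXn2r; rewrite ?nnegrE //; move: b2'; wipe; lra.
  by wipe; lra.
have k3 : gN ^+ 2 <= 1 / 1000.
  have : gN ^+ 2 <= (2 * (1 / 5) ^+ 3) ^+ 2.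
    by apply: lerXn2r; rewrite ?nnegrE //; move: g1 b3'; wipe; lra.
  by wipe; lra.
have r0 := sqr_ge0 rho.
have k2' : rho ^+ 2 * (12 / 10 * b ^+ 2) ^+ 2 <= rho ^+ 2 * (1 / 100) by rewrite ler_wpM2l.
have k3' : rho ^+ 2 * gN ^+ 2 <= rho ^+ 2 * (1 / 1000) by rewrite ler_wpM2l.
have /andP[b14 _] := b_small Hc 14.
by rewrite /nuA; move: q0 q0' q1 q1' q2 q2' q3 q3' k2' k3' r0 r14 b14; wipe => *; apply/andP; split; lra.
Qed.

Lemma flag_le1 j g : g \in flags -> `|V j g| <= 1.
Proof. by move=> /Vflag ->; case: (_ == _); rewrite ?normr0 ?normr1. Qed.

Lemma mask_le l j : (forall g, g \in l -> `|V j g| <= 1) ->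
  forall g, g \in flags ++ l -> `|V j g| <= 1.
Proof. by move=> H g; rewrite mem_cat => /orP[/flag_le1|/H]. Qed.

Lemma rho_gN_le (x : R) : `|x| <= rho * gN -> `|x| <= 1.
Proof.
move=> h; apply: le_trans h _; have [_ _ _ /andP[r0 r1]] := dlf; have /andP[g0 g1] := gN_bounds.
have /andP[_ b3] := b_small Hc 3; have : rho * gN <= 1 / 10 * 1 by apply: ler_pM => //; move: r0 g1 b3; wipe; lra.
by lra.
Qed.

Lemma key_mask_le j g : (j < N)%N -> g \in key_mask -> `|V j g| <= 1.
Proof.
move=> jN; apply: mask_le => // f; have [h0 h1 h3 h2] := data_bounds jN.
have [_ _ _ /andP[r0 r1]] := dlf; have /andP[_ b2] := b_small Hc 2.
rewrite !inE => /orP[/eqP->|/orP[/eqP->|/orP[/eqP->|/orP[/eqP->|/orP[/eqP->|/eqP->]]]]].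
- have /andP[k0 k1] := KY_gen Hrnd Hp Vflag Veq Nb Hc Vrho Veta jN.
  by rewrite ger0_norm //; move: k1 b2; wipe; lra.
- by rewrite Veta //; apply: rho_gN_le.
- exact: rho_gN_le.
- apply: le_trans h2 _; have : rho * (12 / 10 * b ^+ 2) <= 1 / 10 * 1.
    by apply: ler_pM; move: r0 r1 b2; have /andP[b0 _] := b_small Hc 2; move: b0; wipe; lra.
  by lra.
- exact: rho_gN_le.
- by rewrite Vrho // gtr0_norm //; move: r1; wipe; lra.
Qed.

Lemma key_mask_S j : (j < N)%N -> lnS key_mask (V j) = 1 + (V j fKY ^+ 2 + nuA j).
Proof.
move=> jN; rewrite lnS0 // big_cat /= (flags_sq Vflag) !big_cons big_nil Veta // Vrho // /nuA addr0.
by rewrite !addrA.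
Qed.

Definition headA := nth no_head (hs (nth no_layer init_specs 14)) 0.

Lemma V_QQ i : V i fQQ = hout rnd N headA (fun j => lnf rnd key_mask (V j)) i 0.
Proof. exact: (eqns_nth Veq (isT : 28 < 34)%N) i fQQ 0%N 0%N isT. Qed.
Lemma V_NQ i : V i fNQ = hout rnd N headA (fun j => lnf rnd key_mask (V j)) i 1.
Proof. exact: (eqns_nth Veq (isT : 28 < 34)%N) i fNQ 0%N 1%N isT. Qed.

Lemma nuA_bounds2 j : (j < N)%N -> 0 <= nuA j <= 2 * b ^+ 14.
Proof.
move=> jN; have /andP[-> h] := nuA_bounds jN; have /andP[b14 _] := b_small Hc 14.
by move: h b14; wipe; lra.
Qed.

Lemma rank2_adj j : isadj n j -> (rank2 s j)%:R = (j.-1)%:R + 2 :> R.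
Proof. by case: j => [//|j] aj; have /andP[_ h] := aj; rewrite /rank2 h -natrD addn2. Qed.

Lemma rank2_rk i : isadj n i || ispad n i -> (rank2 s i)%:R = (rk s i)%:R + 2 :> R.
Proof. by move=> ap; rewrite -natrD addn2 /rk; case: (rank2 s i) (rank2_ge2 s ap) => [|[]]. Qed.

Lemma c_bounds (k : R) : 0 <= k <= 1 -> 0 <= k * b ^+ 4 <= 2 * b ^+ 4.
Proof. by have /andP[b4 _] := b_small Hc 4; case/andP=> h1 h2; rewrite mulr_ge0 ?(ltW b4) //= ler_pM2r //; apply: le_trans h2 _; rewrite ler1n. Qed.

Lemma b_rel k j : (k <= j)%N -> 0 <= b ^+ j <= (1 / 5) ^+ (j - k) * b ^+ k.
Proof. by move=> kj; have := bpow k (j - k) (b_ok Hc); rewrite subnKC // => /andP[h1 h2]; rewrite (ltW h1) h2. Qed.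

Lemma adj_le j q : isadj n j -> (q <= j.-1)%N -> 0 <= (q%:R : R) <= N%:R.
Proof.
move=> aj qj; rewrite ler0n ler_nat /=; apply: leq_trans qj _; have := adj_index Hp s t aj.
by apply: leq_trans; rewrite leq_pmull // (n_gt0 s).
Qed.

Let divA l m c := fun wf fm c01 mN Lm => @div_hout R p rnd Hrnd Hp n A s t V Vflag Veq b rho tau eta Nb Hc Vrho Veta
  headA key_mask erefl erefl erefl isT isT key_mask_le nuA key_mask_S nuA_bounds2 l m c wf fm c01 mN Lm.
Let bndA l m c := fun wf fm c01 mN Lm => @div_bound R p rnd Hrnd Hp n A s t V Vflag Veq b rho tau eta Nb Hc Vrho Veta
  headA key_mask erefl erefl erefl isT isT key_mask_le nuA key_mask_S nuA_bounds2 l m c wf fm c01 mN Lm.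

Lemma QQ_lin j : (j < N)%N -> isadj n j ->
  `|lin8 (nth [::] (hv headA) 0) (V j) - eta * (j.-1)%:R| <= eta * (1 / 10 * b ^+ 4).
Proof.
move=> jN aj; have := E1f jN; rewrite !lin8_cons lin8_nil Veta // (rank2_adj aj).
have -> : 8%:~R / 8 * V j fE1 + ((- 16%:Z)%:~R / 8 * eta + 0) - eta * (j.-1)%:R
  = V j fE1 - eta * ((j.-1)%:R + 2) by field.
have [_ _ e0 _] := consts_eta Hc.
move/le_trans; apply; rewrite ler_pM2l //; have /andP[h0 h] := b_rel (isT : 4 <= 12)%N.
by have /andP[b4 _] := b_small Hc 4; move: h b4; wipe; lra.
Qed.

Lemma NQ_lin j : (j < N)%N -> isadj n j ->
  `|lin8 (nth [::] (hv headA) 1) (V j) - eta * (n * j.-1)%:R| <= eta * (1 / 10 * b ^+ 4).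
Proof.
move=> jN aj; rewrite (l_keyE Veta jN); have := E1f jN; have := E2f jN; have := E3f jN.
rewrite (rank2_adj aj) -[n.+1%:R]natr1 natrM; move: (V j fE1) (V j fE2) (V j fE3) => x1 x2 x3.
move: (j.-1)%:R n%:R => q m h3 h2 h1.
have -> : x2 - x1 - 2 * x3 + 2 * eta - eta * (m * q) = (x2 - eta * ((m + 1) * (q + 2)))
   - (x1 - eta * (q + 2)) - 2 * (x3 - eta * (m + 1)) by ring.
have [_ _ e0 _] := consts_eta Hc.
have k : eta * (b ^+ 10 + 3 * b ^+ 12) <= eta * (1 / 10 * b ^+ 4).
  rewrite ler_pM2l //; have /andP[_ k1] := b_rel (isT : 4 <= 12)%N; have /andP[_ k2] := b_rel (isT : 4 <= 10)%N.
  by have /andP[b4 _] := b_small Hc 4; move: k1 k2 b4; wipe; lra.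
by move: h1 h2 h3 k; rewrite !ler_norml; wipe => /andP[? ?] /andP[? ?] /andP[? ?] ?; apply/andP; split; lra.
Qed.

Lemma QQ_fact i : (i < N)%N -> isadj n i || ispad n i ->
  `|V i fQQ - eta * (rk s i %/ n)%:R| <= eta * (7 / 10 * b ^+ 4).
Proof.
move=> iN ap; rewrite V_QQ.
have k : 0 <= 1 / 10 * b ^+ 4 <= 2 * b ^+ 4 by apply: c_bounds; lra.
have := @divA 0%N (fun q => q%:R) (1 / 10 * b ^+ 4) isT isT k _ QQ_lin i iN ap.
move=> /(_ (fun j _ aj => adj_le aj (leqnn _))).
by have [_ _ e0 _] := consts_eta Hc; move/le_trans; apply; rewrite ler_pM2l //; wipe; lra.
Qed.

Lemma NQ_fact i : (i < N)%N -> isadj n i || ispad n i ->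
  `|V i fNQ - eta * (n * (rk s i %/ n))%:R| <= eta * (7 / 10 * b ^+ 4).
Proof.
move=> iN ap; rewrite V_NQ.
have k : 0 <= 1 / 10 * b ^+ 4 <= 2 * b ^+ 4 by apply: c_bounds; lra.
have := @divA 1%N (fun q => (n * q)%:R) (1 / 10 * b ^+ 4) isT isT k _ NQ_lin i iN ap.
have mN j : (j < N)%N -> isadj n j -> 0 <= ((n * j.-1)%:R : R) <= N%:R.
  by move=> _ aj; rewrite ler0n ler_nat /=; apply: adj_index.
move=> /(_ mN).
by have [_ _ e0 _] := consts_eta Hc; move/le_trans; apply; rewrite ler_pM2l //; wipe; lra.
Qed.

Lemma QQ_bound i : (i < N)%N -> `|V i fQQ| <= rho * gN.
Proof.
move=> iN; rewrite V_QQ eta_gN.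
have k : 0 <= 1 / 10 * b ^+ 4 <= 2 * b ^+ 4 by apply: c_bounds; lra.
exact: @bndA 0%N (fun q => q%:R) (1 / 10 * b ^+ 4) isT isT k (fun j _ aj => adj_le aj (leqnn _)) QQ_lin i iN.
Qed.

Lemma NQ_bound i : (i < N)%N -> `|V i fNQ| <= rho * gN.
Proof.
move=> iN; rewrite V_NQ eta_gN.
have k : 0 <= 1 / 10 * b ^+ 4 <= 2 * b ^+ 4 by apply: c_bounds; lra.
have mN j : (j < N)%N -> isadj n j -> 0 <= ((n * j.-1)%:R : R) <= N%:R.
  by move=> _ aj; rewrite ler0n ler_nat /=; apply: adj_index.
exact: @bndA 1%N (fun q => (n * q)%:R) (1 / 10 * b ^+ 4) isT isT k mN NQ_lin i iN.
Qed.

Lemma l_remE i : (i < N)%N -> lin8 l_rem (V i) = V i fE1 - 2 * eta - V i fNQ.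
Proof. by move=> iN; rewrite !lin8_cons lin8_nil Veta //; field. Qed.

Lemma REM_fact i : (i < N)%N -> isadj n i || ispad n i ->
  `|lin8 l_rem (V i) - eta * (rk s i %% n)%:R| <= eta * (8 / 10 * b ^+ 4).
Proof.
move=> iN ap; have h1 := E1f iN; have h2 := NQ_fact iN ap; rewrite (rank2_rk ap) in h1.
rewrite l_remE //; have E : (rk s i)%:R = (n * (rk s i %/ n))%:R + (rk s i %% n)%:R :> R.
  by rewrite -natrD mulnC -divn_eq.
rewrite E in h1; move: h1 h2; move: (n * _)%:R (rk s i %% n)%:R (V i fE1) (V i fNQ) => q r x y h1 h2.
have -> : x - 2 * eta - y - eta * r = (x - eta * (q + r + 2)) - (y - eta * q) by ring.
have [_ _ e0 _] := consts_eta Hc.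
have k : eta * b ^+ 12 <= eta * (1 / 10 * b ^+ 4).
  rewrite ler_pM2l //; have /andP[_ k1] := b_rel (isT : 4 <= 12)%N.
  by have /andP[b4 _] := b_small Hc 4; move: k1 b4; wipe; lra.
by move: h1 h2 k; rewrite !ler_norml; wipe => /andP[? ?] /andP[? ?] ?; apply/andP; split; lra.
Qed.

Definition maskB := key_mask ++ [:: fQQ; fNQ].
(** Query and keys are those of [headA], so the winner is again the adjacency token q = r/n; its
    values are now its own quotient and remainder by n. *)
Definition headB := nth no_head (hs (nth no_layer init_specs 15)) 0.
Definition nuB j := nuA j + V j fQQ ^+ 2 + V j fNQ ^+ 2.

Lemma maskB_le j g : (j < N)%N -> g \in maskB -> `|V j g| <= 1.
Proof.
move=> jN; rewrite mem_cat => /orP[|]; first exact: key_mask_le.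
rewrite !inE => /orP[/eqP->|/eqP->]; apply: rho_gN_le; [exact: QQ_bound | exact: NQ_bound].
Qed.

Lemma maskB_S j : (j < N)%N -> lnS maskB (V j) = 1 + (V j fKY ^+ 2 + nuB j).
Proof.
move=> jN; rewrite lnS0 // big_cat /= -lnS0 // key_mask_S // !big_cons big_nil /nuB addr0.
by rewrite !addrA.
Qed.

Lemma nuB_bounds j : (j < N)%N -> 0 <= nuB j <= 2 * b ^+ 14.
Proof.
move=> jN; have /andP[a0 a1] := nuA_bounds jN; have /andP[g0 g1] := gN_bounds.
have /andP[q0 q0'] := sq_data Hc (QQ_bound jN) g0; have /andP[q1 q1'] := sq_data Hc (NQ_bound jN) g0.
have [_ _ /andP[r1 r2] _ _] := Hc; have /andP[_ b3'] := b_small Hc 3.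
have r14 : rho ^+ 2 <= 121 / 100 * b ^+ 14.
  have -> : 121 / 100 * b ^+ 14 = (11 / 10 * b ^+ 7) ^+ 2 by rewrite exprMn -exprM; congr (_ * _); field.
  have /andP[b7 _] := b_small Hc 7.
  by apply: lerXn2r; rewrite ?nnegrE //; move: b7 r1 r2; wipe; lra.
have k3 : gN ^+ 2 <= 1 / 1000.
  have : gN ^+ 2 <= (2 * (1 / 5) ^+ 3) ^+ 2.
    by apply: lerXn2r; rewrite ?nnegrE //; move: g1 b3'; wipe; lra.
  by wipe; lra.
have k3' : rho ^+ 2 * gN ^+ 2 <= rho ^+ 2 * (1 / 1000) by rewrite ler_wpM2l // sqr_ge0.
have /andP[b14 _] := b_small Hc 14.
by rewrite /nuB; move: a0 a1 q0 q0' q1 q1' k3' r14 b14; wipe => *; apply/andP; split; lra.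
Qed.

Lemma V_II i : V i fII = hout rnd N headB (fun j => lnf rnd maskB (V j)) i 0.
Proof. exact: (eqns_nth Veq (isT : 30 < 34)%N) i fII 0%N 0%N isT. Qed.
Lemma V_JJ i : V i fJJ = hout rnd N headB (fun j => lnf rnd maskB (V j)) i 1.
Proof. exact: (eqns_nth Veq (isT : 30 < 34)%N) i fJJ 0%N 1%N isT. Qed.

Let divB l m c := fun wf fm c01 mN Lm => @div_hout R p rnd Hrnd Hp n A s t V Vflag Veq b rho tau eta Nb Hc Vrho Veta
  headB maskB erefl erefl erefl isT isT maskB_le nuB maskB_S nuB_bounds l m c wf fm c01 mN Lm.
Let bndB l m c := fun wf fm c01 mN Lm => @div_bound R p rnd Hrnd Hp n A s t V Vflag Veq b rho tau eta Nb Hc Vrho Veta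
  headB maskB erefl erefl erefl isT isT maskB_le nuB maskB_S nuB_bounds l m c wf fm c01 mN Lm.

Lemma II_lin j : (j < N)%N -> isadj n j ->
  `|lin8 (nth [::] (hv headB) 0) (V j) - eta * (j.-1 %/ n)%:R| <= eta * (8 / 10 * b ^+ 4).
Proof.
move=> jN aj; rewrite lin8_c8 big_seq1; have ap : isadj n j || ispad n j by rewrite aj.
have := QQ_fact jN ap; have [-> _] := rk_adj s aj; move/le_trans; apply.
have [_ _ e0 _] := consts_eta Hc; rewrite ler_pM2l //; have /andP[b4 _] := b_small Hc 4; move: b4; wipe; lra.
Qed.

Lemma JJ_lin j : (j < N)%N -> isadj n j ->
  `|lin8 (nth [::] (hv headB) 1) (V j) - eta * (j.-1 %% n)%:R| <= eta * (8 / 10 * b ^+ 4).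
Proof.
move=> jN aj; have ap : isadj n j || ispad n j by rewrite aj.
by have := REM_fact jN ap; have [-> _] := rk_adj s aj.
Qed.

Let kB : 0 <= 8 / 10 * b ^+ 4 <= 2 * b ^+ 4.
Proof. by apply: c_bounds; lra. Qed.
Let mI j : (j < N)%N -> isadj n j -> 0 <= ((j.-1 %/ n)%:R : R) <= N%:R.
Proof. by move=> _ aj; apply: adj_le aj _; apply: leq_div. Qed.
Let mJ j : (j < N)%N -> isadj n j -> 0 <= ((j.-1 %% n)%:R : R) <= N%:R.
Proof. by move=> _ aj; apply: adj_le aj _; apply: leq_mod. Qed.

Lemma II_fact i : (i < N)%N -> isadj n i || ispad n i ->
  `|V i fII - eta * (rk s i %/ n %/ n)%:R| <= eta * (14 / 10 * b ^+ 4).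
Proof.
move=> iN ap; rewrite V_II.
have := @divB 0%N (fun q => (q %/ n)%:R) (8 / 10 * b ^+ 4) isT isT kB mI II_lin i iN ap.
by have [_ _ e0 _] := consts_eta Hc; move/le_trans; apply; rewrite ler_pM2l //; wipe; lra.
Qed.

Lemma JJ_fact i : (i < N)%N -> isadj n i || ispad n i ->
  `|V i fJJ - eta * ((rk s i %/ n) %% n)%:R| <= eta * (14 / 10 * b ^+ 4).
Proof.
move=> iN ap; rewrite V_JJ.
have := @divB 1%N (fun q => (q %% n)%:R) (8 / 10 * b ^+ 4) isT isT kB mJ JJ_lin i iN ap.
by have [_ _ e0 _] := consts_eta Hc; move/le_trans; apply; rewrite ler_pM2l //; wipe; lra.
Qed.

Lemma II_bound i : (i < N)%N -> `|V i fII| <= rho * gN.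
Proof.
move=> iN; rewrite V_II eta_gN.
exact: @bndB 0%N (fun q => (q %/ n)%:R) (8 / 10 * b ^+ 4) isT isT kB mI II_lin i iN.
Qed.

Lemma JJ_bound i : (i < N)%N -> `|V i fJJ| <= rho * gN.
Proof.
move=> iN; rewrite V_JJ eta_gN.
exact: @bndB 1%N (fun q => (q %% n)%:R) (8 / 10 * b ^+ 4) isT isT kB mJ JJ_lin i iN.
Qed.

End Quotients.

(** * Coordinates rescaled to keys *)

Section Keys.
Variables (R : archiRcfType) (p : nat) (rnd : R -> R).
Hypothesis Hrnd : correct_rounding p rnd.
Hypothesis Hp : (20 <= p)%N.
Variables (n : nat) (A : 'I_n -> 'I_n -> bool) (s t : 'I_n).
Notation N := (len s t).
Notation tok i := (tokn A s t i).
Variable V : nat -> nat -> R.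
Hypothesis Vflag : forall i f, f \in flags -> V i f = (f == tok_flag (tok i))%:R.
Hypothesis Veq : eqns rnd N V (subs_of init_specs).
Notation u := (uerr R p).
Variables b rho tau eta : R.
Hypothesis Nb : N%:R * b = 1.
Hypothesis Hc : consts_ok b u rho tau eta.
Hypothesis Vrho : forall i, (i < N)%N -> V i fRHO = rho.
Hypothesis Vtau : forall i, (i < N)%N -> V i fTAU = tau.
Hypothesis Veta : forall i, (i < N)%N -> V i fETA = eta.

Let dlf := dl_facts Hc.
Notation dl := (eta / rho).
Notation gN := (12 / 10 * (dl * N%:R)).
Let gNb := gN_bounds Nb Hc.
Let dat := data_bounds Hrnd Hp Vflag Veq Nb Hc Vrho Veta.
Let QQb := QQ_bound Hrnd Hp Vflag Veq Nb Hc Vrho Veta.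
Let NQb := NQ_bound Hrnd Hp Vflag Veq Nb Hc Vrho Veta.
Let IIb := II_bound Hrnd Hp Vflag Veq Nb Hc Vrho Veta.
Let JJb := JJ_bound Hrnd Hp Vflag Veq Nb Hc Vrho Veta.

Definition ms16 := [:: fRHO; fQQ; fNQ; fE1; fETA; fII; fJJ].

Lemma S16 i : (i < N)%N -> rho ^+ 2 <= sumsq ms16 (V i) <= rho ^+ 2 * (1 + 24 * b ^+ 6) /\
  (forall g, g \in ms16 -> `|V i g| <= rho).
Proof.
move=> iN; have [h0 h1 _ _] := dat iN; have h2 := QQb iN; have h3 := NQb iN; have h4 := IIb iN; have h5 := JJb iN.
have /andP[g0 g1] := gNb; have [_ _ _ /andP[r0 _]] := dlf; have /andP[b3 b3'] := b_small Hc 3.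
have G : gN ^+ 2 <= 4 * b ^+ 6.
  have -> : 4 * b ^+ 6 = (2 * b ^+ 3) ^+ 2 by rewrite exprMn -exprM; congr (_ * _); field.
  by apply: lerXn2r; rewrite ?nnegrE //; apply: le_trans g1.
have rG : rho ^+ 2 * gN ^+ 2 <= rho ^+ 2 * (4 * b ^+ 6) by rewrite ler_wpM2l ?sqr_ge0.
have sq x : `|x| <= rho * gN -> 0 <= x ^+ 2 <= rho ^+ 2 * gN ^+ 2 by move=> h; apply: (sq_data Hc h g0).
have /andP[a0 a0'] := sq _ h0; have /andP[a1 a1'] := sq _ h1; have /andP[a2 a2'] := sq _ h2.
have /andP[a3 a3'] := sq _ h3; have /andP[a4 a4'] := sq _ h4; have /andP[a5 a5'] := sq _ h5.
have S : sumsq ms16 (V i) = rho ^+ 2 + (V i fQQ ^+ 2 + V i fNQ ^+ 2 + V i fE1 ^+ 2 + eta ^+ 2 + V i fII ^+ 2 + V i fJJ ^+ 2).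
  by rewrite /sumsq !big_cons big_nil addr0 Veta // Vrho // !addrA.
split.
  rewrite S mulrDr mulr1; move: rG a0 a0' a1 a1' a2 a2' a3 a3' a4 a4' a5 a5'; wipe => *.
  by apply/andP; split; lra.
have big (x : R) : `|x| <= rho * gN -> `|x| <= rho.
  by move=> hx; apply: le_trans hx _; apply: ler_piMr; [exact: ltW | move: g1 b3'; wipe; lra].
move=> f; rewrite !inE.
case/orP=> [/eqP->|/orP[/eqP->|/orP[/eqP->|/orP[/eqP->|/orP[/eqP->|/orP[/eqP->|/eqP->]]]]]];
  rewrite ?Vrho ?Veta //; try exact: big.
by rewrite gtr0_norm.
Qed.

Lemma amp16 i f m form : (i < N)%N ->
  (f, [:: (m, 64%:Z)]) \in fo (nth no_layer init_specs 15) ->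
  nth [::] (hd (nth no_layer init_specs 15)) m = form ->
  (wnorm form <= 128)%N -> all (mem ms16) (unzip1 form) ->
  `|V i f - relu (lin8 form (V i) / rho)| <= `|lin8 form (V i)| / rho * (12 * b ^+ 6) + 3 * u.
Proof.
move=> iN fin hform wf fm; have [hS vD] := S16 iN.
have [_ _ _ /andP[r0 _]] := dlf; have /andP[S1 _] := hS.
have /andP[_ b6] := b_small Hc 6; have e1 : 24 * b ^+ 6 <= 1 by move: b6; wipe; lra.
have DS : rho ^+ 2 <= 4 * sumsq ms16 (V i) by move: S1 (sqr_ge0 rho); wipe; lra.
have h := V_ff Hrnd Hp Veq (erefl : nth (SA no_layer) (subs_of init_specs) 31 = SF (nth no_layer init_specs 15))
  isT fin erefl hform isT wf fm r0 vD DS.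
have h2 := relu_lip (div_sqrt_approx (lin8 form (V i)) r0 hS e1).
have := ler_normD (V i f - relu (lin8 form (V i) / Num.sqrt (sumsq ms16 (V i))))
  (relu (lin8 form (V i) / Num.sqrt (sumsq ms16 (V i))) - relu (lin8 form (V i) / rho)).
rewrite addrA subrK; rewrite -/ms16 in h.
have -> : 12 * b ^+ 6 = 24 * b ^+ 6 / 2 by field.
by move: h h2; wipe; lra.
Qed.

Section Key.
Variables (i f m : nat) (form : lform).
Hypothesis iN : (i < N)%N.
Hypothesis fin : (f, [:: (m, 64%:Z)]) \in fo (nth no_layer init_specs 15).
Hypothesis hform : nth [::] (hd (nth no_layer init_specs 15)) m = form.
Hypothesis wf : (wnorm form <= 128)%N.
Hypothesis fm : all (mem ms16) (unzip1 form).

Lemma key_fact k : (k <= N)%N -> `|lin8 form (V i) - eta * k%:R| <= eta * (14 / 10 * b ^+ 4) ->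
  `|V i f - dl * k%:R| <= dl * b ^+ 3.
Proof.
move=> kN h; have am := amp16 iN fin hform wf fm; have [_ E d0 /andP[r0 _]] := dlf.
have L : `|lin8 form (V i) / rho - dl * k%:R| <= dl * (14 / 10 * b ^+ 4).
  have -> : lin8 form (V i) / rho - dl * k%:R = (lin8 form (V i) - eta * k%:R) / rho by field; rewrite gt_eqF.
  by rewrite normrM [`|rho^-1|]gtr0_norm ?invr_gt0 // ler_pdivrMr // mulrAC -E.
have kp : 0 <= dl * k%:R <= dl * N%:R by rewrite mulr_ge0 ?ler0n ?(ltW d0) //= ler_pM2l // ler_nat.
case/andP: kp => k0 k1; have := relu_lip L; rewrite (relu_pos k0) => rl.
have /andP[b3 _] := b_small Hc 3; have /andP[_ p4] := bpow 3 1 (b_ok Hc).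
have /andP[_ p5] := bpow 3 2 (b_ok Hc); have /andP[_ p6] := bpow 3 3 (b_ok Hc).
have /andP[b4 b4'] := b_small Hc 4.
have Lb : `|lin8 form (V i) / rho| <= dl * (N%:R + 1).
  have k2 : dl * (14 / 10 * b ^+ 4) <= dl by rewrite -[leRHS]mulr1 ler_pM2l //; move: b4'; wipe; lra.
  move: L; rewrite ler_distl ler_norml mulrDr mulr1; move: k0 k1 k2 d0; wipe => ? ? ? ? /andP[? ?].
  by apply/andP; split; lra.
have bN : b ^+ 6 * N%:R = b ^+ 5 := bS Nb 5.
have e1 : `|lin8 form (V i)| / rho * (12 * b ^+ 6) <= dl * (12 * (b ^+ 5 + b ^+ 6)).
  have -> : dl * (12 * (b ^+ 5 + b ^+ 6)) = dl * (N%:R + 1) * (12 * b ^+ 6) by rewrite -bN; ring.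
  rewrite -[rho in leLHS]gtr0_norm // -normf_div; apply: ler_wpM2r => //.
  by have /andP[b6 _] := b_small Hc 6; move: b6; wipe; lra.
have u3 := u_dl Hc (isT : 3 <= 30)%N.
have e2 : dl * (14 / 10 * b ^+ 4 + 12 * (b ^+ 5 + b ^+ 6)) <= dl * (9 / 10 * b ^+ 3).
  by rewrite ler_pM2l //; move: p4 p5 p6 b3; wipe; lra.
have k3 : 0 < dl * b ^+ 3 by exact: mulr_gt0.
have := ler_normD (V i f - relu (lin8 form (V i) / rho)) (relu (lin8 form (V i) / rho) - dl * k%:R).
rewrite addrA subrK; move: am rl e1 e2 u3 k3; rewrite !mulrDr; wipe; lra.
Qed.

Lemma key_bound : `|lin8 form (V i)| <= 4 * (rho * gN) -> 0 <= V i f <= 2 * b ^+ 2.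
Proof.
move=> h; have am := amp16 iN fin hform wf fm; have [_ E d0 /andP[r0 _]] := dlf.
rewrite (@V_ff_ge0 R rnd n s t V Veq 31 _ f m i (erefl : _ = SF (nth no_layer init_specs 15)) isT fin) /=.
have /andP[g0 g1] := gNb; have /andP[b2 b2'] := b_small Hc 2; have /andP[b6 b6'] := b_small Hc 6.
have L : `|lin8 form (V i)| / rho <= 4 * gN by rewrite ler_pdivrMr //; move: h; wipe; lra.
have /andP[_ p3] := bpow 2 1 (b_ok Hc).
have e1 : `|lin8 form (V i)| / rho * (12 * b ^+ 6) <= 4 * gN * (1 / 100).
  have c6 : 12 * b ^+ 6 <= 1 / 100 by move: b6'; wipe; lra.
  by apply: ler_pM L c6; [rewrite divr_ge0 // ltW | move: b6; wipe; lra].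
have uu : 3 * u <= 1 / 100 * b ^+ 2.
  have := u_eta Hc (isT : 2 <= 30)%N; have [_ _ _ /andP[_ e2]] := consts_eta Hc.
  have /andP[_ b11] := b_small Hc 11.
  have : eta * b ^+ 2 <= 1 * b ^+ 2 by rewrite ler_pM2r //; move: e2 b11; wipe; lra.
  by move: b2; wipe; lra.
have rl : relu (lin8 form (V i) / rho) <= 4 * gN.
  apply: le_trans L; rewrite -[rho in leRHS]gtr0_norm // -normf_div /relu ge_max normr_ge0; exact: ler_norm.
by move: am; rewrite ler_distl => /andP[_]; move: rl e1 uu g1 p3 b2; rewrite expr1; wipe; lra.
Qed.
End Key.

Lemma rk_le i : isadj n i || ispad n i -> (rk s i <= N)%N.
Proof.
move=> ap; apply: leq_trans (ltnW (rk_lt s ap)) _; apply: leq_trans (cubeN Hp s t).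
by rewrite -addnA leq_addr.
Qed.

Let QQf := QQ_fact Hrnd Hp Vflag Veq Nb Hc Vrho Veta.
Let REMf := REM_fact Hrnd Hp Vflag Veq Nb Hc Vrho Veta.
Let IIf := II_fact Hrnd Hp Vflag Veq Nb Hc Vrho Veta.
Let JJf := JJ_fact Hrnd Hp Vflag Veq Nb Hc Vrho Veta.

Lemma c14 (x y k : R) : k <= 14 / 10 -> `|x - y| <= eta * (k * b ^+ 4) -> `|x - y| <= eta * (14 / 10 * b ^+ 4).
Proof.
have [_ _ e0 _] := consts_eta Hc; have /andP[b4 _] := b_small Hc 4.
by move=> hk; move/le_trans; apply; rewrite ler_pM2l // ler_pM2r.
Qed.

Lemma KQ_fact i : (i < N)%N -> isadj n i || ispad n i -> `|V i fKQ - dl * (rk s i %/ n)%:R| <= dl * b ^+ 3.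
Proof.
move=> iN ap; apply: (key_fact (f := fKQ) (m := 0) iN isT erefl isT isT).
  by apply: leq_trans (rk_le ap); apply: leq_div.
by rewrite lin8_c8 big_seq1; apply: c14 (QQf iN ap); lra.
Qed.

Lemma KR_fact i : (i < N)%N -> isadj n i || ispad n i -> `|V i fKR - dl * (rk s i %% n)%:R| <= dl * b ^+ 3.
Proof.
move=> iN ap; apply: (key_fact (f := fKR) (m := 1) iN isT erefl isT isT).
  by apply: leq_trans (rk_le ap); apply: leq_mod.
by apply: c14 (REMf iN ap); lra.
Qed.

Lemma KI_fact i : (i < N)%N -> isadj n i || ispad n i -> `|V i fKI - dl * (rk s i %/ n %/ n)%:R| <= dl * b ^+ 3.
Proof.
move=> iN ap; apply: (key_fact (f := fKI) (m := 2) iN isT erefl isT isT).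
  by apply: leq_trans (rk_le ap); apply: leq_trans (leq_div _ _) (leq_div _ _).
by rewrite lin8_c8 big_seq1; apply: IIf.
Qed.

Lemma KJ_fact i : (i < N)%N -> isadj n i || ispad n i -> `|V i fKJ - dl * ((rk s i %/ n) %% n)%:R| <= dl * b ^+ 3.
Proof.
move=> iN ap; apply: (key_fact (f := fKJ) (m := 3) iN isT erefl isT isT).
  by apply: leq_trans (rk_le ap); apply: leq_trans (leq_mod _ _) (leq_div _ _).
by rewrite lin8_c8 big_seq1; apply: JJf.
Qed.

Lemma l_rem_bound i : (i < N)%N -> `|lin8 l_rem (V i)| <= 4 * (rho * gN).
Proof.
move=> iN; rewrite (l_remE Veta iN); have [h0 h1 _ _] := dat iN; have h3 := NQb iN.
by move: h0 h1 h3; rewrite !ler_norml; wipe => /andP[? ?] /andP[? ?] /andP[? ?]; apply/andP; split; lra.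
Qed.

Lemma key_bounds i f : (i < N)%N -> f \in [:: fKQ; fKR; fKI; fKJ] -> 0 <= V i f <= 2 * b ^+ 2.
Proof.
move=> iN; have [_ _ _ /andP[r0 _]] := dlf; have /andP[g0 _] := gNb.
have big (x : R) : `|x| <= rho * gN -> `|x| <= 4 * (rho * gN).
  by have := mulr_ge0 (ltW r0) g0; wipe; lra.
rewrite !inE => /orP[/eqP->|/orP[/eqP->|/orP[/eqP->|/eqP->]]].
- by apply: (key_bound (f := fKQ) (m := 0) iN isT erefl isT isT); rewrite lin8_c8 big_seq1; apply/big/QQb.
- by apply: (key_bound (f := fKR) (m := 1) iN isT erefl isT isT); apply: l_rem_bound.
- by apply: (key_bound (f := fKI) (m := 2) iN isT erefl isT isT); rewrite lin8_c8 big_seq1; apply/big/IIb.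
- by apply: (key_bound (f := fKJ) (m := 3) iN isT erefl isT isT); rewrite lin8_c8 big_seq1; apply/big/JJb.
Qed.

End Keys.

(** * Lookup of matrix entries *)

Section Balanced.
Variables (R : archiRcfType) (p : nat) (rnd : R -> R).
Hypothesis Hrnd : correct_rounding p rnd.
Hypothesis Hp : (20 <= p)%N.
Notation u := (uerr R p).

Lemma lin_bal f ms (v : nat -> R) : v fZ = 0 -> lin (bal f) ms v = lin8 f v.
Proof.
move=> vZ; rewrite /lin8 /lin /bal /ev big_cons /= vZ sub0r; move: (lnmu ms v) => m.
elim: f => [|[g c] f IH] /=; first by rewrite !big_nil oppr0 mul0r mul0r addr0.
by rewrite !big_cons -IH /=; move: (foldr _ _ _) (\sum_(j <- f) _) => d S; rewrite opprD rmorphD rmorphN /=; field.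
Qed.

Lemma bal_near f ms (v : nat -> R) w : v fZ = 0 -> flagged ms v -> (wnorm (bal f) <= 128)%N ->
  all (mem ms) (unzip1 (bal f)) -> lnS ms v = 1 + w -> 0 <= w <= 1 ->
  `|rnd (ev (bal f) (lnf rnd ms v)) - lin8 f v| <= `|lin8 f v| * w + 3 * u.
Proof.
move=> vZ [v1 mu1 S9] wf /allP fm SE w01; have /andP[w0 w1] := w01.
have := @lnf_lin R p rnd Hrnd Hp (bal f) ms v 1 wf fm ltr01 v1.
rewrite lin_bal // SE expr1n => h.
have {}h := h (ltac:(move: mu1; wipe; lra)) (ltac:(move: w0; wipe; lra)).
have /andP[q1 q2] := inv_sqrt_bounds w01; move: h q1 q2.
set q := (Num.sqrt (1 + w))^-1; move: (rnd _) (lin8 f v) => r L h q1 q2.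
have w2 : 0 <= w ^+ 2 <= w by rewrite sqr_ge0 expr2 ler_piMr.
case/andP: w2 => w2 w3.
have k : `|L * q - L| <= `|L| * w.
  rewrite -{2}[L]mulr1 -mulrBr normrM; apply: ler_wpM2l => //.
  by rewrite distrC ger0_norm; move: q1 q2 w0 w2 w3; wipe; lra.
have := ler_normD (r - L * q) (L * q - L); rewrite addrA subrK; move: h k; wipe; lra.
Qed.

Lemma relu_bal_near f ms (v : nat -> R) w : v fZ = 0 -> flagged ms v -> (wnorm (bal f) <= 128)%N ->
  all (mem ms) (unzip1 (bal f)) -> lnS ms v = 1 + w -> 0 <= w <= 1 ->
  `|relu (rnd (ev (bal f) (lnf rnd ms v))) - relu (lin8 f v)| <= `|lin8 f v| * w + 3 * u.
Proof. by move=> *; apply/relu_lip/bal_near. Qed.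

End Balanced.

Section KeyGap.
Variable R : archiRcfType.

(** With the indicator the numerator is at least 97/100 and the norm close to 1; without it only
    coordinate terms of at most 3/100 remain, which a norm of any size can only shrink. *)
Lemma key_gap (X1 X2 Y1 Y2 a nu Z1 Z2 a' nu' : R) : `|X1| <= 1 / 50 -> `|X2| <= 1 / 50 ->
  `|Y1| <= 1 / 50 -> `|Y2| <= 1 / 50 -> `|a| <= 1 / 100 -> 0 <= nu -> nu <= 1 / 100 ->
  `|Z1| <= 1 / 10 -> `|Z2| <= 1 / 10 -> `|a'| <= 1 / 100 -> 0 <= nu' ->
  (X1 * Z1 + X2 * Z2 + a') / Num.sqrt (1 + (Z1 ^+ 2 + Z2 ^+ 2 + nu')) + 1 / 2
    <= (X1 * Y1 + X2 * Y2 + 1 + a) / Num.sqrt (1 + (Y1 ^+ 2 + Y2 ^+ 2 + nu)).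
Proof.
move=> x1 x2 y1 y2 a1 n0 n1 z1 z2 a2 n2.
have p5 (x y : R) : `|x| <= 1 / 50 -> `|y| <= 1 / 10 -> `|x * y| <= 1 / 100.
  by move=> hx hy; rewrite normrM; apply: le_trans (_ : 1 / 50 * (1 / 10) <= _); [apply: ler_pM | wipe; lra].
have ten (x : R) : `|x| <= 1 / 50 -> `|x| <= 1 / 10 by move/le_trans; apply; wipe; lra.
have e1 := p5 _ _ x1 z1; have e2 := p5 _ _ x2 z2; have e3 := p5 _ _ x1 (ten _ y1); have e4 := p5 _ _ x2 (ten _ y2).
have sq (x : R) : `|x| <= 1 / 50 -> 0 <= x ^+ 2 <= 1 / 100.
  by move=> h; rewrite sqr_ge0 /=; move: h; rewrite ler_norml; wipe => /andP[? ?]; nra.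
have /andP[s1 s1'] := sq _ y1; have /andP[s2 s2'] := sq _ y2.
set w := Y1 ^+ 2 + Y2 ^+ 2 + nu.
have w0 : 0 <= w by rewrite /w; move: s1 s2 n0; wipe; lra.
have w3 : w <= 3 / 100 by rewrite /w; move: s1' s2' n1; wipe; lra.
have w1 : 0 <= w <= 1 by rewrite w0 /=; move: w3; wipe; lra.
have /andP[q1 _] := inv_sqrt_bounds w1.
have q2 : 95 / 100 <= (Num.sqrt (1 + w))^-1 by move: q1 w3; wipe; lra.
have B0 : 97 / 100 <= X1 * Y1 + X2 * Y2 + 1 + a.
  move: e3 e4 a1; rewrite !ler_norml => /andP[e3 _] /andP[e4 _] /andP[a1 _].
  by move: e3 e4 a1; wipe; move: (X1 * Y1) (X2 * Y2) => *; lra.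
have B : 97 / 100 * (95 / 100) <= (X1 * Y1 + X2 * Y2 + 1 + a) / Num.sqrt (1 + w).
  by apply: ler_pM => //; wipe; lra.
have s3 : 1 <= Num.sqrt (1 + (Z1 ^+ 2 + Z2 ^+ 2 + nu')).
  rewrite -[leLHS]sqrtr1 ler_sqrt; first by rewrite lerDl !addr_ge0 ?sqr_ge0.
  by rewrite !addr_ge0 ?sqr_ge0.
have A0 : X1 * Z1 + X2 * Z2 + a' <= 3 / 100.
  move: e1 e2 a2; rewrite !ler_norml => /andP[_ e1] /andP[_ e2] /andP[_ a2].
  by move: e1 e2 a2; wipe; move: (X1 * Z1) (X2 * Z2) => *; lra.
have A1 : (X1 * Z1 + X2 * Z2 + a') / Num.sqrt (1 + (Z1 ^+ 2 + Z2 ^+ 2 + nu')) <= 3 / 100.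
  rewrite ler_pdivrMr; last exact: lt_le_trans s3.
  by apply: le_trans A0 _; rewrite ler_peMr //; wipe; lra.
by move: A1 B; wipe; lra.
Qed.

End KeyGap.

(** * Lookup by two coordinates with a small bonus *)

Section Gather.
Variables (R : archiRcfType) (p : nat) (rnd : R -> R).
Hypothesis Hrnd : correct_rounding p rnd.
Hypothesis Hp : (20 <= p)%N.
Notation u := (uerr R p).
Variables b rho tau eta : R.
Hypothesis Hc : consts_ok b u rho tau eta.
Notation dl := (eta / rho).
Variables (N n : nat).
Hypothesis nb : n%:R * b <= 1 / 5.
Variables (hsp : head_spec) (ms : seq nat) (v : nat -> nat -> R) (i : nat).
Hypothesis hm0 : hm hsp = false.
Hypothesis okh : okq hsp ms.
Hypothesis flg : forall k, (k < N)%N -> flagged ms (v k).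
Hypothesis iN : (i < N)%N.
Hypothesis S4 : lnS ms (v i) <= 4.
Variables (X1 X2 : R) (x1 x2 : nat) (Y1 Y2 a nu : nat -> R) (y1 y2 : nat -> nat) (P : pred nat).
Hypothesis dotE : forall k, (k < N)%N ->
  dot hsp ms (v i) (v k) = rho * (X1 * Y1 k + X2 * Y2 k + (P k)%:R + a k).
Hypothesis SE : forall k, (k < N)%N -> lnS ms (v k) = 1 + (Y1 k ^+ 2 + Y2 k ^+ 2 + nu k).
Hypothesis nu0 : forall k, (k < N)%N -> 0 <= nu k.
Hypothesis nuP : forall k, (k < N)%N -> P k -> nu k <= 2 * b ^+ 14.
Hypothesis Yb : forall k, (k < N)%N -> `|Y1 k| <= 1 / 10 /\ `|Y2 k| <= 1 / 10.
Hypothesis YP : forall k, (k < N)%N -> P k -> [/\ `|Y1 k - dl * (y1 k)%:R| <= dl * b ^+ 3,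
  `|Y2 k - dl * (y2 k)%:R| <= dl * b ^+ 3, (y1 k <= n)%N & (y2 k <= n)%N].
Hypothesis XP : [/\ `|X1 - dl * x1%:R| <= dl * b ^+ 3, `|X2 - dl * x2%:R| <= dl * b ^+ 3, (x1 <= n)%N & (x2 <= n)%N].
Hypothesis ab : forall k, (k < N)%N -> `|a k| <= 15 / 100 * b ^+ 8.
Notation c := (b ^+ 3 / 4).
Let dlf := dl_facts Hc.

(** The bound b^3/4 comes from dl n <= 11/10 b^4 n <= 0.22 b^3, by n b <= 1/5. *)
Lemma coord_small (Y : R) (y : nat) : `|Y - dl * y%:R| <= dl * b ^+ 3 -> (y <= n)%N -> `|Y| <= c.
Proof.
move=> h yn; have [/andP[d1 d2] _ d0 _] := dlf; have /andP[b3 b3'] := b_small Hc 3.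
have /andP[b0 b0'] := b_ok Hc; have /andP[b4 b4'] := b_small Hc 4.
have k1 : dl * b ^+ 3 <= 1 / 100 * b ^+ 3 by rewrite ler_pM2r //; move: d2 b4'; wipe; lra.
have k2 : 0 <= dl * y%:R <= 11 / 10 * b ^+ 3 * (1 / 5).
  rewrite mulr_ge0 ?ler0n ?(ltW d0) //=; apply: le_trans (_ : 11 / 10 * b ^+ 4 * n%:R <= _).
    by apply: ler_pM; rewrite ?ler0n ?ler_nat // ltW.
  have -> : 11 / 10 * b ^+ 4 * n%:R = 11 / 10 * b ^+ 3 * (n%:R * b) by rewrite (exprD b 3 1) expr1; ring.
  by rewrite ler_pM2l // mulr_gt0 //; lra.
case/andP: k2 => k2 k3; move: h; rewrite ler_distl ler_norml; move: k1 k2 k3 b3; wipe => ? ? ? ? /andP[? ?].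
by apply/andP; split; lra.
Qed.

Lemma near_sq (X Y : R) (x : nat) : `|X - dl * x%:R| <= dl * b ^+ 3 -> `|Y - dl * x%:R| <= dl * b ^+ 3 ->
  (X - Y) ^+ 2 <= 5 * b ^+ 14.
Proof.
move=> h1 h2; have [/andP[d1 d2] _ d0 _] := dlf; have /andP[b3 _] := b_small Hc 3; have /andP[b4 _] := b_small Hc 4.
have k : `|X - Y| <= 11 / 5 * b ^+ 7.
  have : dl * b ^+ 3 <= 11 / 10 * b ^+ 4 * b ^+ 3 by rewrite ler_pM2r.
  have -> : 11 / 10 * b ^+ 4 * b ^+ 3 = 11 / 10 * b ^+ 7 by rewrite -mulrA -exprD.
  move: h1 h2; rewrite !ler_distl; wipe => /andP[? ?] /andP[? ?] ?.
  by apply/andP; split; lra.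
rewrite -(real_normK (num_real (X - Y))); apply: le_trans (_ : (11 / 5 * b ^+ 7) ^+ 2 <= _).
  by apply: lerXn2r; rewrite ?nnegrE //; apply: le_trans k.
rewrite exprMn -exprM; have /andP[b14 _] := b_small Hc 14.
by rewrite ler_pM2r //; lra.
Qed.

Lemma far_sq (X Y : R) (x y : nat) : `|X - dl * x%:R| <= dl * b ^+ 3 -> `|Y - dl * y%:R| <= dl * b ^+ 3 ->
  x != y -> 65 / 100 * b ^+ 8 <= (X - Y) ^+ 2.
Proof.
move=> h1 h2 xy; have [/andP[d1 d2] _ d0 _] := dlf; have /andP[b3 b3'] := b_small Hc 3.
have /andP[b4 _] := b_small Hc 4.
have one : 1 <= `|x%:R - y%:R| :> R.
  wlog lt : x y {h1 h2} xy / (x < y)%N => [H|].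
    by move: (xy); rewrite neq_ltn => /orP[/H->//|/H]; rewrite eq_sym distrC => ->.
  rewrite distrC ger0_norm ?subr_ge0 ?ler_nat 1?ltnW // lerBrDr addrC natr1 ler_nat //.
have k : 82 / 100 * b ^+ 4 <= `|X - Y|.
  have h3 : dl <= `|dl * x%:R - dl * y%:R| by rewrite -mulrBr normrM gtr0_norm // ler_peMr // ltW.
  have := ler_normD (X - Y) ((dl * x%:R - X) + (Y - dl * y%:R)).
  have -> : X - Y + ((dl * x%:R - X) + (Y - dl * y%:R)) = dl * x%:R - dl * y%:R by ring.
  have := ler_normD (dl * x%:R - X) (Y - dl * y%:R); rewrite [`|dl * x%:R - X|]distrC.
  have : dl * b ^+ 3 <= dl * (1 / 125) by rewrite ler_pM2l //; move: b3'; wipe; lra.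
  move: (b ^+ 3) b3 b3' h1 h2 => b3x b3 b3' h1 h2.
  have e8 : dl * b3x <= dl * (1 / 125) by rewrite ler_pM2l //; move: b3'; wipe; lra.
  move: h1 h2 h3 d1 d2 b4 e8; wipe => *; lra.
rewrite -[leRHS](real_normK (num_real (X - Y))); apply: le_trans (_ : (82 / 100 * b ^+ 4) ^+ 2 <= _).
  by rewrite exprMn -exprM; have /andP[b8 _] := b_small Hc 8; rewrite ler_pM2r //; lra.
by apply: lerXn2r; rewrite ?nnegrE //; move: b4; wipe; lra.
Qed.

Lemma rho_gap d : 1 / 100 * b ^+ 12 <= d -> 1000 * u <= rho * d.
Proof.
move=> hd; have [bb _ /andP[r1 _] _ _] := Hc; have [_ _ _ /andP[r0 _]] := dlf.
have k : rho * (1 / 100 * b ^+ 12) <= rho * d by rewrite ler_pM2l.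
apply: le_trans k; have /andP[b12 _] := b_small Hc 12.
have : 8 / 10 * b ^+ 7 * (1 / 100 * b ^+ 12) <= rho * (1 / 100 * b ^+ 12).
  by rewrite ler_pM2r //; move: b12; wipe; lra.
have -> : 8 / 10 * b ^+ 7 * (1 / 100 * b ^+ 12) = 8 / 1000 * b ^+ 19.
  by rewrite (exprD b 7 12); field.
have := u_eta Hc (isT : 20 <= 30)%N.
have [_ _ e0 /andP[_ e2]] := consts_eta Hc.
have : eta * b ^+ 20 <= 121 / 100 * b ^+ 11 * b ^+ 20 by rewrite ler_pM2r //; case/andP: (b_small Hc 20).
rewrite -mulrA -exprD; have /andP[p0 p1] := bpow 19 12 bb.
have /andP[p19 _] := b_small Hc 19.
by move: p1 p19; wipe; lra.
Qed.

Lemma gather_beats (j j0 : 'I_N) d : 1 / 100 * b ^+ 12 <= d ->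
  (X1 * Y1 j + X2 * Y2 j + (P j)%:R + a j) / Num.sqrt (lnS ms (v j)) + d
   <= (X1 * Y1 j0 + X2 * Y2 j0 + (P j0)%:R + a j0) / Num.sqrt (lnS ms (v j0)) ->
  j \notin best rnd N hsp (fun k => lnf rnd ms (v k)) i.
Proof.
move=> hd H; apply: (lookup_beats Hrnd Hp okh hm0 (flg iN) (flg (ltn_ord j)) (flg (ltn_ord j0)) S4).
have [_ _ _ /andP[r0 _]] := dlf.
rewrite !dotE // -!mulrA; apply: le_trans (_ : rho * ((X1 * Y1 j + X2 * Y2 j + (P j)%:R + a j) / Num.sqrt (lnS ms (v j)) + d) <= _).
  by rewrite mulrDr lerD2l; apply: rho_gap.
by rewrite ler_pM2l.
Qed.

Let c_small : 0 <= c <= 1 / 50.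
Proof. by have /andP[b3 b3'] := b_small Hc 3; move: b3 b3'; wipe => *; apply/andP; split; lra. Qed.

Lemma gather_key (j j0 : 'I_N) : P j0 -> j \in best rnd N hsp (fun k => lnf rnd ms (v k)) i -> P j.
Proof.
move=> P0; apply: contraTT => nP; have jN := ltn_ord j; have j0N := ltn_ord j0.
have [h1 h2 x1n x2n] := XP; have xs1 := coord_small h1 x1n; have xs2 := coord_small h2 x2n.
have [g1 g2 y1n y2n] := YP j0N P0; have ys1 := coord_small g1 y1n; have ys2 := coord_small g2 y2n.
have [yb1 yb2] := Yb jN; have /andP[_ c1] := c_small.
have /andP[b8 b8'] := b_small Hc 8; have /andP[b14 b14'] := b_small Hc 14.
have a1 := ab jN; have a0 := ab j0N; have n0 := nu0 jN; have n1 := nu0 j0N; have n2 := nuP j0N P0.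
apply: (@gather_beats j j0 (1 / 2)); first by have /andP[_ b12] := b_small Hc 12; move: b12; wipe; lra.
rewrite (negbTE nP) P0 !SE // addr0 (_ : true%:R = 1 :> R) //.
have aa (x : R) : `|x| <= 15 / 100 * b ^+ 8 -> `|x| <= 1 / 100.
  by move/le_trans; apply; move: b8'; wipe; lra.
have n2' : nu j0 <= 1 / 100 by move: n2 b14'; wipe; lra.
by apply: key_gap (le_trans xs1 c1) (le_trans xs2 c1) (le_trans ys1 c1) (le_trans ys2 c1) (aa _ a0) n1 n2'
  yb1 yb2 (aa _ a1) n0.
Qed.

(** With c = b^3/4 each expansion error is at most b^12/14 + b^14, so that two of them and the
    margin for rounding fit into b^12/2. *)
Lemma gather_cmp (j j0 : 'I_N) : P j -> P j0 ->
  b ^+ 12 / 2 <= (X1 * Y1 j0 + X2 * Y2 j0 + a j0 - (Y1 j0 ^+ 2 + Y2 j0 ^+ 2) / 2)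
     - (X1 * Y1 j + X2 * Y2 j + a j - (Y1 j ^+ 2 + Y2 j ^+ 2) / 2) ->
  j \notin best rnd N hsp (fun k => lnf rnd ms (v k)) i.
Proof.
move=> P1 P0 H; have jN := ltn_ord j; have j0N := ltn_ord j0.
have /andP[c0 c1] := c_small; have /andP[b12 b12'] := b_small Hc 12; have /andP[b6 b6'] := b_small Hc 6.
have c2 : c ^+ 2 = b ^+ 6 / 16 by rewrite exprMn -exprM exprVn; congr (_ / _); rewrite -natrX.
have c2b : 0 <= c ^+ 2 <= 1 / 100 by rewrite c2; move: b6 b6'; wipe => *; apply/andP; split; lra.
have [h1 h2 x1n x2n] := XP; have xs1 := coord_small h1 x1n; have xs2 := coord_small h2 x2n.
have E k : (k < N)%N -> P k -> let t := X1 * Y1 k + X2 * Y2 k + a k in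
  `|(t + 1) / Num.sqrt (lnS ms (v k)) - (1 + t - (Y1 k ^+ 2 + Y2 k ^+ 2) / 2)| <= 1 / 14 * b ^+ 12 + b ^+ 14.
  move=> kN Pk; cbv zeta; set t := _ + a k.
  have [g1 g2 y1n y2n] := YP kN Pk; have ys1 := coord_small g1 y1n; have ys2 := coord_small g2 y2n.
  have sq (x : R) : `|x| <= c -> 0 <= x ^+ 2 <= c ^+ 2.
    by move=> h; rewrite sqr_ge0 -(real_normK (num_real x)); apply: lerXn2r; rewrite ?nnegrE.
  have /andP[s1 s1'] := sq _ ys1; have /andP[s2 s2'] := sq _ ys2.
  have n0 := nu0 kN; have n1 := nuP kN Pk.
  have nc : nu k <= c ^+ 2.
    by rewrite c2; have /andP[_ p8] := bpow 6 8 (b_ok Hc); move: n1 p8 b6; wipe; lra.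
  have ac : `|a k| <= c ^+ 2.
    by apply: le_trans (ab kN) _; rewrite c2; have /andP[_ p2] := bpow 6 2 (b_ok Hc); move: p2 b6; wipe; lra.
  set w := Y1 k ^+ 2 + Y2 k ^+ 2 + nu k.
  have w0 : 0 <= w <= 3 * c ^+ 2 by rewrite /w; move: s1 s1' s2 s2' n0 nc; wipe => *; apply/andP; split; lra.
  have t3 : `|t| <= 3 * c ^+ 2.
    have m (x y : R) : `|x| <= c -> `|y| <= c -> `|x * y| <= c ^+ 2.
      by move=> hx hy; rewrite normrM expr2; apply: ler_pM.
    have := m _ _ xs1 ys1; have := m _ _ xs2 ys2; rewrite /t; move: ac.
    by rewrite !ler_norml; wipe => /andP[? ?] /andP[? ?] /andP[? ?]; apply/andP; split; lra.
  have w1 : 0 <= w <= 1 by case/andP: w0 => -> /= h; case/andP: c2b => _ h'; move: h h'; wipe; lra.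
  have t1 : `|t| <= 1 by case/andP: c2b => _ h'; move: t3 h'; wipe; lra.
  have := expand_bound w1 t1; rewrite (SE kN) -/w [t + 1]addrC => ex.
  have /andP[w0' w3] := w0.
  have k1 : w ^+ 2 <= (3 * c ^+ 2) ^+ 2 by apply: lerXn2r; rewrite ?nnegrE // (le_trans w0').
  have k2 : `|t| * w <= 3 * c ^+ 2 * (3 * c ^+ 2) by apply: ler_pM.
  have k3 : (3 * c ^+ 2) ^+ 2 + 3 * c ^+ 2 * (3 * c ^+ 2) <= 1 / 14 * b ^+ 12.
    have -> : (3 * c ^+ 2) ^+ 2 + 3 * c ^+ 2 * (3 * c ^+ 2) = 9 / 128 * b ^+ 12.
      by rewrite c2 (exprD b 6 6); field.
    by rewrite ler_pM2r //; wipe; lra.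
  move: ex k1 k2 k3 n0 n1; rewrite /w !ler_distl; wipe => /andP[? ?] ? ? ? ? ?; apply/andP; split; lra.
apply: (@gather_beats j j0 (1 / 100 * b ^+ 12)) => //.
have := E _ jN P1; have := E _ j0N P0; cbv zeta; rewrite P1 P0.
have F (x y z : R) : x + y + true%:R + z = x + y + z + 1 by rewrite (_ : true%:R = 1 :> R) //; ring.
rewrite !F; move: H; set t0 := _ + a j0; set t1 := _ + a j.
have /andP[_ p14] := bpow 12 2 (b_ok Hc).
move: (_ / Num.sqrt _) (_ / Num.sqrt _) => z0 z1; rewrite !ler_distl; move: p14 b12; wipe.
by move=> ? ? ? /andP[? ?] /andP[? ?]; lra.
Qed.

(** An unequal coordinate costs at least 65/200 b^8, more than the 30/100 b^8 by which two bonuses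
    can differ. So the coordinates decide first, and among equal coordinates the bonus decides up to
    b^12. *)
Lemma gather_best (j j0 : 'I_N) : P j0 -> y1 j0 = x1 -> y2 j0 = x2 ->
  j \in best rnd N hsp (fun k => lnf rnd ms (v k)) i ->
  [/\ P j, y1 j = x1, y2 j = x2 & a j0 - a j < b ^+ 12].
Proof.
move=> P0 e1 e2 jb; have P1 := gather_key P0 jb; have jN := ltn_ord j; have j0N := ltn_ord j0.
have [h1 h2 x1n x2n] := XP; have [g1 g2 y1n y2n] := YP j0N P0; have [k1 k2 z1n z2n] := YP jN P1.
have /andP[b8 _] := b_small Hc 8; have /andP[b12 b12'] := b_small Hc 12.
have /andP[_ p12] := bpow 8 4 (b_ok Hc); have /andP[_ p14] := bpow 12 2 (b_ok Hc).
have a1 := ab jN; have a0 := ab j0N.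
rewrite e1 in g1; rewrite e2 in g2; have s1 := near_sq h1 g1; have s2 := near_sq h2 g2.
have id k : X1 * Y1 k + X2 * Y2 k + a k - (Y1 k ^+ 2 + Y2 k ^+ 2) / 2
  = (X1 ^+ 2 + X2 ^+ 2) / 2 + a k - ((X1 - Y1 k) ^+ 2 + (X2 - Y2 k) ^+ 2) / 2 by field.
have cmp : ~ b ^+ 12 / 2 <= (a j0 - ((X1 - Y1 j0) ^+ 2 + (X2 - Y2 j0) ^+ 2) / 2)
   - (a j - ((X1 - Y1 j) ^+ 2 + (X2 - Y2 j) ^+ 2) / 2).
  move=> h; move: jb; apply/negP; apply: (gather_cmp P1 P0); rewrite !id; move: h; wipe; lra.
have far (D1 D2 : R) : 65 / 100 * b ^+ 8 <= D1 -> 0 <= D2 ->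
    b ^+ 12 / 2 <= (a j0 - ((X1 - Y1 j0) ^+ 2 + (X2 - Y2 j0) ^+ 2) / 2) - (a j - (D1 + D2) / 2).
  move=> d1 d2; move: a0 a1 s1 s2 p12 p14 d1 d2 b8; rewrite !ler_norml; wipe => /andP[? ?] /andP[? ?] *; lra.
have E1 : y1 j = x1.
  apply/eqP; apply: contraT => ne; case: cmp; apply: far (sqr_ge0 _).
  by apply: far_sq h1 k1 _; rewrite eq_sym.
have E2 : y2 j = x2.
  apply/eqP; apply: contraT => ne; case: cmp; rewrite [(X1 - Y1 j) ^+ 2 + _]addrC.
  by apply: far (sqr_ge0 _); apply: far_sq h2 k2 _; rewrite eq_sym.
split=> //; rewrite E1 in k1; rewrite E2 in k2.
rewrite ltNge; apply/negP => h; apply: cmp.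
have := sqr_ge0 (X1 - Y1 j); have := sqr_ge0 (X2 - Y2 j).
by move: h s1 s2 p14 b12; wipe; lra.
Qed.

End Gather.

(** * Bits in the residual stream: norms, clipping and erasing *)

Section Rounds.
Variables (R : archiRcfType) (p : nat) (rnd : R -> R).
Hypothesis Hrnd : correct_rounding p rnd.
Hypothesis Hp : (20 <= p)%N.
Variables (n : nat) (A : 'I_n -> 'I_n -> bool) (s t : 'I_n).
Notation N := (len s t).
Notation tok i := (tokn A s t i).
Variable V : nat -> nat -> R.
Hypothesis Vflag : forall i f, f \in flags -> V i f = (f == tok_flag (tok i))%:R.
Hypothesis Veq : eqns rnd N V (subs_of init_specs).
Notation u := (uerr R p).
Variables b rho tau eta : R.
Hypothesis Nb : N%:R * b = 1.
Hypothesis Hc : consts_ok b u rho tau eta.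
Hypothesis Vrho : forall i, (i < N)%N -> V i fRHO = rho.
Hypothesis Vtau : forall i, (i < N)%N -> V i fTAU = tau.
Hypothesis Veta : forall i, (i < N)%N -> V i fETA = eta.

Notation dl := (eta / rho).

Lemma tau_tiny : 0 < tau <= 1 / 400 /\ 100 * (100 * u) <= tau.
Proof.
have [_ t0 e0 /andP[_ e2]] := consts_eta Hc; have [bb _ _ /andP[t1 t2] _] := Hc.
have /andP[b9 b9'] := b_small Hc 9; have h := u_eta Hc (isT : 20 <= 30)%N.
have /andP[_ p11] := bpow 9 2 bb; have /andP[b11 _] := b_small Hc 11; have /andP[b20 b20'] := b_small Hc 20.
have k : eta * b ^+ 20 <= 121 / 100 * b ^+ 11 * (1 / 50).
  apply: ler_pM => //; [exact: ltW | exact: ltW | apply: le_trans b20' _].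
  by apply: le_trans (_ : (1 / 5) ^+ 3 <= _); [apply: ler_wiXn2l => //|]; wipe; lra.
split; last by move: h k p11 b9 t1 b11; wipe; lra.
rewrite t0 /=; apply: le_trans t2 _; apply: le_trans (_ : 11 / 10 * (1 / 5) ^+ 4 <= _); last by wipe; lra.
rewrite ler_pM2l; last by wipe; lra.
by apply: le_trans b9' _; apply: ler_wiXn2l => //; wipe; lra.
Qed.

Lemma big_low (l : seq nat) (F : nat -> R) : all (fun g => (g < 56)%N) l ->
  \sum_(f <- l | ~~ (56 <= f)%N) F f = \sum_(f <- l) F f /\ \sum_(f <- l | (56 <= f)%N) F f = 0.
Proof.
move=> /allP al; split.
  rewrite big_seq_cond [RHS]big_seq_cond; apply: eq_bigl => f; rewrite andbT.
  by case fl: (f \in l) => //=; have := al f fl; rewrite ltnNge => ->.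
by rewrite big_seq_cond big1 // => f /andP[/al]; rewrite ltnNge => /negbTE ->.
Qed.

Lemma lnS_bits l bits (v : nat -> R) : all (fun g => (g < 56)%N) l -> all (fun g => (56 <= g)%N) bits ->
  lnS (l ++ bits) v = sumsq l v + (\sum_(g <- bits) v g ^+ 2) / 2 - 64 * ((\sum_(g <- bits) v g) / 128) ^+ 2
  /\ lnmu (l ++ bits) v = (\sum_(g <- bits) v g) / 128.
Proof.
move=> l56 /allP b56; have [e1 e2] := big_low (fun f => v f ^+ 2) l56; have [_ e3] := big_low v l56.
have b1 (F : nat -> R) : \sum_(f <- bits | (56 <= f)%N) F f = \sum_(f <- bits) F f.
  rewrite big_seq_cond [RHS]big_seq_cond; apply: eq_bigl => f; rewrite andbT.
  by case fl: (f \in bits) => //=; rewrite b56.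
have b2 (F : nat -> R) : \sum_(f <- bits | ~~ (56 <= f)%N) F f = 0.
  by rewrite big_seq_cond big1 // => f /andP[/b56->].
by rewrite /lnS /lnmu !big_cat /= e1 e2 e3 !b1 b2 !add0r addr0.
Qed.

Section State.
Variable H : nat -> nat -> R.

(** During the rounds the features below 56 keep the values given by the initial layers; only the
    bits vary. *)
Definition agrees := forall i, (i < N)%N ->
  [/\ forall f, (f < 64)%N -> representable p (H i f), forall f, (f < 56)%N -> H i f = V i f & H i fZ = 0].
Hypothesis Hag : agrees.

Lemma lin8_agree f i : (i < N)%N -> all (fun g => (g < 56)%N) (unzip1 f) -> lin8 f (H i) = lin8 f (V i).
Proof.
move=> iN /allP f56; have [_ h _] := Hag iN; apply: eq_big_seq => x xf.
by rewrite h // f56 // map_f.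
Qed.

Lemma sumsq_agree l i : (i < N)%N -> all (fun g => (g < 56)%N) l ->
  sumsq (flags ++ l) (H i) = 1 + sumsq l (V i).
Proof.
move=> iN /allP l56; have [_ h _] := Hag iN; rewrite /sumsq big_cat /= -(flags_sq Vflag i); congr (_ + _).
  by apply: eq_big_seq => f /(allP (isT : all (fun g => (g < 56)%N) flags)) f56; rewrite h.
by apply: eq_big_seq => f /l56 f56; rewrite h.
Qed.

Lemma agree_le1 l i g : (i < N)%N -> all (fun g => (g < 56)%N) l -> (forall g, g \in l -> `|V i g| <= 1) ->
  g \in flags ++ l -> `|H i g| <= 1.
Proof.
move=> iN /allP l56 hl; have [_ h _] := Hag iN; rewrite mem_cat => /orP[gf|gl].
  by rewrite h ?(flag_le1 Vflag) //; apply: (allP (isT : all (fun g => (g < 56)%N) flags)) gf.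
by rewrite h ?hl // l56.
Qed.

(** 127/256 = 1/2 - 64/128^2: an unpaired feature counts one half in [lnS], less the square of the
    mean it causes. *)
Lemma one_bit l bit i : (i < N)%N -> all (fun g => (g < 56)%N) l -> (56 <= bit)%N ->
  (forall g, g \in l -> `|V i g| <= 1) -> `|H i bit| <= 1 ->
  lnS ((flags ++ l) ++ [:: bit; fZ]) (H i) = 1 + (sumsq l (V i) + 127 / 256 * H i bit ^+ 2) /\
  flagged ((flags ++ l) ++ [:: bit; fZ]) (H i).
Proof.
move=> iN l56 b56 hl hb; have [_ _ hZ] := Hag iN.
have [||E mE] := @lnS_bits (flags ++ l) [:: bit; fZ] (H i); first by rewrite all_cat l56.
  by rewrite /= b56.
rewrite !big_cons !big_nil hZ expr0n !addr0 in E mE.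
have S : lnS ((flags ++ l) ++ [:: bit; fZ]) (H i) = 1 + (sumsq l (V i) + 127 / 256 * H i bit ^+ 2).
  by rewrite E sumsq_agree //; field.
split=> //; split.
- move=> g; rewrite mem_cat => /orP[|]; first exact: agree_le1.
  by rewrite !inE => /orP[/eqP->|/eqP->] //; rewrite hZ normr0; wipe; lra.
- by rewrite mE normrM [`|_^-1|]gtr0_norm ?invr_gt0 //; move: hb; wipe; lra.
rewrite S; have : 0 <= sumsq l (V i) by apply: sumr_ge0 => g _; apply: sqr_ge0.
by move: (sqr_ge0 (H i bit)); wipe; lra.
Qed.

End State.

Lemma relu_diff (x : R) : relu x - relu (- x) = x.
Proof.
case: (lerP 0 x) => h; first by rewrite relu_pos // relu_neg ?subr0 // oppr_le0.
by rewrite (relu_neg (ltW h)) relu_pos ?oppr_ge0 1?ltW // sub0r opprK.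
Qed.

Lemma clip_bounds (x : R) : 0 <= relu x - relu (x - tau) <= tau /\
  (x <= 0 -> relu x - relu (x - tau) = 0) /\ (tau <= x -> relu x - relu (x - tau) = tau).
Proof.
have [/andP[t0 _] _] := tau_tiny; case: (lerP x 0) => h0.
  rewrite (relu_neg h0) relu_neg; last by move: h0 t0; wipe; lra.
  by move: h0 t0; wipe => *; split; [apply/andP; split | split=> *]; lra.
rewrite (relu_pos (ltW h0)); case: (lerP tau x) => h1.
  rewrite relu_pos ?subr_ge0 //.
  by move: h0 h1 t0; wipe => *; split; [apply/andP; split | split=> *]; lra.
rewrite relu_neg; last by move: h1; wipe; lra.
by move: h0 h1 t0; wipe => *; split; [apply/andP; split | split=> *]; lra.
Qed.

Lemma clip_le (z c : R) : 0 <= c <= tau -> `|z - c| <= tau / 100 / 2 -> `|z| <= 105 / 100 * tau.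
Proof.
have [/andP[t0 _] _] := tau_tiny; move=> /andP[c0 c1]; rewrite ler_distl ler_norml => /andP[z0 z1].
by apply/andP; split; move: t0 c0 c1 z0 z1; wipe; lra.
Qed.

Lemma preact_le (x y c : R) : `|x| <= 11 / 10 * tau -> `|y| <= 11 / 10 * tau -> 0 <= c <= 5 * tau ->
  `|2 * x + 2 * y - c| <= 10 * tau.
Proof.
have [/andP[t0 _] _] := tau_tiny; move=> hx hy /andP[c0 c1]; apply: le_trans (ler_normB _ _) _.
rewrite [`|c|]ger0_norm //; have := ler_normD (2 * x) (2 * y); rewrite !normrM [`|2|]gtr0_norm //.
by move: t0 c1 hx hy; wipe; lra.
Qed.

Section Feedforward.
Variables (sp : layer_spec) (v : nat -> R) (w : R).
Notation ms := (fm sp).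
Hypothesis vZ : v fZ = 0.
Hypothesis vf : flagged ms v.
Hypothesis SE : lnS ms v = 1 + w.
Hypothesis wb : 0 <= w <= 10 * tau ^+ 2.

(** Bits have size tau, so the squared norm differs from 1 by O(tau^2) and a preactivation of size
    O(tau) is distorted by O(tau^3) only. *)
Lemma unit_near m f : nth [::] (hd sp) m = bal f -> (wnorm (bal f) <= 128)%N -> all (mem ms) (unzip1 (bal f)) ->
  `|lin8 f v| <= 10 * tau -> `|hid rnd sp v m - relu (lin8 f v)| <= tau / 100 / 10.
Proof.
move=> hf wf fm L; have [/andP[t0 t1] ut] := tau_tiny; have u0 := uerr_gt0 R p.
have /andP[w0 w1] := wb.
have k : tau ^+ 2 <= tau / 400 by rewrite expr2 ler_pM2l //; move: t1; wipe; lra.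
have w01 : 0 <= w <= 1 by rewrite w0 /=; move: w1 k t1; wipe; lra.
rewrite /hid hf; apply: le_trans (relu_bal_near Hrnd Hp vZ vf wf fm SE w01) _.
have h : `|lin8 f v| * w <= 10 * tau * (tau / 40).
  by apply: ler_pM => //; move: w1 k; wipe; lra.
have k2 : 10 * tau * (tau / 40) = tau ^+ 2 / 4 by field.
by rewrite k2 in h; move: h k ut u0 t0; wipe; lra.
Qed.

(** The last two units reproduce v f = relu (v f) - relu (- v f) and cancel the old content. The new
    value depends on the old one through fresh errors only, so nothing accumulates over the
    rounds. *)
Lemma unit4 f m0 m1 m2 m3 L0 : let e := tau / 100 in `|v f| <= 2 * tau ->
  fo_at sp f = [:: (m0, 64%:Z); (m1, - 64%:Z); (m2, - 64%:Z); (m3, 64%:Z)] ->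
  `|hid rnd sp v m0 - relu L0| <= e / 10 -> `|hid rnd sp v m1 - relu (L0 - tau)| <= e / 10 ->
  `|hid rnd sp v m2 - relu (v f)| <= e / 10 -> `|hid rnd sp v m3 - relu (- v f)| <= e / 10 ->
  `|fstep rnd sp v f - (relu L0 - relu (L0 - tau))| <= e / 2.
Proof.
move=> e vb fo h0 h1 h2 h3; have [/andP[t0 t1] ut] := tau_tiny; have u0 := uerr_gt0 R p.
rewrite /fstep fo /ev !big_cons big_nil /=.
have rd := relu_diff (v f); have [/andP[c0 c1] _] := clip_bounds L0.
set S := (X in rnd (_ + rnd X)); have -> : S = hid rnd sp v m0 - hid rnd sp v m1 - hid rnd sp v m2 + hid rnd sp v m3.
  by rewrite /S; field.
move: (hid rnd sp v m0) (hid rnd sp v m1) (hid rnd sp v m2) (hid rnd sp v m3) h0 h1 h2 h3 {S} => a0 a1 a2 a3.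
move: (relu L0) (relu (L0 - tau)) (relu (v f)) (relu (- v f)) rd c0 c1 => r0 r1 r2 r3 rd c0 c1.
rewrite /e !ler_distl => /andP[g0 g1] /andP[g2 g3] /andP[g4 g5] /andP[g6 g7].
have [v0 v1] : - (2 * tau) <= v f /\ v f <= 2 * tau by move: vb; rewrite ler_norml => /andP.
have S1 : `|a0 - a1 - a2 + a3| <= 1.
  by rewrite ler_norml; apply/andP; split; move: g0 g1 g2 g3 g4 g5 g6 g7 rd c0 c1 t0 t1 v0 v1; wipe; lra.
have n1 := rnd_near Hrnd Hp S1 (ler_nat _ 1 512).
have S2 : `|v f + rnd (a0 - a1 - a2 + a3)| <= 1.
  move: n1 => /andP[n1 n1']; rewrite ler_norml; apply/andP; split; move: n1 n1' g0 g1 g2 g3 g4 g5 g6 g7 rd c0 c1 t0 t1 v0 v1 ut u0; wipe; lra.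
have n2 := rnd_near Hrnd Hp S2 (ler_nat _ 1 512).
case/andP: n1 => n1 n1'; case/andP: n2 => n2 n2'.
by apply/andP; split; move: n1 n1' n2 n2' g0 g1 g2 g3 g4 g5 g6 g7 rd t0 ut u0; wipe; lra.
Qed.

Lemma unit2 f m0 m1 : let e := tau / 100 in `|v f| <= 2 * tau ->
  fo_at sp f = [:: (m0, - 64%:Z); (m1, 64%:Z)] ->
  `|hid rnd sp v m0 - relu (v f)| <= e / 10 -> `|hid rnd sp v m1 - relu (- v f)| <= e / 10 ->
  `|fstep rnd sp v f| <= e / 2.
Proof.
move=> e vb fo h2 h3; have [/andP[t0 t1] ut] := tau_tiny; have u0 := uerr_gt0 R p.
rewrite /fstep fo /ev !big_cons big_nil /=; have rd := relu_diff (v f).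
set S := (X in rnd (_ + rnd X)); have -> : S = hid rnd sp v m1 - hid rnd sp v m0 by rewrite /S; field.
move: (hid rnd sp v m0) (hid rnd sp v m1) h2 h3 {S} => a2 a3.
move: (relu (v f)) (relu (- v f)) rd => r2 r3 rd.
rewrite /e !ler_distl => /andP[g0 g1] /andP[g2 g3].
have [v0 v1] : - (2 * tau) <= v f /\ v f <= 2 * tau by move: vb; rewrite ler_norml => /andP.
have S1 : `|a3 - a2| <= 1 by rewrite ler_norml; apply/andP; split; move: g0 g1 g2 g3 rd t0 t1 v0 v1; wipe; lra.
have n1 := rnd_near Hrnd Hp S1 (ler_nat _ 1 512).
have S2 : `|v f + rnd (a3 - a2)| <= 1.
  move: n1 => /andP[n1 n1']; rewrite ler_norml; apply/andP; split; move: n1 n1' g0 g1 g2 g3 rd t0 t1 v0 v1 ut u0; wipe; lra.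
have n2 := rnd_near Hrnd Hp S2 (ler_nat _ 1 512).
case/andP: n1 => n1 n1'; case/andP: n2 => n2 n2'; rewrite ler_norml.
by apply/andP; split; move: n1 n1' n2 n2' g0 g1 g2 g3 rd t0 ut u0; wipe; lra.
Qed.

End Feedforward.


End Rounds.

(** * The lookup specialised to the states of the rounds *)

Section Attend.
Variables (R : archiRcfType) (p : nat) (rnd : R -> R).
Hypothesis Hrnd : correct_rounding p rnd.
Hypothesis Hp : (20 <= p)%N.
Variables (n : nat) (A : 'I_n -> 'I_n -> bool) (s t : 'I_n).
Notation N := (len s t).
Notation tok i := (tokn A s t i).
Variable V : nat -> nat -> R.
Hypothesis Vflag : forall i f, f \in flags -> V i f = (f == tok_flag (tok i))%:R.
Hypothesis Veq : eqns rnd N V (subs_of init_specs).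
Notation u := (uerr R p).
Variables b rho tau eta : R.
Hypothesis Nb : N%:R * b = 1.
Hypothesis Hc : consts_ok b u rho tau eta.
Hypothesis Vrho : forall i, (i < N)%N -> V i fRHO = rho.
Hypothesis Vtau : forall i, (i < N)%N -> V i fTAU = tau.
Hypothesis Veta : forall i, (i < N)%N -> V i fETA = eta.

Let dlf := dl_facts Hc.
Notation dl := (eta / rho).
Notation gN := (12 / 10 * (dl * N%:R)).
Let gNb := gN_bounds Nb Hc.
Let dat := data_bounds Hrnd Hp Vflag Veq Nb Hc Vrho Veta.
Let QQb := QQ_bound Hrnd Hp Vflag Veq Nb Hc Vrho Veta.
Let NQb := NQ_bound Hrnd Hp Vflag Veq Nb Hc Vrho Veta.
Let IIb := II_bound Hrnd Hp Vflag Veq Nb Hc Vrho Veta.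
Let JJb := JJ_bound Hrnd Hp Vflag Veq Nb Hc Vrho Veta.
Let keyb := key_bounds Hrnd Hp Vflag Veq Nb Hc Vrho Veta.
Let taut := tau_tiny Hc.
Let ESf := ES_fact Hrnd Hp Vflag Veq Nb Hc Veta.

Definition keys := [:: fKQ; fKR; fKI; fKJ].
Definition small_feats := [:: fQQ; fNQ; fE1; fETA; fII; fJJ; fES].

Lemma small_le i f : (i < N)%N -> f \in small_feats -> `|V i f| <= rho * gN.
Proof.
move=> iN; have [h0 h1 _ _] := dat iN; rewrite !inE.
case/orP=> [/eqP->|/orP[/eqP->|/orP[/eqP->|/orP[/eqP->|/orP[/eqP->|/orP[/eqP->|/eqP->]]]]]] //.
- exact: QQb.
- exact: NQb.
- by rewrite Veta.
- exact: IIb.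
- exact: JJb.
- exact: (data_small Hc (isT : (0 < 12)%N) (ESf iN) (s2_bounds R Hp s t)).
Qed.

Lemma small_sumsq rest i : (i < N)%N -> all (mem small_feats) rest -> (size rest <= 6)%N ->
  0 <= sumsq rest (V i) <= b ^+ 14 / 10 /\ rho ^+ 2 <= 121 / 100 * b ^+ 14.
Proof.
move=> iN /allP sm s6; have /andP[g0 g1] := gNb; have [_ _ _ /andP[r0 _]] := dlf.
have [_ _ /andP[r1 r2] _ _] := Hc; have /andP[b14 _] := b_small Hc 14; have /andP[_ b3] := b_small Hc 3.
have r14 : rho ^+ 2 <= 121 / 100 * b ^+ 14.
  have -> : 121 / 100 * b ^+ 14 = (11 / 10 * b ^+ 7) ^+ 2 by rewrite exprMn -exprM; congr (_ * _); field.
  have /andP[b7 _] := b_small Hc 7.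
  by apply: lerXn2r; rewrite ?nnegrE //; move: b7 r1 r2; wipe; lra.
split=> //; apply/andP; split; first by apply: sumr_ge0 => g _; apply: sqr_ge0.
have G : gN ^+ 2 <= 1 / 100.
  apply: le_trans (_ : (1 / 10) ^+ 2 <= _); last by wipe; lra.
  by apply: lerXn2r; rewrite ?nnegrE //; move: g1 b3; wipe; lra.
have one g : g \in rest -> V i g ^+ 2 <= 121 / 100 * b ^+ 14 * (1 / 100).
  move=> /sm gs; have /andP[_ q] := sq_data Hc (small_le iN gs) g0; apply: le_trans q _.
  by apply: ler_pM => //; apply: sqr_ge0.
rewrite /sumsq big_seq; apply: le_trans (ler_sum _ one) _.
rewrite -big_seq big_const_seq iter_addr_0 count_predT -mulr_natr.
have q6 : (size rest)%:R <= 6 :> R by rewrite (ler_nat _ _ 6).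
have k : 121 / 100 * b ^+ 14 * (1 / 100) * (size rest)%:R <= 121 / 100 * b ^+ 14 * (1 / 100) * 6.
  by apply: ler_wpM2l => //; move: b14; wipe; lra.
by move: k b14; wipe; lra.
Qed.

Lemma n_b : n%:R * b <= 1 / 5.
Proof.
have /andP[b0 _] := b_ok Hc; have n0 := n_gt0 s.
have h : (n * 5 <= N)%N.
  apply: leq_trans (cubeN Hp s t); case: (n) n0 => [//|[//|m]] _; nia.
have : (n * 5)%:R * b <= 1 by apply: (nat_b Nb Hc h).
by rewrite natrM; move: b0; wipe => *; lra.
Qed.

Lemma fetch hsp ms (H : nat -> nat -> R) i f v e0 : (i < N)%N ->
  nth [::] (hv hsp) 0 = bal f -> (wnorm (bal f) <= 128)%N -> all (mem ms) (unzip1 (bal f)) ->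
  (forall j : 'I_N, j \in best rnd N hsp (fun k => lnf rnd ms (H k)) i ->
    [/\ `|lin8 f (H j) - v| <= e0, `|lin8 f (H j)| <= 105 / 100 * tau, flagged ms (H j), H j fZ = 0 &
       exists2 w, lnS ms (H j) = 1 + w & 0 <= w <= 1 / 70]) ->
  `|v| <= 2 * tau -> 0 <= e0 <= 2 * tau ->
  `|hout rnd N hsp (fun k => lnf rnd ms (H k)) i 0 - v| <= e0 + tau / 50.
Proof.
move=> iN hf wf fm hb v2 /andP[e1 e2]; have [/andP[t0 t1] ut] := taut; have u0 := uerr_gt0 R p.
(* 3/200 is 105/100 divided by 70: the largest bit times the largest distortion by the norm. *)
apply: le_trans (hout_approx Hrnd Hp (e := e0 + tau * (3 / 200) + 3 * u) iN _ _ _) _.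
- by move: v2 t1; wipe; lra.
- by apply/andP; split; move: e1 e2 t0 t1 u0 ut; wipe; lra.
- move=> j /hb[d L F hZ [w SE /andP[w0 w1]]]; rewrite /hval hf.
  have w01 : 0 <= w <= 1 by rewrite w0 /=; move: w1; wipe; lra.
  have h := bal_near Hrnd Hp hZ F wf fm SE w01.
  have k : `|lin8 f (H j)| * w <= 105 / 100 * tau * (1 / 70) by apply: ler_pM.
  have := ler_normD (rnd (ev (bal f) (lnf rnd ms (H j))) - lin8 f (H j)) (lin8 f (H j) - v).
  by rewrite addrA subrK; move: h k d t0; wipe; lra.
by move: ut u0 t0; wipe; lra.
Qed.

Section Head.
Variable H : nat -> nat -> R.
Hypothesis Hag : agrees p s t V H.
Variables (hsp : head_spec) (l : seq nat) (bit k1 k2 : nat) (nur : nat -> R).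
Notation ms := ((flags ++ l) ++ [:: bit; fZ]).
Hypothesis hm0 : hm hsp = false.
Hypothesis okh : okq hsp ms.
Hypothesis l56 : all (fun g => (g < 56)%N) l.
Hypothesis b56 : (56 <= bit)%N.
Hypothesis k1k : k1 \in keys.
Hypothesis k2k : k2 \in keys.
Hypothesis l1 : forall k g, (k < N)%N -> g \in l -> `|V k g| <= 1.
Hypothesis bb : forall k, (k < N)%N -> `|H k bit| <= 105 / 100 * tau.
Hypothesis lS : forall k, (k < N)%N -> sumsq l (V k) = V k k1 ^+ 2 + V k k2 ^+ 2 + nur k.
Variable P : pred nat.
Hypothesis nur0 : forall k, (k < N)%N -> 0 <= nur k <= 1.
Hypothesis nurP : forall k, (k < N)%N -> P k -> nur k <= 14 / 10 * b ^+ 14.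

Lemma bit_sq k : (k < N)%N -> 0 <= 127 / 256 * H k bit ^+ 2 <= b ^+ 14 / 10.
Proof.
move=> kN; have h := bb kN; have [bbn _ _ /andP[_ t2] _] := Hc; have [/andP[t0 t1] _] := taut.
have /andP[b9 _] := b_small Hc 9; have /andP[_ p18] := bpow 14 4 (b_ok Hc); have /andP[b14 _] := b_small Hc 14.
have h2 : H k bit ^+ 2 <= (6 / 5 * b ^+ 9) ^+ 2.
  rewrite -(real_normK (num_real (H k bit))); apply: lerXn2r; rewrite ?nnegrE //.
    by move: b9; wipe; lra.
  by move: h t0 t2; wipe; lra.
rewrite exprMn -exprM in h2; move: h2 p18 b14 (sqr_ge0 (H k bit)); wipe => *; apply/andP; split; lra.
Qed.

Lemma head_state k : (k < N)%N -> flagged ms (H k) /\ lnS ms (H k) = 1 + (V k k1 ^+ 2 + V k k2 ^+ 2 + (nur k + 127 / 256 * H k bit ^+ 2)).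
Proof.
move=> kN; have [/andP[t0 t1] _] := taut.
have h1 : `|H k bit| <= 1 by apply: le_trans (bb kN) _; move: t1; wipe; lra.
have [S F] := one_bit Vflag Hag kN l56 b56 (fun g gl => l1 kN gl) h1.
by split=> //; rewrite S lS //; ring.
Qed.

Lemma key_sq k f : (k < N)%N -> f \in keys -> `|V k f| <= 1 / 10 /\ 0 <= V k f ^+ 2 <= 1 / 150.
Proof.
move=> kN fk; have /andP[h0 h1] := keyb kN fk; have /andP[_ b2] := b_small Hc 2; have /andP[b4 b4'] := b_small Hc 4.
split; first by rewrite ger0_norm //; move: h1 b2; wipe; lra.
rewrite sqr_ge0 /=; have : V k f ^+ 2 <= (2 * b ^+ 2) ^+ 2.
  by apply: lerXn2r; rewrite ?nnegrE // (le_trans h0).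
by rewrite exprMn -exprM; move: b4'; wipe; lra.
Qed.

Lemma head_w k : (k < N)%N -> nur k <= 14 / 10 * b ^+ 14 ->
  exists2 w, lnS ms (H k) = 1 + w & 0 <= w <= 1 / 70.
Proof.
move=> kN nk; have [_ S] := head_state kN; eexists; first exact: S.
have [_ /andP[q1 q1']] := key_sq kN k1k; have [_ /andP[q2 q2']] := key_sq kN k2k.
have /andP[c0 c1] := bit_sq kN; have /andP[n0 _] := nur0 kN.
have k14 : b ^+ 14 <= (1 / 5) ^+ 5.
  have /andP[_ h] := b_small Hc 14; apply: le_trans h _; apply: ler_wiXn2l => //; wipe; lra.
by apply/andP; split; move: q1 q1' q2 q2' c0 c1 n0 nk k14; wipe; lra.
Qed.

Variables (i : nat) (X1 X2 : R) (x1 x2 : nat) (a : nat -> R) (y1 y2 : nat -> nat).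
Hypothesis iN : (i < N)%N.
Hypothesis dotE : forall k, (k < N)%N ->
  dot hsp ms (H i) (H k) = rho * (X1 * V k k1 + X2 * V k k2 + (P k)%:R + a k).
Hypothesis YP : forall k, (k < N)%N -> P k -> [/\ `|V k k1 - dl * (y1 k)%:R| <= dl * b ^+ 3,
  `|V k k2 - dl * (y2 k)%:R| <= dl * b ^+ 3, (y1 k <= n)%N & (y2 k <= n)%N].
Hypothesis XP : [/\ `|X1 - dl * x1%:R| <= dl * b ^+ 3, `|X2 - dl * x2%:R| <= dl * b ^+ 3, (x1 <= n)%N & (x2 <= n)%N].
Hypothesis ab : forall k, (k < N)%N -> `|a k| <= 15 / 100 * b ^+ 8.

Lemma attend (j j0 : 'I_N) : P j0 -> y1 j0 = x1 -> y2 j0 = x2 ->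
  j \in best rnd N hsp (fun k => lnf rnd ms (H k)) i ->
  [/\ P j, y1 j = x1, y2 j = x2 & a j0 - a j < b ^+ 12].
Proof.
have /andP[b14 b14'] := b_small Hc 14.
apply: (gather_best Hrnd Hp Hc n_b hm0 okh (fun k kN => (head_state kN).1) iN _ dotE (fun k kN => (head_state kN).2)) => //.
- have [_ ->] := head_state iN; have [_ /andP[_ q1]] := key_sq iN k1k; have [_ /andP[_ q2]] := key_sq iN k2k.
  have /andP[_ c1] := bit_sq iN; have /andP[_ n1] := nur0 iN.
  have k14 : b ^+ 14 <= 1 by case/andP: (b_ok Hc) => g1 g2; apply: exprn_ile1; [exact: ltW | apply: le_trans g2 _; wipe; lra].
  by move: q1 q2 c1 n1 k14; wipe; lra.
- by move=> k kN; have /andP[n0 _] := nur0 kN; have /andP[c0 _] := bit_sq kN; rewrite addr_ge0.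
- by move=> k kN Pk; have := nurP kN Pk; have /andP[_ c0] := bit_sq kN; move: c0 b14; wipe; lra.
- by move=> k kN; split; [case: (key_sq kN k1k) | case: (key_sq kN k2k)].
Qed.

End Head.

End Attend.

(** * Invariants of the rounds *)

Section RepStep.
Variables (R : archiRcfType) (p : nat) (rnd : R -> R).
Hypothesis Hrnd : correct_rounding p rnd.
Hypothesis Hp : (20 <= p)%N.
Variables (n : nat) (A : 'I_n -> 'I_n -> bool) (s t : 'I_n).
Notation N := (len s t).
Notation tok i := (tokn A s t i).
Variable V : nat -> nat -> R.
Hypothesis Vflag : forall i f, f \in flags -> V i f = (f == tok_flag (tok i))%:R.
Hypothesis Veq : eqns rnd N V (subs_of init_specs).
Notation u := (uerr R p).
Variables b rho tau eta : R.
Hypothesis Nb : N%:R * b = 1.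
Hypothesis Hc : consts_ok b u rho tau eta.
Hypothesis Vrho : forall i, (i < N)%N -> V i fRHO = rho.
Hypothesis Vtau : forall i, (i < N)%N -> V i fTAU = tau.
Hypothesis Veta : forall i, (i < N)%N -> V i fETA = eta.

Let dlf := dl_facts Hc.
Notation dl := (eta / rho).
Let taut := tau_tiny Hc.
Let keyb := key_bounds Hrnd Hp Vflag Veq Nb Hc Vrho Veta.
Let smle := small_le Hrnd Hp Vflag Veq Nb Hc Vrho Veta.
Notation agr := (agrees p s t V).

(** Imposed at all positions, also where the bits mean nothing, because they enter norms and
    averages there too. The three scratch bits must be nearly 0, since a head adds to what they
    contain. *)
Definition bounded (H : nat -> nat -> R) := forall i, (i < N)%N ->
  [/\ `|H i bR| <= 105 / 100 * tau, `|H i bA| <= 105 / 100 * tau, `|H i bX| <= tau / 100,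
      `|H i bY| <= tau / 100 & `|H i bO| <= tau / 100].

(* The adjacency position with row-major index [q n + r] holds the bit [M q r], stored as [0] or [tau]. *)
Definition coded (M : nat -> nat -> bool) (H : nat -> nat -> R) := forall i, (i < N)%N -> isadj n i ->
  `|H i bR - tau * (M (rk s i %/ n) (rk s i %% n))%N%:R| <= tau / 20.

Definition fresh_bits (l : seq nat) := all (fun f => (56 <= f)%N && (f < 63)%N) l.

Lemma astep_agrees sp H : fresh_bits (unzip1 (ao sp)) -> agr H -> agr (astep rnd N sp H).
Proof.
move=> /allP fr Hag i iN; have [h1 h2 h3] := Hag i iN; split.
- by move=> f f64; rewrite /astep; case: (ao_at sp f) => [[hh l]|]; [apply: (rnd_rep Hrnd) | apply: h1].
- move=> f f56; rewrite /astep ao_at_none ?h2 //.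
  by apply/negP => /fr /andP[]; rewrite leqNgt f56.
by rewrite /astep ao_at_none //; apply/negP => /fr /andP[_]; rewrite ltnn.
Qed.

Lemma fstep_same sp H i f : agr H -> (i < N)%N -> (f < 64)%N -> f \notin unzip1 (fo sp) ->
  fstep rnd sp (H i) f = H i f.
Proof.
move=> Hag iN f64 nf; have [h1 _ _] := Hag i iN.
by rewrite /fstep fo_at_nil // ev_nil (rnd0 Hrnd Hp) addr0 (rnd_id Hrnd (h1 f f64)).
Qed.

Lemma fstep_agrees sp H : fresh_bits (unzip1 (fo sp)) -> agr H -> agr (fun i => fstep rnd sp (H i)).
Proof.
move=> /allP fr Hag i iN; have [h1 h2 h3] := Hag i iN; split.
- by move=> f f64; apply: (rnd_rep Hrnd).
- move=> f f56; rewrite fstep_same ?h2 //; first exact: ltn_trans f56 _.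
  by apply/negP => /fr /andP[]; rewrite leqNgt f56.
by rewrite fstep_same //; apply/negP => /fr /andP[_]; rewrite ltnn.
Qed.

Lemma lin_nil ms (v : nat -> R) : lin [::] ms v = 0.
Proof. by rewrite /lin ev_nil. Qed.

Lemma to_units L (k : nat) c : c <= 14 / 10 -> `|L - eta * k%:R| <= eta * (c * b ^+ 4) ->
  `|L / rho - dl * k%:R| <= dl * b ^+ 3.
Proof.
move=> c14 h; have [_ E d0 /andP[r0 _]] := dlf.
have -> : L / rho - dl * k%:R = (L - eta * k%:R) / rho by field; rewrite gt_eqF.
rewrite normrM [`|rho^-1|]gtr0_norm ?invr_gt0 // ler_pdivrMr // mulrAC -E; apply: le_trans h _.
have [_ _ e0 _] := consts_eta Hc; rewrite ler_pM2l //.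
have /andP[_ p4] := bpow 3 1 (b_ok Hc); have /andP[b3 _] := b_small Hc 3; have /andP[b4 _] := b_small Hc 4.
have : c * b ^+ 4 <= 14 / 10 * b ^+ 4 by rewrite ler_pM2r.
by move: p4 b3; rewrite expr1; wipe; lra.
Qed.

Lemma adj_at x1 x2 : (x1 < n)%N -> (x2 < n)%N ->
  exists j : 'I_N, [/\ isadj n j, (rk s j %/ n)%N = x1 & (rk s j %% n)%N = x2].
Proof.
move=> h1 h2; have [|j jE ja] := @adj_of_lt p Hp n s t (x1 * n + x2).
  by apply: leq_trans (_ : x1.+1 * n <= _)%N; [rewrite mulSn addnC ltn_add2r | rewrite leq_mul2r h1 orbT].
have rE : rk s j = (x1 * n + x2)%N by have [-> _] := rk_adj s ja; rewrite jE.
exists j; rewrite rE; split=> //.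
  by rewrite divnMDl ?(n_gt0 s) // divn_small // addn0.
by rewrite modnMDl modn_small.
Qed.

Lemma coord_lt i : isadj n i || ispad n i ->
  [/\ (rk s i %% n < n)%N, ((rk s i %/ n) %% n < n)%N, (rk s i %/ n %/ n < n)%N & isadj n i -> (rk s i %/ n < n)%N].
Proof.
move=> ap; have n0 := n_gt0 s; rewrite !ltn_mod !ltn_divLR // (rk_lt s ap) n0; split=> // ai.
by have [-> h] := rk_adj s ai.
Qed.

Section RepHead.
Variables (hsp : head_spec) (k1 k2 bit : nat) (rest : seq nat).
Notation l := (k1 :: k2 :: rest ++ [:: fRHO]).
Notation ms := ((flags ++ l) ++ [:: bit; fZ]).
Hypothesis k1k : k1 \in keys.
Hypothesis k2k : k2 \in keys.
Hypothesis rsm : all (mem small_feats) rest.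
Hypothesis rsz : (size rest <= 6)%N.
Hypothesis b56 : (56 <= bit)%N.
Hypothesis hm0 : hm hsp = false.
Hypothesis okh : okq hsp ms.
Hypothesis hvE : nth [::] (hv hsp) 0 = bal (c8 [:: bit]).
Variable H : nat -> nat -> R.
Hypothesis Hag : agr H.
Hypothesis bb : forall k, (k < N)%N -> `|H k bit| <= 105 / 100 * tau.

Let l56 : all (fun g => (g < 56)%N) l.
Proof.
have kk k : k \in keys -> (k < 56)%N by move: k; apply/allP.
rewrite /= !kk // all_cat /= andbT; apply/allP => g /(allP rsm); move: g; exact/allP.
Qed.

Let l1 k g : (k < N)%N -> g \in l -> `|V k g| <= 1.
Proof.
move=> kN; have kk f : f \in keys -> `|V k f| <= 1.
  move=> fk; have /andP[h0 h1] := keyb kN fk; have /andP[_ b2] := b_small Hc 2.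
  by rewrite ger0_norm //; move: h1 b2; wipe; lra.
rewrite !inE mem_cat inE; case/orP=> [/eqP->|/orP[/eqP->|/orP[gr|/eqP->]]]; [exact: kk | exact: kk | |].
  by apply: (rho_gN_le Nb Hc); apply: smle => //; apply: (allP rsm).
by have [_ _ _ /andP[r0 r1]] := dlf; rewrite Vrho // gtr0_norm //; move: r1; wipe; lra.
Qed.

Definition nurep k := sumsq rest (V k) + rho ^+ 2.

Let lS k : (k < N)%N -> sumsq l (V k) = V k k1 ^+ 2 + V k k2 ^+ 2 + nurep k.
Proof. by move=> kN; rewrite /sumsq !big_cons big_cat /= big_seq1 Vrho // /nurep /sumsq !addrA. Qed.

Let nur k : (k < N)%N -> 0 <= nurep k /\ nurep k <= 14 / 10 * b ^+ 14.
Proof.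
move=> kN; have [/andP[h0 h1] r2] := small_sumsq Hrnd Hp Vflag Veq Nb Hc Vrho Veta kN rsm rsz.
have /andP[b14 _] := b_small Hc 14; rewrite /nurep.
by split; move: h0 h1 r2 (sqr_ge0 rho) b14; wipe; lra.
Qed.

Let nur01 k : (k < N)%N -> 0 <= nurep k <= 1.
Proof.
move=> /nur[h0 h1]; rewrite h0 /=; apply: le_trans h1 _; have /andP[_ b2] := b_small Hc 2.
have /andP[_ h] := bpow 2 12 (b_ok Hc); have /andP[b0 _] := b_small Hc 2.
have : (1 / 5) ^+ 12 * b ^+ 2 <= 1 * b ^+ 2 by rewrite ler_pM2r //; apply: exprn_ile1; wipe; lra.
by move: h b2; wipe; lra.
Qed.

Lemma rep_hout i v e0 : (i < N)%N -> `|v| <= 2 * tau -> 0 <= e0 <= 2 * tau ->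
  (forall j : 'I_N, j \in best rnd N hsp (fun k => lnf rnd ms (H k)) i -> `|H j bit - v| <= e0) ->
  `|hout rnd N hsp (fun k => lnf rnd ms (H k)) i 0 - v| <= e0 + tau / 50.
Proof.
move=> iN v2 e02 hb.
apply: (fetch Hrnd Hp Hc iN hvE) => //.
  apply/allP => g; rewrite -[unzip1 _]/[:: fZ; bit] !inE => /orP[] /eqP ->; by rewrite mem_cat !inE eqxx ?orbT.
move=> j jb; have jN := ltn_ord j; rewrite lin8_c8 big_seq1.
have [F _] := head_state Vflag Hc Hag l56 b56 l1 bb lS jN.
split=> //; [exact: hb | exact: bb | by have [_ _] := Hag jN |].
apply: (head_w Hrnd Hp Vflag Veq Nb Hc Vrho Veta Hag l56 b56 k1k k2k l1 bb lS nur01 jN).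
by case: (nur jN).
Qed.

(** Wherever the head looks, it averages bits, and an average is bounded like its terms. *)
Lemma rep_hout_le i : (i < N)%N -> `|hout rnd N hsp (fun k => lnf rnd ms (H k)) i 0| <= 107 / 100 * tau.
Proof.
move=> iN; have [/andP[t0 _] _] := taut; rewrite -[hout _ _ _ _ _ _]subr0.
apply: le_trans (rep_hout (v := 0) (e0 := 105 / 100 * tau) iN _ _ _) _.
- by rewrite normr0; move: t0; wipe; lra.
- by apply/andP; split; move: t0; wipe; lra.
- by move=> j _; rewrite subr0; apply: bb.
by wipe; lra.
Qed.

Variables (P : pred nat) (i : nat) (X1 X2 : R) (x1 x2 : nat) (a : nat -> R) (y1 y2 : nat -> nat).
Hypothesis iN : (i < N)%N.
Hypothesis dotE : forall k, (k < N)%N ->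
  dot hsp ms (H i) (H k) = rho * (X1 * V k k1 + X2 * V k k2 + (P k)%:R + a k).
Hypothesis YP : forall k, (k < N)%N -> P k -> [/\ `|V k k1 - dl * (y1 k)%:R| <= dl * b ^+ 3,
  `|V k k2 - dl * (y2 k)%:R| <= dl * b ^+ 3, (y1 k <= n)%N & (y2 k <= n)%N].
Hypothesis XP : [/\ `|X1 - dl * x1%:R| <= dl * b ^+ 3, `|X2 - dl * x2%:R| <= dl * b ^+ 3, (x1 <= n)%N & (x2 <= n)%N].
Hypothesis ab : forall k, (k < N)%N -> `|a k| <= 15 / 100 * b ^+ 8.

Lemma rep_attend (j j0 : 'I_N) : P j0 -> y1 j0 = x1 -> y2 j0 = x2 ->
  j \in best rnd N hsp (fun k => lnf rnd ms (H k)) i ->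
  [/\ P j, y1 j = x1, y2 j = x2 & a j0 - a j < b ^+ 12].
Proof.
by apply: (attend Hrnd Hp Vflag Veq Nb Hc Vrho Veta Hag hm0 okh l56 b56 k1k k2k l1 bb lS nur01
  (fun k kN _ => (nur kN).2) iN dotE YP XP ab).
Qed.

End RepHead.

End RepStep.

(** * One round squares the reachability matrix *)

Section RepOne.
Variables (R : archiRcfType) (p : nat) (rnd : R -> R).
Hypothesis Hrnd : correct_rounding p rnd.
Hypothesis Hp : (20 <= p)%N.
Variables (n : nat) (A : 'I_n -> 'I_n -> bool) (s t : 'I_n).
Notation N := (len s t).
Notation tok i := (tokn A s t i).
Variable V : nat -> nat -> R.
Hypothesis Vflag : forall i f, f \in flags -> V i f = (f == tok_flag (tok i))%:R.
Hypothesis Veq : eqns rnd N V (subs_of init_specs).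
Notation u := (uerr R p).
Variables b rho tau eta : R.
Hypothesis Nb : N%:R * b = 1.
Hypothesis Hc : consts_ok b u rho tau eta.
Hypothesis Vrho : forall i, (i < N)%N -> V i fRHO = rho.
Hypothesis Vtau : forall i, (i < N)%N -> V i fTAU = tau.
Hypothesis Veta : forall i, (i < N)%N -> V i fETA = eta.

Let dlf := dl_facts Hc.
Notation dl := (eta / rho).
Let taut := tau_tiny Hc.
Let REMf := REM_fact Hrnd Hp Vflag Veq Nb Hc Vrho Veta.
Let IIf := II_fact Hrnd Hp Vflag Veq Nb Hc Vrho Veta.
Let JJf := JJ_fact Hrnd Hp Vflag Veq Nb Hc Vrho Veta.
Let KQf := KQ_fact Hrnd Hp Vflag Veq Nb Hc Vrho Veta.
Let KRf := KR_fact Hrnd Hp Vflag Veq Nb Hc Vrho Veta.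
Notation agr := (agrees p s t V).
Notation bnd := (bounded s t tau).

Definition rest1 := [:: fII; fJJ; fE1; fETA; fNQ].
Notation ms1 := ((flags ++ (fKQ :: fKR :: rest1 ++ [:: fRHO])) ++ [:: bR; fZ]).

Lemma step_near (x h v e : R) : `|x| <= tau / 100 -> `|h - v| <= e -> `|v| <= 2 * tau -> 0 <= e <= 2 * tau ->
  `|rnd (x + h) - v| <= e + tau / 80.
Proof.
move=> hx hh hv /andP[e0 e2]; have [/andP[t0 t1] ut] := taut; have u0 := uerr_gt0 R p.
move: hx hh hv; rewrite !ler_norml !lerBlDr => /andP[x0 x1] /andP[h0 h1] /andP[v0 v1].
have S : `|x + h| <= 1 by rewrite ler_norml; apply/andP; split; move: x0 x1 h0 h1 v0 v1 t1 e0 e2 t0; wipe; lra.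
have /andP[n1 n2] := rnd_near Hrnd Hp S (ler_nat _ 1 512).
by apply/andP; split; move: n1 n2 x0 x1 h0 h1 ut u0 t0; wipe; lra.
Qed.

Section Rep1.
Variables (M : nat -> nat -> bool) (H : nat -> nat -> R).
Hypothesis Hag : agr H.
Hypothesis Hb : bnd H.
Hypothesis Hcd : coded s t tau M H.

Let bR105 k : (k < N)%N -> `|H k bR| <= 105 / 100 * tau.
Proof. by case/Hb. Qed.

Lemma adj_YP k : (k < N)%N -> isadj n k ->
  [/\ `|V k fKQ - dl * (rk s k %/ n)%:R| <= dl * b ^+ 3, `|V k fKR - dl * (rk s k %% n)%:R| <= dl * b ^+ 3,
      (rk s k %/ n <= n)%N & (rk s k %% n <= n)%N].
Proof.
move=> kN ak; have ap : isadj n k || ispad n k by rewrite ak.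
have [c1 _ _ c2] := coord_lt s ap; split; [exact: KQf | exact: KRf | exact/ltnW/c2 | exact: ltnW].
Qed.

Lemma adj_fetch hsp i X1 X2 x1 x2 : (i < N)%N -> hm hsp = false -> okq hsp ms1 ->
  nth [::] (hv hsp) 0 = bal (c8 [:: bR]) -> (x1 < n)%N -> (x2 < n)%N ->
  (forall k, (k < N)%N -> dot hsp ms1 (H i) (H k) = rho * (X1 * V k fKQ + X2 * V k fKR + (isadj n k)%:R + 0)) ->
  `|X1 - dl * x1%:R| <= dl * b ^+ 3 -> `|X2 - dl * x2%:R| <= dl * b ^+ 3 ->
  `|hout rnd N hsp (fun k => lnf rnd ms1 (H k)) i 0 - tau * (M x1 x2)%:R| <= tau / 20 + tau / 50.
Proof.
move=> iN hm0 ok hvE h1 h2 dE X1f X2f; have [/andP[t0 t1] _] := taut.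
apply: (rep_hout Hrnd Hp Vflag Veq Nb Hc Vrho Veta (k1 := fKQ) (k2 := fKR) (bit := bR) (rest := rest1)) => //.
- by case: (M _ _); rewrite ?mulr1 ?mulr0 ?normr0 ?gtr0_norm //; move: t0; wipe; lra.
- by apply/andP; split; move: t0; wipe; lra.
move=> j jb; have [j0 [a0 e1 e2]] := adj_at Hp s t h1 h2.
have z0 k : (k < N)%N -> `|(fun=> 0 : R) k| <= 15 / 100 * b ^+ 8.
  by move=> _; rewrite normr0; have /andP[b8 _] := b_small Hc 8; move: b8; wipe; lra.
have [aj <- <- _] := rep_attend Hrnd Hp Vflag Veq Nb Hc Vrho Veta (k1 := fKQ) (k2 := fKR) (bit := bR) (rest := rest1)
  isT isT isT isT isT hm0 ok Hag bR105 iN dE adj_YP (And4 X1f X2f (ltnW h1) (ltnW h2)) z0 a0 e1 e2 jb.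
exact: Hcd.
Qed.

Let hsA := nth no_head (hs rep1) 0.
Let hsB := nth no_head (hs rep1) 1.

Lemma adj_flag k : (k < N)%N -> \sum_(f <- [:: fT0; fT1]) V k f = (isadj n k)%:R.
Proof.
move=> kN; rewrite (sum_flag Vflag) //; last exact: (allP (isT : all (mem flags) [:: fT0; fT1])).
by rewrite (flag_adj A kN).
Qed.

Lemma dotA i k : (i < N)%N -> (k < N)%N -> dot hsA ms1 (H i) (H k) =
  rho * (V i fII / rho * V k fKQ + lin8 l_rem (V i) / rho * V k fKR + (isadj n k)%:R + 0).
Proof.
move=> iN kN; have [_ _ zi] := Hag iN; have [_ _ zk] := Hag kN.
have [_ _ _ /andP[r0 _]] := dlf; have rn : rho != 0 by rewrite gt_eqF.
rewrite /dot !big_ord_recl big_ord0 /= !lin_bal // lin_nil !(lin8_agree Hag iN) // !(lin8_agree Hag kN) //.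
rewrite !lin8_c8 adj_flag // !big_seq1 Vrho //; move: (lin8 _ _) (_%:R) => x y.
by field.
Qed.

Lemma dotB i k : (i < N)%N -> (k < N)%N -> dot hsB ms1 (H i) (H k) =
  rho * (lin8 l_rem (V i) / rho * V k fKQ + V i fJJ / rho * V k fKR + (isadj n k)%:R + 0).
Proof.
move=> iN kN; have [_ _ zi] := Hag iN; have [_ _ zk] := Hag kN.
have [_ _ _ /andP[r0 _]] := dlf; have rn : rho != 0 by rewrite gt_eqF.
rewrite /dot !big_ord_recl big_ord0 /= !lin_bal // lin_nil !(lin8_agree Hag iN) // !(lin8_agree Hag kN) //.
rewrite !lin8_c8 adj_flag // !big_seq1 Vrho //; move: (lin8 _ _) (_%:R) => x y.
by field.
Qed.

Let H1 := astep rnd N rep1 H.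

Lemma H1_bits i : (i < N)%N ->
  [/\ H1 i bR = H i bR, H1 i bA = H i bA, H1 i bO = H i bO,
      `|H1 i bX| <= 11 / 10 * tau & `|H1 i bY| <= 11 / 10 * tau].
Proof.
move=> iN; have [/andP[t0 t1] _] := taut; have [_ _ hx hy _] := Hb iN; split=> //.
- have h := rep_hout_le Hrnd Hp Vflag Veq Nb Hc Vrho Veta (hsp := hsA) (k1 := fKQ) (k2 := fKR) (bit := bR) (rest := rest1)
    isT isT isT isT isT erefl Hag bR105 iN.
  rewrite -[hout _ _ _ _ _ _]subr0 in h.
  have := step_near hx h; rewrite normr0 subr0 => k.
  apply: le_trans (k _ _) _; [| apply/andP; split |]; move: t0; wipe; lra.
- have h := rep_hout_le Hrnd Hp Vflag Veq Nb Hc Vrho Veta (hsp := hsB) (k1 := fKQ) (k2 := fKR) (bit := bR) (rest := rest1)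
    isT isT isT isT isT erefl Hag bR105 iN.
  rewrite -[hout _ _ _ _ _ _]subr0 in h.
  have := step_near hy h; rewrite normr0 subr0 => k.
  apply: le_trans (k _ _) _; [| apply/andP; split |]; move: t0; wipe; lra.
Qed.

(** The padding token of index (i n + j) n + k has the digits i, j, k, which the quotients and
    remainders in the statement spell out. *)
Lemma H1_pad i : (i < N)%N -> ispad n i ->
  `|H1 i bX - tau * (M (rk s i %/ n %/ n) (rk s i %% n))%N%:R| <= tau * (9 / 100) /\
  `|H1 i bY - tau * (M (rk s i %% n) ((rk s i %/ n) %% n))%N%:R| <= tau * (9 / 100).
Proof.
move=> iN pi; have ap : isadj n i || ispad n i by rewrite pi orbT.
have [c1 c2 c3 _] := coord_lt s ap; have [/andP[t0 t1] _] := taut; have [_ _ hx hy _] := Hb iN.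
have le2 (B : bool) : `|tau * B%:R| <= 2 * tau.
  by case: B; rewrite ?mulr1 ?mulr0 ?normr0 ?gtr0_norm //; move: t0; wipe; lra.
have e2 : 0 <= tau / 20 + tau / 50 <= 2 * tau by apply/andP; split; move: t0; wipe; lra.
have fR := to_units Hc (_ : 8 / 10 <= 14 / 10) (REMf iN ap).
have fI := to_units Hc (lexx _) (IIf iN ap); have fJ := to_units Hc (lexx _) (JJf iN ap).
have {}fR := fR (ltac:(wipe; lra)).
split.
  have h := adj_fetch iN (erefl : hm hsA = false) isT erefl c3 c1 (fun k => dotA iN) fI fR.
  by apply: le_trans (step_near hx h (le2 _) e2) _; move: t0; wipe; lra.
have h := adj_fetch iN (erefl : hm hsB = false) isT erefl c1 c2 (fun k => dotB iN) fR fJ.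
by apply: le_trans (step_near hy h (le2 _) e2) _; move: t0; wipe; lra.
Qed.

End Rep1.

End RepOne.

(** * First repeated layer: conjunction and erasure *)

Section RepOneFF.
Variables (R : archiRcfType) (p : nat) (rnd : R -> R).
Hypothesis Hrnd : correct_rounding p rnd.
Hypothesis Hp : (20 <= p)%N.
Variables (n : nat) (A : 'I_n -> 'I_n -> bool) (s t : 'I_n).
Notation N := (len s t).
Notation tok i := (tokn A s t i).
Variable V : nat -> nat -> R.
Hypothesis Vflag : forall i f, f \in flags -> V i f = (f == tok_flag (tok i))%:R.
Hypothesis Veq : eqns rnd N V (subs_of init_specs).
Notation u := (uerr R p).
Variables b rho tau eta : R.
Hypothesis Nb : N%:R * b = 1.
Hypothesis Hc : consts_ok b u rho tau eta.
Hypothesis Vrho : forall i, (i < N)%N -> V i fRHO = rho.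
Hypothesis Vtau : forall i, (i < N)%N -> V i fTAU = tau.
Hypothesis Veta : forall i, (i < N)%N -> V i fETA = eta.

Let taut := tau_tiny Hc.
Notation agr := (agrees p s t V).
Notation bnd := (bounded s t tau).

Lemma ff_state (G : nat -> nat -> R) i bits x y z : agr G -> (i < N)%N ->
  all (fun g => (56 <= g)%N) bits -> \sum_(g <- bits) G i g = x + y + z ->
  \sum_(g <- bits) G i g ^+ 2 = x ^+ 2 + y ^+ 2 + z ^+ 2 ->
  (forall g, g \in bits -> `|G i g| <= 11 / 10 * tau) ->
  `|x| <= 11 / 10 * tau -> `|y| <= 11 / 10 * tau -> `|z| <= 11 / 10 * tau ->
  flagged ((flags ++ [:: fTAU]) ++ bits) (G i) /\
  exists2 w, lnS ((flags ++ [:: fTAU]) ++ bits) (G i) = 1 + w & 0 <= w <= 10 * tau ^+ 2.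
Proof.
move=> Hag iN b56 s1 s2 gb hx hy hz; have [/andP[t0 t1] _] := taut.
have [E mE] := @lnS_bits R (flags ++ [:: fTAU]) bits (G i) isT b56.
rewrite s1 s2 (sumsq_agree Vflag Hag) // /sumsq big_seq1 Vtau // in E mE.
have sq (q : R) : `|q| <= 11 / 10 * tau -> 0 <= q ^+ 2 <= 121 / 100 * tau ^+ 2.
  move=> h; rewrite sqr_ge0 /=; have -> : 121 / 100 * tau ^+ 2 = (11 / 10 * tau) ^+ 2 by field.
  rewrite -(real_normK (num_real q)); apply: lerXn2r; rewrite ?nnegrE //.
  by move: t0; wipe; lra.
have /andP[x0 x1] := sq _ hx; have /andP[y0 y1] := sq _ hy; have /andP[z0 z1] := sq _ hz.
have c3 := sum3_sq x y z; have c0 := sqr_ge0 (x + y + z); have tt := sqr_ge0 tau.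
set w := tau ^+ 2 + (x ^+ 2 + y ^+ 2 + z ^+ 2) / 2 - (x + y + z) ^+ 2 / 256.
have Ew : lnS ((flags ++ [:: fTAU]) ++ bits) (G i) = 1 + w by rewrite E /w; field.
have w0 : 0 <= w by rewrite /w; move: x0 y0 z0 c3 tt; wipe; lra.
have w1 : w <= 10 * tau ^+ 2 by rewrite /w; move: x1 y1 z1 c0 tt; wipe; lra.
split; last by exists w => //; rewrite w0 w1.
split.
- move=> g; rewrite mem_cat => /orP[gl|gl].
    apply: (agree_le1 Vflag Hag iN (isT : all (fun g => (g < 56)%N) [:: fTAU]) _ gl).
    by move=> f; rewrite inE => /eqP ->; rewrite Vtau // gtr0_norm //; move: t1; wipe; lra.
  by apply: le_trans (gb g gl) _; move: t1; wipe; lra.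
- rewrite mE normrM [`|_^-1|]gtr0_norm ?invr_gt0 //.
  have : `|x + y + z| <= 33 / 10 * tau.
    by move: hx hy hz; rewrite !ler_norml; wipe => /andP[? ?] /andP[? ?] /andP[? ?]; apply/andP; split; lra.
  by move: t1; wipe; lra.
by rewrite Ew; move: w0; wipe; lra.
Qed.

Section Rep1FF.
Variables (M : nat -> nat -> bool) (H : nat -> nat -> R).
Hypothesis Hag : agr H.
Hypothesis Hb : bnd H.
Hypothesis Hcd : coded s t tau M H.
Let H1 := astep rnd N rep1 H.
Let H2 i := fstep rnd rep1 (H1 i).

Let ag1 : agr H1.
Proof. exact: (astep_agrees (sp := rep1) Hrnd isT Hag). Qed.

(** For two true bits L0 is nominally 3/2 tau, otherwise at most - tau/2. The inputs are off by
    9/100 tau each and have coefficient 2, which gives 36/100 tau, within the margin tau/2 on both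
    sides of the ramp. *)
Lemma rep1_out i : (i < N)%N ->
  [/\ H2 i bR = H i bR, H2 i bO = H i bO, `|H2 i bX| <= tau / 100, `|H2 i bY| <= tau / 100 &
     `|H2 i bA| <= 105 / 100 * tau /\
     (ispad n i -> `|H2 i bA - tau * (M (rk s i %/ n %/ n) (rk s i %% n) && M (rk s i %% n) ((rk s i %/ n) %% n))%N%:R|
        <= tau / 100)].
Proof.
move=> iN; have [/andP[t0 t1] ut] := taut; have [hr ha ho hx hy] := H1_bits Hrnd Hp Vflag Veq Nb Hc Vrho Veta Hag Hb iN.
rewrite -/H1 in hr ha ho hx hy.
have hA : `|H1 i bA| <= 11 / 10 * tau.
  by rewrite ha; have [_ h _ _ _] := Hb iN; move: h t0; wipe; lra.
have [_ _ z1] := ag1 iN.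
have [|||F [w SE wb]] := @ff_state H1 i [:: bX; bY; bA; fZ] (H1 i bX) (H1 i bY) (H1 i bA) ag1 iN isT _ _ _ hx hy hA.
- by rewrite !big_cons big_nil z1 !addr0 !addrA.
- by rewrite !big_cons big_nil z1 expr0n !addr0 !addrA.
- move=> g; rewrite !inE => /orP[/eqP->|/orP[/eqP->|/orP[/eqP->|/eqP->]]] //.
  by rewrite z1 normr0; move: t0; wipe; lra.
rewrite -[(flags ++ _) ++ _]/(fm rep1) in F SE.
have un m f := @unit_near R p rnd Hrnd Hp b rho tau eta Hc rep1 (H1 i) w z1 F SE wb m f.
have l8 f L : lin8 f (H1 i) = L -> `|L| <= 10 * tau -> `|lin8 f (H1 i)| <= 10 * tau by move=> ->.
have one (f : nat) : lin8 (c8 [:: f]) (H1 i) = H1 i f by rewrite lin8_c8 big_seq1.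
have opp (f : nat) : lin8 [:: (f, - 8%:Z)] (H1 i) = - H1 i f by rewrite lin8_cons lin8_nil; field.
have small f : `|H1 i f| <= 11 / 10 * tau -> `|H1 i f| <= 10 * tau /\ `|H1 i f| <= 2 * tau.
  by move=> h; split; move: h t0; wipe; lra.
have Ptau : H1 i fTAU = tau by have [_ h _] := ag1 iN; rewrite h // Vtau.
set L0 := 2 * H1 i bX + 2 * H1 i bY - 5 / 2 * tau.
have e0 : lin8 [:: (bX, 16%:Z); (bY, 16%:Z); (fTAU, - 20%:Z)] (H1 i) = L0.
  by rewrite !lin8_cons lin8_nil Ptau /L0; field.
have e1 : lin8 [:: (bX, 16%:Z); (bY, 16%:Z); (fTAU, - 28%:Z)] (H1 i) = L0 - tau.
  by rewrite !lin8_cons lin8_nil Ptau /L0; field.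
have c5 : 0 <= 5 / 2 * tau <= 5 * tau by apply/andP; split; move: t0; wipe; lra.
have c7 : 0 <= 5 / 2 * tau + tau <= 5 * tau by apply/andP; split; move: t0; wipe; lra.
have b0 : `|L0| <= 10 * tau /\ `|L0 - tau| <= 10 * tau.
  by split; [exact: (preact_le Hc) | rewrite /L0 -addrA -opprD; exact: (preact_le Hc)].
have u0 := un 0%N _ erefl isT isT (l8 _ _ e0 b0.1).
have u1 := un 1%N _ erefl isT isT (l8 _ _ e1 b0.2).
have [sA sA2] := small _ hA; have [sX sX2] := small _ hx; have [sY sY2] := small _ hy.
have u2 := un 2 _ erefl isT isT (l8 _ _ (one bA) sA).
have nsA : `|- H1 i bA| <= 10 * tau by rewrite normrN.
have nsX : `|- H1 i bX| <= 10 * tau by rewrite normrN.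
have nsY : `|- H1 i bY| <= 10 * tau by rewrite normrN.
have u3 := un 3 _ erefl isT isT (l8 _ _ (opp bA) nsA).
have u4 := un 4 _ erefl isT isT (l8 _ _ (one bX) sX).
have u5 := un 5 _ erefl isT isT (l8 _ _ (opp bX) nsX).
have u6 := un 6 _ erefl isT isT (l8 _ _ (one bY) sY).
have u7 := un 7 _ erefl isT isT (l8 _ _ (opp bY) nsY).
rewrite e0 in u0; rewrite e1 in u1; rewrite (one bA) in u2; rewrite (one bX) in u4; rewrite (one bY) in u6.
rewrite (opp bA) in u3; rewrite (opp bX) in u5; rewrite (opp bY) in u7.
have half (q : R) : `|q| <= tau / 100 / 2 -> `|q| <= tau / 100 by move: t0; wipe; lra.
have kA := unit4 Hrnd Hp Hc sA2 (erefl : fo_at rep1 bA = _) u0 u1 u2 u3.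
have kX := unit2 Hrnd Hp Hc sX2 (erefl : fo_at rep1 bX = _) u4 u5.
have kY := unit2 Hrnd Hp Hc sY2 (erefl : fo_at rep1 bY = _) u6 u7.
rewrite -!/(H2 i _) in kA kX kY.
have [c01 [cl ch]] := clip_bounds Hc L0.
split; [| | exact: half | exact: half | split; first exact: (clip_le Hc c01)].
- by rewrite /H2 (fstep_same Hrnd Hp ag1).
- by rewrite /H2 (fstep_same Hrnd Hp ag1).
move=> pi; have [] := H1_pad Hrnd Hp Vflag Veq Nb Hc Vrho Veta Hag Hb Hcd iN pi; rewrite -/H1.
have lo : L0 <= 0 -> `|H2 i bA| <= tau / 100 by move=> h; apply: half; move: kA; rewrite (cl h) subr0.
have hi : tau <= L0 -> `|H2 i bA - tau| <= tau / 100 by move=> h; apply: half; move: kA; rewrite (ch h).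
case: (M _ _); case: (M _ _); rewrite /= ?mulr1 ?mulr0 ?subr0 => X Y; [apply: hi | apply: lo | apply: lo | apply: lo];
  move: X Y; rewrite /L0 !ler_norml => /andP[x0 x1] /andP[y0 y1]; move: x0 x1 y0 y1 t0; wipe; lra.
Qed.

Lemma rep1_agrees : agr H2.
Proof. exact: (fstep_agrees (sp := rep1) Hrnd Hp isT ag1). Qed.

End Rep1FF.

End RepOneFF.

(** * Second repeated layer: disjunction over the middle vertex *)

Section RepTwo.
Variables (R : archiRcfType) (p : nat) (rnd : R -> R).
Hypothesis Hrnd : correct_rounding p rnd.
Hypothesis Hp : (20 <= p)%N.
Variables (n : nat) (A : 'I_n -> 'I_n -> bool) (s t : 'I_n).
Notation N := (len s t).
Notation tok i := (tokn A s t i).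
Variable V : nat -> nat -> R.
Hypothesis Vflag : forall i f, f \in flags -> V i f = (f == tok_flag (tok i))%:R.
Hypothesis Veq : eqns rnd N V (subs_of init_specs).
Notation u := (uerr R p).
Variables b rho tau eta : R.
Hypothesis Nb : N%:R * b = 1.
Hypothesis Hc : consts_ok b u rho tau eta.
Hypothesis Vrho : forall i, (i < N)%N -> V i fRHO = rho.
Hypothesis Vtau : forall i, (i < N)%N -> V i fTAU = tau.
Hypothesis Veta : forall i, (i < N)%N -> V i fETA = eta.

Let dlf := dl_facts Hc.
Notation dl := (eta / rho).
Let taut := tau_tiny Hc.
Let REMf := REM_fact Hrnd Hp Vflag Veq Nb Hc Vrho Veta.
Let QQf := QQ_fact Hrnd Hp Vflag Veq Nb Hc Vrho Veta.
Let KIf := KI_fact Hrnd Hp Vflag Veq Nb Hc Vrho Veta.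
Let KJf := KJ_fact Hrnd Hp Vflag Veq Nb Hc Vrho Veta.
Notation agr := (agrees p s t V).
Notation bnd := (bounded s t tau).

Definition rest2 := [:: fQQ; fE1; fETA; fNQ].
Notation ms2 := ((flags ++ (fKI :: fKJ :: rest2 ++ [:: fRHO])) ++ [:: bA; fZ]).

Definition square (M : nat -> nat -> bool) q r := M q r || has (fun k => M q k && M k r) (iota 0 n).

Lemma pad_at x1 x2 k : (x1 < n)%N -> (x2 < n)%N -> (k < n)%N ->
  exists j : 'I_N, [/\ ispad n j, (rk s j %/ n %/ n)%N = x1, ((rk s j %/ n) %% n)%N = x2 & (rk s j %% n)%N = k].
Proof.
move=> h1 h2 hk; have n0 := n_gt0 s; have [_ t1 t2 t3] := thresholds Hp s t.
set q := (x1 * n + x2)%N; set r := (q * n + k)%N.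
have step a c m : (a < m)%N -> (c < n)%N -> (a * n + c < m * n)%N.
  by move=> ha hc; apply: leq_trans (_ : a.+1 * n <= _)%N; [rewrite mulSn addnC ltn_add2r | rewrite leq_mul2r ha orbT].
have rn : (r < n ^ 3)%N by rewrite (_ : n ^ 3 = n * n * n)%N ?step // !expnS expn0 muln1 mulnA.
have pr : ispad n (sPAD n + r) by rewrite /ispad leq_addr /sTA ltn_add2l.
have rN : (sPAD n + r < N)%N.
  by case/andP: pr => _ pr; apply: ltn_trans pr (ltn_trans t2 t3).
have rE : rk s (sPAD n + r) = r by have [-> _] := rk_pad s pr; rewrite addKn.
exists (Ordinal rN); rewrite /= rE; split=> //.
- by rewrite /r divnMDl // (divn_small hk) addn0 /q divnMDl // divn_small // addn0.
- by rewrite /r divnMDl // (divn_small hk) addn0 /q modnMDl modn_small.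
- by rewrite /r modnMDl modn_small.
Qed.

Section Rep2.
Variables (M : nat -> nat -> bool) (G : nat -> nat -> R).
Hypothesis Hag : agr G.
Hypothesis GR : forall i, (i < N)%N -> `|G i bR| <= 105 / 100 * tau.
Hypothesis GA : forall i, (i < N)%N -> `|G i bA| <= 105 / 100 * tau.
Hypothesis GO : forall i, (i < N)%N -> `|G i bO| <= tau / 100.
Hypothesis Hcd : coded s t tau M G.
Hypothesis padA : forall i, (i < N)%N -> ispad n i ->
  `|G i bA - tau * (M (rk s i %/ n %/ n) (rk s i %% n) && M (rk s i %% n) ((rk s i %/ n) %% n))%N%:R| <= tau / 100.

Let hsC := nth no_head (hs rep2) 0.

Lemma pad_flag k : (k < N)%N -> V k fPAD = (ispad n k)%:R.
Proof. by move=> kN; rewrite Vflag // eq_sym (flag_PAD A kN). Qed.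

Lemma dotC i k : (i < N)%N -> (k < N)%N -> dot hsC ms2 (G i) (G k) =
  rho * (V i fQQ / rho * V k fKI + lin8 l_rem (V i) / rho * V k fKJ + (ispad n k)%:R + G k bA / 2).
Proof.
move=> iN kN; have [_ hi zi] := Hag iN; have [_ hk zk] := Hag kN.
have [_ _ _ /andP[r0 _]] := dlf; have rn : rho != 0 by rewrite gt_eqF.
rewrite /dot !big_ord_recl big_ord0 /= !lin_bal // [lin8 (c8 [:: bA]) _]lin8_c8 big_seq1.
rewrite !(lin8_agree Hag iN) // !(lin8_agree Hag kN) //; move: (lin8 l_rem _) => x.
rewrite !lin8_cons !lin8_nil pad_flag // Vrho //; move: (ispad n k)%:R => y.
by field.
Qed.

Lemma pad_YP k : (k < N)%N -> ispad n k ->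
  [/\ `|V k fKI - dl * (rk s k %/ n %/ n)%:R| <= dl * b ^+ 3, `|V k fKJ - dl * ((rk s k %/ n) %% n)%:R| <= dl * b ^+ 3,
      (rk s k %/ n %/ n <= n)%N & ((rk s k %/ n) %% n <= n)%N].
Proof.
move=> kN ak; have ap : isadj n k || ispad n k by rewrite ak orbT.
have [_ c2 c3 _] := coord_lt s ap; split; [exact: KIf | exact: KJf | exact: ltnW | exact: ltnW].
Qed.

Let H3 := astep rnd N rep2 G.

Lemma H3_bits i : (i < N)%N -> [/\ H3 i bR = G i bR, H3 i bA = G i bA, H3 i bX = G i bX, H3 i bY = G i bY
  & `|H3 i bO| <= 11 / 10 * tau].
Proof.
move=> iN; have [/andP[t0 t1] _] := taut; split=> //.
have h := rep_hout_le Hrnd Hp Vflag Veq Nb Hc Vrho Veta (hsp := hsC) (k1 := fKI) (k2 := fKJ) (bit := bA) (rest := rest2)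
  isT isT isT isT isT erefl Hag GA iN.
rewrite -[hout _ _ _ _ _ _]subr0 in h.
have := step_near Hrnd Hp Hc (GO iN) h; rewrite normr0 subr0 => k.
apply: le_trans (k _ _) _; [| apply/andP; split |]; move: t0; wipe; lra.
Qed.

(** The candidates are the tokens (i,j,k) with k free. A true conjunction has an advantage of about
    tau/2, far above the tolerance b^12 of the lookup: if one k is true, all winners are true, and
    otherwise all are false. In both cases the averaged bits agree. *)
Lemma H3_adj i : (i < N)%N -> isadj n i ->
  `|H3 i bO - tau * (has (fun k => M (rk s i %/ n) k && M k (rk s i %% n)) (iota 0 n))%N%:R| <= tau / 20.
Proof.
move=> iN ai; have ap : isadj n i || ispad n i by rewrite ai.
have [c1 _ _ c2] := coord_lt s ap; have {}c2 := c2 ai; have [/andP[t0 t1] _] := taut.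
set x1 := (rk s i %/ n)%N in c2 *; set x2 := (rk s i %% n)%N in c1 *.
set ex := has _ _.
have fR := to_units Hc (_ : 8 / 10 <= 14 / 10) (REMf iN ap).
have fQ := to_units Hc (_ : 7 / 10 <= 14 / 10) (QQf iN ap).
have {}fR := fR (ltac:(wipe; lra)); have {}fQ := fQ (ltac:(wipe; lra)).
have ab k : (k < N)%N -> `|G k bA / 2| <= 15 / 100 * b ^+ 8.
  move=> kN; have [_ _ _ /andP[_ t2] _] := Hc; have /andP[_ p9] := bpow 8 1 (b_ok Hc).
  have /andP[b8 _] := b_small Hc 8.
  rewrite normrM [`|2^-1|]gtr0_norm ?invr_gt0 //; move: (GA kN) t2 p9 b8; rewrite expr1; wipe; lra.
have win k : (k < n)%N -> forall j : 'I_N, j \in best rnd N hsC (fun k => lnf rnd ms2 (G k)) i ->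
    [/\ ispad n j, (rk s j %/ n %/ n)%N = x1, ((rk s j %/ n) %% n)%N = x2 &
      tau * (M x1 k && M k x2)%:R - tau * (M x1 (rk s j %% n) && M (rk s j %% n) x2)%N%:R <= tau / 10].
  move=> kn j jb; have [j0 [p0 e1 e2 e3]] := pad_at c2 c1 kn.
  have [pj f1 f2 lt] := rep_attend Hrnd Hp Vflag Veq Nb Hc Vrho Veta (k1 := fKI) (k2 := fKJ) (bit := bA) (rest := rest2)
    isT isT isT isT isT (erefl : hm hsC = false) isT Hag GA iN (fun k => dotC iN) pad_YP (And4 fQ fR (ltnW c2) (ltnW c1))
    ab p0 e1 e2 jb.
  split=> //; have h0 := padA (ltn_ord j0) p0; have h1 := padA (ltn_ord j) pj.
  rewrite e1 e2 e3 in h0; rewrite f1 f2 in h1.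
  have b12 : b ^+ 12 <= tau / 50.
    have [_ _ _ /andP[t3 _] _] := Hc; have /andP[_ p12] := bpow 9 3 (b_ok Hc).
    by have /andP[b9 _] := b_small Hc 9; move: t3 p12 b9; wipe; lra.
  move: h0 h1; rewrite !ler_distl; move: (_ * _%:R) (_ * _%:R) => z0 z1 /andP[h0 _] /andP[_ h1].
  by move: h0 h1 lt b12 t0; wipe; lra.
have h := @rep_hout R p rnd Hrnd Hp n A s t V Vflag Veq b rho tau eta Nb Hc Vrho Veta hsC fKI fKJ bA rest2
  isT isT isT isT isT erefl G Hag GA i (tau * ex%:R) (tau / 100) iN.
have le2 (B : bool) : `|tau * B%:R| <= 2 * tau.
  by case: B; rewrite ?mulr1 ?mulr0 ?normr0 ?gtr0_norm //; move: t0; wipe; lra.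
have v2 := le2 ex.
have e2 : 0 <= tau / 100 <= 2 * tau by apply/andP; split; move: t0; wipe; lra.
have hb (j : 'I_N) : j \in best rnd N hsC (fun k => lnf rnd ms2 (G k)) i -> `|G j bA - tau * ex%:R| <= tau / 100.
  move=> jb; have jN := ltn_ord j; have [pj f1 f2 _] := win 0%N (n_gt0 s) j jb.
  have hj := padA jN pj; rewrite f1 f2 in hj.
  suff -> : ex = M x1 (rk s j %% n)%N && M (rk s j %% n)%N x2 by [].
  apply/idP/idP => [/hasP[k]|mm]; last first.
    by apply/hasP; exists (rk s j %% n)%N; rewrite // mem_iota add0n ltn_mod (n_gt0 s).
  rewrite mem_iota add0n => kn mk; have [_ _ _] := win k kn j jb; rewrite mk mulr1.
  by case: (_ && _) => //; rewrite mulr0 subr0 => le; exfalso; move: le t0; wipe; lra.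
have {}h := h v2 e2 hb; have e3 : 0 <= tau / 100 + tau / 50 <= 2 * tau by apply/andP; split; move: t0; wipe; lra.
by apply: le_trans (step_near Hrnd Hp Hc (GO iN) h v2 e3) _; move: t0; wipe; lra.
Qed.

Let H4 i := fstep rnd rep2 (H3 i).
Let ag3 : agr H3.
Proof. exact: (astep_agrees (sp := rep2) Hrnd isT Hag). Qed.

Lemma rep2_agrees : agr H4.
Proof. exact: (fstep_agrees (sp := rep2) Hrnd Hp isT ag3). Qed.

(** L0 is nominally - tau/2 if both inputs are false and at least 3/2 tau otherwise; inputs within
    tau/20 move it by at most tau/5. The output is again within tau/20, so the accuracy is
    reproduced by every round. *)
Lemma rep2_out i : (i < N)%N ->
  [/\ H4 i bA = G i bA, H4 i bX = G i bX, H4 i bY = G i bY, `|H4 i bO| <= tau / 100 &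
     `|H4 i bR| <= 105 / 100 * tau /\
     (isadj n i -> `|H4 i bR - tau * (square M (rk s i %/ n) (rk s i %% n))%N%:R| <= tau / 20)].
Proof.
move=> iN; have [/andP[t0 t1] ut] := taut; have [hr ha hx hy ho] := H3_bits iN.
have hR : `|H3 i bR| <= 11 / 10 * tau.
  by rewrite hr; have h := GR iN; move: h t0; wipe; lra.
have [_ _ z1] := ag3 iN; have h0 : `|0 : R| <= 11 / 10 * tau by rewrite normr0; move: t0; wipe; lra.
have [|||F [w SE wb]] := @ff_state R p n A s t V Vflag b rho tau eta Hc Vtau H3 i [:: bR; bO; fZ] (H3 i bR) (H3 i bO) 0 ag3 iN isT _ _ _ hR ho h0.
- by rewrite !big_cons big_nil z1 !addr0.
- by rewrite !big_cons big_nil z1 expr0n !addr0.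
- by move=> g; rewrite !inE => /orP[/eqP->|/orP[/eqP->|/eqP->]] //; rewrite z1.
rewrite -[(flags ++ _) ++ _]/(fm rep2) in F SE.
have un m f := @unit_near R p rnd Hrnd Hp b rho tau eta Hc rep2 (H3 i) w z1 F SE wb m f.
have l8 f L : lin8 f (H3 i) = L -> `|L| <= 10 * tau -> `|lin8 f (H3 i)| <= 10 * tau by move=> ->.
have one (f : nat) : lin8 (c8 [:: f]) (H3 i) = H3 i f by rewrite lin8_c8 big_seq1.
have opp (f : nat) : lin8 [:: (f, - 8%:Z)] (H3 i) = - H3 i f by rewrite lin8_cons lin8_nil; field.
have small f : `|H3 i f| <= 11 / 10 * tau -> `|H3 i f| <= 10 * tau /\ `|H3 i f| <= 2 * tau.
  by move=> h; split; move: h t0; wipe; lra.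
have Ptau : H3 i fTAU = tau by have [_ h _] := ag3 iN; rewrite h // Vtau.
set L0 := 2 * H3 i bR + 2 * H3 i bO - tau / 2.
have e0 : lin8 [:: (bR, 16%:Z); (bO, 16%:Z); (fTAU, - 4%:Z)] (H3 i) = L0.
  by rewrite !lin8_cons lin8_nil Ptau /L0; field.
have e1 : lin8 [:: (bR, 16%:Z); (bO, 16%:Z); (fTAU, - 12%:Z)] (H3 i) = L0 - tau.
  by rewrite !lin8_cons lin8_nil Ptau /L0; field.
have c5 : 0 <= tau / 2 <= 5 * tau by apply/andP; split; move: t0; wipe; lra.
have c7 : 0 <= tau / 2 + tau <= 5 * tau by apply/andP; split; move: t0; wipe; lra.
have b0 : `|L0| <= 10 * tau /\ `|L0 - tau| <= 10 * tau.
  by split; [exact: (preact_le Hc) | rewrite /L0 -addrA -opprD; exact: (preact_le Hc)].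
have u0 := un 0%N _ erefl isT isT (l8 _ _ e0 b0.1).
have u1 := un 1%N _ erefl isT isT (l8 _ _ e1 b0.2).
have [sR sR2] := small _ hR; have [sO sO2] := small _ ho.
have nsR : `|- H3 i bR| <= 10 * tau by rewrite normrN.
have nsO : `|- H3 i bO| <= 10 * tau by rewrite normrN.
have u2 := un 2 _ erefl isT isT (l8 _ _ (one bR) sR).
have u3 := un 3 _ erefl isT isT (l8 _ _ (opp bR) nsR).
have u4 := un 4 _ erefl isT isT (l8 _ _ (one bO) sO).
have u5 := un 5 _ erefl isT isT (l8 _ _ (opp bO) nsO).
rewrite e0 in u0; rewrite e1 in u1; rewrite (one bR) in u2; rewrite (one bO) in u4.
rewrite (opp bR) in u3; rewrite (opp bO) in u5.
have half (q : R) : `|q| <= tau / 100 / 2 -> `|q| <= tau / 100 by move: t0; wipe; lra.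
have kR := unit4 Hrnd Hp Hc sR2 (erefl : fo_at rep2 bR = _) u0 u1 u2 u3.
have kO := unit2 Hrnd Hp Hc sO2 (erefl : fo_at rep2 bO = _) u4 u5.
rewrite -!/(H4 i _) in kR kO.
have [c01 [cl ch]] := clip_bounds Hc L0.
split; [| | | exact: half | split; first exact: (clip_le Hc c01)].
- by rewrite /H4 (fstep_same Hrnd Hp ag3).
- by rewrite /H4 (fstep_same Hrnd Hp ag3).
- by rewrite /H4 (fstep_same Hrnd Hp ag3).
move=> ai; have := H3_adj iN ai; have := Hcd iN ai; rewrite -hr /square.
have fine (q : R) : `|q| <= tau / 100 / 2 -> `|q| <= tau / 20 by move: t0; wipe; lra.
have lo : L0 <= 0 -> `|H4 i bR| <= tau / 20 by move=> h; apply: fine; move: kR; rewrite (cl h) subr0.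
have hi : tau <= L0 -> `|H4 i bR - tau| <= tau / 20 by move=> h; apply: fine; move: kR; rewrite (ch h).
case: (M _ _); case: (has _ _); rewrite /= ?mulr1 ?mulr0 ?subr0 => X Y; [apply: hi | apply: hi | apply: hi | apply: lo];
  move: X Y; rewrite /L0 !ler_norml => /andP[x0 x1] /andP[y0 y1]; move: x0 x1 y0 y1 t0; wipe; lra.
Qed.

End Rep2.

Definition round_step (H : nat -> nat -> R) :=
  let H2 i := fstep rnd rep1 (astep rnd N rep1 H i) in
  fun i => fstep rnd rep2 (astep rnd N rep2 H2 i).

Lemma round_correct M H : agr H -> bnd H -> coded s t tau M H ->
  [/\ agr (round_step H), bnd (round_step H) & coded s t tau (square M) (round_step H)].
Proof.
move=> Hag Hb Hcd; set H2 := fun i => fstep rnd rep1 (astep rnd N rep1 H i).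
have ag2 : agr H2 by exact: rep1_agrees.
have o1 i (iN : (i < N)%N) := rep1_out Hrnd Hp Vflag Veq Nb Hc Vrho Vtau Veta Hag Hb Hcd iN.
have GR i : (i < N)%N -> `|H2 i bR| <= 105 / 100 * tau.
  by move=> iN; have [e _ _ _ _] := o1 i iN; rewrite [H2 i bR]e; case: (Hb i iN).
have GA i : (i < N)%N -> `|H2 i bA| <= 105 / 100 * tau by move=> /o1[_ _ _ _ []].
have GO i : (i < N)%N -> `|H2 i bO| <= tau / 100.
  by move=> iN; have [_ e _ _ _] := o1 i iN; rewrite [H2 i bO]e; case: (Hb i iN).
have cd2 : coded s t tau M H2.
  by move=> i iN ai; have [e _ _ _ _] := o1 i iN; rewrite [H2 i bR]e; apply: Hcd.
have pA i : (i < N)%N -> ispad n i ->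
   `|H2 i bA - tau * (M (rk s i %/ n %/ n) (rk s i %% n) && M (rk s i %% n) ((rk s i %/ n) %% n))%N%:R| <= tau / 100.
  by move=> /o1[_ _ _ _ [_ h]]; apply: h.
have o2 i (iN : (i < N)%N) := rep2_out ag2 GR GA GO cd2 pA iN.
split; first exact: rep2_agrees.
  move=> i iN; have [e1 e2 e3 h4 [h5 _]] := o2 i iN; have [_ _ x1 y1 [a1 _]] := o1 i iN.
  by split=> //; rewrite /round_step ?[fstep _ _ _ bA]e1 ?[fstep _ _ _ bX]e2 ?[fstep _ _ _ bY]e3.
by move=> i iN; have [_ _ _ _ [_ h]] := o2 i iN.
Qed.

End RepTwo.

(** * Walks, and the answer *)

Section Walks.
Variables (n : nat) (A : 'I_n -> 'I_n -> bool) (M0 : nat -> nat -> bool).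
Hypothesis M0E : forall a c : 'I_n, M0 a c = A a c.
Notation walk m := (iter m (square n) M0).

Lemma walk_connect m (a c : 'I_n) : walk m a c -> connect A a c.
Proof.
elim: m a c => [|m IH] a c /=; first by rewrite M0E; apply: connect1.
case/orP=> [/IH//|/hasP[k]]; rewrite mem_iota add0n => kn /andP[h1 h2].
exact: connect_trans (IH a (Ordinal kn) h1) (IH (Ordinal kn) c h2).
Qed.

(** A path longer than 2^m splits into its first 2^m edges and a non-empty rest of at most 2^m
    edges, joined at the middle vertex of [square]; shorter paths persist because [square] keeps the
    old entries. *)
Lemma path_walk m (a : 'I_n) l : path A a l -> (0 < size l <= 2 ^ m)%N -> walk m a (last a l).
Proof.
elim: m a l => [|m IH] a l.
  by case: l => [//|c [|? ?]] //=; rewrite andbT M0E => ->.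
move=> pl /andP[l0 l2]; rewrite /= /square; case: (leqP (size l) (2 ^ m)) => h.
  by rewrite IH // l0.
apply/orP; right; apply/hasP; set l1 := take (2 ^ m) l; set l3 := drop (2 ^ m) l.
have lE : l1 ++ l3 = l by exact: cat_take_drop.
move: pl; rewrite -lE cat_path last_cat => /andP[p1 p3].
exists (last a l1 : nat); first by rewrite mem_iota add0n /= ltn_ord.
rewrite !IH //=; first by rewrite size_drop; rewrite expnS in l2; lia.
by rewrite size_take h expn_gt0 leqnn.
Qed.

(** A path without repeated vertices has fewer than n edges, hence at most 2^([up_log 2 n]). The
    empty path, which no walk covers, is the case a = c. *)
Lemma connect_walk (a c : 'I_n) : connect A a c = (a == c) || walk (up_log 2 n) a c.
Proof.
apply/idP/idP => [/connectP[l pl ->]|/orP[/eqP->|/walk_connect//]]; last exact: connect0.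
case: (shortenP pl) => l' pl' ul' _; case: l' pl' ul' => [|x l'] pl' ul'; first by rewrite eqxx.
apply/orP; right; apply: path_walk => //=.
have : (size (a :: x :: l') <= n)%N by rewrite -(card_uniqP ul') -[X in (_ <= X)%N]card_ord; apply: max_card.
by move=> /= h; apply: leq_trans (ltnW h) (up_logP n (isT : 1 < 2)%N).
Qed.

End Walks.

(** * The repeated and final layers on features *)

Section RoundLayers.
Variables (R : archiRcfType) (p : nat) (rnd : R -> R).
Hypothesis Hrnd : correct_rounding p rnd.
Hypothesis Hp : (20 <= p)%N.
Variable N : nat.

(** Features are indexed by all natural numbers, but [pl] is faithful only below 64. *)
Definition eq64 (H G : nat -> nat -> R) := forall i f, (f < 64)%N -> H i f = G i f.

Lemma astep_ext sp H G : okm (am sp) -> eq64 H G -> eq64 (astep rnd N sp H) (astep rnd N sp G).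
Proof.
move=> /andP[_ /allP om] HG i f f64; rewrite /astep (HG i f f64); case: (ao_at sp f) => [[hh l]|]; last by [].
congr (rnd (_ + _)); apply: hout_ext => j g; apply: lnf_ext => q qm.
by apply: HG; apply: om.
Qed.

Lemma fstep_ext sp H G : okm (fm sp) -> eq64 H G ->
  eq64 (fun i => fstep rnd sp (H i)) (fun i => fstep rnd sp (G i)).
Proof.
move=> /andP[_ /allP om] HG i f f64; rewrite /fstep (HG i f f64); congr (rnd (_ + rnd _)).
apply: eq_bigr => x _; congr (_ * _); rewrite /hid; congr (relu (rnd _)).
by apply: eq_bigr => y _; congr (_ * _); apply: lnf_ext => q /om; apply: HG.
Qed.

(** These layers write only features from 56 on, which have no partner, so overwriting is allowed
    without a freshness condition. *)
Lemma unpaired_layer sp (h : state R dimT) : oka sp -> okff sp -> symst p h ->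
  all (fun f => (56 <= f)%N) (unzip1 (ao sp) ++ unzip1 (fo sp)) ->
  symst p (layer_apply rnd N (mkL sp) h) /\
  eq64 (feat (layer_apply rnd N (mkL sp) h)) (fun i => fstep rnd sp (astep rnd N sp (feat h) i)).
Proof.
move=> oa of_ sh /allP t56.
have fa i f (h' : state R dimT) : (f < 56)%N -> f \in unzip1 (ao sp) -> feat h' i f = 0.
  by move=> f56 fl; have := t56 f; rewrite mem_cat fl leqNgt f56 => /(_ isT).
have ff i f (h' : state R dimT) : (f < 56)%N -> f \in unzip1 (fo sp) -> feat h' i f = 0.
  by move=> f56 fl; have := t56 f; rewrite mem_cat fl orbT leqNgt f56 => /(_ isT).
have st i f (f64 : (f < 64)%N) := @attn_step R p rnd Hrnd Hp N sp h i f oa sh (fa i f h) f64.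
set h1 := attn_sublayer rnd N (mkL sp) h.
have sh1 : symst p h1 by move=> i f f64; have [e1 [e2 r]] := st i f f64; rewrite /h1 e1 e2.
have st2 i f (f64 : (f < 64)%N) := @ff_step R p rnd Hrnd Hp sp h1 i f of_ sh1 (ff i f h1) f64.
have E1 : eq64 (feat h1) (astep rnd N sp (feat h)) by move=> i f f64; case: (st i f f64).
split; first by move=> i f f64; rewrite /layer_apply; have [e1 [e2 r]] := st2 i f f64; rewrite e1 e2.
move=> i f f64; rewrite /layer_apply /feat; have [-> _] := st2 i f f64.
by apply: (fstep_ext _ E1) => //; case/and4P: of_.
Qed.

End RoundLayers.

(** * The final lookup of the entry (s,t) *)

Section FinalLayer.
Variables (R : archiRcfType) (p : nat) (rnd : R -> R).
Hypothesis Hrnd : correct_rounding p rnd.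
Hypothesis Hp : (20 <= p)%N.
Variables (n : nat) (A : 'I_n -> 'I_n -> bool) (s t : 'I_n).
Notation N := (len s t).
Notation tok i := (tokn A s t i).
Variable V : nat -> nat -> R.
Hypothesis Vflag : forall i f, f \in flags -> V i f = (f == tok_flag (tok i))%:R.
Hypothesis Veq : eqns rnd N V (subs_of init_specs).
Notation u := (uerr R p).
Variables b rho tau eta : R.
Hypothesis Nb : N%:R * b = 1.
Hypothesis Hc : consts_ok b u rho tau eta.
Hypothesis Vrho : forall i, (i < N)%N -> V i fRHO = rho.
Hypothesis Vtau : forall i, (i < N)%N -> V i fTAU = tau.
Hypothesis Veta : forall i, (i < N)%N -> V i fETA = eta.

Let dlf := dl_facts Hc.
Notation dl := (eta / rho).
Let taut := tau_tiny Hc.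
Let E1f := E1_fact Hrnd Hp Vflag Veq Nb Hc Veta.
Let ESf := ES_fact Hrnd Hp Vflag Veq Nb Hc Veta.
Let GBb := GB_bounds Hrnd Hp Vflag Veq Nb Hc Vrho Veta.
Let GBl := GB_last Hrnd Hp Vflag Veq Nb Hc Vrho Veta.
Let smle := small_le Hrnd Hp Vflag Veq Nb Hc Vrho Veta.
Let keyb := key_bounds Hrnd Hp Vflag Veq Nb Hc Vrho Veta.
Notation agr := (agrees p s t V).
Notation l3 := [:: fKQ; fKR; fES; fE1; fETA; fRHO; fGB].
Notation ms3 := ((flags ++ l3) ++ [:: bR; fZ]).
Notation hsF := (nth no_head (hs final_spec) 0).

Definition nuF k := sumsq [:: fES; fE1; fETA] (V k) + rho ^+ 2 + V k fGB ^+ 2.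

Let lS k : (k < N)%N -> sumsq l3 (V k) = V k fKQ ^+ 2 + V k fKR ^+ 2 + nuF k.
Proof. by move=> kN; rewrite /nuF /sumsq !big_cons !big_nil Vrho // !addr0; ring. Qed.

Let l1 k g : (k < N)%N -> g \in l3 -> `|V k g| <= 1.
Proof.
move=> kN; have kk f : f \in keys -> `|V k f| <= 1.
  move=> fk; have /andP[h0 h1] := keyb kN fk; have /andP[_ b2] := b_small Hc 2.
  by rewrite ger0_norm //; move: h1 b2; wipe; lra.
have sm f : f \in small_feats -> `|V k f| <= 1 by move=> fs; apply: (rho_gN_le Nb Hc); apply: smle.
rewrite !inE; case/orP=> [/eqP->|/orP[/eqP->|/orP[/eqP->|/orP[/eqP->|/orP[/eqP->|/orP[/eqP->|/eqP->]]]]]].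
- exact: kk.
- exact: kk.
- exact: sm.
- exact: sm.
- exact: sm.
- by have [_ _ _ /andP[r0 r1]] := dlf; rewrite Vrho // gtr0_norm //; move: r1; wipe; lra.
by have [/andP[h0 h1] _] := GBb kN; rewrite ger0_norm //; move: h1; wipe; lra.
Qed.

Lemma nuF_bounds k : (k < N)%N -> 0 <= nuF k <= 1.
Proof.
move=> kN; have [/andP[h0 h1] h2] := small_sumsq Hrnd Hp Vflag Veq Nb Hc Vrho Veta kN
  (isT : all (mem small_feats) [:: fES; fE1; fETA]) isT.
have [/andP[g0 g1] _] := GBb kN; have g2 : V k fGB ^+ 2 <= 81 / 100.
  apply: le_trans (_ : (9 / 10) ^+ 2 <= _); last by wipe; lra.
  by apply: lerXn2r; rewrite ?nnegrE //; wipe; lra.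
have /andP[_ p14] := bpow 2 12 (b_ok Hc); have /andP[b0 b2] := b_small Hc 2.
have k14 : (1 / 5) ^+ 12 * b ^+ 2 <= 1 * b ^+ 2 by rewrite ler_pM2r //; apply: exprn_ile1; wipe; lra.
by rewrite /nuF; move: h0 h1 h2 g2 p14 k14 b2 (sqr_ge0 rho) (sqr_ge0 (V k fGB)); wipe => *; apply/andP; split; lra.
Qed.

(** At b-tokens [fGB] may be of constant size and inflate the norm; the adjacency tokens and the
    first position are of other kinds. *)
Lemma nuF_small k : (k < N)%N -> tok k <> TB -> nuF k <= 14 / 10 * b ^+ 14.
Proof.
move=> kN kTB; have [/andP[h0 h1] h2] := small_sumsq Hrnd Hp Vflag Veq Nb Hc Vrho Veta kN
  (isT : all (mem small_feats) [:: fES; fE1; fETA]) isT.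
have [/andP[g0 _] /(_ kTB) g1] := GBb kN; have /andP[b7 _] := b_small Hc 7; have /andP[b14 _] := b_small Hc 14.
have u7 := u_eta Hc (isT : 7 <= 30)%N; have [_ _ _ /andP[_ e2]] := consts_eta Hc; have /andP[_ b11] := b_small Hc 11.
have k7 : eta * b ^+ 7 <= 1 * b ^+ 7.
  rewrite ler_pM2r //; apply: le_trans e2 _; apply: le_trans (_ : 121 / 100 * (1 / 5) <= _); last by wipe; lra.
  rewrite ler_pM2l; last by wipe; lra.
  by apply: le_trans b11 _; apply: le_trans (_ : (1 / 5) ^+ 1 <= _); [apply: ler_wiXn2l => //|rewrite expr1]; wipe; lra.
have g2 : V k fGB ^+ 2 <= (1 / 10 * b ^+ 7) ^+ 2.
  by apply: lerXn2r; rewrite ?nnegrE //; move: g1 u7 k7 b7 (uerr_gt0 R p); wipe; lra.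
rewrite exprMn -exprM in g2.
by rewrite /nuF; move: h1 h2 g2 b14; wipe; lra.
Qed.

Section Final.
Variables (M : nat -> nat -> bool) (H : nat -> nat -> R).
Hypothesis Hag : agr H.
Hypothesis HR : forall k, (k < N)%N -> `|H k bR| <= 105 / 100 * tau.
Hypothesis Hcd : coded s t tau M H.
Notation i := (last_pos s t).
Hypothesis Hans : H i bANS = 0.
Let iN : (i < N)%N := last_lt s t.

Let X1 := (V i fES - 2 * eta) / rho.
Let X2 := (V i fE1 - 2 * eta) / rho.

Lemma bos_flag k : (k < N)%N -> V k fBOS = (k == 0)%N%:R.
Proof. by move=> kN; rewrite Vflag // eq_sym (flag_BOS A kN). Qed.

Lemma dotF k : (k < N)%N -> dot hsF ms3 (H i) (H k) =
  rho * (X1 * V k fKQ + X2 * V k fKR + (isadj n k)%:R + V i fGB * (k == 0)%N%:R / rho).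
Proof.
move=> kN; have [_ hi zi] := Hag iN; have [_ hk zk] := Hag kN.
have [_ _ _ /andP[r0 _]] := dlf; have rn : rho != 0 by rewrite gt_eqF.
rewrite /dot !big_ord_recl big_ord0 /= !lin_bal // !(lin8_agree Hag iN) // !(lin8_agree Hag kN) //.
rewrite [lin8 (c8 [:: fT0; fT1]) _]lin8_c8 (adj_flag Vflag) // !lin8_cons !lin8_nil bos_flag // Vrho // Veta //.
by rewrite /X1 /X2; move: (isadj n k)%:R ((k == 0)%N%:R) => x y; field.
Qed.

Lemma X_facts : `|X1 - dl * (s : nat)%:R| <= dl * b ^+ 3 /\ `|X2 - dl * (t : nat)%:R| <= dl * b ^+ 3.
Proof.
have [_ _ e0 _] := consts_eta Hc.
have k : eta * b ^+ 12 <= eta * (1 * b ^+ 4).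
  rewrite ler_pM2l // mul1r; have /andP[_ h] := bpow 4 8 (b_ok Hc); have /andP[b4 _] := b_small Hc 4.
  apply: le_trans h _; rewrite -[leRHS]mul1r ler_pM2r //; apply: exprn_ile1; wipe; lra.
have c1 : 1 <= 14 / 10 :> R by wipe; lra.
have hs := ESf iN; have ht := E1f iN; rewrite (rank2_last Hp s t) in ht.
split; apply: (to_units Hc c1); apply: le_trans k.
  by have -> : V i fES - 2 * eta - eta * (s : nat)%:R = V i fES - eta * s.+2%:R by rewrite (_ : s.+2%:R = (s : nat)%:R + 2) -?natrD ?addn2 //; ring.
by have -> : V i fE1 - 2 * eta - eta * (t : nat)%:R = V i fE1 - eta * t.+2%:R by rewrite (_ : t.+2%:R = (t : nat)%:R + 2) -?natrD ?addn2 //; ring.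
Qed.

Let ans := astep rnd N final_spec H i bANS.
Let ansE : ans = rnd (0 + hout rnd N hsF (fun k => lnf rnd ms3 (H k)) i 0).
Proof. by rewrite -Hans. Qed.

Lemma valF (j : nat) : (j < N)%N -> lin8 (c8 [:: fBOS; bR]) (H j) = (j == 0)%N%:R + H j bR.
Proof.
move=> jN; have [_ h _] := Hag jN.
by rewrite lin8_c8 !big_cons big_nil addr0 h // bos_flag.
Qed.

(** For s <> t the gate is of size u, so even divided by rho it is a bonus that cannot outweigh a
    coordinate, and the lookup is the usual one among adjacency tokens. *)
Lemma final_ne : s != t -> `|ans - tau * (M s t)%:R| <= tau / 10.
Proof.
move=> ne; have [/andP[t0 t1] ut] := taut; have u0 := uerr_gt0 R p.
have gl := GBl; rewrite (negbTE ne) in gl; have [/andP[g0 _] _] := GBb iN.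
have [_ E d0 /andP[r0 _]] := dlf; have /andP[b8 b8'] := b_small Hc 8.
have ab k : (k < N)%N -> `|V i fGB * (k == 0)%N%:R / rho| <= 15 / 100 * b ^+ 8.
  move=> kN; have u8 := u_eta Hc (isT : 8 <= 30)%N.
  have [/andP[_ d1] _ _ _] := dlf; have /andP[_ b4] := b_small Hc 4.
  rewrite normrM [`|rho^-1|]gtr0_norm ?invr_gt0 // ler_pdivrMr // normrM [`|V i fGB|]ger0_norm //.
  have k1 : `|(k == 0)%N%:R| <= 1 :> R by case: (k == 0)%N; rewrite ?normr1 ?normr0.
  have : V i fGB * `|(k == 0)%N%:R| <= 6 * u * 1 by apply: ler_pM.
  have : eta * b ^+ 8 <= 15 / 100 * b ^+ 8 * rho.
    rewrite {1}E -mulrA [rho * _]mulrC mulrA ler_pM2r // ler_pM2r //.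
    by apply: le_trans d1 _; move: b4; wipe; lra.
  by move: u8 u0; wipe; lra.
have [h1 h2] := X_facts; have [j0 [a0 e1 e2]] := adj_at Hp s t (ltn_ord s) (ltn_ord t).
have le2 (B : bool) : `|tau * B%:R| <= 2 * tau.
  by case: B; rewrite ?mulr1 ?mulr0 ?normr0 ?gtr0_norm //; move: t0; wipe; lra.
have nP k : (k < N)%N -> isadj n k -> nuF k <= 14 / 10 * b ^+ 14.
  by move=> kN ak; apply: nuF_small => //; case: (tok_adj_or A s t ak) => ->.
have h : `|hout rnd N hsF (fun k => lnf rnd ms3 (H k)) i 0 - tau * (M s t)%:R| <= tau / 20 + tau / 50.
  apply: (fetch Hrnd Hp Hc iN (f := c8 [:: fBOS; bR])) => //; last by apply/andP; split; move: t0; wipe; lra.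
  move=> j jb; have jN := ltn_ord j.
  have [aj f1 f2 _] := attend Hrnd Hp Vflag Veq Nb Hc Vrho Veta Hag (erefl : hm hsF = false) (isT : okq hsF ms3)
    (isT : all (fun g => (g < 56)%N) l3) (isT : (55 < bR)%N) (isT : fKQ \in keys) (isT : fKR \in keys) l1 HR lS
    nuF_bounds nP iN dotF (adj_YP Hrnd Hp Vflag Veq Nb Hc Vrho Veta)
    (And4 h1 h2 (ltnW (ltn_ord s)) (ltnW (ltn_ord t))) ab a0 e1 e2 jb.
  have jz : (j == 0 :> nat)%N = false by case/andP: aj; case: (j : nat).
  rewrite valF // jz add0r; have [F _] := head_state Vflag Hc Hag (isT : all (fun g => (g < 56)%N) l3) (isT : (55 < bR)%N) l1 HR lS jN.
  split=> //; [by have := Hcd jN aj; rewrite f1 f2 | exact: HR | by case: (Hag jN) |].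
  by apply: (head_w Hrnd Hp Vflag Veq Nb Hc Vrho Veta Hag _ _ _ _ l1 HR lS nuF_bounds jN) => //; apply: nP.
have z0 : `|0 : R| <= tau / 100 by rewrite normr0; move: t0; wipe; lra.
have e3 : 0 <= tau / 20 + tau / 50 <= 2 * tau by apply/andP; split; move: t0; wipe; lra.
by rewrite ansE; apply: le_trans (step_near Hrnd Hp Hc z0 h (le2 _) e3) _; move: t0; wipe; lra.
Qed.

(** For s = t the gate gives the first position a score of at least 0.48 before the common factor,
    against at most 0.12 for all others, whose scores carry the factor rho <= 1/10. Its value is
    about 1, enormous compared with tau. *)
Lemma final_eq : s == t -> 1 / 2 <= ans.
Proof.
move=> st; have [/andP[t0 t1] ut] := taut; have u0 := uerr_gt0 R p.
have gl := GBl; rewrite st in gl; have [_ _ d0 /andP[r0 r1]] := dlf.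
have [h1 h2] := X_facts; have nb := n_b Hp Nb Hc.
have xs1 := coord_small Hc nb h1 (ltnW (ltn_ord s)); have xs2 := coord_small Hc nb h2 (ltnW (ltn_ord t)).
have c5 (x : R) : `|x| <= b ^+ 3 / 4 -> `|x| <= 1 / 50.
  by have /andP[_ b3] := b_small Hc 3; move=> h; move: h b3; wipe; lra.
have {}xs1 := c5 _ xs1; have {}xs2 := c5 _ xs2.
have XY k : (k < N)%N -> `|X1 * V k fKQ + X2 * V k fKR| <= 1 / 100.
  move=> kN; have [y1 _] := key_sq Hrnd Hp Vflag Veq Nb Hc Vrho Veta kN (isT : fKQ \in keys).
  have [y2 _] := key_sq Hrnd Hp Vflag Veq Nb Hc Vrho Veta kN (isT : fKR \in keys).
  have p5 (x y : R) : `|x| <= 1 / 50 -> `|y| <= 1 / 10 -> `|x * y| <= 1 / 50 * (1 / 10).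
    by move=> hx hy; rewrite normrM; apply: ler_pM.
  apply: le_trans (ler_normD _ _) _; have := p5 _ _ xs1 y1; have := p5 _ _ xs2 y2; wipe; lra.
have st3 k (kN : (k < N)%N) := head_state Vflag Hc Hag (isT : all (fun g => (g < 56)%N) l3) (isT : (55 < bR)%N) l1 HR lS kN.
have S1 k : (k < N)%N -> 1 <= lnS ms3 (H k) <= 4.
  move=> kN; have [_ ->] := st3 k kN; have /andP[n0 n1] := nuF_bounds kN.
  have [_ /andP[y1 y1']] := key_sq Hrnd Hp Vflag Veq Nb Hc Vrho Veta kN (isT : fKQ \in keys).
  have [_ /andP[y2 y2']] := key_sq Hrnd Hp Vflag Veq Nb Hc Vrho Veta kN (isT : fKR \in keys).
  have /andP[z1 z2] := bit_sq Hc HR kN; have /andP[_ b14] := b_small Hc 14.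
  have k14 : b ^+ 14 <= 1.
    by case/andP: (b_ok Hc) => g1 g2; apply: exprn_ile1; [exact: ltW | apply: le_trans g2 _; wipe; lra].
  by apply/andP; split; move: n0 n1 y1 y1' y2 y2' z1 z2 k14; wipe; lra.
have zN := len_gt0 s t; have [w0 Sw /andP[w00 w01]] :
    exists2 w, lnS ms3 (H 0) = 1 + w & 0 <= w <= 1 / 70.
  apply: (head_w Hrnd Hp Vflag Veq Nb Hc Vrho Veta Hag _ _ _ _ l1 HR lS nuF_bounds zN) => //.
  exact: nuF_small.
have w1 : 0 <= w0 <= 1 by rewrite w00 /=; move: w01; wipe; lra.
have best0 (j : 'I_N) : j \in best rnd N hsF (fun k => lnf rnd ms3 (H k)) i -> (j : nat) = 0%N.
  apply: contraTeq => jz; have jN := ltn_ord j; have /andP[_ S4] := S1 _ iN.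
  apply: (lookup_beats Hrnd Hp (isT : okq hsF ms3) erefl (st3 _ iN).1 (st3 _ jN).1 (st3 _ (ltn_ord (pos0 s t))).1 S4).
  rewrite !dotF // (negbTE jz) mulr0 mul0r addr0.
  rewrite (_ : (pos0 s t : nat) = 0%N) // (_ : isadj n 0 = false) // eqxx addr0.
  have -> : rho * (X1 * V 0 fKQ + X2 * V 0 fKR + V i fGB * 1%:R / rho) = rho * (X1 * V 0 fKQ + X2 * V 0 fKR) + V i fGB.
    by field; rewrite gt_eqF.
  have /andP[q1 _] := inv_sqrt_bounds w1; rewrite Sw.
  have k0 : - (1 / 100) <= rho * (X1 * V 0 fKQ + X2 * V 0 fKR).
    have : `|rho * (X1 * V 0 fKQ + X2 * V 0 fKR)| <= 1 * (1 / 100).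
      rewrite normrM; apply: ler_pM => //; last exact: XY.
      by rewrite gtr0_norm //; move: r1; wipe; lra.
    by rewrite ler_norml => /andP[h _]; apply: le_trans h; wipe; lra.
  have L : 49 / 100 * (98 / 100) <= (rho * (X1 * V 0 fKQ + X2 * V 0 fKR) + V i fGB) / Num.sqrt (1 + w0).
    by apply: ler_pM; [wipe; lra | wipe; lra | move: k0 gl; wipe; lra | move: q1 w01; wipe; lra].
  have s1 : 1 <= Num.sqrt (lnS ms3 (H j)).
    by have /andP[h _] := S1 _ jN; rewrite -[leLHS]sqrtr1 ler_sqrt //; apply: le_trans h.
  have U : rho * (X1 * V j fKQ + X2 * V j fKR + (isadj n j)%:R) / Num.sqrt (lnS ms3 (H j)) <= 12 / 100.
    rewrite ler_pdivrMr; last exact: lt_le_trans s1.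
    have : rho * (X1 * V j fKQ + X2 * V j fKR + (isadj n j)%:R) <= 1 / 10 * (101 / 100).
      have k1 : X1 * V j fKQ + X2 * V j fKR + (isadj n j)%:R <= 101 / 100.
        have := XY _ jN; rewrite ler_norml => /andP[_ h]; have : (isadj n j)%:R <= 1 :> R by case: (isadj n j).
        by move: h; wipe; lra.
      apply: le_trans (_ : rho * (101 / 100) <= _); first by rewrite ler_pM2l.
      by rewrite ler_pM2r //; wipe; lra.
    by move: s1; wipe; lra.
  by move: L U ut u0 t1; wipe; lra.
have hb (j : 'I_N) : j \in best rnd N hsF (fun k => lnf rnd ms3 (H k)) i ->
    `|hval rnd hsF (fun k => lnf rnd ms3 (H k)) 0 j - 1| <= 1 / 10.
  move=> jb; have j0 := best0 j jb; rewrite j0 /hval.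
  have := bal_near Hrnd Hp (f := c8 [:: fBOS; bR]) _ (st3 _ zN).1 isT isT Sw w1.
  have [_ _ z0] := Hag zN; move=> /(_ z0); rewrite valF // eqxx => hn.
  have r5 := HR zN; have L1 : `|1%:R + H 0 bR| <= 2.
    by apply: le_trans (ler_normD _ _) _; rewrite normr1; move: r5 t1; wipe; lra.
  have hw : `|1%:R + H 0 bR| * w0 <= 2 * (1 / 70) by apply: ler_pM.
  move: (rnd (ev _ _)) hn => r hn; have -> : r - 1 = (r - (1%:R + H 0 bR)) + H 0 bR by ring.
  by apply: le_trans (ler_normD _ _) _; move: hn hw r5 t1 ut u0; wipe; lra.
have h := hout_approx Hrnd Hp iN (_ : `|1 : R| <= 256) (_ : 0 <= 1 / 10 <= 1) hb.
have n1 : `|1 : R| <= 256 by rewrite normr1 (ler_nat _ 1 256).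
have {}h := h n1 (ltac:(apply/andP; split; wipe; lra)).
rewrite ansE add0r (rnd_id Hrnd); last exact: (rnd_rep Hrnd).
by move: h; rewrite ler_distl => /andP[h _]; move: h ut t1 u0; wipe; lra.
Qed.

End Final.

End FinalLayer.

(** * Unrolling the transformer *)

Section Unrolling.
Variables (R : archiRcfType) (p : nat) (rnd : R -> R).
Hypothesis Hrnd : correct_rounding p rnd.
Hypothesis Hp : (20 <= p)%N.
Variables (n : nat) (A : 'I_n -> 'I_n -> bool) (s t : 'I_n).
Notation N := (len s t).
Notation tok i := (tokn A s t i).
Variable V : nat -> nat -> R.
Hypothesis Vflag : forall i f, f \in flags -> V i f = (f == tok_flag (tok i))%:R.
Hypothesis Veq : eqns rnd N V (subs_of init_specs).
Notation u := (uerr R p).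
Variables b rho tau eta : R.
Hypothesis Nb : N%:R * b = 1.
Hypothesis Hc : consts_ok b u rho tau eta.
Hypothesis Vrho : forall i, (i < N)%N -> V i fRHO = rho.
Hypothesis Vtau : forall i, (i < N)%N -> V i fTAU = tau.
Hypothesis Veta : forall i, (i < N)%N -> V i fETA = eta.

Notation agr := (agrees p s t V).
Notation lst := (last_pos s t).

(** [bANS] must still be 0 at the last position, because the final layer adds the answer to it. *)
Definition reaches (M : nat -> nat -> bool) (h : state R dimT) :=
  [/\ symst p h, agr (feat h), bounded s t tau (feat h), coded s t tau M (feat h) & feat h lst bANS = 0].

Lemma eq64_agrees H G : eq64 H G -> agr G -> agr H.
Proof.
move=> E ag i iN; have [h1 h2 h3] := ag i iN; split; last by rewrite E.
  by move=> f f64; rewrite E //; apply: h1.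
by move=> f f56; rewrite E ?h2 //; apply: ltn_trans f56 _.
Qed.

Lemma round_reaches M h : reaches M h ->
  reaches (square n M) (layer_apply rnd N (mkL rep2) (layer_apply rnd N (mkL rep1) h)).
Proof.
case=> sh ag bd cd a0; have /and5P[oa1 of1 oa2 of2 _] := ok_rep.
have [sh1 E1] := unpaired_layer Hrnd Hp N (sp := rep1) oa1 of1 sh isT.
have [sh2 E2] := unpaired_layer Hrnd Hp N (sp := rep2) oa2 of2 sh1 isT.
set h2 := layer_apply rnd N (mkL rep2) _ in sh2 E2 *.
have E : eq64 (feat h2) (round_step rnd s t (feat h)).
  move=> i f f64; rewrite E2 //.
  exact: (fstep_ext rnd (isT : okm (fm rep2)) (astep_ext rnd N (isT : okm (am rep2)) E1) i f64).
have [ag2 bd2 cd2] := round_correct Hrnd Hp Vflag Veq Nb Hc Vrho Vtau Veta ag bd cd.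
split=> //; first exact: eq64_agrees E ag2.
- by move=> i iN; have := bd2 i iN; rewrite !E.
- by move=> i iN ai; have := cd2 i iN ai; rewrite E.
have lN := last_lt s t; rewrite E // /round_step.
have g1 : agr (astep rnd N rep1 (feat h)) by exact: (astep_agrees (sp := rep1) Hrnd isT ag).
have g2 : agr (fun i => fstep rnd rep1 (astep rnd N rep1 (feat h) i)).
  exact: (fstep_agrees (sp := rep1) Hrnd Hp isT g1).
set H2 := fun i => _ in g2 *.
have g3 : agr (astep rnd N rep2 H2) by exact: (astep_agrees (sp := rep2) Hrnd isT g2).
rewrite (fstep_same Hrnd Hp g3) // -[astep _ _ _ _ _ _]/(H2 lst bANS) /H2.
by rewrite (fstep_same Hrnd Hp g1).
Qed.

Lemma rounds_reach m M h : reaches M h ->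
  reaches (iter m (square n) M) (foldl (fun h L => layer_apply rnd N L h) h
    (flatten (nseq m [:: mkL rep1; mkL rep2]))).
Proof.
elim: m M h => [//|m IH] M h hM.
by rewrite iterSr; apply/IH/round_reaches.
Qed.

Lemma answer_reaches M h : reaches M h ->
  let h' := layer_apply rnd N (mkL final_spec) h in
  [/\ representable p (feat h' lst bANS), feat h' lst fTAU = tau, s == t -> 1 / 2 <= feat h' lst bANS &
     s != t -> `|feat h' lst bANS - tau * (M s t)%:R| <= tau / 10].
Proof.
case=> sh ag bd cd a0; have /and5P[_ _ _ _ /andP[oa of_]] := ok_rep; cbv zeta.
have [sh1 E1] := unpaired_layer Hrnd Hp N (sp := final_spec) oa of_ sh isT.
have lN := last_lt s t; have HR k : (k < N)%N -> `|feat h k bR| <= 105 / 100 * tau by case/bd.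
have g1 : agr (astep rnd N final_spec (feat h)) by exact: (astep_agrees (sp := final_spec) Hrnd isT ag).
have [r1 e1 _] := g1 _ lN; rewrite !E1 // !(fstep_same Hrnd Hp g1) // (e1 fTAU isT) Vtau //.
split=> //; first exact: r1.
  exact: (final_eq Hrnd Hp Vflag Veq Nb Hc Vrho Veta ag HR a0).
exact: (final_ne Hrnd Hp Vflag Veq Nb Hc Vrho Veta ag HR cd a0).
Qed.

End Unrolling.

(** * Assembly: precision, embedding and output *)

Section Main.
Variables (R : archiRcfType) (p : nat) (rnd : R -> R).
Hypothesis Hrnd : correct_rounding p rnd.
Variables (n : nat) (A : 'I_n -> 'I_n -> bool) (s t : 'I_n).
Notation N := (len s t).
Hypothesis pN : (65 * up_log 2 N <= p)%N.

Lemma precision_ge20 : (20 <= p)%N.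
Proof.
apply: leq_trans pN; have : (0 < up_log 2 N)%N.
  by rewrite up_log_gt0 /= /len addnS ltnS /sTB addnS.
by case: (up_log 2 N) => // k _; rewrite mulnS; apply: leq_trans (leq_addr _ _).
Qed.
Let Hp := precision_ge20.

Definition embedded : state R dimT :=
  fun i k => wt rnd (opart (fun f => (f == tok_flag (tokn A s t i))%:R) k).

Lemma embedded_symst : symst p embedded /\
  forall i f, (f < 64)%N -> feat embedded i f = (f == tok_flag (tokn A s t i))%:R.
Proof.
have E i f : (f < 64)%N -> feat embedded i f = (f == tok_flag (tokn A s t i))%:R.
  move=> f64; rewrite /feat /embedded /pl opart_l inordK //.
  by case: (_ == _); rewrite /wt ?rmorph1 ?rmorph0 ?(rnd1 Hrnd Hp) ?(rnd0 Hrnd Hp).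
split=> // i f f64; rewrite -/(feat embedded i f) E //; split; first exact: rep_bool.
rewrite /embedded /pr opart_r inordK //; case: ifP => _; first by rewrite /wt rmorph0 (rnd0 Hrnd Hp).
have rN1 : rnd (- 1) = - 1 by apply: (rnd_id Hrnd); have := @rep_int R p Hp (- 1) isT.
by case: (_ == _); rewrite /wt ?oppr0 ?rmorphN ?rmorph1 ?rmorph0 /= ?rmorph1 ?rN1 ?oppr0 ?(rnd0 Hrnd Hp).
Qed.

Definition initial_matrix q r := tok_flag (tokn A s t (1 + (q * n + r))) == fT1.

Lemma final_state : exists h : state R dimT, exists2 tau : R, 0 < tau <= 1 / 400 /\ 100 * (100 * uerr R p) <= tau &
  [/\ foldl (fun h L => layer_apply rnd N L h) embedded (unrolled_layers connectivity_transformer (up_log 2 n)) = h,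
     representable p (feat h (last_pos s t) bANS), feat h (last_pos s t) fTAU = tau &
     if connect A s t then 9 / 10 * tau <= feat h (last_pos s t) bANS else feat h (last_pos s t) bANS <= tau / 10].
Proof.
have [sy0 f0] := embedded_symst.
have N5 := N_ge5 Hp s t.
pose b : R := N%:R^-1; have bE : b = N%:R^-1 by [].
have Hu : u_bound p b by apply: (uerr_small R Hp N5 (c := 50)).
have NbE : N%:R * b = 1 := Nb Hp N5 bE.
have Hc : consts_ok b (uerr R p) (cst rnd b 6) (cst rnd b 8) (cst rnd b 10).
  split; [exact: (b_itv Hp N5 bE) | by rewrite uerr_gt0; exact: Hu | exact: (rho_bounds Hrnd Hp N5 bE Hu)
    | exact: (tau_bounds Hrnd Hp N5 bE Hu) | exact: (eta_bounds Hrnd Hp N5 bE Hu)].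
have z0 i f : (f < 64)%N -> f \notin flags -> feat embedded i f = 0.
  move=> f64 nf; rewrite f0 //; case: eqP => // e; move: nf; rewrite e.
  by case: (tokn A s t i).
have [sh V1 V0 Veq] := trajectory Hrnd Hp N chk_init sy0 z0.
set h17 := foldl _ _ _ in sh V1 V0 Veq.
have Vflag i f : f \in flags -> feat h17 i f = (f == tok_flag (tokn A s t i))%:R.
  move=> ff; have f64 : (f < 64)%N by apply: (allP (isT : all (fun g => (g < 64)%N) flags)).
  by rewrite V1 // f0.
have Vrho := @V_RHO R p rnd Hrnd Hp n A s t _ Vflag Veq b bE.
have Vtau := @V_TAU R p rnd Hrnd Hp n A s t _ Vflag Veq b bE.
have Veta := @V_ETA R p rnd Hrnd Hp n A s t _ Vflag Veq b bE.
move: (cst rnd b 6) (cst rnd b 8) (cst rnd b 10) Hc Vrho Vtau Veta => rho tau eta Hc Vrho Vtau Veta.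
have [/andP[t0 t1] ut] := tau_tiny Hc.
have Z i f : (f < 64)%N -> f \notin flags ++ flatten (map targets (subs_of init_specs)) -> feat h17 i f = 0 := V0 i f.
have R17 : reaches p s t (feat h17) tau initial_matrix h17.
  split=> //; last by apply: Z.
  - by move=> i iN; split=> // [f f64|]; [case: (sh i f f64) | apply: Z].
  - move=> i iN; rewrite (Z i bA isT isT) (Z i bX isT isT) (Z i bY isT isT) (Z i bO isT isT) normr0; have h := R_init Hrnd Hp Vflag Veq Hc Vtau iN.
    have t2 : 0 <= tau / 100 by move: t0; wipe; lra.
    have t3 : 0 <= 105 / 100 * tau by move: t0; wipe; lra.
    split=> //; move: h; case: (_ == _); rewrite ?mulr1 ?mulr0 ?subr0; last by move: t0; wipe; lra.
    by rewrite ler_distl ler_norml; move: t0; wipe => ? /andP[? ?]; apply/andP; split; lra.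
  move=> i iN ai; have h := R_init Hrnd Hp Vflag Veq Hc Vtau iN.
  have [rE _] := rk_adj s ai; rewrite /initial_matrix -divn_eq rE.
  have -> : (1 + i.-1 = i)%N by case/andP: ai => i0 _; rewrite add1n prednK.
  by apply: le_trans h _; move: t0; wipe; lra.
have Rm := rounds_reach Hrnd Hp Vflag Veq NbE Hc Vrho Vtau Veta (up_log 2 n) R17.
have := answer_reaches Hrnd Hp Vflag Veq NbE Hc Vrho Vtau Veta Rm.
set h := layer_apply _ _ _ _ => -[a1 a2 a3 a4].
exists h; exists tau; first by rewrite t0 t1.
split=> //; first by rewrite /unrolled_layers !foldl_cat -[ut_init _]/(map mkL init_specs) foldl_subs.
have M0E (a c : 'I_n) : initial_matrix a c = A a c.
  by rewrite /initial_matrix tok_adj; case: (A a c).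
rewrite (connect_walk M0E); case: (boolP (s == t)) => st.
  by rewrite /=; apply: le_trans (a3 st); move: t1; wipe; lra.
have := a4 st; rewrite orFb; case: (iter _ _ _ _ _); rewrite ?mulr1 ?mulr0 ?subr0 ?ler_distl ?ler_norml => /andP[h1 h2];
  by move: h1 h2; wipe; lra.
Qed.

Lemma logitE o (h : state R dimT) i f : unemb o = lpart (cf f) -> okf 64 f ->
  rnd (\sum_(k < dimT) wt rnd (unemb o k) * h i k) = rnd (ev f (feat h i)).
Proof.
move=> -> ok; exact: (@linmap_l R p rnd Hrnd Hp 1 (fun _ => f) (h i) ord0 ok).
Qed.

(** The answer is at least 9/10 tau or at most tau/10, while the logit of [T0] is tau/2 up to u, and
    u is below tau / 10000. *)
Lemma transformer_correct : ut_outputs rnd connectivity_transformer (up_log 2 n) (conn_input A s t)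
  (if connect A s t then T1 else T0).
Proof.
have [h [tau [/andP[t0 t1] ut] [hE ra te fin]]] := final_state.
have u0 := uerr_gt0 R p.
have L o f : unemb o = lpart (cf f) -> okf 64 f ->
    ut_logits rnd connectivity_transformer (up_log 2 n) (conn_input A s t) o = rnd (ev f (feat h (last_pos s t))).
  move=> uo ok; rewrite -(logitE h (last_pos s t) uo ok) /ut_logits; cbv zeta.
  rewrite -[TBOS :: _]/(inp A s t) size_inp -hE.
  by rewrite (_ : N.-1 = last_pos s t) // /len addnS.
have L1 : ut_logits rnd connectivity_transformer (up_log 2 n) (conn_input A s t) T1 = feat h (last_pos s t) bANS.
  rewrite (L T1 [:: (bANS, 64%:Z)]) // /ev big_cons big_nil addr0 /= (_ : 64%:~R / 64 = 1 :> R) ?mul1r.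
    exact: (rnd_id Hrnd).
  by field.
have L0 : rnd (tau / 2) = ut_logits rnd connectivity_transformer (up_log 2 n) (conn_input A s t) T0.
  by rewrite (L T0 [:: (fTAU, 32%:Z)]) // /ev big_cons big_nil addr0 /= te; congr rnd; field.
have Lo o : o <> T1 -> o <> T0 -> ut_logits rnd connectivity_transformer (up_log 2 n) (conn_input A s t) o = 0.
  by move=> o1 o0; rewrite (L o [::]) ?ev_nil ?(rnd0 Hrnd Hp) //; case: o o1 o0.
have b0 : `|tau / 2| <= 1 by rewrite gtr0_norm; move: t0 t1; wipe; lra.
have /andP[n1 n2] := rnd_near Hrnd Hp b0 (ler_nat _ 1 512).
rewrite L0 in n1 n2; move=> o'.
have LP := Lo TPad (ltac:(discriminate)) (ltac:(discriminate)).
have LA := Lo TA (ltac:(discriminate)) (ltac:(discriminate)).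
have LB := Lo TB (ltac:(discriminate)) (ltac:(discriminate)).
have LS := Lo TBOS (ltac:(discriminate)) (ltac:(discriminate)).
case: (connect A s t) fin => fin; destruct o' => ne; try by case: ne.
all: rewrite ?L1 ?LP ?LA ?LB ?LS; move: fin n1 n2 ut u0 t0; wipe; lra.
Qed.

End Main.

Theorem mainTheorem5 :
  exists T : UTransformer,
    [/\ size (ut_init T) = 17%N, size (ut_rep T) = 2%N, size (ut_final T) = 1%N &
    exists c : nat, (0 < c)%N /\
    forall (n : nat) (A : 'I_n -> 'I_n -> bool) (s t : 'I_n) (p : nat),
      let ws := conn_input A s t in
      (c * up_log 2 (size ws).+1 <= p)%N ->
      forall rnd : realalg -> realalg, correct_rounding p rnd ->
        ut_outputs rnd T (up_log 2 n) ws (if connect A s t then T1 else T0)].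
Proof.
(* 65 = 50 + 15: by [uerr_small] it makes the rounding errors at most b^50. *)
exists connectivity_transformer; split=> //; exists 65%N; split=> // n A s t p ws pN rnd Hrnd.
apply: (transformer_correct (R := realalg) Hrnd).
by rewrite -(size_inp A s t).
Qed.
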